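(* Let $\mathcal T$ be a triangulation of a polygonal domain $\Omega$ with $n_V$ vertices, $n_E$ edges, $n_T$ triangles. Let $\mathcal M$ be a set of pairs $(\Delta,i)$ formed as follows: for each vertex $v$ of $\mathcal T$, choose one triangle $\Delta\ni v$ and include the six pairs $(\Delta,i)$ with $i$ an index associated with $v$ in $\Delta$; for each edge $e$ of $\mathcal T$, choose one triangle $\Delta$ containing $e$ and include the three pairs $(\Delta,i)$ with $i$ an index associated with $e$ in $\Delta$; for each triangle $\Delta$ include $(\Delta,28)$. Then $\mathcal M$ is a minimal determining set for $\mathbb S_3^2(\mathcal T_{WS_3})$: if $s\in\mathbb S_3^2(\mathcal T_{WS_3})$ satisfies $\tilde b_{i,\Delta}(s)=0$ for all $(\Delta,i)\in\mathcal M$, then $s\equiv0$; and $\#\mathcal M=6n_V+3n_E+n_T=\dim\mathbb S_3^2(\mathcal T_{WS_3})$.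
   Context: For each triangle $\Delta$ of $\mathcal T$ fix an ordering $(v_1,v_2,v_3)$ of its vertices and set $v_{1,2}=\tfrac23v_2+\tfrac13v_3$, $v_{1,3}=\tfrac13v_2+\tfrac23v_3$, $v_{2,1}=\tfrac23v_1+\tfrac13v_3$, $v_{2,3}=\tfrac13v_1+\tfrac23v_3$, $v_{3,1}=\tfrac23v_1+\tfrac13v_2$, $v_{3,2}=\tfrac13v_1+\tfrac23v_2$. $\Delta_{WS_3}$ is the partition of $\Delta$ by all segments joining pairs of the nine points $v_k,v_{k,l}$; $\mathcal T_{WS_3}$ applies this split to every triangle; $\mathbb S_3^2(\mathcal T_{WS_3})$ is the space of $C^2(\Omega)$ functions that are cubic polynomials on each polygon of $\mathcal T_{WS_3}$. Local basis on $\Delta$: for a multiset $\Xi$ of six points with full-dimensional hull, $M_\Xi(x)=\mathrm{vol}_3(\sigma\cap\pi^{-1}(x))/\mathrm{vol}_5(\sigma)$ for any positive-volume simplex $\sigma\subset\mathbb R^5$ whose vertices project (first two coordinates, $\pi$) onto $\Xi$. $B_i=w_iM_{\Xi_i}$ (values on $\partial\Delta$ by continuity from the interior) with $\Xi_1=\{v_1^{(4)},v_{3,1},v_{2,1}\}$, $\Xi_2=\{v_2^{(4)},v_{3,2},v_{1,2}\}$, $\Xi_3=\{v_3^{(4)},v_{1,3},v_{2,3}\}$, $\Xi_4=\{v_1^{(3)},v_{3,1},v_{3,2},v_{2,1}\}$, $\Xi_5=\{v_1^{(3)},v_{2,1},v_{2,3},v_{3,1}\}$, $\Xi_6=\{v_2^{(3)},v_{1,2},v_{1,3},v_{3,2}\}$,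 $\Xi_7=\{v_2^{(3)},v_{3,2},v_{3,1},v_{1,2}\}$, $\Xi_8=\{v_3^{(3)},v_{2,3},v_{2,1},v_{1,3}\}$, $\Xi_9=\{v_3^{(3)},v_{1,3},v_{1,2},v_{2,3}\}$, $\Xi_{10}=\{v_1^{(2)},v_{3,1},v_{3,2},v_2,v_{2,1}\}$, $\Xi_{11}=\{v_1^{(2)},v_{2,1},v_{2,3},v_3,v_{3,1}\}$, $\Xi_{12}=\{v_2^{(2)},v_{1,2},v_{1,3},v_3,v_{3,2}\}$, $\Xi_{13}=\{v_2^{(2)},v_{3,2},v_{3,1},v_1,v_{1,2}\}$, $\Xi_{14}=\{v_3^{(2)},v_{2,3},v_{2,1},v_1,v_{1,3}\}$, $\Xi_{15}=\{v_3^{(2)},v_{1,3},v_{1,2},v_2,v_{2,3}\}$, $\Xi_{16}=\{v_1^{(2)},v_{3,1},v_{3,2},v_{2,1},v_{2,3}\}$, $\Xi_{17}=\{v_2^{(2)},v_{3,2},v_{3,1},v_{1,2},v_{1,3}\}$, $\Xi_{18}=\{v_3^{(2)},v_{1,3},v_{1,2},v_{2,3},v_{2,1}\}$, $\Xi_{19}=\{v_1,v_2,v_{3,1},v_{3,2},v_{2,1},v_{1,2}\}$, $\Xi_{20}=\{v_2,v_3,v_{1,2},v_{1,3},v_{3,2},v_{2,3}\}$, $\Xi_{21}=\{v_3,v_1,v_{2,3},v_{2,1},v_{1,3},v_{3,1}\}$, $\Xi_{22}=\{v_1,v_{3,1},v_{3,2},v_{1,2},v_{2,3},v_{2,1}\}$,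 $\Xi_{23}=\{v_1,v_{2,1},v_{2,3},v_{1,3},v_{3,2},v_{3,1}\}$, $\Xi_{24}=\{v_2,v_{1,2},v_{1,3},v_{2,3},v_{3,1},v_{3,2}\}$, $\Xi_{25}=\{v_2,v_{3,1},v_{3,2},v_{1,2},v_{1,3},v_{2,1}\}$, $\Xi_{26}=\{v_3,v_{2,3},v_{2,1},v_{3,1},v_{1,2},v_{1,3}\}$, $\Xi_{27}=\{v_3,v_{1,2},v_{1,3},v_{2,3},v_{2,1},v_{3,2}\}$, $\Xi_{28}=\{v_{3,1},v_{3,2},v_{1,2},v_{1,3},v_{2,3},v_{2,1}\}$ (superscript = multiplicity), $w_i=\frac{|\Delta|}{15}c_i$, $c=(\tfrac16^{\times3},\tfrac13^{\times6},\tfrac12^{\times6},\tfrac23^{\times3},\tfrac56^{\times3},\tfrac23^{\times6},1)$; and $\tilde B_{i,\Delta}=B_i$ ($i\le21$), $\tilde B_{22,\Delta}=2B_{22}-B_{23}+\tfrac13B_{28}$, $\tilde B_{23,\Delta}=2B_{23}-B_{22}+\tfrac13B_{28}$, $\tilde B_{24,\Delta}=2B_{24}-B_{25}+\tfrac13B_{28}$, $\tilde B_{25,\Delta}=2B_{25}-B_{24}+\tfrac13B_{28}$, $\tilde B_{26,\Delta}=2B_{26}-B_{27}+\tfrac13B_{28}$, $\tilde B_{27,\Delta}=2B_{27}-B_{26}+\tfrac13B_{28}$, $\tilde B_{28,\Delta}=-B_{28}$. These 28 functions form a basis of the $C^2$ piecewise cubics on $\Delta_{WS_3}$, so each $s\in\mathbb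 S_3^2(\mathcal T_{WS_3})$ has unique coefficients with $s|_\Delta=\sum_{i=1}^{28}\tilde b_{i,\Delta}(s)\tilde B_{i,\Delta}$. Index association in $\Delta$: indices associated with vertex $v_1$: $\{1,4,5,10,11,16\}$; with $v_2$: $\{2,6,7,12,13,17\}$; with $v_3$: $\{3,8,9,14,15,18\}$; with edge $[v_1,v_2]$: $\{19,22,25\}$; with edge $[v_1,v_3]$: $\{21,23,26\}$; with edge $[v_2,v_3]$: $\{20,24,27\}$; with the triangle: $\{28\}$. *)

(* Defs.v *)
From HB Require Import structures.
From mathcomp Require Import all_boot all_order all_algebra.
From mathcomp Require Import all_classical all_reals all_analysis.
Set Implicit Arguments. Unset Strict Implicit. Unset Printing Implicit Defensive.
Import Order.TTheory GRing.Theory Num.Theory.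
Import numFieldNormedType.Exports.
Local Open Scope classical_set_scope.
Local Open Scope ring_scope.

Section WS3.
Context {R : realType}.

Definition pt := (R * R)%type.

Definition leb2 := (@lebesgue_measure R \x @lebesgue_measure R)%E.
Definition leb3 := (leb2 \x @lebesgue_measure R)%E.
Definition leb5 := (leb2 \x leb3)%E.

Definition hull {V : lmodType R} (A : set V) : set V :=
  [set x | exists (n : nat) (q : 'I_n -> V) (l : 'I_n -> R),
      (forall i, A (q i)) /\ (forall i, 0 <= l i) /\
      \sum_(i < n) l i = 1 /\ x = \sum_(i < n) l i *: q i].

Definition tri_set (v : 'I_3 -> pt) : set pt := hull (range v).

Definition det2 (a b : pt) : R := a.1 * b.2 - a.2 * b.1.

Definition nondegenerate (v : 'I_3 -> pt) : Prop :=
  det2 (v (1 : 'I_3) - v 0) (v (2 : 'I_3) - v 0) != 0.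

Definition tri_area (v : 'I_3 -> pt) : R :=
  `| det2 (v (1 : 'I_3) - v 0) (v (2 : 'I_3) - v 0) | / 2.

Definition R3 := ((R * R) * R)%type.

Definition lifted_simplex (Xi : 'I_6 -> pt) (y : 'I_6 -> R3) : set (pt * R3) :=
  hull (range (fun j => (Xi j, y j))).

Definition slice (Xi : 'I_6 -> pt) (y : 'I_6 -> R3) (x : pt) : set R3 :=
  [set z | lifted_simplex Xi y (x, z)].

Definition good_lift (Xi : 'I_6 -> pt) (y : 'I_6 -> R3) : Prop :=
  (0 < leb5 (lifted_simplex Xi y))%E.

(** M_Xi(x) = vol_3(sigma cap pi^-1(x)) / vol_5(sigma), for a
    positive-volume simplex sigma whose vertices project onto Xi (the
    value does not depend on the choice of sigma; we take a chosen one). *)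
Definition simplex_spline (Xi : 'I_6 -> pt) (x : pt) : R :=
  match pselect (exists y, good_lift Xi y) with
  | left h => let y := projT1 (cid h) in
              fine (leb3 (slice Xi y x)) / fine (leb5 (lifted_simplex Xi y))
  | right _ => 0
  end.

Section Tri.
Variable v : 'I_3 -> pt.
Let v1 := v 0. Let v2 := v (1 : 'I_3). Let v3 := v (2 : 'I_3).
Definition v12 : pt := (2/3) *: v2 + (1/3) *: v3.
Definition v13 : pt := (1/3) *: v2 + (2/3) *: v3.
Definition v21 : pt := (2/3) *: v1 + (1/3) *: v3.
Definition v23 : pt := (1/3) *: v1 + (2/3) *: v3.
Definition v31 : pt := (2/3) *: v1 + (1/3) *: v2.
Definition v32 : pt := (1/3) *: v1 + (2/3) *: v2.

Definition nine_points : seq pt := [:: v1; v2; v3; v12; v13; v21; v23; v31; v32].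

Definition knot_list : seq (seq pt) := [::
  [:: v1; v1; v1; v1; v31; v21];
  [:: v2; v2; v2; v2; v32; v12];
  [:: v3; v3; v3; v3; v13; v23];
  [:: v1; v1; v1; v31; v32; v21];
  [:: v1; v1; v1; v21; v23; v31];
  [:: v2; v2; v2; v12; v13; v32];
  [:: v2; v2; v2; v32; v31; v12];
  [:: v3; v3; v3; v23; v21; v13];
  [:: v3; v3; v3; v13; v12; v23];
  [:: v1; v1; v31; v32; v2; v21];
  [:: v1; v1; v21; v23; v3; v31];
  [:: v2; v2; v12; v13; v3; v32];
  [:: v2; v2; v32; v31; v1; v12];
  [:: v3; v3; v23; v21; v1; v13];
  [:: v3; v3; v13; v12; v2; v23];
  [:: v1; v1; v31; v32; v21; v23];
  [:: v2; v2; v32; v31; v12; v13];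
  [:: v3; v3; v13; v12; v23; v21];
  [:: v1; v2; v31; v32; v21; v12];
  [:: v2; v3; v12; v13; v32; v23];
  [:: v3; v1; v23; v21; v13; v31];
  [:: v1; v31; v32; v12; v23; v21];
  [:: v1; v21; v23; v13; v32; v31];
  [:: v2; v12; v13; v23; v31; v32];
  [:: v2; v31; v32; v12; v13; v21];
  [:: v3; v23; v21; v31; v12; v13];
  [:: v3; v12; v13; v23; v21; v32];
  [:: v31; v32; v12; v13; v23; v21] ].

Definition knots (i : nat) (j : 'I_6) : pt := nth 0 (nth [::] knot_list i) j.

Definition cweight (i : nat) : R :=
  if (i < 3)%N then 1/6 else if (i < 9)%N then 1/3 else if (i < 15)%N then 1/2
  else if (i < 18)%N then 2/3 else if (i < 21)%N then 5/6
  else if (i < 27)%N then 2/3 else 1.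

(** B_{i+1} = w_{i+1} M_{Xi_{i+1}}, with w_i = |Delta|/15 c_i  (0-based i) *)
Definition Bws (i : nat) (x : pt) : R :=
  tri_area v / 15 * cweight i * simplex_spline (knots i) x.

Definition Btilde (i : 'I_28) (x : pt) : R :=
  match nat_of_ord i with
  | 21 => 2 * Bws 21 x - Bws 22 x + 1/3 * Bws 27 x
  | 22 => 2 * Bws 22 x - Bws 21 x + 1/3 * Bws 27 x
  | 23 => 2 * Bws 23 x - Bws 24 x + 1/3 * Bws 27 x
  | 24 => 2 * Bws 24 x - Bws 23 x + 1/3 * Bws 27 x
  | 25 => 2 * Bws 25 x - Bws 26 x + 1/3 * Bws 27 x
  | 26 => 2 * Bws 26 x - Bws 25 x + 1/3 * Bws 27 x
  | 27 => - Bws 27 x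
  | k => Bws k x
  end.

Definition segment (a b : pt) : set pt :=
  [set x | exists t : R, 0 <= t <= 1 /\ x = (1 - t) *: a + t *: b].

(** x and y lie in the same (open) polygon of Delta_{WS_3}: both are interior
    points of Delta and the segment [x,y] meets none of the segments joining
    pairs of the nine points. (All these segments are chords of the convex
    set Delta, so the polygons are convex.) *)
Definition same_cell (x y : pt) : Prop :=
  (tri_set v)° x /\ (tri_set v)° y /\
  forall a b, a \in nine_points -> b \in nine_points ->
    segment x y `&` segment a b = set0.

End Tri.

Definition cubic_poly (P : pt -> R) : Prop :=
  exists a : 'I_4 -> 'I_4 -> R, forall y : pt,
    P y = \sum_(i < 4) \sum_(j < 4 | (i + j <= 3)%N) a i j * y.1 ^+ i * y.2 ^+ j.

Definition piecewise_cubic_WS3 (v : 'I_3 -> pt) (s : pt -> R) : Prop :=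
  forall x, same_cell v x x ->
    exists P, cubic_poly P /\ forall y, same_cell v x y -> s y = P y.

Definition e1 : pt := (1, 0).
Definition e2 : pt := (0, 1).
Definition edir (j : bool) : pt := if j then e2 else e1.

(** C^2(Omega) for a closed set Omega (= closure of its interior): s is
    continuous on Omega, all partial derivatives of order <= 2 exist in the
    interior of Omega and extend continuously to Omega. *)
Definition C2_on (Om : set pt) (s : pt -> R) : Prop :=
  {within Om, continuous s} /\
  forall j : bool, exists g1 : pt -> R,
    {within Om, continuous g1} /\
    (forall x, Om° x -> is_derive x (edir j) s (g1 x)) /\
    forall k : bool, exists g2 : pt -> R,
      {within Om, continuous g2} /\
      (forall x, Om° x -> is_derive x (edir k) g1 (g2 x)).

Section Triangulation.
Variables (nV nT : nat) (p : 'I_nV -> pt) (tri : 'I_nT -> 'I_3 -> 'I_nV).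

Definition tverts (t : 'I_nT) : 'I_3 -> pt := fun k => p (tri t k).

Definition vset (t : 'I_nT) : {set 'I_nV} := [set tri t k | k : 'I_3].

Definition domain : set pt := \bigcup_(t in [set: 'I_nT]) tri_set (tverts t).

Definition is_triangulation : Prop :=
  injective p /\
  (forall t, nondegenerate (tverts t)) /\
  (forall v : 'I_nV, exists t k, tri t k = v) /\
  (forall t t', t != t' ->
     vset t != vset t' /\
     tri_set (tverts t) `&` tri_set (tverts t') =
       hull [set p w | w in [set w | w \in vset t :&: vset t']]).

Definition is_edge (a b : 'I_nV) : bool :=
  [exists t, exists k1, exists k2, (k1 != k2) && (tri t k1 == a) && (tri t k2 == b)].

Definition nE : nat := #|[set e : 'I_nV * 'I_nV | (e.1 < e.2)%N && is_edge e.1 e.2]|.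

(** indices (0-based) associated with vertex v_{k+1} of a triangle *)
Definition vidx (k : 'I_3) (i : 'I_28) : bool :=
  nat_of_ord i \in nth [::] [:: [:: 0; 3; 4; 9; 10; 15];
                               [:: 1; 5; 6; 11; 12; 16];
                               [:: 2; 7; 8; 13; 14; 17]]%N k.

(** indices (0-based) associated with the edge [v_{k1+1}, v_{k2+1}] *)
Definition eidx (k1 k2 : 'I_3) (i : 'I_28) : bool :=
  (k1 != k2) &&
  (nat_of_ord i \in nth [::] [:: [:: 19; 23; 26];    (* edge [v2,v3] *)
                               [:: 20; 22; 25];    (* edge [v1,v3] *)
                               [:: 18; 21; 24]]%N  (* edge [v1,v2] *)
                    (3 - (k1 + k2))%N).

Definition Mset (vch : 'I_nV -> 'I_nT) (ech : 'I_nV -> 'I_nV -> 'I_nT)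
  : {set 'I_nT * 'I_28} :=
  [set x : 'I_nT * 'I_28 |
    [exists w : 'I_nV, (x.1 == vch w) &&
        [exists k : 'I_3, (tri x.1 k == w) && vidx k x.2]]
    || [exists a : 'I_nV, exists b : 'I_nV,
          [&& (a < b)%N, is_edge a b, x.1 == ech a b &
          [exists k1 : 'I_3, exists k2 : 'I_3,
              [&& tri x.1 k1 == a, tri x.1 k2 == b & eidx k1 k2 x.2]]]]
    || (nat_of_ord x.2 == 27%N)].

Definition S32 : set (pt -> R) :=
  [set s | C2_on domain s /\ forall t, piecewise_cubic_WS3 (tverts t) s].

Definition coeffs_of (s : pt -> R) (c : 'I_nT -> 'I_28 -> R) : Prop :=
  forall t x, (tri_set (tverts t))° x ->
    s x = \sum_(i < 28) c t i * Btilde (tverts t) i x.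

End Triangulation.

Definition has_dim_on (Om : set pt) (S : set (pt -> R)) (n : nat) : Prop :=
  exists f : 'I_n -> pt -> R,
    (forall i, S (f i)) /\
    (forall a : 'I_n -> R,
        (forall x, Om x -> \sum_(i < n) a i * f i x = 0) -> forall i, a i = 0) /\
    (forall s, S s -> exists a : 'I_n -> R,
        forall x, Om x -> s x = \sum_(i < n) a i * f i x).

End WS3.

(* Main.v *)
(* On one triangle, subtracting multiples of the cubes [max (l, 0)^3] of the affine forms [l] vanishing on the lines of
   the split removes the jumps of the third derivatives of a C^2 piecewise cubic, since such a jump is constant along
   each line.  So the splines on the split are the combinations of ten cubes of affine forms and eighteen truncated
   cubes.  The 28 functionals consisting of the 2-jets at the vertices, the normal derivative at the midpoint and the
   second normal derivatives at the two third points of each edge, and the value at the barycentre are unisolvent on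
   them.  The 2-jet of a spline along an edge depends only on the functionals attached to that edge and its ends, so
   values prescribed on a triangulation glue to a C^2 spline, which gives the dimension 6 n_V + 3 n_E + n_T.

   For the determining set, the coefficients attached to a vertex vanish if and only if the 2-jet at that vertex does;
   when all vertex coefficients vanish, the coefficients attached to an edge vanish if and only if the 1-jet at its
   midpoint and the 2-jets at its third points do.  Both follow by comparing the decay of the nonnegative simplex
   splines along curves ending at these points.  As jets of a C^2 spline agree on neighbouring triangles, the vanishing
   of the chosen coefficients propagates to all triangles. *)
From Stdlib Require Import ZArith.
Require Import Defs.
From HB Require Import structures.
From mathcomp Require Import all_boot all_order all_algebra.
From mathcomp Require Import perm.
From mathcomp Require Import ssrZ zify.
From mathcomp Require Import ring lra.
From mathcomp Require Import all_classical all_reals all_analysis.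
From mathcomp Require Import measurable_realfun.
Set Implicit Arguments. Unset Strict Implicit. Unset Printing Implicit Defensive.
Import Order.TTheory GRing.Theory Num.Theory.
Import numFieldNormedType.Exports.
Local Open Scope classical_set_scope.
Local Open Scope ring_scope.
Delimit Scope Z_scope with Zb.

(** * Lebesgue measure in the plane and in space *)

(** A simplex spline is defined through an arbitrarily chosen lift, so it must first be described
    without the lift: three of the six barycentric weights parametrize every slice, a change of lift
    multiplies all slice volumes by one common factor, and the factor cancels against the volume of
    the simplex. Decay estimates then amount to comparing the set of admissible weights with boxes.
    The constancy of a jump along a line is delicate where other lines cross it. At most three lines
    of the split meet at an inner point, so two directions can be spent on making the crossing lines
    invisible. Near [v31] two splines of the edge groups have the same quadratic order, one being
    twice the other up to third order; the mixed basis is what separates their coefficients. Every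
    combinatorial fact about the split is a statement on integer barycentric triples and is checked
    by evaluation. *)

Lemma pushforward_measure_of d d' (T1 : measurableType d) (T2 : measurableType d') (R : realType)
  (m : {measure set T1 -> \bar R}) (f : T1 -> T2) : measurable_fun setT f -> {measure set T2 -> \bar R}.
Proof. move=> mf; exact: (measure_function_pushforward__canonical__measure_function_Measure m mf). Defined.

(** * Uniqueness of translation-invariant sigma-finite measures on an abelian group *)

Section Haar.
Local Open Scope ereal_scope.
Context d (T : measurableType d) (R : realType).
Variables (plus : T -> T -> T) (opp : T -> T) (zero : T).
Hypothesis plusA : forall x y z, plus x (plus y z) = plus (plus x y) z.
Hypothesis plusC : forall x y, plus x y = plus y x.
Hypothesis plus0 : forall x, plus zero x = x.
Hypothesis plusN : forall x, plus (opp x) x = zero.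
Hypothesis mplus : measurable_fun setT (fun p : T * T => plus p.1 p.2).
Hypothesis mopp : measurable_fun setT opp.

Definition translation_invariant (m : set T -> \bar R) :=
  forall t S, measurable S -> m ((fun x => plus x t) @^-1` S) = m S.

Lemma plusK x y : plus (plus x y) (opp y) = x.
Proof. by rewrite -plusA [plus y _]plusC plusN plusC plus0. Qed.

(* Double counting of [{(x, y) | S x /\ C (x + y)}] by Tonelli. *)
Lemma haar_swap (m mu : {sigma_finite_measure set T -> \bar R}) (S C : set T) :
  translation_invariant m -> translation_invariant mu ->
  measurable S -> measurable C ->
  mu C * m S = mu (opp @^-1` S) * m C.
Proof.
move=> tm tmu mS mC.
(* The shear [(x, y) -> (x + y, y)] carries [E] to [E'], so their sections at fixed [y] are
   translates of one another. At fixed [x] in [S] the section of [E] is a translate of [C]; at fixed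
   [x] in [C] the section of [E'] is a translate of the reflected [S]. *)
pose E : set (T * T) := (fst @^-1` S) `&` ((fun p => plus p.1 p.2) @^-1` C).
pose E' : set (T * T) := (fst @^-1` C) `&` ((fun p => plus p.1 (opp p.2)) @^-1` S).
have mpre (f : T * T -> T) (X : set T) : measurable_fun setT f -> measurable X ->
    measurable (f @^-1` X).
  by move=> mf mX; rewrite -[_ @^-1` _]setTI; exact: mf.
have mpre1 (f : T -> T) (X : set T) : measurable_fun setT f -> measurable X ->
    measurable (f @^-1` X).
  by move=> mf mX; rewrite -[_ @^-1` _]setTI; exact: mf.
have mminus : measurable_fun setT (fun p : T * T => plus p.1 (opp p.2)).
  apply: (measurableT_comp mplus (g := fun p => (p.1, opp p.2))).
  apply: measurable_fun_pair; first exact: measurable_fst.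
  exact: (measurableT_comp mopp).
have mE : measurable E.
  by apply: measurableI; apply: mpre => //; exact: measurable_fst.
have mE' : measurable E'.
  by apply: measurableI; apply: mpre => //; exact: measurable_fst.
have := indic_fubini_tonelli m mu mE.
rewrite (indic_fubini_tonelli_FE mu mE) (indic_fubini_tonelli_GE m mE).
have := indic_fubini_tonelli m mu mE'.
rewrite (indic_fubini_tonelli_FE mu mE') (indic_fubini_tonelli_GE m mE').
have -> : m \o ysection E' = m \o ysection E.
  apply/funext => y /=; rewrite -(tm y); last exact: measurable_ysection.
  congr (m _); apply/seteqP; split => x /=; rewrite /ysection /= !inE /E /E' /=.
    by rewrite plusK => -[].
  by rewrite plusK => -[].
move=> <-; rewrite (_ : mu \o xsection E = fun x => mu C * (\1_S x)%:E); last first.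
  apply/funext => x /=; rewrite indicE; case: (boolP (x \in S)) => xS.
    rewrite mule1 -(tmu x C mC); congr (mu _); apply/seteqP; split => y /=;
      rewrite /xsection /= !inE /E /=; rewrite plusC; first by case.
    by split => //; rewrite inE in xS.
  rewrite mule0 (_ : xsection _ _ = set0) ?measure0//; apply/seteqP; split => y //=.
  by rewrite /xsection /= inE => -[/= ? _]; move/negP: xS; rewrite inE.
rewrite (_ : mu \o xsection E' = fun x => mu (opp @^-1` S) * (\1_C x)%:E); last first.
  apply/funext => x /=; rewrite indicE; case: (boolP (x \in C)) => xC; last first.
    rewrite mule0 (_ : xsection _ _ = set0) ?measure0//; apply/seteqP; split => y //=.
    by rewrite /xsection /= inE => -[/= ? _]; move/negP: xC; rewrite inE.
  rewrite mule1 -(tmu x); last exact: measurable_xsection.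
  have oppD y : plus x (opp (plus y x)) = opp y.
    set a := opp _; rewrite -(plusK (plus x a) y) [plus (plus x a) y]plusC plusA.
    by rewrite [plus _ a]plusC plusN plus0.
  congr (mu _); apply/seteqP; split => y /=; rewrite /xsection /= !inE /E' /= oppD.
    by case.
  by move=> yS; split; first by rewrite inE in xC.
rewrite !ge0_integralZl//; [|exact/measurable_EFinP/measurable_indic|exact/measurable_EFinP/measurable_indic].
by rewrite !integral_indic// !setIT => ->.
Qed.

(** With [m] in both places, [haar_swap] shows that [m] is invariant under reflection, because
    [m C = 1] cancels. With [m], [mu] and the reflected [S] it then gives the proportionality. *)
Lemma haar_unique (m mu : {sigma_finite_measure set T -> \bar R}) (C S : set T) :
  translation_invariant m -> translation_invariant mu ->
  measurable C -> measurable S -> m C = 1 -> mu S = mu C * m S.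
Proof.
move=> tm tmu mC mS mC1.
have mpre1 (X : set T) : measurable X -> measurable (opp @^-1` X).
  by move=> mX; rewrite -[_ @^-1` _]setTI; exact: mopp.
have oppK x : opp (opp x) = x.
  by rewrite -[LHS]plus0 plusC -(plusN x) plusA plusN plus0.
have h1 := haar_swap tm tmu (mpre1 _ mS) mC.
have h2 := haar_swap tm tm mS mC.
move: h2; rewrite mC1 mul1e mule1 => h2; move: h1; rewrite -h2 => ->.
rewrite mC1 mule1; congr (mu _); apply/seteqP; split => x /=; by rewrite oppK.
Qed.

(** The image of [m] under an additive bijection is again translation-invariant, hence proportional
    to [m]. The factors for [g] and for its inverse multiply to 1, which makes [K] finite and
    positive; no determinant enters. *)
Lemma haar_iso (m : {sigma_finite_measure set T -> \bar R}) (C : set T) (g h : T -> T) :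
  translation_invariant m -> measurable C -> m C = 1 ->
  measurable_fun setT g -> measurable_fun setT h ->
  cancel g h -> cancel h g -> {morph g : x y / plus x y} ->
  exists2 K : R, (0 < K)%R & forall S, measurable S -> m (g @^-1` S) = K%:E * m S.
Proof.
move=> tm mC mC1 mg mh gh hg gD.
have hD : {morph h : x y / plus x y}.
  by move=> x y; apply: (can_inj gh); rewrite gD !hg.
have key (f k : T -> T) : measurable_fun setT f -> measurable_fun setT k -> cancel f k ->
   cancel k f -> {morph f : x y / plus x y} ->
   forall S, measurable S -> m (f @^-1` S) = m (f @^-1` C) * m S.
  move=> mf mk fk kf fD S mS.
  have sf : sigma_finite setT (pushforward m f).
    have [F TF mF] := sigma_finiteT m.
    exists (fun n => k @^-1` (F n)).
      apply/seteqP; split => // x _.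
      have : (\bigcup_i F i) (k x) by rewrite -TF.
      by move=> [i _ ?]; exists i.
    move=> i; have [mFi Fi] := mF i; split.
      by rewrite -[_ @^-1` _]setTI; exact: mk.
    rewrite /pushforward (_ : f @^-1` _ = F i)//.
    by apply/seteqP; split => x /=; rewrite fk.
  pose mu1 : {measure set T -> \bar R} := pushforward_measure_of m mf.
  pose mu : {sigma_finite_measure set T -> \bar R} :=
    HB.pack (mu1 : set T -> \bar R) (Measure.on mu1) (Measure_isSigmaFinite.Build _ _ _ mu1 sf).
  apply: (@haar_unique m mu C S) => // t X mX.
  have mfX : measurable (f @^-1` X) by have := mf measurableT _ mX; rewrite setTI.
  rewrite /mu /= /pushforward -[RHS](tm (k t))//.
  by congr (m _); apply/seteqP; split => x /=; rewrite fD kf.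
have KK : m (g @^-1` C) * m (h @^-1` C) = 1.
  have mhC : measurable (h @^-1` C) by rewrite -[_ @^-1` _]setTI; exact: mh.
  rewrite -(key g h)// -mC1; congr (m _).
  by apply/seteqP; split => x /=; rewrite gh.
have : 0 <= m (g @^-1` C) by [].
have h0 : 0 <= m (h @^-1` C) by [].
case E : (m (g @^-1` C)) => [K| |] // K0; last first.
  exfalso; move: KK; rewrite E; move: h0.
  rewrite le_eqVlt => /predU1P[<-|h0]; first by rewrite mule0 => /eqP; rewrite eqe eq_sym oner_eq0.
  by rewrite gt0_mulye.
exists K; last by move=> S mS; rewrite (key g h)// E.
rewrite lt_neqAle; move: K0; rewrite lee_fin => ->; rewrite andbT.
apply/eqP => K0; move: KK; rewrite E -K0 mul0e => /eqP.
by rewrite eqe eq_sym oner_eq0.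
Qed.
End Haar.

(** * Translation invariance and box volumes for the products of Lebesgue measure *)

Section LebesguePowers.
Context {R : realType}.
Local Open Scope ereal_scope.
Local Notation T1 := (measurableTypeR R).
Local Notation T2 := (T1 * T1)%type.
Local Notation T3 := (T2 * T1)%type.
Let plus1 (x y : T1) : T1 := (x + y)%R.
Let plus2 (x y : T2) : T2 := (x.1 + y.1, x.2 + y.2)%R.
Let plus3 (x y : T3) : T3 := (plus2 x.1 y.1, plus1 x.2 y.2)%R.
Let mu : {sigma_finite_measure set T1 -> \bar R} := @lebesgue_measure R.

Lemma leb1_translation : translation_invariant plus1 mu.
Proof.
move=> t S mS.
have mt : measurable_fun setT (fun x : T1 => plus1 x t).
  exact: (@measurable_funD _ T1 R setT (fun x => x) (fun x => t)).
have := @lebesgue_measure_unique R (pushforward_measure_of mu mt) _ S mS.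
move=> h; apply/esym/h => /= _ [[a b]] _ <- /=; rewrite /pushforward.
rewrite (_ : _ @^-1` _ = `](a - t)%R, (b - t)%R]%classic); last first.
  apply/seteqP; split => x /=; rewrite !in_itv /= /plus1 => /andP[h1 h2]; apply/andP;
    split; move: h1 h2; lra.
rewrite /mu /= !lebesgue_measure_itv /= !lte_fin; have -> : (a - t < b - t = (a < b))%R by apply/idP/idP; lra.
by case: ifP => // _; rewrite -!EFinB; congr EFin; ring.
Qed.

Lemma product_translation d1 d2 (U1 : measurableType d1) (U2 : measurableType d2)
  (p1 : U1 -> U1 -> U1) (p2 : U2 -> U2 -> U2)
  (m1 : {sigma_finite_measure set U1 -> \bar R}) (m2 : {sigma_finite_measure set U2 -> \bar R}) :
  (forall t, measurable_fun setT (fun x => p1 x t)) ->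
  (forall t, measurable_fun setT (fun x => p2 x t)) ->
  translation_invariant p1 m1 -> translation_invariant p2 m2 ->
  translation_invariant (fun x y => (p1 x.1 y.1, p2 x.2 y.2)) (m1 \x m2).
Proof.
move=> mp1 mp2 t1 t2 t S mS.
pose f (x : U1 * U2) := (p1 x.1 t.1, p2 x.2 t.2).
have mf : measurable_fun setT f.
  apply: measurable_fun_pair.
    by apply: (measurableT_comp (mp1 t.1)); exact: measurable_fst.
  by apply: (measurableT_comp (mp2 t.2)); exact: measurable_snd.
have := @product_measure_unique _ _ U1 U2 R m1 m2 (pushforward_measure_of (m1 \x m2) mf) _ S mS.
move=> h; apply/esym/h => A B mA mB /=; rewrite /pushforward.
have -> : f @^-1` (A `*` B) = ((fun x => p1 x t.1) @^-1` A) `*` ((fun x => p2 x t.2) @^-1` B) by [].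
have mA' : measurable ((fun x => p1 x t.1) @^-1` A).
  by have := mp1 t.1 measurableT _ mA; rewrite setTI.
have mB' : measurable ((fun x => p2 x t.2) @^-1` B).
  by have := mp2 t.2 measurableT _ mB; rewrite setTI.
have -> := product_measure1E m1 m2 mA' mB'; congr (_ * _); [exact: t1|exact: t2].
Qed.

Let mp1 t : measurable_fun setT (fun x : T1 => plus1 x t).
Proof. exact: (@measurable_funD _ T1 R setT (fun x => x) (fun x => t)). Qed.
Let mp2 t : measurable_fun setT (fun x : T2 => plus2 x t).
Proof.
apply: measurable_fun_pair.
  by apply: (measurableT_comp (mp1 t.1)); exact: measurable_fst.
by apply: (measurableT_comp (mp1 t.2)); exact: measurable_snd.
Qed.

Let product_sigma_finite d1 d2 (U1 : measurableType d1) (U2 : measurableType d2)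
  (m1 : {sigma_finite_measure set U1 -> \bar R}) (m2 : {sigma_finite_measure set U2 -> \bar R}) :
  sigma_finite setT (m1 \x m2).
Proof.
have /sigma_finiteP[F [TF ndF Foo]] := sigma_finiteT m1.
have /sigma_finiteP[G [TG ndG Goo]] := sigma_finiteT m2.
exists (fun n => F n `*` G n).
  rewrite -setXTT TF TG predeqE => -[x y]; split.
    move=> [/= [n _ Fnx] [k _ Gky]]; exists (maxn n k) => //; split.
    - by move: x Fnx; exact/subsetPset/ndF/leq_maxl.
    - by move: y Gky; exact/subsetPset/ndG/leq_maxr.
  by move=> [n _ []/= ? ?]; split; exists n.
move=> k; have [? ?] := Foo k; have [? ?] := Goo k.
split; first exact: measurableX.
have -> : (m1 \x m2) (F k `*` G k) = m1 (F k) * m2 (G k) by apply: product_measure1E.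
by rewrite lte_mul_pinfty// ge0_fin_numE.
Qed.

(** Packaging the product as a sigma-finite measure makes Fubini and [haar_iso] applicable to it,
    and lets the construction be iterated. *)
Definition sigma_finite_product d1 d2 (U1 : measurableType d1) (U2 : measurableType d2)
  (m1 : {sigma_finite_measure set U1 -> \bar R}) (m2 : {sigma_finite_measure set U2 -> \bar R})
  : {sigma_finite_measure set (U1 * U2)%type -> \bar R} :=
  HB.pack (m1 \x m2) (Measure.on (m1 \x m2))
    (Measure_isSigmaFinite.Build _ _ _ (m1 \x m2) (product_sigma_finite m1 m2)).

Definition leb2m : {sigma_finite_measure set T2 -> \bar R} := sigma_finite_product mu mu.
Definition leb3m : {sigma_finite_measure set T3 -> \bar R} := sigma_finite_product leb2m mu.

Lemma leb3E S : @leb3 R S = leb3m S. Proof. by []. Qed.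
(** A product measure integrates the measures of the sections, by definition and for arbitrary sets.
    This is where the three-dimensional slices of a lifted simplex enter its volume. *)
Lemma leb5E S : @leb5 R S = \int[leb2m]_x leb3m (xsection S x). Proof. by []. Qed.

Lemma leb2_translation : translation_invariant plus2 leb2m.
Proof. exact: (product_translation mp1 mp1 leb1_translation leb1_translation). Qed.

Lemma leb3_translation : translation_invariant plus3 leb3m.
Proof. exact: (product_translation mp2 mp1 leb2_translation leb1_translation). Qed.

Lemma leb2_box (A B : set T1) : measurable A -> measurable B -> leb2m (A `*` B) = mu A * mu B.
Proof. exact: product_measure1E. Qed.

Lemma leb3_box (A B C : set T1) : measurable A -> measurable B -> measurable C ->
  leb3m (A `*` B `*` C) = mu A * mu B * mu C.
Proof.
move=> mA mB mC; rewrite -leb2_box//.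
by apply: product_measure1E => //; exact: measurableX.
Qed.

Lemma leb3_itv (a b c a' b' c' : R) : (a <= a')%R -> (b <= b')%R -> (c <= c')%R ->
  leb3m (`[a, a'] `*` `[b, b'] `*` `[c, c']) = ((a' - a) * (b' - b) * (c' - c))%:E.
Proof.
move=> h1 h2 h3; have key (x y : R) : (x <= y)%R -> mu `[x, y]%classic = (y - x)%:E.
  rewrite /mu /= lebesgue_measure_itv /= lte_fin le_eqVlt => /predU1P[->|->//].
  by rewrite ltxx subrr.
by rewrite leb3_box// !key// -!EFinM.
Qed.

Lemma leb2_itv (a b a' b' : R) : (a <= a')%R -> (b <= b')%R ->
  leb2m (`[a, a'] `*` `[b, b']) = ((a' - a) * (b' - b))%:E.
Proof.
move=> h1 h2; have key (x y : R) : (x <= y)%R -> mu `[x, y]%classic = (y - x)%:E.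
  rewrite /mu /= lebesgue_measure_itv /= lte_fin le_eqVlt => /predU1P[->|->//].
  by rewrite ltxx subrr.
by rewrite leb2_box// !key// -!EFinM.
Qed.

(** [K] is the inverse of the absolute determinant of [g]. Its value cancels in the quotient that
    defines a simplex spline; in [leb3_halve], where it matters, it is read off from a cube. *)
Lemma leb3_linear (g h : T3 -> T3) : measurable_fun setT g -> measurable_fun setT h ->
  cancel g h -> cancel h g -> {morph g : x y / plus3 x y} ->
  exists2 K : R, (0 < K)%R & forall S, measurable S -> leb3m (g @^-1` S) = K%:E * leb3m S.
Proof.
move=> mg mh gh hg gD.
pose opp3 (x : T3) : T3 := (- x.1.1, - x.1.2, - x.2)%R.
pose C : set T3 := (`[0%R, 1%R] `*` `[0%R, 1%R] `*` `[0%R, 1%R])%classic.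
have pA x y z : plus3 x (plus3 y z) = plus3 (plus3 x y) z.
  by rewrite /plus3 /plus2 /plus1 /= !addrA.
have pC x y : plus3 x y = plus3 y x.
  rewrite /plus3 /plus2 /plus1 /=; congr (_, _, _); exact: addrC.
have p0 x : plus3 (0, 0, 0)%R x = x.
  by case: x => [[x y] z]; rewrite /plus3 /plus2 /plus1 /= !add0r.
have pN x : plus3 (opp3 x) x = (0, 0, 0)%R.
  by rewrite /plus3 /plus2 /plus1 /= !addNr.
have mpl : measurable_fun setT (fun p : T3 * T3 => plus3 p.1 p.2).
  apply: measurable_fun_pair; first apply: measurable_fun_pair.
  - apply: (@measurable_funD _ _ R setT (fun p : T3 * T3 => p.1.1.1) (fun p => p.2.1.1)).
      by do 2 (apply: (measurableT_comp measurable_fst)); exact: measurable_fst.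
    by do 2 (apply: (measurableT_comp measurable_fst)); exact: measurable_snd.
  - apply: (@measurable_funD _ _ R setT (fun p : T3 * T3 => p.1.1.2) (fun p => p.2.1.2)).
      by apply: (measurableT_comp measurable_snd); apply: (measurableT_comp measurable_fst); exact: measurable_fst.
    by apply: (measurableT_comp measurable_snd); apply: (measurableT_comp measurable_fst); exact: measurable_snd.
  - apply: (@measurable_funD _ _ R setT (fun p : T3 * T3 => p.1.2) (fun p => p.2.2)).
      by apply: (measurableT_comp measurable_snd); exact: measurable_fst.
    by apply: (measurableT_comp measurable_snd); exact: measurable_snd.
have mop : measurable_fun setT opp3.
  apply: measurable_fun_pair; first apply: measurable_fun_pair.
  - by apply: measurable_funN; apply: (measurableT_comp measurable_fst); exact: measurable_fst.
  - by apply: measurable_funN; apply: (measurableT_comp measurable_snd); exact: measurable_fst.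
  - by apply: measurable_funN; exact: measurable_snd.
have mC : measurable C by apply: measurableX; [apply: measurableX|].
have mC1 : leb3m C = 1 by rewrite leb3_itv// !subr0 !mulr1.
exact: (haar_iso pA pC p0 pN mpl mop leb3_translation mC mC1 mg mh gh hg gD).
Qed.

End LebesguePowers.

(** * Truncated cubes *)

Section TruncatedCubes.
Context {R : realType}.
Implicit Types (u k : R) (x w : @pt R).

Definition pp u : R := Num.max u 0.

Lemma ppE u : pp u = if 0 <= u then u else 0.
Proof. by rewrite /pp maxC /Num.max; case: ltP => h; case: leP => //; lra. Qed.

Lemma pp_pos u : 0 <= u -> pp u = u. Proof. by rewrite ppE => ->. Qed.
Lemma pp_neg u : u <= 0 -> pp u = 0. Proof. by move=> h; rewrite ppE; case: leP => //; lra. Qed.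
Lemma ppZ c u : 0 <= c -> pp (c * u) = c * pp u.
Proof.
move=> c0; rewrite /pp; case: (leP 0 u) => u0; first by rewrite !max_l// mulr_ge0.
by rewrite [LHS]max_r ?mulr0// mulr_ge0_le0// ltW.
Qed.
(** The cube of the positive part is C^2 with Lipschitz second derivative. This bound and the next
    two are the corresponding Taylor estimates for the powers 1, 2 and 3, uniform across the kink
    and with constant 1. *)
Lemma pp_taylor1 u k : `|pp (u + k) - pp u| <= `|k|.
Proof.
rewrite !ppE; case: (leP 0 (u + k)) => h1; case: (leP 0 u) => h2;
  rewrite ler_norml; apply/andP; split; case: (ger0P k) => h3; lra.
Qed.

Lemma pp_taylor2 u k : `|pp (u + k) ^+ 2 - pp u ^+ 2 - 2 * pp u * k| <= `|k| ^+ 2.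
Proof.
rewrite real_normK ?num_real//.
by rewrite !ppE; case: (leP 0 (u + k)) => h1; case: (leP 0 u) => h2;
  rewrite ler_norml; apply/andP; split; nra.
Qed.

Lemma pp_taylor3 u k :
  `|pp (u + k) ^+ 3 - pp u ^+ 3 - 3 * pp u ^+ 2 * k - 3 * pp u * k ^+ 2| <= `|k| ^+ 3.
Proof.
rewrite !ppE; case: (leP 0 (u + k)) => h1; case: (leP 0 u) => h2.
- by rewrite (_ : _ - _ = k ^+ 3); [rewrite normrX|ring].
- rewrite (_ : _ - _ = (u + k) ^+ 3); last ring.
  rewrite ger0_norm ?exprn_ge0// (ger0_norm (_ : 0 <= k)); last lra.
  by rewrite lerXn2r ?nnegrE; lra.
- rewrite (_ : _ - _ = - ((- k) ^+ 3 - (- (u + k)) ^+ 3)) ?normrN; last ring.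
  have k0 : 0 <= - k by lra.
  rewrite -[`|k|]normrN (ger0_norm k0).
  have : (- (u + k)) ^+ 3 <= (- k) ^+ 3 by rewrite lerXn2r ?nnegrE; lra.
  have : 0 <= (- (u + k)) ^+ 3 by rewrite exprn_ge0; lra.
  by move=> ? ?; rewrite ger0_norm; lra.
- by rewrite (_ : _ - _ = 0); [rewrite normr0 exprn_ge0|ring].
Qed.

Definition aff (l : R * @pt R) x : R := l.1 + (l.2.1 * x.1 + l.2.2 * x.2).
Definition lin (l : R * @pt R) w : R := l.2.1 * w.1 + l.2.2 * w.2.

Lemma affD l x w : aff l (x + w) = aff l x + lin l w.
Proof. by rewrite /aff /lin /=; ring. Qed.
Lemma linD l v w : lin l (v + w) = lin l v + lin l w.
Proof. by rewrite /lin /=; ring. Qed.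
Lemma linZ l c w : lin l (c *: w) = c * lin l w.
Proof. by rewrite /lin /= /GRing.scale /=; ring. Qed.

Definition nrm w : R := `|w.1| + `|w.2|.

Lemma nrm_ge0 w : 0 <= nrm w. Proof. by rewrite addr_ge0. Qed.

Lemma nrmZ c w : nrm (c *: w) = `|c| * nrm w.
Proof. by rewrite /nrm /= /GRing.scale /= !normrM mulrDr. Qed.

Lemma lin_bound l w : `|lin l w| <= nrm l.2 * nrm w.
Proof.
rewrite /lin /nrm; apply: (le_trans (ler_normD _ _)); rewrite !normrM.
by rewrite mulrDl !mulrDr lerD// ?lerDl ?lerDr mulr_ge0.
Qed.

Section Tcs.
Context {I : finType}.
Variables (a : I -> R) (L : I -> R * @pt R).

(** A combination of truncated cubes, followed by its first and second directional derivatives as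
    explicit formulas. They make sense at every point of the plane, so jets at points of the
    boundary of a triangle need no limits. *)
Definition tcs x : R := \sum_i a i * pp (aff (L i) x) ^+ 3.
Definition tcs1 x v : R := \sum_i a i * (3 * pp (aff (L i) x) ^+ 2 * lin (L i) v).
Definition tcs2 x v w : R := \sum_i a i * (6 * pp (aff (L i) x) * (lin (L i) v * lin (L i) w)).

Lemma tcs1D x (v w : @pt R) : tcs1 x (v + w) = tcs1 x v + tcs1 x w.
Proof. by rewrite /tcs1 -big_split; apply: eq_bigr => i _; rewrite linD /=; ring. Qed.
Lemma tcs1Z x c w : tcs1 x (c *: w) = c * tcs1 x w.
Proof. by rewrite /tcs1 mulr_sumr; apply: eq_bigr => i _; rewrite linZ /=; ring. Qed.
Lemma tcs2C x v w : tcs2 x v w = tcs2 x w v.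
Proof. by apply: eq_bigr => i _; ring. Qed.
Lemma tcs2D x (u v w : @pt R) : tcs2 x u (v + w) = tcs2 x u v + tcs2 x u w.
Proof. by rewrite /tcs2 -big_split; apply: eq_bigr => i _; rewrite linD /=; ring. Qed.
Lemma tcs2Z x c (u w : @pt R) : tcs2 x u (c *: w) = c * tcs2 x u w.
Proof. by rewrite /tcs2 mulr_sumr; apply: eq_bigr => i _; rewrite linZ /=; ring. Qed.

Let C : R := \sum_i 6 * `|a i| * (1 + nrm (L i).2) ^+ 3.

Let C_ge0 : 0 <= C.
Proof. by apply: sumr_ge0 => i _; rewrite mulr_ge0 ?mulr_ge0 ?exprn_ge0 ?addr_ge0 ?nrm_ge0. Qed.

Let tc i n : (n <= 3)%N -> (nrm (L i).2) ^+ n <= (1 + nrm (L i).2) ^+ 3.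
Proof.
move=> n3; have h := nrm_ge0 (L i).2.
apply: (@le_trans _ _ ((1 + nrm (L i).2) ^+ n)).
  by apply: lerXn2r; rewrite ?nnegrE ?lerDr// addr_ge0.
by apply: ler_weXn2l => //; rewrite lerDl.
Qed.

Let bnd (f : I -> R) (K : R) : 0 <= K ->
  (forall i, `|f i| <= 6 * (1 + nrm (L i).2) ^+ 3 * K) -> `|\sum_i a i * f i| <= C * K.
Proof.
move=> K0 h; apply: (le_trans (ler_norm_sum _ _ _)); rewrite /C mulr_suml.
apply: ler_sum => i _; rewrite normrM.
have -> : 6 * `|a i| * (1 + nrm (L i).2) ^+ 3 * K = `|a i| * (6 * (1 + nrm (L i).2) ^+ 3 * K) by ring.
by rewrite ler_wpM2l.
Qed.

(** The scalar Taylor bounds are summed over the forms. The factor [(1 + nrm (L i).2) ^+ 3]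
    dominates all powers up to the third of a gradient, so one constant serves the three estimates
    and every base point. *)
Lemma tcs_taylor : exists2 C : R, 0 <= C & forall x,
  [/\ forall w, `|tcs (x + w) - tcs x - tcs1 x w - tcs2 x w w / 2| <= C * nrm w ^+ 3,
      forall v w, `|tcs1 (x + w) v - tcs1 x v - tcs2 x v w| <= C * (nrm v * nrm w ^+ 2) &
      forall u v w : @pt R, `|tcs2 (x + w) u v - tcs2 x u v| <= C * (nrm u * nrm v * nrm w)].
Proof.
exists C => // x; split => [w|v w|u v w].
- have -> : tcs (x + w) - tcs x - tcs1 x w - tcs2 x w w / 2 = \sum_i a i *
     (pp (aff (L i) x + lin (L i) w) ^+ 3 - pp (aff (L i) x) ^+ 3
      - 3 * pp (aff (L i) x) ^+ 2 * lin (L i) w - 3 * pp (aff (L i) x) * lin (L i) w ^+ 2).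
    rewrite /tcs /tcs1 /tcs2 mulr_suml -!sumrB; apply: eq_bigr => i _; rewrite affD.
    by field.
  apply: bnd => [|i]; first by rewrite exprn_ge0// nrm_ge0.
  apply: (le_trans (pp_taylor3 _ _)).
  apply: (@le_trans _ _ ((nrm (L i).2 * nrm w) ^+ 3)).
    by apply: lerXn2r; rewrite ?nnegrE ?mulr_ge0 ?nrm_ge0// lin_bound.
  rewrite exprMn ler_wpM2r ?exprn_ge0 ?nrm_ge0//.
  apply: (le_trans (tc i (leqnn 3))); rewrite ler_peMl ?exprn_ge0 ?addr_ge0 ?nrm_ge0//; lra.
- have -> : tcs1 (x + w) v - tcs1 x v - tcs2 x v w = \sum_i a i * (3 * lin (L i) v *
     (pp (aff (L i) x + lin (L i) w) ^+ 2 - pp (aff (L i) x) ^+ 2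
      - 2 * pp (aff (L i) x) * lin (L i) w)).
    rewrite /tcs1 /tcs2 -!sumrB; apply: eq_bigr => i _; rewrite affD; ring.
  apply: bnd => [|i]; first by rewrite mulr_ge0 ?exprn_ge0// nrm_ge0.
  rewrite !normrM (ger0_norm (_ : 0 <= 3)) //.
  have h1 := lin_bound (L i) v; have h2 := lin_bound (L i) w.
  have h3 := pp_taylor2 (aff (L i) x) (lin (L i) w).
  have h4 : `|lin (L i) w| ^+ 2 <= (nrm (L i).2 * nrm w) ^+ 2.
    by apply: lerXn2r; rewrite ?nnegrE ?mulr_ge0 ?nrm_ge0.
  have h5 := le_trans h3 h4.
  have := ler_pM (normr_ge0 _) (normr_ge0 _) h1 h5.
  have h6 := tc i (leqnn 3).
  have h7 : 0 <= nrm v * nrm w ^+ 2 by rewrite mulr_ge0 ?exprn_ge0// nrm_ge0.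
  have := ler_wpM2r h7 h6.
  have h8 : 0 <= (1 + nrm (L i).2) ^+ 3 by rewrite exprn_ge0// addr_ge0// nrm_ge0.
  have := mulr_ge0 h8 h7.
  have -> : nrm (L i).2 * nrm v * (nrm (L i).2 * nrm w) ^+ 2 = nrm (L i).2 ^+ 3 * (nrm v * nrm w ^+ 2) by ring.
  have lem (W Z X Y K : R) : 0 <= X * K -> Y * K <= X * K -> W * Z <= Y * K -> 3 * W * Z <= 6 * X * K.
    by move=> ? ? ?; lra.
  exact: lem.
- have -> : tcs2 (x + w) u v - tcs2 x u v = \sum_i a i * (6 * (lin (L i) u * lin (L i) v) *
     (pp (aff (L i) x + lin (L i) w) - pp (aff (L i) x))).
    rewrite /tcs2 -!sumrB; apply: eq_bigr => i _; rewrite affD; ring.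
  apply: bnd => [|i]; first by rewrite !mulr_ge0// nrm_ge0.
  rewrite !normrM (ger0_norm (_ : 0 <= 6)) // -[X in X <= _]mulrA.
  have lem (A X K : R) : A <= X * K -> 6 * A <= 6 * X * K by lra.
  apply: lem.
  have h1 := lin_bound (L i) u; have h2 := lin_bound (L i) v.
  have h3 := le_trans (pp_taylor1 (aff (L i) x) (lin (L i) w)) (lin_bound (L i) w).
  have h12 := ler_pM (normr_ge0 _) (normr_ge0 _) h1 h2.
  have := ler_pM (mulr_ge0 (normr_ge0 _) (normr_ge0 _)) (normr_ge0 _) h12 h3.
  move/le_trans; apply.
  have h7 : 0 <= nrm u * nrm v * nrm w by rewrite !mulr_ge0 ?nrm_ge0.
  have := ler_wpM2r h7 (tc i (leqnn 3)); move=> h; apply: le_trans h; rewrite le_eqVlt; apply/orP; left; apply/eqP; ring.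
Qed.

End Tcs.

(** The coefficients are peeled off one at a time: the constant term is bounded by a multiple of
    [h], hence zero; after division by [h] the same holds for the next one, and so on. *)
Lemma quadratic_O3 (p0 p1 p2 C e : R) : 0 < e ->
  (forall h : R, 0 < h < e -> `|p0 + p1 * h + p2 * h ^+ 2| <= C * h ^+ 3) ->
  [/\ p0 = 0, p1 = 0 & p2 = 0].
Proof.
move=> e0 H.
have key (c K : R) : (forall h : R, 0 < h < Num.min e 1 -> `|c| <= K * h) -> c = 0.
  move=> h; apply/eqP; rewrite -normr_eq0 eq_le normr_ge0 andbT leNgt; apply/negP => c0.
  have m0 : 0 < Num.min e 1 by rewrite lt_min e0 ltr01.
  pose K' := `|K| + 1; have K'0 : 0 < K' by rewrite ltr_wpDl.
  pose h0 := Num.min (Num.min e 1 / 2) (`|c| / (2 * K')).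
  have h00 : 0 < h0 by rewrite lt_min !divr_gt0// mulr_gt0.
  have h01 : h0 < Num.min e 1 by rewrite gt_min ltr_pdivrMr// ltr_pMr// ltr1n.
  have := h h0; rewrite h00 h01 => /(_ isT).
  have : K * h0 <= K' * h0 by rewrite ler_wpM2r ?(ltW h00)// /K' (le_trans (ler_norm _))// lerDl.
  have : K' * h0 <= `|c| / 2.
    have -> : `|c| / 2 = K' * (`|c| / (2 * K')) by field; rewrite gt_eqF.
    by rewrite ler_wpM2l ?(ltW K'0)// ge_min lexx orbT.
  move: c0; lra.
have bd (h : R) : 0 < h < Num.min e 1 -> [/\ 0 < h, h < e, h < 1 & `|p0 + p1 * h + p2 * h ^+ 2| <= C * h ^+ 3].
  by rewrite lt_min => /and3P[h1 h2 h3]; split => //; apply: H; rewrite h1.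
have C0 : 0 <= C.
  have m0 : 0 < Num.min e 1 by rewrite lt_min e0 ltr01.
  have [|h1 h2 h3 h4] := bd (Num.min e 1 / 2).
    by rewrite divr_gt0// ltr_pdivrMr// ltr_pMr// ltr1n.
  have := le_trans (normr_ge0 _) h4; rewrite pmulr_lge0//; exact: exprn_gt0.
have z0 : p0 = 0.
  apply: (key _ (C + `|p1| + `|p2|)) => h /bd[h1 _ h2 h3].
  have -> : p0 = (p0 + p1 * h + p2 * h ^+ 2) - p1 * h - p2 * h ^+ 2 by ring.
  apply: (le_trans (ler_normB _ _)); rewrite !mulrDl.
  apply: lerD; last by rewrite normrM ler_wpM2l// ger0_norm ?exprn_ge0 ?(ltW h1)// expr2; nra.
  apply: (le_trans (ler_normB _ _)); apply: lerD; last by rewrite normrM (gtr0_norm h1).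
  apply: (le_trans h3); rewrite ler_wpM2l// !exprS expr0 mulr1; nra.
subst p0.
have z1 : p1 = 0.
  apply: (key _ (C + `|p2|)) => h /bd[h1 _ h2 h3].
  have -> : p1 = (p1 + p2 * h) - p2 * h by ring.
  apply: (le_trans (ler_normB _ _)); rewrite !mulrDl.
  apply: lerD; last by rewrite normrM (gtr0_norm h1).
  rewrite -(ler_pM2r h1) -[X in _ * X <= _](gtr0_norm h1) -normrM.
  have -> : (p1 + p2 * h) * h = 0 + p1 * h + p2 * h ^+ 2 by ring.
  apply: (le_trans h3); rewrite -mulrA ler_wpM2l// !exprS expr0 mulr1; nra.
subst p1; split => //.
apply: (key _ C) => h /bd[h1 _ h2 h3].
have h20 : 0 < h ^+ 2 by rewrite exprn_gt0.
rewrite -(ler_pM2r h20) -[X in _ * X <= _](gtr0_norm h20) -normrM.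
have -> : p2 * h ^+ 2 = 0 + 0 * h + p2 * h ^+ 2 by ring.
by apply: (le_trans h3); rewrite -mulrA -exprS.
Qed.

Section Jets.
Context {I : finType}.
Variables (a : I -> R) (L : I -> R * @pt R).

Definition jet0 x := [/\ tcs a L x = 0, forall v, tcs1 a L x v = 0 & forall v w, tcs2 a L x v w = 0].

Definition ray_O3 x w := exists2 C : R, True & exists2 e : R, 0 < e &
  forall h : R, 0 < h < e -> `|tcs a L (x + h *: w)| <= C * h ^+ 3.

Lemma ray_O3P x w : ray_O3 x w ->
  [/\ tcs a L x = 0, tcs1 a L x w = 0 & tcs2 a L x w w = 0].
Proof.
move=> [C _ [e e0 H]]; have [K K0 /(_ x)[T3 _ _]] := tcs_taylor a L.
have [|] := @quadratic_O3 (tcs a L x) (tcs1 a L x w) (tcs2 a L x w w / 2) (C + K * nrm w ^+ 3) e e0.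
  move=> h he; have /andP[h0 _] := he; have := T3 (h *: w); have := H h he.
  rewrite nrmZ (gtr0_norm h0) tcs1Z tcs2Z tcs2C tcs2Z exprMn => h1 h2.
  have -> : tcs a L x + tcs1 a L x w * h + tcs2 a L x w w / 2 * h ^+ 2 =
    tcs a L (x + h *: w) - (tcs a L (x + h *: w) - tcs a L x - h * tcs1 a L x w - h * (h * tcs2 a L x w w) / 2).
    by field.
  apply: (le_trans (ler_normB _ _)); rewrite mulrDl; apply: lerD => //.
  by apply: (le_trans h2); rewrite -mulrA [nrm w ^+ 3 * _]mulrC.
move=> h0 h1 /eqP h2; split => //; apply/eqP; move: h2; rewrite mulf_eq0 => /orP[//|].
by rewrite invr_eq0 pnatr_eq0.
Qed.

Lemma jet0_ray x w : jet0 x -> exists2 C : R, 0 <= C & forall w, `|tcs a L (x + w)| <= C * nrm w ^+ 3.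
Proof.
move=> [h0 h1 h2]; have [K K0 /(_ x)[T3 _ _]] := tcs_taylor a L; exists K => // v.
by have := T3 v; rewrite h0 h1 h2 mul0r !subr0.
Qed.

(** The rays along [u] and [v] kill the value, the gradient and the two pure second derivatives. The
    third ray has nonzero components along both, so its second derivative isolates the mixed one.
    This is how decay along rays becomes a vanishing 2-jet. *)
Lemma jet0_rays x (u v w : @pt R) (al be : R) : det2 u v != 0 -> w = al *: u + be *: v ->
  al != 0 -> be != 0 -> ray_O3 x u -> ray_O3 x v -> ray_O3 x w -> jet0 x.
Proof.
move=> duv -> al0 be0 /ray_O3P[z0 u1 u2] /ray_O3P[_ v1 v2] /ray_O3P[_ _ w2].
have uv : tcs2 a L x u v = 0.
  move: w2; rewrite tcs2D !tcs2Z ![tcs2 _ _ _ (_ + _) _]tcs2C !tcs2D !tcs2Z u2 v2 [tcs2 _ _ _ v u]tcs2C.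
  rewrite !mulr0 addr0 add0r => /eqP.
  have -> : al * (be * tcs2 a L x u v) + be * (al * tcs2 a L x u v) = (2 * al * be) * tcs2 a L x u v by ring.
  by rewrite mulf_eq0 !mulf_eq0 (negPf al0) (negPf be0) pnatr_eq0 /= => /eqP.
have dec (y : @pt R) : y = (det2 y v / det2 u v) *: u + (det2 u y / det2 u v) *: v.
  case: y u v duv {u1 u2 v1 v2 uv w2} => [y1 y2] [u1 u2] [v1 v2] duv.
  by congr pair; rewrite /= /GRing.scale /=; move: duv; rewrite /det2 /= => duv; field.
split => // [y|y y']; first by rewrite (dec y) tcs1D !tcs1Z u1 v1 !mulr0 addr0.
rewrite (dec y) (dec y') tcs2D !tcs2Z ![tcs2 _ _ _ (_ + _) _]tcs2C !tcs2D !tcs2Z.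
by rewrite u2 v2 uv [tcs2 _ _ _ v u]tcs2C uv !(mulr0, addr0).
Qed.

End Jets.
End TruncatedCubes.

(** * Volumes of slices and simplex splines *)

Section HullOfFamily.
Context {R : realType}.

(** The definition of [hull] allows repetitions and sums of any length; adding up the weights that
    fall on the same point leaves one weight per index. *)
Lemma hull_finite {V : lmodType R} (n : nat) (g : 'I_n -> V) x :
  hull (range g) x <-> exists l : 'I_n -> R,
    [/\ forall i, 0 <= l i, \sum_i l i = 1 & x = \sum_i l i *: g i].
Proof.
split=> [[m [q [l [qA [l0 [l1 ->]]]]]]|[l [l0 l1 ->]]]; last first.
  by exists n, g, l; split => [i|//]; exists i.
have {}qA i : exists j, q i = g j by have [j _ <-] := qA i; exists j.
pose f i := projT1 (cid (qA i)).
have fE i : q i = g (f i) by rewrite /f; case: cid.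
exists (fun j => \sum_(i | f i == j) l i); split.
- by move=> j; apply: sumr_ge0.
- rewrite -l1 (exchange_big_dep xpredT) //=; apply: eq_bigr => i _.
  by rewrite (eq_bigl (pred1 (f i))) ?big_pred1_eq// => j; rewrite eq_sym.
- under [RHS]eq_bigr do rewrite scaler_suml.
  rewrite (exchange_big_dep xpredT) //=; apply: eq_bigr => i _.
  by rewrite (eq_bigl (pred1 (f i))) ?big_pred1_eq ?fE// => j; rewrite eq_sym.
Qed.

Lemma pair_sum (U V : nmodType) (I : finType) (f : I -> U) (g : I -> V) :
  \sum_i (f i, g i) = (\sum_i f i, \sum_i g i) :> U * V.
Proof. by rewrite [LHS]surjective_pairing; congr pair; exact: big_morph. Qed.

Lemma ord6P (Q : 'I_6 -> Prop) : Q 0 -> Q 1 -> Q 2 -> Q 3 -> Q 4 -> Q 5 -> forall i, Q i.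
Proof.
move=> q0 q1 q2 q3 q4 q5; case=> [[|[|[|[|[|[|//]]]]]] h].
- by rewrite (_ : Ordinal h = 0)//; exact/val_inj.
- by rewrite (_ : Ordinal h = 1)//; exact/val_inj.
- by rewrite (_ : Ordinal h = 2)//; exact/val_inj.
- by rewrite (_ : Ordinal h = 3)//; exact/val_inj.
- by rewrite (_ : Ordinal h = 4)//; exact/val_inj.
- by rewrite (_ : Ordinal h = 5)//; exact/val_inj.
Qed.

Lemma sum_ord6 (V : nmodType) (F : 'I_6 -> V) :
  \sum_i F i = F 0 + (F 1 + (F 2 + (F 3 + (F 4 + F 5)))).
Proof.
rewrite !big_ord_recl big_ord0 addr0 /=.
by congr (F _ + (F _ + (F _ + (F _ + (F _ + F _))))); exact/val_inj.
Qed.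

End HullOfFamily.

(** * Linear images and planes in three-dimensional space *)

Section Slices.
Context {R : realType}.
Local Notation T1 := (measurableTypeR R).
Local Notation T2 := (T1 * T1)%type.
Local Notation T3 := (T2 * T1)%type.
Local Notation mu := (@lebesgue_measure R).

(** [z] is a row vector multiplied by [M] from the right, so composition of maps follows the order
    of the matrix product. *)
Definition mxmap (M : 'M[R]_3) (z : T3) : T3 :=
  (z.1.1 * M 0 0 + z.1.2 * M 1 0 + z.2 * M 2 0,
   z.1.1 * M 0 1 + z.1.2 * M 1 1 + z.2 * M 2 1,
   z.1.1 * M 0 2 + z.1.2 * M 1 2 + z.2 * M 2 2).

Lemma mxmapM M N z : mxmap N (mxmap M z) = mxmap (M *m N) z.
Proof.
rewrite /mxmap /= !mxE !big_ord_recl !big_ord0 /=.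
have -> : lift ord0 (ord0 : 'I_2) = 1 :> 'I_3 by apply/val_inj.
have -> : lift ord0 (lift ord0 (ord0 : 'I_1)) = 2 :> 'I_3 by apply/val_inj.
by congr (_, _, _); ring.
Qed.

Lemma mxmap1 z : mxmap 1%:M z = z.
Proof.
by case: z => [[a b] c]; rewrite /mxmap /= !mxE /= !(mulr0, mulr1, addr0, add0r).
Qed.

Lemma measurable_mxmap M : measurable_fun setT (mxmap M).
Proof.
have m1 : measurable_fun setT (fun z : T3 => z.1.1).
  by apply: (measurableT_comp measurable_fst); exact: measurable_fst.
have m2 : measurable_fun setT (fun z : T3 => z.1.2).
  by apply: (measurableT_comp measurable_snd); exact: measurable_fst.
have m3 : measurable_fun setT (fun z : T3 => z.2) by exact: measurable_snd.
have key (a b c : R) : measurable_fun setT (fun z : T3 => z.1.1 * a + z.1.2 * b + z.2 * c).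
  apply: measurable_funD; first apply: measurable_funD;
    by apply: measurable_funM => //; exact: measurable_cst.
by apply: measurable_fun_pair; [apply: measurable_fun_pair|]; exact: key.
Qed.

Lemma mxmapD M (x y : T3) : mxmap M (x.1.1 + y.1.1, x.1.2 + y.1.2, x.2 + y.2) =
  ((mxmap M x).1.1 + (mxmap M y).1.1, (mxmap M x).1.2 + (mxmap M y).1.2, (mxmap M x).2 + (mxmap M y).2).
Proof. by rewrite /mxmap /=; congr (_, _, _); ring. Qed.

Lemma leb3_mx (M : 'M[R]_3) : M \in unitmx ->
  exists2 K : R, 0 < K & forall S, measurable S -> leb3m (mxmap M @^-1` S) = (K%:E * leb3m S)%E.
Proof.
move=> uM; apply: (@leb3_linear R (mxmap M) (mxmap (invmx M))).
- exact: measurable_mxmap.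
- exact: measurable_mxmap.
- by move=> z; rewrite mxmapM mulmxV// mxmap1.
- by move=> z; rewrite mxmapM mulVmx// mxmap1.
- by move=> x y; rewrite -mxmapD.
Qed.

Definition scalar3 (v : R * R * R) (z : T3) : R := v.1.1 * z.1.1 + v.1.2 * z.1.2 + v.2 * z.2.

Lemma measurable_dot3 v : measurable_fun setT (scalar3 v).
Proof.
have m1 : measurable_fun setT (fun z : T3 => z.1.1).
  by apply: (measurableT_comp measurable_fst); exact: measurable_fst.
have m2 : measurable_fun setT (fun z : T3 => z.1.2).
  by apply: (measurableT_comp measurable_snd); exact: measurable_fst.
have m3 : measurable_fun setT (fun z : T3 => z.2) by exact: measurable_snd.
apply: measurable_funD; first apply: measurable_funD;
  by apply: measurable_funM => //; exact: measurable_cst.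
Qed.

Lemma measurable_plane v c : measurable [set z : T3 | scalar3 v z = c].
Proof.
have -> : [set z : T3 | scalar3 v z = c] = scalar3 v @^-1` [set c] by [].
by rewrite -[_ @^-1` _]setTI; apply: measurable_dot3.
Qed.

(** If the last coordinate of the normal is nonzero, the plane is a graph over the first two
    coordinates and its sections are single points. A transposition of coordinates, which scales the
    measure by a positive factor, reduces the other cases to this one. *)
Lemma leb3_plane v c : v != (0, 0, 0) -> leb3m [set z : T3 | scalar3 v z = c] = 0%E.
Proof.
have last (w : R * R * R) d : w.2 != 0 -> leb3m [set z : T3 | scalar3 w z = d] = 0%E.
  move=> w0; apply: integral0_eq => /= x _.
  have : xsection [set z : T3 | scalar3 w z = d] x `<=` [set (d - w.1.1 * x.1 - w.1.2 * x.2) / w.2].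
    move=> y; rewrite /xsection /= inE /scalar3 /= => <-; field; exact: w0.
  move=> sub; have h1 := lebesgue_measure_set1 ((d - w.1.1 * x.1 - w.1.2 * x.2) / w.2).
  apply/eqP; rewrite -measure_le0 -h1; apply: le_measure; rewrite ?inE//.
  by apply: measurable_xsection; exact: measurable_plane.
case: v => [[a b] e] v0.
have [e0|e0] := eqVneq e 0; last exact: last.
have swap (i : 'I_3) (w : R * R * R) : w.2 != 0 ->
    (forall z, scalar3 w (mxmap (tperm_mx i 2) z) = scalar3 (a, b, e) z) ->
    leb3m [set z : T3 | scalar3 (a, b, e) z = c] = 0%E.
  move=> w0 wE.
  have [|K K0 KE] := @leb3_mx (tperm_mx i 2); first exact: unitmx_perm.
  have := KE _ (measurable_plane w c); rewrite last// mule0 => <-; congr (leb3m _).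
  by apply/seteqP; split => z /=; rewrite wE.
have [b0|b0] := eqVneq b 0.
  apply: (swap 0 (e, b, a)); first by apply: contraNneq v0 => /= ->; rewrite b0 e0.
  by move=> z; rewrite /mxmap /scalar3 /= !mxE !permE /=; ring.
apply: (swap 1 (a, e, b)) => // z.
by rewrite /mxmap /scalar3 /= !mxE !permE /=; ring.
Qed.

(** Measurability can be dispensed with: the integral of a nonnegative function is a supremum over
    the simple functions below it, and a larger function has more of these. *)
Lemma ge0_integral_mono d (T : measurableType d) (m : {measure set T -> \bar R}) (f g : T -> \bar R) :
  (forall x, 0 <= f x)%E -> (forall x, f x <= g x)%E -> (\int[m]_x f x <= \int[m]_x g x)%E.
Proof.
move=> f0 fg; rewrite !ge0_integralTE// => [|x]; last exact: le_trans (fg x).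
by apply: ereal_sup_le => _ [h hf <-]; exists h => // x; exact: le_trans (fg x).
Qed.

(* [leb3m] is defined on all sets, and stays monotone on the non-measurable ones. *)
Lemma le_leb3 (S S' : set T3) : S `<=` S' -> (leb3m S <= leb3m S')%E.
Proof.
move=> sub; apply: ge0_integral_mono => x /=; first exact: mu_ext_ge0.
by apply: le_mu_ext => y; rewrite /xsection /= !inE; exact: sub.
Qed.

(** The image of a singular [M] is orthogonal to a null vector of [M], so [S] lies in a plane. Since
    [S] may fail to be measurable, the conclusion goes through monotonicity on all sets. *)
Lemma leb3_slice_singular (M : 'M[R]_3) (S : set T3) (z0 : T3) : M \notin unitmx ->
  (forall z, S z -> exists q, z = z0 + mxmap M q) -> leb3m S = 0%E.
Proof.
rewrite unitmxE unitfE negbK -det_tr => /det0P[v v0 vM] SM.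
pose w : R * R * R := (v 0 0, v 0 1, v 0 2).
have w0 : w != (0, 0, 0).
  apply: contraNneq v0 => -[e0 e1 e2]; apply/eqP/rowP; case=> [[|[|[|//]]] h]; rewrite mxE.
  - by rewrite -[RHS]e0; congr (v _ _); exact/val_inj.
  - by rewrite -[RHS]e1; congr (v _ _); exact/val_inj.
  - by rewrite -[RHS]e2; congr (v _ _); exact/val_inj.
have wM q : scalar3 w (mxmap M q) = 0.
  have h j : v 0 0 * M j 0 + v 0 1 * M j 1 + v 0 2 * M j 2 = 0.
    have /rowP/(_ j) := vM; rewrite !mxE !big_ord_recl big_ord0 !mxE /= addr0 addrA => h.
    rewrite -[RHS]h; congr (_ + _ + _); congr (v _ _ * M _ _); exact/val_inj.
  rewrite /scalar3 /mxmap /w /=.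
  transitivity (q.1.1 * (v 0 0 * M 0 0 + v 0 1 * M 0 1 + v 0 2 * M 0 2) +
    q.1.2 * (v 0 0 * M 1 0 + v 0 1 * M 1 1 + v 0 2 * M 1 2) +
    q.2 * (v 0 0 * M 2 0 + v 0 1 * M 2 1 + v 0 2 * M 2 2)); first by ring.
  by rewrite !h !mulr0 !addr0.
apply/eqP; rewrite eq_le; apply/andP; split; last by apply: integral_ge0 => x _; exact: mu_ext_ge0.
rewrite -(leb3_plane (scalar3 w z0) w0); apply: le_leb3 => z /SM[q ->] /=.
by rewrite -[RHS]addr0 -(wM q) /scalar3 /=; ring.
Qed.

End Slices.

(** * The slices of a lifted simplex, parametrized by three barycentric weights *)

Section SplineFormula.
Context {R : realType}.
Local Notation T1 := (measurableTypeR R).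
Local Notation T2 := (T1 * T1)%type.
Local Notation T3 := (T2 * T1)%type.
Local Notation mu := (@lebesgue_measure R).

Variables (P : 'I_6 -> @pt R).
Let P0 := P 0. Let P1 := P 1. Let P2 := P 2. Let P3 := P 3. Let P4 := P 4. Let P5 := P 5.
Let D := det2 (P1 - P0) (P2 - P0).
Hypothesis D0 : D != 0.

Definition bar1 (u : @pt R) : R := det2 u (P2 - P0) / D.
Definition bar2 (u : @pt R) : R := det2 (P1 - P0) u / D.

Lemma bar_dec u : u = bar1 u *: (P1 - P0) + bar2 u *: (P2 - P0).
Proof.
case: u => a b; rewrite /bar1 /bar2; move: D0; rewrite /D /det2 /= => h.
by congr pair; rewrite /= /GRing.scale /=; field.
Qed.

Lemma bar_uniq (a b : R) u : u = a *: (P1 - P0) + b *: (P2 - P0) -> a = bar1 u /\ b = bar2 u.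
Proof.
move=> ->; rewrite /bar1 /bar2; move: D0; rewrite /D /det2 /= /GRing.scale /= => h.
by split; field.
Qed.

Definition knot_shift (q : T3) : @pt R :=
  q.1.1 *: (P3 - P0) + q.1.2 *: (P4 - P0) + q.2 *: (P5 - P0).

(** Six barycentric weights representing [x] satisfy three affine equations. The weights [q] of the
    last three knots are free; those of the first three, which are affinely independent, follow by
    Cramer's rule. The resulting admissible set [Qset] does not involve any lift. *)
Definition weights (x : @pt R) (q : T3) : 'I_6 -> R := fun i =>
  let u := x - P0 - knot_shift q in
  tnth [tuple 1 - (q.1.1 + q.1.2 + q.2) - bar1 u - bar2 u; bar1 u; bar2 u; q.1.1; q.1.2; q.2] i.

Definition Qset (x : @pt R) : set T3 := [set q | forall i, 0 <= weights x q i].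

Lemma weightsP (x : @pt R) (l : 'I_6 -> R) : \sum_i l i = 1 -> x = \sum_i l i *: P i ->
  forall i, l i = weights x (l 3, l 4, l 5) i.
Proof.
rewrite !sum_ord6 => l1 xE.
have e : x - P0 - knot_shift (l 3, l 4, l 5) = l 1 *: (P1 - P0) + l 2 *: (P2 - P0).
  rewrite xE /knot_shift /=; have -> : l 0 = 1 - (l 1 + (l 2 + (l 3 + (l 4 + l 5)))) by rewrite -l1; ring.
  rewrite -/P0 -/P1 -/P2 -/P3 -/P4 -/P5.
  by case: (P0) (P1) (P2) (P3) (P4) (P5) => ? ? [? ?] [? ?] [? ?] [? ?] [? ?];
    congr pair; rewrite /= /GRing.scale /=; ring.
have [e1 e2] := bar_uniq e.
apply: ord6P; rewrite /weights /tnth /= -?e1 -?e2 //.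
by rewrite -l1; ring.
Qed.

Lemma sum_weights x q : \sum_i weights x q i = 1.
Proof. by rewrite sum_ord6 /weights /tnth /=; ring. Qed.

(** For a lift [y], the fibre coordinate of a point of the simplex above [x] is an affine function
    of the free weights. Its constant term is [origin]; its linear part, [lift_mx], does not depend
    on [x]. *)
Definition origin (y : 'I_6 -> @R3 R) (x : @pt R) : T3 :=
  y 0 + bar1 (x - P0) *: (y 1 - y 0) + bar2 (x - P0) *: (y 2 - y 0).

Definition edge_image (y : 'I_6 -> @R3 R) (k : 'I_6) : T3 :=
  y k - y 0 - bar1 (P k - P0) *: (y 1 - y 0) - bar2 (P k - P0) *: (y 2 - y 0).

Definition lift_mx (y : 'I_6 -> @R3 R) : 'M[R]_3 := \matrix_(i, j)
  let w := edge_image y (tnth [tuple 3; 4; 5] i) in tnth [tuple w.1.1; w.1.2; w.2] j.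

Lemma weighted_sum (y : 'I_6 -> @R3 R) x q :
  \sum_i weights x q i *: y i = origin y x + mxmap (lift_mx y) q.
Proof.
rewrite sum_ord6 /origin /mxmap /lift_mx !mxE /tnth /= /edge_image /weights /tnth /= /knot_shift /bar1 /bar2 /det2.
rewrite -/P0 -/P1 -/P2 -/P3 -/P4 -/P5.
case: (y 0) (y 1) (y 2) (y 3) (y 4) (y 5) => [[? ?] ?] [[? ?] ?] [[? ?] ?] [[? ?] ?] [[? ?] ?] [[? ?] ?].
by congr (_, _, _); rewrite /= /GRing.scale /=; ring.
Qed.

Lemma measurable_weights i : measurable_fun setT (fun p : T2 * T3 => weights p.1 p.2 i).
Proof.
have m1 : measurable_fun setT (fun p : T2 * T3 => p.1.1).
  by apply: (measurableT_comp measurable_fst); exact: measurable_fst.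
have m2 : measurable_fun setT (fun p : T2 * T3 => p.1.2).
  by apply: (measurableT_comp measurable_snd); exact: measurable_fst.
have m3 : measurable_fun setT (fun p : T2 * T3 => p.2.1.1).
  by do 2 (apply: (measurableT_comp measurable_fst)); exact: measurable_snd.
have m4 : measurable_fun setT (fun p : T2 * T3 => p.2.1.2).
  by apply: (measurableT_comp measurable_snd); apply: (measurableT_comp measurable_fst); exact: measurable_snd.
have m5 : measurable_fun setT (fun p : T2 * T3 => p.2.2).
  by apply: (measurableT_comp measurable_snd); exact: measurable_snd.
have mB (f g : T2 * T3 -> R) : measurable_fun setT f -> measurable_fun setT g -> measurable_fun setT (fun p => f p - g p).
  by move=> mf mg; exact: measurable_funB.
have mZ (f : T2 * T3 -> R) (c : R) : measurable_fun setT f -> measurable_fun setT (fun p => f p * c).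
  by move=> mf; exact: measurable_funM.
have mZl (f : T2 * T3 -> R) (c : R) : measurable_fun setT f -> measurable_fun setT (fun p => c * f p).
  by move=> mf; exact: measurable_funM.
have mD3 : measurable_fun setT (fun p : T2 * T3 => p.2.1.1 + p.2.1.2 + p.2.2).
  by apply: measurable_funD => //; exact: measurable_funD.
have mc (c a3 a4 a5 : R) (f : T2 * T3 -> R) : measurable_fun setT f ->
    measurable_fun setT (fun p : T2 * T3 => f p - c - (p.2.1.1 * a3 + p.2.1.2 * a4 + p.2.2 * a5)).
  move=> mf; apply: (mB (fun p => f p - c)); first exact: (mB f).
  by apply: measurable_funD; [apply: measurable_funD|]; exact: mZ.
have mu1 : measurable_fun setT (fun p : T2 * T3 => ((p.1 : @pt R) - P0 - knot_shift p.2).1) by exact: mc.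
have mu2 : measurable_fun setT (fun p : T2 * T3 => ((p.1 : @pt R) - P0 - knot_shift p.2).2) by exact: mc.
have mb1 : measurable_fun setT (fun p : T2 * T3 => bar1 ((p.1 : @pt R) - P0 - knot_shift p.2)).
  by apply: (mZ); apply: (mB); exact: (mZ).
have mb2 : measurable_fun setT (fun p : T2 * T3 => bar2 ((p.1 : @pt R) - P0 - knot_shift p.2)).
  by apply: (mZ); apply: (mB); exact: (mZl).
by move: i; apply: ord6P => //; apply: (mB) => //; apply: (mB) => //; exact: (mB).
Qed.

Definition Qgraph : set (T2 * T3) := [set p | Qset p.1 p.2].

Lemma measurable_Qgraph : measurable Qgraph.
Proof.
have -> : Qgraph = \bigcap_(i in [set: 'I_6]) ((fun p : T2 * T3 => weights p.1 p.2 i) @^-1` `[0, +oo[).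
  apply/seteqP; split => p /= h i; last by have := h i I; rewrite /= in_itv /= andbT.
  by move=> _; rewrite /= in_itv /= andbT; exact: h.
apply: fin_bigcap_measurable; first exact: finite_finset.
by move=> i _; rewrite -[_ @^-1` _]setTI; apply: measurable_weights.
Qed.

Lemma xsection_Qgraph x : xsection Qgraph x = Qset x.
Proof. by apply/seteqP; split => q; rewrite /xsection /= inE. Qed.

Lemma measurable_Qset x : measurable (Qset x).
Proof. by rewrite -xsection_Qgraph; apply: measurable_xsection; exact: measurable_Qgraph. Qed.

Lemma Qset_sub1 x : Qset x `<=` `[0, 1] `*` `[0, 1] `*` `[0, 1].
Proof.
move=> [[q1 q2] q3] h; have := sum_weights x (q1, q2, q3); rewrite sum_ord6.
have := h 0; have := h 1; have := h 2; have := h 3; have := h 4; have := h 5.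
have -> : weights x (q1, q2, q3) 3 = q1 by [].
have -> : weights x (q1, q2, q3) 4 = q2 by [].
have -> : weights x (q1, q2, q3) 5 = q3 by [].
move: (weights _ _ 0) (weights _ _ 1) (weights _ _ 2) => a b c h1 h2 h3 h4 h5 h6 h7.
by split; [split|]; rewrite /= in_itv /=; apply/andP; split; lra.
Qed.

(** Up to a translation, the set of points [x] for which given nonnegative free weights of sum
    [1 - s] are admissible. *)
Definition tri_cone (s : R) : set T2 := [set u | [/\ 0 <= bar1 u, 0 <= bar2 u & bar1 u + bar2 u <= s]].

Lemma measurable_tri_cone s : measurable (tri_cone s).
Proof.
have m2 (c : R) (f : T2 -> R) : measurable_fun setT f -> measurable (f @^-1` `]-oo, c]).
  by move=> mf; rewrite -[_ @^-1` _]setTI; apply: mf.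
have ma (c d : R) : measurable_fun setT (fun u : T2 => c * u.1 + d * u.2).
  apply: measurable_funD; apply: measurable_funM => //.
pose a1 := - bar1 (1, 0); pose a2 := - bar1 (0, 1); pose b1 := - bar2 (1, 0); pose b2 := - bar2 (0, 1).
have -> : tri_cone s = ((fun u : T2 => a1 * u.1 + a2 * u.2) @^-1` `]-oo, 0]) `&`
   ((fun u : T2 => b1 * u.1 + b2 * u.2) @^-1` `]-oo, 0]) `&`
   ((fun u : T2 => (- a1 - b1) * u.1 + (- a2 - b2) * u.2) @^-1` `]-oo, s]).
  have e1 u : bar1 u = - (a1 * u.1 + a2 * u.2) by rewrite /a1 /a2 /bar1 /det2 /=; ring.
  have e2 u : bar2 u = - (b1 * u.1 + b2 * u.2) by rewrite /b1 /b2 /bar2 /det2 /=; ring.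
  rewrite /tri_cone; apply/seteqP; split => u /=; rewrite !in_itv /= e1 e2.
    by move=> [? ? ?]; split; [split|]; lra.
  by move=> [[? ?] ?]; split; lra.
by apply: measurableI; [apply: measurableI|]; apply: m2; exact: ma.
Qed.

Definition cone_volume (q : T3) : \bar R :=
  if [&& 0 <= q.1.1, 0 <= q.1.2 & 0 <= q.2] then leb2m (tri_cone (1 - (q.1.1 + q.1.2 + q.2))) else 0%E.

Lemma ysection_volume (q : T3) : leb2m (ysection Qgraph q) = cone_volume q.
Proof.
rewrite /cone_volume; case: ifP => [/and3P[q1 q2 q3]|qn]; last first.
  rewrite (_ : ysection _ _ = set0) ?measure0//; apply/seteqP; split => x //=.
  rewrite /ysection /= inE /Qgraph /= => h; move: qn.
  have := h 3; have := h 4; have := h 5; rewrite /weights /tnth /=.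
  by move=> -> -> ->.
rewrite -(leb2_translation (- (P0 + knot_shift q)) (measurable_tri_cone _)); congr (leb2m _).
apply/seteqP; split => x /=; rewrite /ysection /= inE /Qgraph /=.
  move=> h; have := h 0; have := h 1; have := h 2; rewrite /weights /tnth /=.
  have -> : (x.1 + (- (P0 + knot_shift q)).1, x.2 + (- (P0 + knot_shift q)).2) = x - P0 - knot_shift q.
    by rewrite -addrA -opprD.
  by move=> ? ? ?; split => //; lra.
have -> : (x.1 + (- (P0 + knot_shift q)).1, x.2 + (- (P0 + knot_shift q)).2) = x - P0 - knot_shift q.
  by rewrite -addrA -opprD.
by move=> [h1 h2 h3]; apply: ord6P; rewrite /weights /tnth //=; lra.
Qed.

Definition total_volume : \bar R := (\int[leb3m]_q cone_volume q)%E.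

(** Exchange of the order of integration. The right-hand side depends on the first three knots only,
    which [near_kap] exploits to compare two different splines. *)
Lemma total_volumeE : (\int[leb2m]_x leb3m (Qset x) = total_volume)%E.
Proof.
have := indic_fubini_tonelli leb2m leb3m measurable_Qgraph.
rewrite (indic_fubini_tonelli_FE leb3m measurable_Qgraph) (indic_fubini_tonelli_GE leb2m measurable_Qgraph).
move=> h; transitivity (\int[leb2m]_x (leb3m \o xsection Qgraph) x)%E.
  by apply: eq_integral => x _ /=; rewrite xsection_Qgraph.
by rewrite h /total_volume; apply: eq_integral => q _ /=; rewrite ysection_volume.
Qed.

Lemma tri_cone_bounded : (leb2m (tri_cone 1) < +oo)%E.
Proof.
pose a : R := `|(P1 - P0).1| + `|(P2 - P0).1|; pose b : R := `|(P1 - P0).2| + `|(P2 - P0).2|.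
pose B : set T2 := `[- a, a] `*` `[- b, b].
have sub : tri_cone 1 `<=` B.
  move=> u [h1 h2 h3].
  have key (s t x y : R) : 0 <= s -> 0 <= t -> s + t <= 1 -> `|s * x + t * y| <= `|x| + `|y|.
    move=> s0 t0 st; apply: (le_trans (ler_normD _ _)); rewrite !normrM (ger0_norm s0) (ger0_norm t0).
    by apply: lerD; rewrite ler_piMl//; lra.
  by rewrite [u]bar_dec; split; rewrite /= in_itv /= -ler_norml; exact: key.
have mab : measurable B by exact: measurableX.
apply: (le_lt_trans (le_measure _ _ _ sub)); rewrite ?inE//; first exact: measurable_tri_cone.
have a0 : 0 <= a by rewrite /a addr_ge0.
have b0 : 0 <= b by rewrite /b addr_ge0.
have BE : leb2m B = ((a - - a) * (b - - b))%:E by apply: leb2_itv; rewrite ge0_cp.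
by rewrite [X in (X < _)%E](_ : _ = ((a - - a) * (b - - b))%:E) ?ltry//; exact: BE.
Qed.

Lemma cone_volume_ge0 q : (0 <= cone_volume q)%E.
Proof. by rewrite /cone_volume; case: ifP. Qed.

Lemma measurable_cone_volume : measurable_fun setT cone_volume.
Proof.
rewrite (_ : cone_volume = leb2m \o ysection Qgraph); first by apply: measurable_fun_ysection; exact: measurable_Qgraph.
by apply/funext => q /=; rewrite ysection_volume.
Qed.
Hint Resolve cone_volume_ge0 measurable_cone_volume : core.

Lemma total_volume_lty : (total_volume < +oo)%E.
Proof.
pose B : set T3 := `[0, 1] `*` `[0, 1] `*` `[0, 1].
have mB : measurable B by apply: measurableX; [exact: measurableX|].
rewrite /total_volume.
have m1 : measurable_fun setT (fun q => leb2m (tri_cone 1) * (\1_B q)%:E)%E.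
  apply: emeasurable_funM => //; exact/measurable_EFinP/measurable_indic.
have g1 q : (0 <= leb2m (tri_cone 1) * (\1_B q)%:E)%E by rewrite mule_ge0.
apply: (@le_lt_trans _ _ (\int[leb3m]_q (leb2m (tri_cone 1) * (\1_B q)%:E))%E).
  apply: ge0_le_integral => //.
  - move=> [[q1 q2] q3] _; rewrite /cone_volume /=; case: ifP => [/and3P[h1 h2 h3]|_]; last by rewrite mule_ge0.
    have [hq|hq] := leP (q1 + q2 + q3) 1.
      rewrite indicE mem_set ?mule1.
        apply: le_measure; rewrite ?inE//; try exact: measurable_tri_cone.
        by move=> u /= [? ? ?]; split => //; lra.
      by rewrite /B /= !in_itv /=; split; [split|]; apply/andP; split; lra.
    rewrite (_ : tri_cone _ = set0) ?measure0 ?mule_ge0//.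
    by apply/seteqP; split => u //= [? ? ?]; lra.
rewrite ge0_integralZl//; last exact/measurable_EFinP/measurable_indic.
rewrite integral_indic// setIT.
have BE : leb3m B = ((1 - 0) * (1 - 0) * (1 - 0))%:E by apply: leb3_itv; exact: ler01.
rewrite [X in (X < _)%E](_ : _ = leb2m (tri_cone 1) * ((1 - 0) * (1 - 0) * (1 - 0))%:E)%E; last by congr (_ * _)%E; exact: BE.
by rewrite subr0 !mulr1 mule1; exact: tri_cone_bounded.
Qed.

(** Free weights of at most 1/6 each leave at least 1/2 for the other three, and a triangle of
    positive scale contains a small square. *)
Lemma total_volume_gt0 : (0 < total_volume)%E.
Proof.
pose B : set T3 := `[0, 1 / 6] `*` `[0, 1 / 6] `*` `[0, 1 / 6].
have mB : measurable B by apply: measurableX; [exact: measurableX|].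
have m1 : measurable_fun setT (fun q => leb2m (tri_cone (1 / 2)) * (\1_B q)%:E)%E.
  apply: emeasurable_funM => //; exact/measurable_EFinP/measurable_indic.
have g1 q : (0 <= leb2m (tri_cone (1 / 2)) * (\1_B q)%:E)%E by rewrite mule_ge0.
apply: (@lt_le_trans _ _ (\int[leb3m]_q (leb2m (tri_cone (1 / 2)) * (\1_B q)%:E))%E); last first.
  apply: ge0_le_integral => //.
  - move=> [[q1 q2] q3] _; rewrite indicE; case: (boolP (_ \in B)) => /= qB; last first.
      by rewrite mule0 /cone_volume; case: ifP.
    move: qB; rewrite inE /B /= !in_itv /= => -[[/andP[h1 h2] /andP[h3 h4]] /andP[h5 h6]].
    rewrite mule1 /cone_volume /= h1 h3 h5 /=.
    apply: le_measure; rewrite ?inE//; try exact: measurable_tri_cone.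
    by move=> u /= [? ? ?]; split => //; lra.
rewrite ge0_integralZl//; last exact/measurable_EFinP/measurable_indic.
rewrite integral_indic// setIT.
have h16 : 0 <= 1 / 6 :> R by lra.
have BE : leb3m B = ((1 / 6 - 0) * (1 / 6 - 0) * (1 / 6 - 0))%:E by apply: leb3_itv; exact: h16.
rewrite [X in (_ < X)%E](_ : _ = leb2m (tri_cone (1 / 2)) * ((1 / 6 - 0) * (1 / 6 - 0) * (1 / 6 - 0))%:E)%E; last by congr (_ * _)%E; exact: BE.
apply: mule_gt0; last by rewrite lte_fin subr0 !mulr_gt0.
have [c hc] : exists c : @pt R, bar1 c = 1 / 8 /\ bar2 c = 1 / 8.
  exists ((1 / 8) *: (P1 - P0) + (1 / 8) *: (P2 - P0)).
  by have [<- <-] := bar_uniq (erefl ((1 / 8) *: (P1 - P0) + (1 / 8) *: (P2 - P0))).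
(* [k] bounds the coefficients of [bar1] and of [bar2]. On the square of half-side [1 / (16 k)]
   around [c] both coordinates therefore stay within 1/16 of 1/8, and their sum stays below 1/2. *)
pose k := 1 + `|bar1 (1, 0)| + `|bar1 (0, 1)| + `|bar2 (1, 0)| + `|bar2 (0, 1)|.
have k1 : 1 <= k by rewrite /k -!addrA lerDl !addr_ge0.
pose e : R := (16 * k)^-1.
have e0 : 0 < e by rewrite invr_gt0; lra.
pose B' : set T2 := `[c.1 - e, c.1 + e] `*` `[c.2 - e, c.2 + e].
have sub : B' `<=` tri_cone (1 / 2).
  move=> u [] /=; rewrite !in_itv /= => hu1 hu2.
  have key (f : @pt R -> R) : f c = 1 / 8 -> (forall a b : @pt R, f (a + b) = f a + f b) ->
      (forall r (a : @pt R), f (r *: a) = r * f a) -> `|f (1, 0)| + `|f (0, 1)| <= k ->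
      1 / 16 <= f u <= 3 / 16.
    move=> fc fD fZ fk.
    have -> : (u : @pt R) = c + ((u.1 - c.1) *: (1, 0) + (u.2 - c.2) *: (0, 1)).
      by case: (u) => a b; congr pair; rewrite /= /GRing.scale /=; ring.
    rewrite fD fc fD !fZ.
    have : `|(u.1 - c.1) * f (1, 0) + (u.2 - c.2) * f (0, 1)| <= 1 / 16.
      apply: (le_trans (ler_normD _ _)); rewrite !normrM.
      have b1 : `|u.1 - c.1| <= e by rewrite ler_norml; apply/andP; split; move: hu1 => /andP[]; lra.
      have b2 : `|u.2 - c.2| <= e by rewrite ler_norml; apply/andP; split; move: hu2 => /andP[]; lra.
      apply: (@le_trans _ _ (e * (`|f (1, 0)| + `|f (0, 1)|))).
        by rewrite mulrDr lerD// ler_wpM2r.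
      have -> : 1 / 16 = e * k by rewrite /e; field; rewrite gt_eqF//; lra.
      by rewrite ler_wpM2l// ltW.
    by rewrite ler_norml => /andP[h1 h2]; apply/andP; split; lra.
  have := key bar1 hc.1; have := key bar2 hc.2 => k2' k1'.
  have /andP[? ?] : 1 / 16 <= bar1 u <= 3 / 16.
    apply: k1' => [a b|r a|]; try by rewrite /bar1 /det2 /= /GRing.scale /=; ring.
    by rewrite /k; have := normr_ge0 (bar2 (1, 0)); have := normr_ge0 (bar2 (0, 1)); lra.
  have /andP[? ?] : 1 / 16 <= bar2 u <= 3 / 16.
    apply: k2' => [a b|r a|]; try by rewrite /bar2 /det2 /= /GRing.scale /=; ring.
    by rewrite /k; have := normr_ge0 (bar1 (1, 0)); have := normr_ge0 (bar1 (0, 1)); lra.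
  by rewrite /tri_cone /=; split; lra.
have mab : measurable B' by exact: measurableX.
apply: (@lt_le_trans _ _ (leb2m B')); last first.
  by apply: le_measure; rewrite ?inE//; exact: measurable_tri_cone.
have BE' : leb2m B' = ((c.1 + e - (c.1 - e)) * (c.2 + e - (c.2 - e)))%:E by apply: leb2_itv; lra.
rewrite [X in (_ < X)%E](_ : _ = ((c.1 + e - (c.1 - e)) * (c.2 + e - (c.2 - e)))%:E); last exact: BE'.
by rewrite lte_fin mulr_gt0//; lra.
Qed.

Definition kap : R := (fine total_volume)^-1.

Lemma total_volume_fine : total_volume = (fine total_volume)%:E.
Proof. by rewrite fineK// ge0_fin_numE ?total_volume_lty// ltW// total_volume_gt0. Qed.

Lemma kap_gt0 : 0 < kap.
Proof. by rewrite invr_gt0 -lte_fin -total_volume_fine total_volume_gt0. Qed.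

Lemma slice_Qset (y : 'I_6 -> @R3 R) x :
  slice P y x = [set z | exists2 q, Qset x q & z = origin y x + mxmap (lift_mx y) q].
Proof.
apply/seteqP; split => z; rewrite /slice /lifted_simplex /=.
  move=> /hull_finite[l [l0 l1 e]].
  have [xE zE] : (x, z) = (\sum_i l i *: P i, \sum_i l i *: y i) by rewrite e -pair_sum.
  exists (l 3, l 4, l 5); first by move=> i; rewrite -(weightsP l1 xE).
  by rewrite -weighted_sum zE; apply: eq_bigr => i _; rewrite -(weightsP l1 xE).
move=> [q Qq ->]; apply/hull_finite; exists (weights x q); split => //; first exact: sum_weights.
rewrite -weighted_sum; transitivity (\sum_i weights x q i *: P i, \sum_i weights x q i *: y i); last by rewrite -pair_sum.
congr pair; rewrite sum_ord6 /weights /tnth /=.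
set u := x - P0 - knot_shift q; have -> : x = u + P0 + knot_shift q by rewrite /u [_ - knot_shift q + _]addrAC !subrK.
rewrite {1}[u]bar_dec /knot_shift; move: (bar1 _) (bar2 _) => a b.
rewrite -/P0 -/P1 -/P2 -/P3 -/P4 -/P5.
by case: (P0) (P1) (P2) (P3) (P4) (P5) => ? ? [? ?] [? ?] [? ?] [? ?] [? ?];
    congr pair; rewrite /= /GRing.scale /=; ring.
Qed.

Lemma slice_measure (y : 'I_6 -> @R3 R) : lift_mx y \in unitmx ->
  exists2 K : R, 0 < K & forall x, leb3m (slice P y x) = (K%:E * leb3m (Qset x))%E.
Proof.
move=> uW; have [|K K0 KE] := @leb3_mx R (invmx (lift_mx y)); first by rewrite unitmx_inv.
exists K => // x; rewrite -(KE _ (measurable_Qset x)).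
have mS : measurable (mxmap (invmx (lift_mx y)) @^-1` Qset x : set T3).
  by have := measurable_mxmap (invmx (lift_mx y)) measurableT (measurable_Qset x); rewrite setTI.
rewrite -(leb3_translation (- origin y x) mS); congr (leb3m _).
rewrite slice_Qset; apply/seteqP; split => z /=.
  move=> [q Qq ->].
  rewrite (_ : (_, _) = mxmap (lift_mx y) q) ?mxmapM ?mulmxV ?mxmap1//.
  by case: (mxmap _ _) => [[? ?] ?]; congr (_, _, _) => /=; ring.
move=> Qq; exists (mxmap (invmx (lift_mx y)) (z - origin y x)) => //.
by rewrite mxmapM mulVmx// mxmap1 addrC subrK.
Qed.

(** A lift with singular matrix has only null slices, and so a simplex of volume zero. *)
Lemma good_lift_unit (y : 'I_6 -> @R3 R) : good_lift P y -> lift_mx y \in unitmx.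
Proof.
apply: contraTT => uW; rewrite -leNgt /good_lift leb5E.
rewrite (_ : (\int[leb2m]_x _ = 0)%E)//; apply: integral0_eq => x _.
apply: (leb3_slice_singular (z0 := origin y x) uW) => z.
rewrite /xsection /= inE => h; have : slice P y x z by [].
by rewrite slice_Qset => -[q _ ->]; exists q.
Qed.

Lemma leb5_lift (y : 'I_6 -> @R3 R) (K : R) : 0 <= K ->
  (forall x, leb3m (slice P y x) = (K%:E * leb3m (Qset x))%E) ->
  leb5 (lifted_simplex P y) = (K * fine total_volume)%:E.
Proof.
move=> K0 KE; rewrite leb5E EFinM -total_volume_fine -total_volumeE -ge0_integralZl//; last first.
  have := measurable_fun_xsection leb3m measurable_Qgraph.
  by apply: eq_measurable_fun => x _ /=; rewrite xsection_Qgraph.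
apply: eq_integral => x _; rewrite -KE; congr (leb3m _).
by apply/seteqP; split => z; rewrite /xsection /= inE.
Qed.

Lemma good_lift_exists : exists y : 'I_6 -> @R3 R, good_lift P y.
Proof.
(* The first three knots are lifted to the origin and the last three to the unit vectors, so that
   the free weights themselves are the fibre coordinates. *)
pose y (i : 'I_6) : @R3 R := tnth [tuple 0; 0; 0; (1, 0, 0); (0, 1, 0); (0, 0, 1)] i.
have W1 : lift_mx y = 1%:M.
  apply/matrixP; case=> [[|[|[|//]]] hi]; case=> [[|[|[|//]]] hj];
    by rewrite !mxE /tnth /= /edge_image /y /tnth /= /GRing.scale /= ?subrr ?subr0 ?mulr0 ?subr0.
have uW : lift_mx y \in unitmx by rewrite W1 unitmx1.
have [K K0 KE] := slice_measure uW; exists y.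
rewrite /good_lift (leb5_lift (ltW K0) KE) lte_fin mulr_gt0//.
by rewrite -lte_fin -total_volume_fine total_volume_gt0.
Qed.

(** One factor [K] scales every slice, hence also the volume of the simplex; it cancels in the
    quotient. This is the independence of the chosen lift. *)
Lemma good_lift_ratio (y : 'I_6 -> @R3 R) x : good_lift P y ->
  fine (leb3 (slice P y x)) / fine (leb5 (lifted_simplex P y)) = kap * fine (leb3m (Qset x)).
Proof.
move=> gy; have uW := good_lift_unit gy.
have [K K0 KE] := slice_measure uW.
rewrite (leb5_lift (ltW K0) KE) leb3E KE /kap /=.
have Qf : leb3m (Qset x) \is a fin_num.
  rewrite ge0_fin_numE//; apply: (le_lt_trans (le_leb3 (@Qset_sub1 x))).
  by rewrite leb3_itv// ltry.
rewrite fineM//= invfM mulrACA divff ?mul1r 1?mulrC//; exact: lt0r_neq0.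
Qed.

End SplineFormula.

(** Reordering the knots together with their lifts changes neither the simplex nor its slices. Any
    three affinely independent knots may thus be put first, and the choice is adapted to each
    estimate. *)
Lemma simplex_splineE {R : realType} (X : 'I_6 -> @pt R) (s : {perm 'I_6}) (P : 'I_6 -> @pt R) x :
  (forall i, P i = X (s i)) -> det2 (P 1 - P 0) (P 2 - P 0) != 0 ->
  simplex_spline X x = kap P * fine (leb3m (Qset P x)).
Proof.
move=> PX D0.
have lifted (y : 'I_6 -> @R3 R) : lifted_simplex P (fun i => y (s i)) = lifted_simplex X y.
  rewrite /lifted_simplex; congr hull; apply/seteqP; split => _ [i _ <-].
    by exists (s i); rewrite ?PX.
  by exists ((s^-1)%g i) => //; rewrite PX permKV.
have sl (y : 'I_6 -> @R3 R) : slice P (fun i => y (s i)) x = slice X y x by rewrite /slice lifted.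
have good (y : 'I_6 -> @R3 R) : good_lift P (fun i => y (s i)) = good_lift X y by rewrite /good_lift lifted.
rewrite /simplex_spline; case: pselect => [h|nh].
  case: cid => y /= gy; rewrite -(sl y) -(lifted y).
  have gy' : good_lift P (fun i => y (s i)) by rewrite (good y); exact: gy.
  exact: (good_lift_ratio D0 x gy').
exfalso; apply: nh; have [y gy] := good_lift_exists D0.
exists (fun i => y ((s^-1)%g i)); rewrite -(good (fun i => y ((s^-1)%g i))).
have -> : (fun i => y ((s^-1)%g (s i))) = y by apply/funext => i; rewrite permK.
exact: gy.
Qed.

(** * Bivariate cubics *)

Section Cubics.
Context {R : realType}.
Implicit Types (c d : nat -> R) (z u w y : @pt R).

Definition cubf c y : R :=
  c 0 + c 1 * y.1 + c 2 * y.2 + c 3 * y.1 ^+ 2 + c 4 * (y.1 * y.2) + c 5 * y.2 ^+ 2 +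
  c 6 * y.1 ^+ 3 + c 7 * (y.1 ^+ 2 * y.2) + c 8 * (y.1 * y.2 ^+ 2) + c 9 * y.2 ^+ 3.

Definition is_cubic (P : @pt R -> R) := exists c, P =1 cubf c.

Lemma cubic_poly_is_cubic (P : @pt R -> R) : cubic_poly P -> is_cubic P.
Proof.
move=> [a aE].
pose o0 : 'I_4 := ord0; pose o1 : 'I_4 := lift ord0 ord0.
pose o2 : 'I_4 := lift ord0 (lift ord0 ord0); pose o3 : 'I_4 := lift ord0 (lift ord0 (lift ord0 ord0)).
exists (nth 0 [:: a o0 o0; a o1 o0; a o0 o1; a o2 o0; a o1 o1; a o0 o2; a o3 o0; a o2 o1; a o1 o2; a o0 o3]).
move=> y; rewrite aE /cubf /=.
rewrite !big_ord_recl !big_ord0; do 4 rewrite big_mkcond !big_ord_recl !big_ord0 /=.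
rewrite /o0 /o1 /o2 /o3 /bump /=; ring.
Qed.

Lemma is_cubic_poly (P : @pt R -> R) : is_cubic P -> cubic_poly P.
Proof.
move=> [c cE].
exists (fun i j => nth 0 (nth [::] [:: [:: c 0; c 2; c 5; c 9]; [:: c 1; c 4; c 8]; [:: c 3; c 7]; [:: c 6]] i) j).
move=> y; rewrite cE /cubf /=.
rewrite !big_ord_recl !big_ord0; do 4 rewrite big_mkcond !big_ord_recl !big_ord0 /=.
rewrite /bump /=; ring.
Qed.

Lemma is_cubicD P Q : is_cubic P -> is_cubic Q -> is_cubic (fun y => P y + Q y).
Proof. by move=> [c cE] [d dE]; exists (fun n => c n + d n) => y; rewrite cE dE /cubf; ring. Qed.

Lemma is_cubicZ k P : is_cubic P -> is_cubic (fun y => k * P y).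
Proof. by move=> [c cE]; exists (fun n => k * c n) => y; rewrite cE /cubf; ring. Qed.

Lemma is_cubicB P Q : is_cubic P -> is_cubic Q -> is_cubic (fun y => P y - Q y).
Proof. by move=> [c cE] [d dE]; exists (fun n => c n - d n) => y; rewrite cE dE /cubf; ring. Qed.

Lemma is_cubic_prod3 (l m n : R * @pt R) : is_cubic (fun y => aff l y * aff m y * aff n y).
Proof.
case: l => a1 [b1 c1]; case: m => a2 [b2 c2]; case: n => a3 [b3 c3].
exists (nth 0 [:: a1 * a2 * a3; b1 * a2 * a3 + a1 * b2 * a3 + a1 * a2 * b3;
  c1 * a2 * a3 + a1 * c2 * a3 + a1 * a2 * c3;
  b1 * b2 * a3 + b1 * a2 * b3 + a1 * b2 * b3;
  b1 * c2 * a3 + c1 * b2 * a3 + b1 * a2 * c3 + c1 * a2 * b3 + a1 * b2 * c3 + a1 * c2 * b3;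
  c1 * c2 * a3 + c1 * a2 * c3 + a1 * c2 * c3;
  b1 * b2 * b3; b1 * b2 * c3 + b1 * c2 * b3 + c1 * b2 * b3;
  b1 * c2 * c3 + c1 * b2 * c3 + c1 * c2 * b3; c1 * c2 * c3]) => y.
by rewrite /cubf /aff /=; ring.
Qed.

Lemma cubf_prod3 c (X Y : @pt R -> R) (lx ly : R * @pt R) :
  (forall p, X p = aff lx p) -> (forall p, Y p = aff ly p) ->
  is_cubic (fun p => cubf c (X p, Y p)).
Proof.
move=> XE YE; pose l1 : R * @pt R := (1, (0, 0)).
have l1E p : aff l1 p = 1 by rewrite /aff /l1 /=; ring.
have t := is_cubic_prod3.
have := is_cubicZ (c 9) (t ly ly ly).
move/(is_cubicD (is_cubicZ (c 8) (t lx ly ly))).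
move/(is_cubicD (is_cubicZ (c 7) (t lx lx ly))).
move/(is_cubicD (is_cubicZ (c 6) (t lx lx lx))).
move/(is_cubicD (is_cubicZ (c 5) (t ly ly l1))).
move/(is_cubicD (is_cubicZ (c 4) (t lx ly l1))).
move/(is_cubicD (is_cubicZ (c 3) (t lx lx l1))).
move/(is_cubicD (is_cubicZ (c 2) (t ly l1 l1))).
move/(is_cubicD (is_cubicZ (c 1) (t lx l1 l1))).
move/(is_cubicD (is_cubicZ (c 0) (t l1 l1 l1))).
by move=> [d dE]; exists d => p; rewrite -dE /cubf !l1E XE YE /=; ring.
Qed.

Lemma is_cubic_affine P z u w : is_cubic P ->
  is_cubic (fun p : @pt R => P (z + p.1 *: u + p.2 *: w)).
Proof.
move=> [c cE].
have hX p : z.1 + p.1 * u.1 + p.2 * w.1 = aff (z.1, (u.1, w.1)) p by rewrite /aff /=; ring.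
have hY p : z.2 + p.1 * u.2 + p.2 * w.2 = aff (z.2, (u.2, w.2)) p by rewrite /aff /=; ring.
by have [d dE] := cubf_prod3 c hX hY; exists d => p; rewrite cE -dE.
Qed.

Lemma is_cubic_line P z w : is_cubic P -> exists q0 q1 q2 q3 : R, forall h,
  P (z + h *: w) = q0 + q1 * h + q2 * h ^+ 2 + q3 * h ^+ 3.
Proof.
move=> /(@is_cubic_affine _ z 0 w)[d dE]; exists (d 0), (d 2), (d 5), (d 9) => h.
have := dE (0, h); rewrite /= scaler0 addr0 => ->; rewrite /cubf /=; ring.
Qed.

Lemma cubic_small0 (a b c d e : R) : 0 < e ->
  (forall t, `|t| < e -> a + b * t + c * t ^+ 2 + d * t ^+ 3 = 0) -> [/\ a = 0, b = 0, c = 0 & d = 0].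
Proof.
(* A cubic is determined by its values at [0], [k], [-k] and [2k]; the choice [k = e / 3] keeps all
   four in the range of the hypothesis. *)
move=> e0 H; pose k := e / 3; have k0 : 0 < k by rewrite divr_gt0.
have kn : k != 0 by rewrite gt_eqF.
have h0 : a = 0 by have := H 0; rewrite normr0 => /(_ e0) <-; ring.
have h1 : a + b * k + c * k ^+ 2 + d * k ^+ 3 = 0.
  by apply: H; rewrite gtr0_norm// /k; lra.
have h2 : a - b * k + c * k ^+ 2 - d * k ^+ 3 = 0.
  by rewrite -(H (- k)); [ring|rewrite normrN gtr0_norm// /k; lra].
have h3 : a + 2 * b * k + 4 * c * k ^+ 2 + 8 * d * k ^+ 3 = 0.
  by rewrite -(H (2 * k)); [ring|rewrite gtr0_norm ?mulr_gt0// /k; lra].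
have c0 : c * k ^+ 2 = 0 by lra.
have d0 : d * k ^+ 3 = 0 by lra.
have b0 : b * k = 0 by lra.
have z (x y : R) : y != 0 -> x * y = 0 -> x = 0.
  by move=> yn /eqP; rewrite mulf_eq0 (negPf yn) orbF => /eqP.
by split=> //; [apply: (z _ k)|apply: (z _ (k ^+ 2))|apply: (z _ (k ^+ 3))] => //; rewrite expf_neq0.
Qed.

(** On each line through the centre of the ball the difference is a cubic in one variable that
    vanishes near 0. *)
Lemma cubic_ball_eq P Q z e : is_cubic P -> is_cubic Q -> 0 < e ->
  (forall w, nrm w < e -> P (z + w) = Q (z + w)) -> P =1 Q.
Proof.
move=> cP cQ e0 H y; have cD := is_cubicB cP cQ.
have [q0 [q1 [q2 [q3 E]]]] := is_cubic_line z (y - z) cD.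
have n0 := nrm_ge0 (y - z).
have k0 : 0 < e / (1 + nrm (y - z)) by rewrite divr_gt0// ltr_pwDl.
have [|a b c d] := @cubic_small0 q0 q1 q2 q3 _ k0.
  move=> t ht; rewrite -E H ?subrr// nrmZ.
  apply: (@le_lt_trans _ _ (`|t| * (1 + nrm (y - z)))); first by rewrite ler_wpM2l// lerDr.
  by rewrite -ltr_pdivlMr// ltr_pwDl.
have := E 1; rewrite a b c d scale1r [z + _]addrC subrK !mul0r !addr0 => /eqP.
by rewrite subr_eq0 => /eqP.
Qed.

(** Differentiability without quotients, so that [h = 0] needs no separate treatment;
    [is_derive_der1] relates it to [is_derive]. *)
Definition der1 (f : R -> R) (x d : R) := forall e, 0 < e -> exists2 k : R, 0 < k &
  forall h, `|h| < k -> `|f (x + h) - f x - d * h| <= e * `|h|.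

Lemma der1_uniq f x (d d' : R) : der1 f x d -> der1 f x d' -> d = d'.
Proof.
move=> H H'; apply/eqP; rewrite -subr_eq0 -normr_eq0 eq_le normr_ge0 andbT leNgt; apply/negP => c0.
have e0 : 0 < `|d - d'| / 4 by rewrite divr_gt0.
have [k k0 K] := H _ e0; have [k' k'0 K'] := H' _ e0.
pose h := Num.min k k' / 2; have m0 : 0 < Num.min k k' by rewrite lt_min k0.
have h0 : 0 < h by rewrite divr_gt0.
have hm : h < Num.min k k' by rewrite /h; lra.
have := K h; have := K' h; rewrite gtr0_norm//.
move: hm; rewrite lt_min => /andP[-> ->] => /(_ isT) a /(_ isT) b.
have : `|(d - d') * h| <= `|d - d'| / 2 * h.
  have -> : (d - d') * h = (f (x + h) - f x - d' * h) - (f (x + h) - f x - d * h) by ring.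
  by apply: (le_trans (ler_normB _ _)); lra.
by rewrite normrM (gtr0_norm h0) ler_pM2r//; lra.
Qed.

Lemma der1_poly f x (b0 b1 b2 b3 e : R) : 0 < e ->
  (forall h, `|h| < e -> f (x + h) = b0 + b1 * h + b2 * h ^+ 2 + b3 * h ^+ 3) -> der1 f x b1.
Proof.
move=> e0 H eps eps0; pose K := `|b2| + `|b3| + 1.
have K0 : 0 < K by rewrite ltr_pwDr// addr_ge0.
exists (Num.min (Num.min e 1) (eps / K)); first by rewrite !lt_min e0 ltr01 divr_gt0.
move=> h; rewrite !lt_min => /andP[/andP[he h1] hk].
have -> : f x = b0 by rewrite -[x in LHS]addr0 H ?normr0//; ring.
rewrite H// (_ : _ - _ = (b2 + b3 * h) * h * h); last ring.
rewrite normrM ler_wpM2r// normrM.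
apply: (@le_trans _ _ (K * `|h|)).
  rewrite ler_wpM2r//; apply: (le_trans (ler_normD _ _)); rewrite normrM /K.
  have := normr_ge0 b3; nra.
by rewrite mulrC -ler_pdivlMr// ltW.
Qed.

Definition cont1 (f : R -> R) (x : R) := forall e, 0 < e -> exists2 k : R, 0 < k &
  forall h, `|h| < k -> `|f (x + h) - f x| < e.

(** Continuity at 0 forces the value to be the one-sided limit of the polynomial. The sign
    [(-1) ^+ s] selects the side. *)
Lemma cont1_side f (a b c d k : R) (s : bool) : cont1 f 0 -> 0 < k ->
  (forall h, 0 < h < k -> f ((-1) ^+ s * h) = a + b * h + c * h ^+ 2 + d * h ^+ 3) -> f 0 = a.
Proof.
move=> cf k0 H; apply/eqP; rewrite -subr_eq0 -normr_eq0 eq_le normr_ge0 andbT leNgt; apply/negP => c0.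
have e0 : 0 < `|f 0 - a| / 2 by rewrite divr_gt0.
have [k' k'0 K'] := cf _ e0.
pose K := `|b| + `|c| + `|d| + 1; have K0 : 0 < K by rewrite ltr_pwDr// !addr_ge0.
have e1 : 0 < `|f 0 - a| / 4 / K by rewrite divr_gt0// divr_gt0.
pose m := Num.min (Num.min k k') (Num.min 1 (`|f 0 - a| / 4 / K)).
have m0 : 0 < m by rewrite /m !lt_min k0 k'0 ltr01 e1.
pose h := m / 2; have h0 : 0 < h by rewrite divr_gt0.
have hm : h < m by rewrite /h; lra.
move: (hm); rewrite /m !lt_min => /andP[/andP[hk hk'] /andP[h1 he]].
have := K' ((-1) ^+ s * h); rewrite add0r normrM normrX normrN1 expr1n mul1r gtr0_norm// => /(_ hk').
rewrite H ?h0// => hh.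
have : `|b * h + c * h ^+ 2 + d * h ^+ 3| <= K * h.
  rewrite (_ : _ + _ = (b + c * h + d * h ^+ 2) * h); last ring.
  rewrite normrM (gtr0_norm h0) ler_pM2r//; apply: (le_trans (ler_normD _ _)).
  have h2 : h ^+ 2 <= 1 by rewrite expr_le1// ltW.
  apply: (le_trans (lerD (ler_normD _ _) (lexx _))).
  rewrite (normrM c) (normrM d) normrX (gtr0_norm h0) /K.
  have : `|c| * h <= `|c| by rewrite ler_piMr// ltW.
  have : `|d| * h ^+ 2 <= `|d| by rewrite ler_piMr.
  lra.
have : K * h < `|f 0 - a| / 4 by rewrite mulrC -ltr_pdivlMr.
have : `|f 0 - a| <= `|a + b * h + c * h ^+ 2 + d * h ^+ 3 - f 0| + `|b * h + c * h ^+ 2 + d * h ^+ 3|.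
  rewrite -[`|f 0 - a|]normrN (_ : - (f 0 - a) = (a + b * h + c * h ^+ 2 + d * h ^+ 3 - f 0) - (b * h + c * h ^+ 2 + d * h ^+ 3)); last ring.
  exact: ler_normB.
lra.
Qed.

(** Strictly on one side the derivatives [g] and [g1] are those of the cubic; continuity carries
    this to 0. Applied on both sides of a line it shows that the two neighbouring cubics have the
    same transversal 2-jet there. *)
Lemma C2_cubic_side f g g1 (b0 b1 b2 b3 k : R) (s : bool) : 0 < k ->
  cont1 f 0 -> cont1 g 0 -> cont1 g1 0 ->
  (forall x, `|x| < k -> der1 f x (g x)) -> (forall x, `|x| < k -> der1 g x (g1 x)) ->
  (forall h, 0 < h < k -> f ((-1) ^+ s * h) = b0 + b1 * ((-1) ^+ s * h) + b2 * h ^+ 2 + b3 * ((-1) ^+ s * h) ^+ 3) ->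
  [/\ f 0 = b0, g 0 = b1 & g1 0 = 2 * b2].
Proof.
move=> k0 cf cg cg1 dg dg1 H.
have s2 : ((-1) ^+ s) ^+ 2 = 1 :> R by rewrite -exprM mulnC exprM sqrrN expr1n expr1n.
have F h : 0 < h < k -> f ((-1) ^+ s * h) = b0 + b1 * ((-1) ^+ s * h) + b2 * ((-1) ^+ s * h) ^+ 2 + b3 * ((-1) ^+ s * h) ^+ 3.
  by move=> /H ->; rewrite [((-1) ^+ s * h) ^+ 2]exprMn s2 mul1r.
have nearby h : 0 < h < k -> exists2 e : R, 0 < e & forall r, `|r| < e ->
    exists2 h', 0 < h' < k & (-1) ^+ s * h + r = (-1) ^+ s * h'.
  move=> /andP[h0 hk]; exists (Num.min h (k - h)); first by rewrite lt_min h0 subr_gt0.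
  move=> r; rewrite lt_min => /andP[r1 r2]; exists (h + (-1) ^+ s * r); last by rewrite mulrDr mulrA -expr2 s2 mul1r.
  have : `|(-1) ^+ s * r| = `|r| by rewrite normrM normrX normrN1 expr1n mul1r.
  have := ler_norm ((-1) ^+ s * r); have := ler_norm (- ((-1) ^+ s * r)); rewrite normrN.
  by move=> ? ? ?; apply/andP; split; lra.
have absk h : 0 < h < k -> `|(-1) ^+ s * h| < k.
  by move=> /andP[h0 hk]; rewrite normrM normrX normrN1 expr1n mul1r gtr0_norm.
have G h : 0 < h < k -> g ((-1) ^+ s * h) = b1 + 2 * b2 * ((-1) ^+ s * h) + 3 * b3 * h ^+ 2.
  move=> hk; apply: (der1_uniq (dg _ (absk h hk))).
  have [e e0 E] := nearby h hk; set x := (-1) ^+ s * h.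
  have -> : b1 + 2 * b2 * x + 3 * b3 * h ^+ 2 = b1 + 2 * b2 * x + 3 * b3 * x ^+ 2 by rewrite /x exprMn s2 mul1r.
  apply: (@der1_poly f x (b0 + b1 * x + b2 * x ^+ 2 + b3 * x ^+ 3) _ (b2 + 3 * b3 * x) b3 e) => // r /E[h' h'k].
  by rewrite -/x => xr; rewrite xr F// -xr; ring.
have G1 h : 0 < h < k -> g1 ((-1) ^+ s * h) = 2 * b2 + 6 * b3 * ((-1) ^+ s * h).
  move=> hk; apply: (der1_uniq (dg1 _ (absk h hk))).
  have [e e0 E] := nearby h hk; set x := (-1) ^+ s * h.
  apply: (@der1_poly g x (b1 + 2 * b2 * x + 3 * b3 * x ^+ 2) _ (3 * b3) 0 e) => // r /E[h' h'k].
  rewrite -/x => xr; rewrite xr G//.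
  have -> : 3 * b3 * h' ^+ 2 = 3 * b3 * ((-1) ^+ s * h') ^+ 2 by rewrite exprMn s2 mul1r.
  by rewrite -xr; ring.
split.
- apply: (@cont1_side f b0 (b1 * (-1) ^+ s) b2 (b3 * ((-1) ^+ s) ^+ 3) k s) => // h hk; rewrite H// exprMn; ring.
- apply: (@cont1_side g b1 (2 * b2 * (-1) ^+ s) (3 * b3) 0 k s) => // h hk; rewrite G//; ring.
- apply: (@cont1_side g1 (2 * b2) (6 * b3 * (-1) ^+ s) 0 0 k s) => // h hk; rewrite G1//; ring.
Qed.

End Cubics.

(** * Piecewise cubics on an arrangement of lines *)

Section Path.
Context {R : realType}.

Lemma finite_lower_bound (I : finType) (P : pred I) (F : I -> R) (m : R) : 0 < m ->
  (forall i, P i -> 0 < F i) -> exists e : R, [/\ 0 < e, e <= m & forall i, P i -> e <= F i].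
Proof.
move=> m0 F0; exists (\big[Num.min/m]_(i | P i) F i); split.
- by apply/bigmin_gtP; split.
- exact: bigmin_le_id.
- by move=> i Pi; exact: bigmin_le_cond.
Qed.

Lemma affB (l : R * @pt R) A B : lin l (B - A) = aff l B - aff l A.
Proof. by rewrite /aff /lin /=; ring. Qed.

Lemma sign_transfer (p q r t : R) : 0 < p * r -> 0 < q * t -> r * t < 0 -> p * q < 0.
Proof. by move=> h1 h2 h3; rewrite -(nmulr_lgt0 _ h3) mulrACA mulr_gt0. Qed.

Lemma same_trans (p q r : R) : p != 0 -> 0 < p * q -> 0 < p * r -> 0 < q * r.
Proof.
move=> p0 h1 h2; have := mulr_gt0 h1 h2.
by rewrite mulrACA -expr2 pmulr_rgt0// lt_neqAle eq_sym sqrf_eq0 p0 sqr_ge0.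
Qed.

Lemma affine_sign (p q t t' : R) : 0 <= t <= 1 -> 0 <= t' <= 1 ->
  (p + t * (q - p)) * (p + t' * (q - p)) < 0 -> p * q < 0.
Proof.
move=> /andP[t0 t1] /andP[t'0 t'1] h; rewrite ltNge; apply/negP => pq.
have e : (p + t * (q - p)) * (p + t' * (q - p)) =
  (1 - t) * (1 - t') * p ^+ 2 + t * t' * q ^+ 2 + ((1 - t) * t' + t * (1 - t')) * (p * q) by ring.
have h1 : 0 <= (1 - t) * (1 - t') * p ^+ 2 by rewrite mulr_ge0 ?sqr_ge0// mulr_ge0; lra.
have h2 : 0 <= t * t' * q ^+ 2 by rewrite mulr_ge0 ?sqr_ge0// mulr_ge0; lra.
have h3 : 0 <= ((1 - t) * t' + t * (1 - t')) * (p * q) by rewrite mulr_ge0// addr_ge0// mulr_ge0; lra.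
by move: h; rewrite e; lra.
Qed.

(* Walking along a segment and crossing the lines in groups of simultaneous zeros. *)
Lemma path_induction (n : nat) (V : Type) (f0 f1 : 'I_n -> R) (X : R -> V) :
  let f i t := f0 i + t * f1 i in
  let reg t := forall i, f i t != 0 in
  reg 0 -> reg 1 ->
  (forall t t' z : R, 0 <= t -> t <= z -> z <= t' -> t' <= 1 -> reg t -> reg t' ->
     (forall i, f i t * f i t' < 0 -> f i z = 0) -> X t = X t') ->
  X 0 = X 1.
Proof.
move=> f reg r0 r1 H.
pose S (t t' : R) : {set 'I_n} := [set i : 'I_n | (f i t * f i t' < 0)%R]%SET.
suff : forall k (t t' : R), 0 <= t -> t <= t' -> t' <= 1 -> reg t -> reg t' -> (#|S t t'| <= k)%N -> X t = X t'.
  by move=> /(_ _ 0 1 (lexx 0) ler01 (lexx 1) r0 r1 (leqnn _)).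
elim=> [|k IH] t t' t0 tt' t'1 rt rt'.
  rewrite leqn0 cards_eq0 => /eqP E; apply: (H t t' t') => // i hi.
  have : i \in S t t' by rewrite inE.
  by rewrite E inE.
move=> cS; have [E|[i]] := set_0Vmem (S t t').
  by apply: (IH _ _ t0 tt' t'1 rt rt'); rewrite E cards0.
rewrite inE => hi.
pose root j := - f0 j / f1 j.
have fE j s : f1 j != 0 -> f j s = f1 j * (s - root j) by move=> ?; rewrite /f /root; field.
have f1n j s s' : f j s * f j s' < 0 -> f1 j != 0.
  by move=> h; apply/eqP => e; move: h; rewrite /f e !mulr0 !addr0 -expr2 ltNge sqr_ge0.
have between j s s' : s <= s' -> f j s * f j s' < 0 -> s < root j < s'.
  move=> ss' h; have n0 := f1n _ _ _ h; move: h; rewrite !fE//.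
  rewrite mulrACA -expr2 pmulr_rlt0; last by rewrite lt_neqAle eq_sym sqrf_eq0 n0 sqr_ge0.
  by move=> h; apply/andP; split; rewrite ltNge; apply/negP => h'; nra.
have betweenP j s s' : f1 j != 0 -> s < root j < s' -> f j s * f j s' < 0.
  move=> n0 /andP[h1 h2]; rewrite !fE// mulrACA -expr2 pmulr_rlt0.
    by nra.
  by rewrite lt_neqAle eq_sym sqrf_eq0 n0 sqr_ge0.
set z := root i; have /andP[tz zt'] := between _ _ _ tt' hi; rewrite -/z in tz zt'.
(* [e] is at most the distance from [z] to any other root and to [t] and [t']. Between [z - e / 2]
   and [z + e / 2] only the forms that vanish at [z] itself change sign. *)
have [e [e0 em eF]] := @finite_lower_bound _ (fun j => root j != z) (fun j => `|root j - z|)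
  (Num.min (z - t) (t' - z)) (ltac:(by rewrite lt_min !subr_gt0 tz zt'))
  (fun j (jz : root j != z) => ltac:(by rewrite normr_gt0 subr_eq0)).
move: em; rewrite le_min => /andP[em1 em2].
pose t1 := z - e / 2; pose t2 := z + e / 2.
have regz s : `|s - z| < e -> s != z -> reg s.
  move=> se sz j; have [j0|j0] := eqVneq (f1 j) 0.
    by have := rt j; rewrite /f j0 !mulr0.
  rewrite fE// mulf_neq0// subr_eq0; apply/eqP => sE.
  by have := eF j; rewrite -sE => /(_ sz); rewrite leNgt se.
have ht1 : t <= t1 by rewrite /t1; lra.
have ht2 : t2 <= t' by rewrite /t2; lra.
have h12 : t1 < z by rewrite /t1; lra.
have h21 : z < t2 by rewrite /t2; lra.
have rt1 : reg t1.
  apply: regz; last by rewrite lt_eqF.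
  by rewrite /t1 addrC addKr normrN gtr0_norm; lra.
have rt2 : reg t2.
  apply: regz; last by rewrite gt_eqF.
  by rewrite /t2 addrC addKr gtr0_norm; lra.
have cardlt s s' : t <= s -> s <= s' -> s' <= t' -> (s' < z \/ z < s) -> (#|S s s'| <= k)%N.
  move=> h1 h2 h3 hz; rewrite -ltnS; apply: leq_trans cS; apply: proper_card.
  apply/properP; split.
    apply/fintype.subsetP => j; rewrite !inE => hj; have /andP[b1 b2] := between _ _ _ h2 hj.
    by apply: betweenP; [exact: f1n hj|apply/andP; split; lra].
  exists i; rewrite inE//; apply/negP => hj; have /andP[] := between _ _ _ h2 hj.
  by rewrite -/z; case: hz; lra.
have e1 : X t = X t1 by apply: IH => //; [lra|apply: cardlt => //; [lra|left]].
have e2 : X t2 = X t' by apply: IH => //; [lra|apply: cardlt => //; [lra|right]].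
have e3 : X t1 = X t2.
  apply: (H t1 t2 z) => //; try lra.
  move=> j hj; have n0 := f1n _ _ _ hj; have hlt : t1 <= t2 by lra.
  have /andP[b1 b2] := between _ _ _ hlt hj.
  have [jz|jz] := eqVneq (root j) z.
    by rewrite fE// jz subrr mulr0.
  have := eF _ jz; rewrite ler_normr => /orP[]; rewrite /t1 /t2 in b1 b2; lra.
by rewrite e1 e3 e2.
Qed.

End Path.

(** * Walking between the cells of a line arrangement in an open convex set *)

Section Arrangement.
Context {R : realType}.
Variables (m : nat) (L : 'I_m -> R * @pt R) (U : @pt R -> Prop).
Local Notation a i := (aff (L i)).
Hypothesis Ucvx : forall A B (t : R), U A -> U B -> 0 <= t <= 1 -> U (A + t *: (B - A)).
Hypothesis Uopn : forall A, U A -> exists2 e : R, 0 < e & forall w, nrm w < e -> U (A + w).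
Hypothesis npar : forall i j z, i != j -> U z -> a i z = 0 -> a j z = 0 -> det2 (L i).2 (L j).2 != 0.
Hypothesis conc3 : forall z, U z -> (#|[set i | (a i z == 0)%R]%SET| <= 3)%N.
Hypothesis Lnz : forall i, (L i).2 != 0.

Definition regular A := U A /\ forall i, a i A != 0.
Definition same_side i A B := 0 < a i A * a i B.
Definition separates i A B := a i A * a i B < 0.

Lemma near_point z : U z -> exists2 e : R, 0 < e & forall w, nrm w < e ->
  U (z + w) /\ forall i, a i z != 0 -> same_side i z (z + w).
Proof.
move=> Uz; have [e0 e00 eU] := Uopn Uz.
have [e [h1 h2 h3]] := @finite_lower_bound R _ (fun i => a i z != 0) (fun i => `|a i z| / (nrm (L i).2 + 1)) e0 e00
  (fun i (h : a i z != 0) => ltac:(by rewrite divr_gt0 ?normr_gt0// ltr_wpDl// nrm_ge0)).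
exists e => // w we; split; first by apply: eU; lra.
move=> i iz; rewrite /same_side affD.
have n1 : 0 < nrm (L i).2 + 1 by rewrite ltr_wpDl// nrm_ge0.
have : `|lin (L i) w| < `|a i z|.
  apply: (le_lt_trans (lin_bound _ _)).
  apply: (@le_lt_trans _ _ ((nrm (L i).2 + 1) * nrm w)); first by rewrite ler_wpM2r ?nrm_ge0// lerDl.
  by rewrite mulrC -ltr_pdivlMr//; apply: (lt_le_trans we); exact: h3.
rewrite ltr_norml => /andP[b1 b2].
have [h|h|h] := ltrgt0P (a i z); last by rewrite h eqxx in iz.
  by rewrite (gtr0_norm h) in b1 b2; nra.
by rewrite (ltr0_norm h) in b1 b2; nra.
Qed.

Lemma near_regular A : regular A -> exists2 e : R, 0 < e & forall w, nrm w < e ->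
  regular (A + w) /\ forall i, same_side i A (A + w).
Proof.
move=> [UA rA]; have [e e0 H] := near_point UA; exists e => // w /H[UAw s].
split; last by move=> i; exact: s.
by split=> // i; have := s i (rA i); rewrite /same_side; apply: contraTneq => ->; rewrite mulr0 ltxx.
Qed.

Lemma not_sep_same i A B : regular A -> regular B -> ~ separates i A B -> same_side i A B.
Proof.
move=> [_ /(_ i) rA] [_ /(_ i) rB] /negP; rewrite /separates /same_side -leNgt le_eqVlt => /predU1P[|//].
by move/esym/eqP; rewrite mulf_eq0 (negPf rA) (negPf rB).
Qed.

Lemma path_segment (V : Type) (X : @pt R -> V) A B : regular A -> regular B ->
  (forall t t' s : R, 0 <= t -> t <= s -> s <= t' -> t' <= 1 ->
     let C := A + t *: (B - A) in let D := A + t' *: (B - A) in let z := A + s *: (B - A) in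
     regular C -> regular D -> (forall i, separates i C D -> a i z = 0) -> X C = X D) -> X A = X B.
Proof.
move=> [UA rA] [UB rB] H.
have aE i t : a i (A + t *: (B - A)) = a i A + t * lin (L i) (B - A) by rewrite affD linZ.
have U01 (t : R) : 0 <= t <= 1 -> U (A + t *: (B - A)) by move=> h; exact: Ucvx.
have := @path_induction R m V (fun i => a i A) (fun i => lin (L i) (B - A)) (fun t => X (A + t *: (B - A))).
rewrite /= scale0r addr0 scale1r [A + _]addrC subrK; apply.
- by move=> i; rewrite mul0r addr0.
- by move=> i; rewrite mul1r -affD [A + _]addrC subrK.
- move=> t t' s t0 ts st' t'1 rt rt' Hs; apply: (H t t' s) => //.
  + by split; [apply: U01; lra|move=> i; rewrite aE].
  + by split; [apply: U01; lra|move=> i; rewrite aE].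
  + by move=> i; rewrite /separates !aE; exact: Hs.
Qed.

Lemma sep_segment i A B (t t' : R) : 0 <= t <= 1 -> 0 <= t' <= 1 ->
  separates i (A + t *: (B - A)) (A + t' *: (B - A)) -> separates i A B.
Proof.
move=> t01 t'01; rewrite /separates !affD !linZ.
by rewrite affB; exact: affine_sign.
Qed.

Lemma lin_det i j (v : @pt R) : det2 (L i).2 (L j).2 != 0 -> lin (L i) v = 0 -> lin (L j) v = 0 -> v = 0.
Proof.
case: v => x y; rewrite /lin /det2 /=; case: (L i) (L j) => _ [b c] [_ [b' c']] /= d e e'.
have ex : (b * c' - c * b') * x = 0.
  have -> : (b * c' - c * b') * x = c' * (b * x + c * y) - c * (b' * x + c' * y) by ring.
  by rewrite e e' !mulr0 subr0.
have ey : (b * c' - c * b') * y = 0.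
  have -> : (b * c' - c * b') * y = b * (b' * x + c' * y) - b' * (b * x + c * y) by ring.
  by rewrite e e' !mulr0 subr0.
by move/eqP: ex; move/eqP: ey; rewrite !mulf_eq0 (negPf d) /= => /eqP -> /eqP ->.
Qed.

Section Invariant.
Variables (V : Type) (X : @pt R -> V).
Hypothesis Xsame : forall C D, regular C -> regular D -> (forall i, same_side i C D) -> X C = X D.

(** All lines to be crossed pass through [z], while the segment misses [z]. Two of them crossed at
    the same moment would share a second point, so the crossings happen one at a time. *)
Lemma path_off_point A B z : regular A -> regular B -> U z -> det2 (B - A) (z - A) != 0 ->
  (forall i, separates i A B -> a i z = 0) ->
  (forall i C D, regular C -> regular D -> separates i A B -> separates i C D -> (forall k, k != i -> same_side k C D) -> X C = X D) ->
  X A = X B.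
Proof.
move=> rA rB Uz dz sz inv; apply: path_segment => // t t' s t0 ts st' t'1 C D z' rC rD sz'.
have sAB i : separates i C D -> separates i A B by apply: sep_segment; lra.
have uniq2 i j : separates i C D -> separates j C D -> i = j.
  move=> si sj; apply/eqP/negPn/negP => ij.
  have d := npar ij Uz (sz _ (sAB _ si)) (sz _ (sAB _ sj)).
  have zz k : separates k C D -> lin (L k) (z' - z) = 0.
    by move=> sk; rewrite affB (sz' _ sk) (sz _ (sAB _ sk)) subr0.
  have /eqP := lin_det d (zz _ si) (zz _ sj); rewrite subr_eq0 => /eqP zE.
  move: dz; rewrite -zE /z' [A + _]addrC addrK.
  rewrite (_ : det2 _ _ = 0) ?eqxx//; case: (B - A) => x y; rewrite /det2 /= /GRing.scale /=; ring.
have [[i si]|ns] := pselect (exists i, separates i C D).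
  apply: (inv i) => //; first exact: sAB.
  by move=> k ki; apply: not_sep_same => // sk; move/eqP: ki; apply; exact: uniq2.
by apply: Xsame => // i; apply: not_sep_same => // si; apply: ns; exists i.
Qed.

(** If all crossings coincide, the segment is pushed sideways by a small multiple of its normal. The
    ends stay in their cells and the common point is now avoided. *)
Lemma path_through_point A B (s : R) : regular A -> regular B -> 0 <= s <= 1 ->
  (forall i, separates i A B -> a i (A + s *: (B - A)) = 0) ->
  (forall i C D, regular C -> regular D -> separates i A B -> separates i C D -> (forall k, k != i -> same_side k C D) -> X C = X D) ->
  X A = X B.
Proof.
move=> rA rB s01 sz inv.
have [AB|AB] := eqVneq A B; first by rewrite AB.
pose v := B - A; pose n : @pt R := (- v.2, v.1).
have v0 : 0 < v.1 ^+ 2 + v.2 ^+ 2.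
  rewrite lt_neqAle addr_ge0 ?sqr_ge0// andbT eq_sym paddr_eq0 ?sqr_ge0// !sqrf_eq0.
  apply/negP => /andP[/eqP e1 /eqP e2]; move/eqP: AB; apply; apply/eqP; rewrite eq_sym -subr_eq0.
  by apply/eqP; rewrite -/v [v]surjective_pairing e1 e2.
have [eA eA0 HA] := near_regular rA; have [eB eB0 HB] := near_regular rB.
pose d := Num.min eA eB / (2 * (nrm n + 1)).
have n1 : 0 < nrm n + 1 by rewrite ltr_wpDl// nrm_ge0.
have m0 : 0 < Num.min eA eB by rewrite lt_min eA0.
have d0 : 0 < d by rewrite divr_gt0// mulr_gt0.
have dn : nrm (d *: n) < Num.min eA eB.
  rewrite nrmZ gtr0_norm// /d mulrAC ltr_pdivrMr ?mulr_gt0// ltr_pM2l//.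
  by have := nrm_ge0 n; lra.
move: dn; rewrite lt_min => /andP[dA dB].
have [rA' sA'] := HA _ dA; have [rB' sB'] := HB _ dB.
have seps i : separates i (A + d *: n) (B + d *: n) -> separates i A B.
  exact: (sign_transfer (sA' i) (sB' i)).
rewrite (Xsame rA rA' sA') (Xsame rB rB' sB').
apply: (@path_off_point _ _ (A + s *: v)) => //.
- by apply: Ucvx => //; [case: rA|case: rB].
- have -> : B + d *: n - (A + d *: n) = v by rewrite opprD addrACA subrr addr0.
  have -> : A + s *: v - (A + d *: n) = s *: v - d *: n by rewrite opprD addrACA subrr add0r.
  have -> : det2 v (s *: v - d *: n) = - d * (v.1 ^+ 2 + v.2 ^+ 2).
    by rewrite /n /det2 /= /GRing.scale /=; ring.
  by rewrite mulf_neq0 ?oppr_eq0// gt_eqF.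
- by move=> i /seps; exact: sz.
- by move=> i C D rC rD /seps; exact: inv.
Qed.

(** Invariance under the crossing of a single line suffices: groups of simultaneous crossings along
    the segment are resolved by [path_through_point]. *)
Lemma path_global A B : regular A -> regular B ->
  (forall i C D, regular C -> regular D -> separates i C D -> (forall k, k != i -> same_side k C D) -> X C = X D) ->
  X A = X B.
Proof.
move=> rA rB inv; apply: path_segment => // t t' s t0 ts st' t'1 C D z rC rD sz.
have [tt'|tt'] := eqVneq t t'; first by rewrite /C /D tt'.
have lt : t < t' by rewrite lt_neqAle tt'; lra.
pose r := (s - t) / (t' - t); have dt : 0 < t' - t by rewrite subr_gt0.
apply: (@path_through_point C D r) => //.
- apply/andP; split; first by rewrite /r divr_ge0 ?(ltW dt) ?subr_ge0.
  by rewrite /r ler_pdivrMr// mul1r; lra.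
- move=> i /sz; rewrite /z; congr (a i _ = _).
  have -> : D - C = (t' - t) *: (B - A) by rewrite /D /C opprD addrACA subrr add0r scalerBl.
  by rewrite scalerA /r divfK ?gt_eqF// /C -addrA -scalerDl [t + _]addrC subrK.
- by move=> i E F rE rF _; exact: inv.
Qed.

End Invariant.

(** The mixed third difference at the origin. On a cubic it is the constant third derivative, so it
    measures jumps of third derivatives without any differentiation. *)
Definition third_diff (P : @pt R -> R) (u v w : @pt R) : R :=
  P (u + v + w) - P (u + v) - P (u + w) - P (v + w) + P u + P v + P w - P 0.

Lemma third_diff_cube P Q (c : R) i u v w : (forall y, P y - Q y = c * a i y ^+ 3) ->
  third_diff P u v w - third_diff Q u v w = 6 * c * (lin (L i) u * lin (L i) v * lin (L i) w).
Proof.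
move=> H; transitivity ((P (u + v + w) - Q (u + v + w)) - (P (u + v) - Q (u + v)) - (P (u + w) - Q (u + w)) -
  (P (v + w) - Q (v + w)) + (P u - Q u) + (P v - Q v) + (P w - Q w) - (P 0 - Q 0)).
  by rewrite /third_diff; ring.
rewrite !H !affD; have -> : a i u = a i 0 + lin (L i) u by rewrite -affD add0r.
have -> : a i v = a i 0 + lin (L i) v by rewrite -affD add0r.
have -> : a i w = a i 0 + lin (L i) w by rewrite -affD add0r.
ring.
Qed.

Variable PA : @pt R -> @pt R -> R.
Hypothesis PAcub : forall A, regular A -> is_cubic (PA A).
Hypothesis PAsame : forall A B, regular A -> regular B -> (forall i, same_side i A B) -> PA A = PA B.
Hypothesis PAjump : forall A B i, regular A -> regular B -> separates i A B ->
  (forall k, k != i -> same_side k A B) -> exists c : R, forall y, PA B y - PA A y = c * a i y ^+ 3.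

Definition normal i : @pt R := ((L i).2.1 ^+ 2 + (L i).2.2 ^+ 2)^-1 *: (L i).2.

Let sq_gt0 i : 0 < (L i).2.1 ^+ 2 + (L i).2.2 ^+ 2.
Proof.
rewrite lt_neqAle addr_ge0 ?sqr_ge0// andbT eq_sym paddr_eq0 ?sqr_ge0// !sqrf_eq0.
apply/negP => /andP[/eqP e1 /eqP e2]; move/eqP: (Lnz i); apply.
by rewrite [(L i).2]surjective_pairing e1 e2.
Qed.

Lemma lin_normal i (d : R) : lin (L i) (d *: normal i) = d.
Proof.
rewrite linZ /normal linZ /lin -!expr2 mulVf ?mulr1// gt_eqF//; exact: sq_gt0.
Qed.

Lemma lin_normal1 i : lin (L i) (normal i) = 1.
Proof.
rewrite /normal linZ /lin -!expr2 mulVf// gt_eqF//; exact: sq_gt0.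
Qed.

Definition on_wall i z := [/\ U z, a i z = 0 & forall k, k != i -> a k z != 0].

(** The jump is required for all small displacements [d], so that jumps found at two points of a
    line can be compared at a common distance from it. *)
Definition wall_jump i z (c : R) := exists2 e : R, 0 < e & forall d : R, 0 < d < e ->
  [/\ regular (z + d *: normal i), regular (z - d *: normal i),
      forall k, k != i -> same_side k z (z + d *: normal i) /\ same_side k z (z - d *: normal i) &
      forall y, PA (z + d *: normal i) y - PA (z - d *: normal i) y = c * a i y ^+ 3].

Lemma wall_jump_exists i z : on_wall i z -> exists c, wall_jump i z c.
Proof.
move=> [Uz iz kz]; have [e e0 eH] := near_point Uz.
have n1 : 0 < nrm (normal i) + 1 by rewrite ltr_wpDl// nrm_ge0.
pose e1 := e / (nrm (normal i) + 1); have e10 : 0 < e1 by rewrite divr_gt0.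
have small (d : R) : `|d| < e1 -> nrm (d *: normal i) < e.
  move=> de; rewrite nrmZ; apply: (@le_lt_trans _ _ (`|d| * (nrm (normal i) + 1))).
    by rewrite ler_wpM2l// lerDl.
  by rewrite -ltr_pdivlMr.
have reg (d : R) : 0 < `|d| -> `|d| < e1 -> regular (z + d *: normal i) /\ (forall k, k != i -> same_side k z (z + d *: normal i)).
  move=> d0 /small /eH[Ud sd]; split; last by move=> k ki; apply: sd; exact: kz.
  split=> // k; have [->|ki] := eqVneq k i; first by rewrite affD iz add0r lin_normal -normr_gt0.
  by have := sd k (kz k ki); rewrite /same_side; apply: contraTneq => ->; rewrite mulr0 ltxx.
have regP (d : R) : 0 < d < e1 -> regular (z + d *: normal i) /\ (forall k, k != i -> same_side k z (z + d *: normal i)).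
  by move=> /andP[d0 d1]; apply: reg; rewrite gtr0_norm.
have regN (d : R) : 0 < d < e1 -> regular (z - d *: normal i) /\ (forall k, k != i -> same_side k z (z - d *: normal i)).
  by move=> /andP[d0 d1]; rewrite -scaleNr; apply: reg; rewrite normrN gtr0_norm.
have sameP (d d' : R) k : 0 < d < e1 -> 0 < d' < e1 -> same_side k (z + d *: normal i) (z + d' *: normal i).
  move=> hd hd'; have [->|ki] := eqVneq k i.
    by rewrite /same_side !affD iz !add0r !lin_normal mulr_gt0//; [case/andP: hd|case/andP: hd'].
  have s1 := (regP d hd).2 k ki; have s2 := (regP d' hd').2 k ki.
  exact: same_trans (kz k ki) s1 s2.
have sameN (d d' : R) k : 0 < d < e1 -> 0 < d' < e1 -> same_side k (z - d *: normal i) (z - d' *: normal i).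
  move=> hd hd'; have [->|ki] := eqVneq k i.
    rewrite /same_side -!scaleNr !affD iz !add0r !lin_normal mulrNN mulr_gt0//; [by case/andP: hd|by case/andP: hd'].
  have s1 := (regN d hd).2 k ki; have s2 := (regN d' hd').2 k ki.
  exact: same_trans (kz k ki) s1 s2.
have h12 : 0 < e1 / 2 < e1 by apply/andP; split; lra.
have [rP sP] := regP _ h12; have [rN sN] := regN _ h12.
have [|k ki|c cE] := @PAjump (z - (e1 / 2) *: normal i) (z + (e1 / 2) *: normal i) i rN rP.
- rewrite /separates -scaleNr !affD iz !add0r !lin_normal mulNr oppr_lt0 mulr_gt0//; lra.
- have s1 := sP k ki; have s2 := sN k ki.
  exact: same_trans (kz k ki) s2 s1.
exists c, e1 => // d hd; have [rP' sP'] := regP _ hd; have [rN' sN'] := regN _ hd; split => //.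
  by move=> k ki; split; [exact: sP'|exact: sN'].
by move=> y; rewrite -cE (PAsame rP' rP) 1?(PAsame rN' rN)// => k; [exact: sameN|exact: sameP].
Qed.

End Arrangement.

Lemma conv_pos {R : realType} (t u v : R) : 0 <= t <= 1 -> 0 < u -> 0 < v -> 0 < (1 - t) * u + t * v.
Proof.
move=> /andP[t0 t1] u0 v0; have [t1'|t1'] := ltrP t 1.
  by rewrite ltr_wpDr ?mulr_ge0 ?(ltW v0)// mulr_gt0// subr_gt0.
have -> : t = 1 by apply/eqP; rewrite eq_le t1.
by rewrite subrr mul0r add0r mul1r.
Qed.

(** In coordinates: [(x, y)] and [(x', y')] are parallel to a line, the vector with factor [s] is a
    nonzero multiple of its normal, and so a point of the line does not lie on a parallel at nonzero
    distance. *)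
Lemma off_line {R : realType} (b b' q s x y x' y' : R) : b * x + b' * y = 0 -> b * x' + b' * y' = 0 ->
  b * (q * b) + b' * (q * b') = 1 -> s != 0 -> (x, y) != 0 -> x * (y' - s * (q * b')) - y * (x' - s * (q * b)) != 0.
Proof.
move=> e1 e2 n1 s0; apply: contra => /eqP dd.
have ex : b * x = - (b' * y) by lra.
have ex' : b * x' = - (b' * y') by lra.
have ey : b' * y = - (b * x) by lra.
have ey' : b' * y' = - (b * x') by lra.
have bw : b * (x * y' - y * x') = 0.
  transitivity ((b * x) * y' - y * (b * x')); first by ring.
  by rewrite ex ex'; ring.
have bw' : b' * (x * y' - y * x') = 0.
  transitivity (x * (b' * y') - (b' * y) * x'); first by ring.
  by rewrite ey ey'; ring.
have w0 : x * y' - y * x' = 0.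
  transitivity ((b * (q * b) + b' * (q * b')) * (x * y' - y * x')); first by rewrite n1 mul1r.
  transitivity (q * b * (b * (x * y' - y * x')) + q * b' * (b' * (x * y' - y * x'))); first by ring.
  by rewrite bw bw' !mulr0 addr0.
have q0 : q * (y * b - x * b') = 0.
  have : s * (q * (y * b - x * b')) = 0 by rewrite -dd -[LHS]addr0 -w0; ring.
  by move/eqP; rewrite mulf_eq0 (negPf s0) => /eqP.
have x0 : x = 0.
  transitivity ((b * (q * b) + b' * (q * b')) * x); first by rewrite n1 mul1r.
  transitivity (q * b * (b * x + b' * y) - b' * (q * (y * b - x * b'))); first by ring.
  by rewrite e1 q0 !mulr0 subr0.
have y0 : y = 0.
  transitivity ((b * (q * b) + b' * (q * b')) * y); first by rewrite n1 mul1r.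
  transitivity (q * b' * (b * x + b' * y) + b * (q * (y * b - x * b'))); first by ring.
  by rewrite e1 q0 !mulr0 addr0.
by rewrite x0 y0.
Qed.

(** * The jump across a line is constant along that line *)

Section Walls.
Context {R : realType}.
Variables (m : nat) (L : 'I_m -> R * @pt R) (U : @pt R -> Prop).
Local Notation a i := (aff (L i)).
Hypothesis Ucvx : forall A B (t : R), U A -> U B -> 0 <= t <= 1 -> U (A + t *: (B - A)).
Hypothesis Uopn : forall A, U A -> exists2 e : R, 0 < e & forall w, nrm w < e -> U (A + w).
Hypothesis npar : forall i j z, i != j -> U z -> a i z = 0 -> a j z = 0 -> det2 (L i).2 (L j).2 != 0.
(** At a crossing on a given line at most two further lines pass. A third difference has three
    directions: two make these lines invisible and one is left for the given line. *)
Hypothesis conc3 : forall z, U z -> (#|[set i | (a i z == 0)%R]%SET| <= 3)%N.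
Hypothesis Lnz : forall i, (L i).2 != 0.
Variable PA : @pt R -> @pt R -> R.
Local Notation regular := (regular L U).
Local Notation same := (same_side L).
Local Notation sep := (separates L).
Local Notation on_wall := (on_wall L U).
Local Notation normal := (normal L).
Local Notation wall_jump := (wall_jump L U PA).
Hypothesis PAcub : forall A, regular A -> is_cubic (PA A).
Hypothesis PAsame : forall A B, regular A -> regular B -> (forall i, same i A B) -> PA A = PA B.
Hypothesis PAjump : forall A B i, regular A -> regular B -> sep i A B ->
  (forall k, k != i -> same k A B) -> exists c : R, forall y, PA B y - PA A y = c * a i y ^+ 3.

Definition along i : @pt R := (- (L i).2.2, (L i).2.1).

Lemma lin_along i j : lin (L j) (along i) = - det2 (L j).2 (L i).2.
Proof. by rewrite /lin /along /det2 /=; ring. Qed.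

Lemma lin_along0 i : lin (L i) (along i) = 0.
Proof. by rewrite /lin /along /=; ring. Qed.

Lemma wall_jump_uniq i z z' c c' : wall_jump i z c -> wall_jump i z' c' -> z = z' -> c = c'.
Proof.
move=> jz jz' zz; case: jz => e e0 H; move: jz'; rewrite -zz => -[e' e'0 H'].
pose d := Num.min e e' / 2; have m0 : 0 < Num.min e e' by rewrite lt_min e0.
have : d < Num.min e e' by rewrite /d; lra.
have d0 : 0 < d by rewrite divr_gt0.
rewrite lt_min => /andP[de de'].
have [|_ _ _ E] := H d; first by rewrite d0.
have [|_ _ _ E'] := H' d; first by rewrite d0.
(* A point where the form of line [i] equals 1, so that the two jump polynomials take the values [c]
   and [c'] there. *)
pose y : @pt R := normal i - (a i 0) *: normal i.
have yE : a i y = 1.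
  have -> : y = 0 + (1 - a i 0) *: normal i by rewrite add0r scalerBl scale1r.
  by rewrite affD lin_normal//; ring.
by have := E' y; rewrite E yE expr1n !mulr1.
Qed.

(* Third differences in directions parallel to the other walls through a crossing do not see those walls. *)
Lemma wall_jump_step i z z' zc c c' : wall_jump i z c -> wall_jump i z' c' ->
  on_wall i z -> on_wall i z' -> U zc -> a i zc = 0 ->
  (forall k, k != i -> sep k z z' -> a k zc = 0) -> c = c'.
Proof.
move=> jz jz' [Uz iz kz] [Uz' iz' kz'] Uc ic sc.
have [zz|zz] := eqVneq z z'; first exact: wall_jump_uniq jz jz' zz.
pose S : {set 'I_m} := [set k | (k != i) && (a k z * a k z' < 0)%R]%SET.
have S2 : (#|S| <= 2)%N.
  have : (#|i |: S| <= 3)%N.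
    apply: leq_trans (conc3 Uc); apply: subset_leq_card; apply/fintype.subsetP => k.
    rewrite !inE => /predU1P[->|/andP[ki sk]]; first by rewrite ic.
    by rewrite (sc k ki sk).
  by rewrite cardsU1 inE eqxx.
have alongi k : k \in S -> lin (L i) (along k) != 0.
  rewrite inE => /andP[ki sk]; rewrite lin_along oppr_eq0.
  by apply: (npar _ Uc ic (sc k ki sk)); rewrite eq_sym.
have normi : lin (L i) (normal i) != 0 by rewrite lin_normal1// oner_eq0.
(* Each crossed line receives a direction parallel to itself, and the normal fills the places left
   over. By [npar] all these directions are transverse to line [i], so its jump remains visible. *)
have [u1 [u2 [i1 i2 kU]]] : exists u1 u2 : @pt R, [/\ lin (L i) u1 != 0, lin (L i) u2 != 0 &
    forall k, k \in S -> lin (L k) u1 = 0 \/ lin (L k) u2 = 0].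
  case E : (enum S) => [|k1 [|k2 [|k3 s]]].
  - exists (normal i), (normal i); split => // k; by rewrite -mem_enum E.
  - exists (along k1), (normal i); split => //; first by apply: alongi; rewrite -mem_enum E mem_head.
    by move=> k; rewrite -mem_enum E inE => /eqP ->; left; exact: lin_along0.
  - exists (along k1), (along k2); split.
    + by apply: alongi; rewrite -mem_enum E mem_head.
    + by apply: alongi; rewrite -mem_enum E !inE eqxx orbT.
    + by move=> k; rewrite -mem_enum E !inE => /orP[]/eqP ->; [left|right]; exact: lin_along0.
  - by move: S2; rewrite cardE E.
case: (jz) => e e0 H; case: (jz') => e' e'0 H'.
pose d := Num.min e e' / 2; have m0 : 0 < Num.min e e' by rewrite lt_min e0.
have : d < Num.min e e' by rewrite /d; lra.
have d0 : 0 < d by rewrite divr_gt0.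
rewrite lt_min => /andP[de de'].
have [|rP rN ss E] := H d; first by rewrite d0.
have [|rP' rN' ss' E'] := H' d; first by rewrite d0.
pose X C := third_diff (PA C) u1 u2 (normal i).
have Xsame C D : regular C -> regular D -> (forall k, same k C D) -> X C = X D.
  by move=> rC rD sCD; rewrite /X (PAsame rC rD sCD).
have v0 : z' - z != 0 by rewrite subr_eq0 eq_sym.
have vi : lin (L i) (z' - z) = 0 by rewrite affB iz iz' subr0.
have dv (s : R) : s != 0 -> det2 (z' - z) (zc - (z + s *: normal i)) != 0.
  move=> s0.
  have ci : lin (L i) (zc - z) = 0 by rewrite affB iz ic subr0.
  have n1 := lin_normal1 Lnz i.
  apply/eqP => dd.
  move: (vi) (ci) (n1) => h1 h2 h3.
  have := @off_line R (L i).2.1 (L i).2.2 ((L i).2.1 ^+ 2 + (L i).2.2 ^+ 2)^-1 s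
    (z' - z).1 (z' - z).2 (zc - z).1 (zc - z).2 h1 h2 h3 s0.
  rewrite -surjective_pairing => /(_ v0) /eqP; apply; rewrite -dd /det2 /normal /= /GRing.scale /=; ring.
have sgn (s : R) k : s != 0 -> regular (z + s *: normal i) -> regular (z' + s *: normal i) ->
   (forall k, k != i -> same k z (z + s *: normal i)) -> (forall k, k != i -> same k z' (z' + s *: normal i)) ->
   sep k (z + s *: normal i) (z' + s *: normal i) -> k \in S.
  move=> s0 r1 r2 s1 s2; rewrite inE; have [->|ki] := eqVneq k i.
    by rewrite /separates !affD iz iz' !add0r -expr2 ltNge sqr_ge0.
  by apply: sign_transfer; [exact: s1|exact: s2].
(* On the parallel to the wall at signed distance [s], the third difference does not notice the
   lines crossed between [z] and [z']. Using both sides of the wall shows that the jump itself is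
   unchanged. *)
have main (s : R) : s != 0 -> regular (z + s *: normal i) -> regular (z' + s *: normal i) ->
   (forall k, k != i -> same k z (z + s *: normal i)) -> (forall k, k != i -> same k z' (z' + s *: normal i)) ->
   X (z + s *: normal i) = X (z' + s *: normal i).
  move=> s0 r1 r2 s1 s2.
  apply: (path_off_point Ucvx npar Xsame r1 r2 Uc).
  - have -> : z' + s *: normal i - (z + s *: normal i) = z' - z by rewrite opprD addrACA subrr addr0.
    exact: dv.
  - by move=> k /(sgn s k s0 r1 r2 s1 s2); rewrite inE => /andP[ki sk]; exact: sc.
  - move=> k C D rC rD /(sgn s k s0 r1 r2 s1 s2) kS skCD sameCD.
    have [c0 cE] := PAjump rC rD skCD sameCD.
    apply/esym/eqP; rewrite -subr_eq0 /X (third_diff_cube _ _ _ cE).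
    by case: (kU k kS) => ->; rewrite ?mul0r ?mulr0 ?mul0r ?mulr0.
have P1 : X (z + d *: normal i) = X (z' + d *: normal i).
  apply: main => //; first by rewrite gt_eqF.
  - by move=> k /ss[].
  - by move=> k /ss'[].
have N1 : X (z - d *: normal i) = X (z' - d *: normal i).
  rewrite -!scaleNr; apply: main; rewrite ?scaleNr//; first by rewrite oppr_eq0 gt_eqF.
  - by move=> k /ss[].
  - by move=> k /ss'[].
have T1 := third_diff_cube u1 u2 (normal i) E; have T2 := third_diff_cube u1 u2 (normal i) E'.
have : 6 * c * (lin (L i) u1 * lin (L i) u2 * lin (L i) (normal i)) =
       6 * c' * (lin (L i) u1 * lin (L i) u2 * lin (L i) (normal i)).
  by rewrite -T1 -T2; move: P1 N1; rewrite /X => -> ->.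
rewrite lin_normal1// mulr1 => /eqP; rewrite -subr_eq0 -mulrBl -mulrBr !mulf_eq0 pnatr_eq0 /=.
by rewrite (negPf i1) (negPf i2) /= orbF subr_eq0 => /eqP.
Qed.

Lemma wall_jump_const i z z' c c' : wall_jump i z c -> wall_jump i z' c' ->
  on_wall i z -> on_wall i z' -> c = c'.
Proof.
move=> jz jz' wz wz'.
pose X (y : @pt R) := if pselect (exists c0, wall_jump i y c0) is left h then projT1 (cid h) else 0.
have XE y c0 : wall_jump i y c0 -> X y = c0.
  rewrite /X => jy; case: pselect => [h|[]]; last by exists c0.
  by case: cid => c1 jy1 /=; exact: wall_jump_uniq jy1 jy erefl.
rewrite -(XE _ _ jz) -(XE _ _ jz').
case: (wz) (wz') => Uz iz kz [Uz' iz' kz'].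
have vi : lin (L i) (z' - z) = 0 by rewrite affB iz iz' subr0.
(* The form of line [i] vanishes along the whole walk, which takes place on that line. It is
   replaced by the constant 1 so that the regularity condition of [path_induction] concerns the
   other lines only. *)
pose f0 k : R := if k == i then 1 else a k z.
pose f1 k : R := if k == i then 0 else lin (L k) (z' - z).
have fE k (t : R) : k != i -> f0 k + t * f1 k = a k (z + t *: (z' - z)).
  by move=> /negPf ki; rewrite /f0 /f1 ki affD linZ.
have := @path_induction R m R f0 f1 (fun t => X (z + t *: (z' - z))).
rewrite /= scale0r addr0 scale1r [z + _]addrC subrK; apply.
- by move=> k; rewrite mul0r addr0 /f0; case: (k =P i) => [_|/eqP ki]; [by rewrite oner_eq0|exact: kz].
- move=> k; have [->|ki] := eqVneq k i; first by rewrite /f0 /f1 eqxx mulr0 addr0 oner_eq0.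
  by rewrite fE// scale1r [z + _]addrC subrK; exact: kz'.
move=> t t' s t0 ts st' t'1 rt rt' Hs.
have wall (r : R) : 0 <= r <= 1 -> (forall k, f0 k + r * f1 k != 0) -> on_wall i (z + r *: (z' - z)).
  move=> r01 rr; split; first exact: Ucvx.
    by rewrite affD iz linZ vi mulr0 addr0.
  by move=> k ki; rewrite -fE.
have w1 := wall t (ltac:(apply/andP; split; lra)) rt.
have w2 := wall t' (ltac:(apply/andP; split; lra)) rt'.
have [c1 j1] := wall_jump_exists Uopn Lnz PAsame PAjump w1.
have [c2 j2] := wall_jump_exists Uopn Lnz PAsame PAjump w2.
rewrite (XE _ _ j1) (XE _ _ j2).
apply: (@wall_jump_step i _ _ (z + s *: (z' - z)) _ _ j1 j2 w1 w2).
- by apply: Ucvx => //; apply/andP; split; lra.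
- by rewrite affD iz linZ vi mulr0 addr0.
- move=> k ki; rewrite /separates -!fE//; exact: Hs.
Qed.

Lemma regular_near z (e : R) : U z -> 0 < e -> exists2 w, nrm w < e & regular (z + w) /\ forall i, a i z != 0 -> same i z (z + w).
Proof.
move=> Uz e0; have [e1 e10 H] := near_point L Uopn Uz.
(* [b] exceeds the absolute value of every slope, so the direction [(1, b)] is parallel to no
   line. *)
pose b : R := 1 + \sum_i `|(L i).2.1 / (L i).2.2|.
have b0 : 0 <= b by rewrite addr_ge0// sumr_ge0.
pose v : @pt R := (1, b).
have vi i : lin (L i) v != 0.
  rewrite /lin /v /= mulr1; have [c0|c0] := eqVneq (L i).2.2 0.
    rewrite c0 mul0r addr0; apply: contra (Lnz i) => /eqP c1.
    by rewrite [(L i).2]surjective_pairing c0 c1.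
  have hb : `|(L i).2.1 / (L i).2.2| < b.
    rewrite /b (bigD1 i)//= addrCA ltrDl ltr_wpDr// sumr_ge0//.
  apply/eqP => h; have bE : b = - ((L i).2.1 / (L i).2.2).
    by apply: (mulfI c0); rewrite mulrN mulrCA divff// mulr1; lra.
  by move: hb; rewrite bE -normrN => /(le_lt_trans (ler_norm _)); rewrite ltxx.
have n1 : 0 < nrm v + 1 by rewrite ltr_wpDl// nrm_ge0.
pose d := Num.min e e1 / (nrm v + 1).
have m0 : 0 < Num.min e e1 by rewrite lt_min e0.
have d0 : 0 < d by rewrite divr_gt0.
have : nrm (d *: v) < Num.min e e1.
  by rewrite nrmZ gtr0_norm// /d mulrAC ltr_pdivrMr// ltr_pM2l// ltrDl.
rewrite lt_min => /andP[de de1]; have [Udv sdv] := H _ de1.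
exists (d *: v) => //; split => //; split => // i.
have [iz|iz] := eqVneq (a i z) 0.
  by rewrite affD iz add0r linZ mulf_neq0// gt_eqF.
by have := sdv i iz; rewrite /same_side; apply: contraTneq => ->; rewrite mulr0 ltxx.
Qed.

(** With [k i] the constant jump across line [i], subtracting [k i] times the cube of its form on
    its positive side removes every jump. The remaining polynomial is unchanged by each single
    crossing and is therefore the same in all cells. *)
Theorem arrangement_cubics z0 : U z0 -> exists (P : @pt R -> R) (k : 'I_m -> R), is_cubic P /\
  forall A, regular A -> forall y, PA A y = P y + \sum_i (if 0 < a i A then k i * a i y ^+ 3 else 0).
Proof.
move=> U0.
pose jumps i (c : R) := exists2 z, on_wall i z & wall_jump i z c.
(* A line without any wall point in [U] is given the coefficient 0. *)
pose k i := if pselect (exists c, jumps i c) is left h then projT1 (cid h) else 0.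
have kE i z c : on_wall i z -> wall_jump i z c -> k i = c.
  rewrite /k => wz jz; case: pselect => [h|[]]; last by exists c, z.
  by case: cid => c1 [z1 wz1 jz1] /=; exact: wall_jump_const jz1 jz wz1 wz.
pose X A y := PA A y - \sum_i (if 0 < a i A then k i * a i y ^+ 3 else 0).
have Xsame y C D : regular C -> regular D -> (forall i, same i C D) -> X C y = X D y.
  move=> rC rD sCD; rewrite /X (PAsame rC rD sCD); congr (_ - _); apply: eq_bigr => i _.
  have := sCD i; rewrite /same_side => h.
  have -> // : (0 < a i C) = (0 < a i D).
  by apply/idP/idP => h1; [rewrite pmulr_rgt0 in h|rewrite pmulr_lgt0 in h].
have cross y i C D : regular C -> regular D -> a i C < 0 -> 0 < a i D -> (forall j, j != i -> same j C D) -> X C y = X D y.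
  move=> rC rD iC iD sj.
  have siCD : sep i C D by rewrite /separates nmulr_rlt0.
  have [c cE] := PAjump rC rD siCD sj.
  have aD0 : 0 < a i D - a i C by lra.
  pose t := - a i C / (a i D - a i C).
  have t01 : 0 <= t <= 1.
    apply/andP; split; first by rewrite divr_ge0 ?(ltW aD0)// oppr_ge0 ltW.
    by rewrite ler_pdivrMr// mul1r; lra.
  pose z := C + t *: (D - C).
  have Uz : U z by apply: Ucvx => //; [case: rC|case: rD].
  have iz : a i z = 0.
    by rewrite /z affD linZ affB /t divfK ?gt_eqF// subrr.
  have sz j : j != i -> same j z C /\ same j z D.
    move=> ji; have := sj j ji; rewrite /same_side /z affD linZ affB.
    move: (a j C) (a j D) => p q h; move: t01 => /andP[t0 t1].
    have e1 : (p + t * (q - p)) * p = (1 - t) * p ^+ 2 + t * (p * q) by ring.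
    have e2 : (p + t * (q - p)) * q = (1 - t) * (p * q) + t * q ^+ 2 by ring.
    have p0 : 0 < p ^+ 2 by rewrite lt_neqAle eq_sym sqrf_eq0 sqr_ge0 andbT; apply/eqP => p0; rewrite p0 mul0r ltxx in h.
    have q0 : 0 < q ^+ 2 by rewrite lt_neqAle eq_sym sqrf_eq0 sqr_ge0 andbT; apply/eqP => q0; rewrite q0 mulr0 ltxx in h.
    by rewrite e1 e2; split; apply: conv_pos => //; apply/andP.
  have wz : on_wall i z.
    split => // j ji; have [h _] := sz j ji; move: h; rewrite /same_side.
    by apply: contraTneq => ->; rewrite mul0r ltxx.
  have [c' jz] := wall_jump_exists Uopn Lnz PAsame PAjump wz.
  have kc' := kE _ _ _ wz jz; case: (jz) => e e0 H.
  have h2 : 0 < e / 2 < e by apply/andP; split; lra.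
  have [rP rN ss E] := H _ h2.
  have nz j : j != i -> a j z != 0 by case: wz => _ _; apply.
  have PD : PA D = PA (z + (e / 2) *: normal i).
    apply: PAsame => // j; have [->|ji] := eqVneq j i.
      by rewrite /same_side affD iz add0r lin_normal// mulr_gt0//; lra.
    by apply: same_trans (nz j ji) (sz j ji).2 (ss j ji).1.
  have PC : PA C = PA (z - (e / 2) *: normal i).
    apply: PAsame => // j; have [->|ji] := eqVneq j i.
      by rewrite /same_side -scaleNr affD iz add0r lin_normal// mulrN oppr_gt0 nmulr_rlt0//; lra.
    by apply: same_trans (nz j ji) (sz j ji).1 (ss j ji).2.
  rewrite /X (bigD1 i)//= [in RHS](bigD1 i)//= iD (_ : 0 < a i C = false) ?add0r; last by apply/negbTE; rewrite -leNgt ltW.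
  rewrite kc'; have := E y; rewrite -PD -PC => <-.
  rewrite (eq_bigr (fun j => if 0 < a j D then k j * a j y ^+ 3 else 0)); first by ring.
  move=> j ji; have h := sj j ji; rewrite /same_side in h.
  have -> // : (0 < a j C) = (0 < a j D).
  by apply/idP/idP => h1; [rewrite pmulr_rgt0 in h|rewrite pmulr_lgt0 in h].
have inv y i C D : regular C -> regular D -> sep i C D -> (forall j, j != i -> same j C D) -> X C y = X D y.
  move=> rC rD siCD sj; have := siCD; rewrite /separates => h.
  have [h1|h1|h1] := ltrgt0P (a i C).
  - apply/esym; apply: (@cross y i D C) => //; first by rewrite pmulr_rlt0 in h.
    by move=> j /sj; rewrite /same_side mulrC.
  - by apply: (@cross y i C D) => //; rewrite nmulr_rlt0 in h.
  - by move: h; rewrite h1 mul0r ltxx.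
have [w _ [r0 _]] := regular_near U0 ltr01.
exists (X (z0 + w)), k; split.
  rewrite /X; apply: is_cubicB; first exact: PAcub.
  suff : forall s : seq 'I_m, is_cubic (fun y => \sum_(i <- s) (if 0 < a i (z0 + w) then k i * a i y ^+ 3 else 0)).
    by move=> /(_ (index_enum _)).
  elim=> [|i s IH].
    by exists (fun=> 0) => y; rewrite big_nil /cubf; ring.
  have ci : is_cubic (fun y => if 0 < a i (z0 + w) then k i * a i y ^+ 3 else 0).
    case: (0 < a i (z0 + w)); last by exists (fun=> 0) => y; rewrite /cubf; ring.
    have [c cE] := is_cubicZ (k i) (is_cubic_prod3 (L i) (L i) (L i)).
    by exists c => y; rewrite -cE; ring.
  have [c cE] := is_cubicD ci IH.
  by exists c => y; rewrite big_cons -cE.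
move=> A rA y; have := path_global Ucvx Uopn npar (Xsame y) r0 rA (inv y).
by rewrite {2}/X => ->; rewrite subrK.
Qed.

End Walls.

(** * C^2 piecewise cubics as combinations of truncated cubes *)

Section SplineOnArrangement.
Context {R : realType}.
Variables (m : nat) (L : 'I_m -> R * @pt R) (U : @pt R -> Prop).
Local Notation a i := (aff (L i)).
Hypothesis Ucvx : forall A B (t : R), U A -> U B -> 0 <= t <= 1 -> U (A + t *: (B - A)).
Hypothesis Uopn : forall A, U A -> exists2 e : R, 0 < e & forall w, nrm w < e -> U (A + w).
Hypothesis npar : forall i j z, i != j -> U z -> a i z = 0 -> a j z = 0 -> det2 (L i).2 (L j).2 != 0.
Hypothesis conc3 : forall z, U z -> (#|[set i | (a i z == 0)%R]%SET| <= 3)%N.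
Hypothesis Lnz : forall i, (L i).2 != 0.
Local Notation regular := (regular L U).
Local Notation same := (same_side L).
Local Notation sep := (separates L).

Definition cont2 (f : @pt R -> R) x := forall e : R, 0 < e -> exists2 d : R, 0 < d &
  forall w, nrm w < d -> `|f (x + w) - f x| < e.

(** [g j] and [h j] stand for the first and second derivatives along the [j]-th axis. Every line is
    transverse to one of the two axes, and derivatives along that axis already determine the form of
    the jump. *)
Variables (s : @pt R -> R) (g h : bool -> @pt R -> R).
Hypothesis cs : forall x, U x -> cont2 s x.
Hypothesis cg : forall j x, U x -> cont2 (g j) x.
Hypothesis ch : forall j x, U x -> cont2 (h j) x.
Hypothesis ds : forall j x, U x -> der1 (fun t => s (x + t *: edir j)) 0 (g j x).
Hypothesis dg : forall j x, U x -> der1 (fun t => g j (x + t *: edir j)) 0 (h j x).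
Hypothesis pc : forall A, regular A -> exists P : @pt R -> R, is_cubic P /\
  forall y, U y -> (forall i, same i A y) -> s y = P y.

Lemma sign_prod (x y z : R) : x * y < 0 -> y * z < 0 -> 0 < x * z.
Proof.
move=> h1 h2; have h3 : 0 < y ^+ 2 * (x * z).
  by rewrite (_ : _ * _ = (x * y) * (y * z)); [rewrite nmulr_rgt0|ring].
have y0 : 0 < y ^+ 2 by rewrite exprn_even_gt0//=; apply: contraTneq h1 => ->; rewrite mulr0 ltxx.
by move: h3; rewrite pmulr_rgt0.
Qed.

Lemma along_span i v : lin (L i) v = 0 -> exists p : R, v = p *: along L i.
Proof.
have := Lnz i; rewrite /lin /along; case: (L i) => [a0 [b c]]; case: v => v1 v2 /= bc e9.
have N0 : b ^+ 2 + c ^+ 2 != 0.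
  rewrite paddr_eq0 ?sqr_ge0// !sqrf_eq0; apply: contra bc => /andP[/eqP h1 /eqP h2].
  by rewrite h1 h2.
exists ((b * v2 - c * v1) / (b ^+ 2 + c ^+ 2)).
rewrite /GRing.scale /= /scale_pair /=; congr (_, _); apply: (mulIf N0); rewrite /GRing.scale /= [RHS]mulrAC divfK//;
  apply/eqP; rewrite -subr_eq0; apply/eqP.
  by rewrite (_ : _ - _ = b * (b * v1 + c * v2)); [rewrite e9 mulr0|ring].
by rewrite (_ : _ - _ = c * (b * v1 + c * v2)); [rewrite e9 mulr0|ring].
Qed.

Lemma cont2_line (f : @pt R -> R) (x w : @pt R) : cont2 f x -> cont1 (fun t => f (x + t *: w)) 0.
Proof.
move=> cf e e0; have [d d0 H] := cf e e0.
have n1 : 0 < nrm w + 1 by rewrite ltr_wpDl// nrm_ge0.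
exists (d / (nrm w + 1)); first by rewrite divr_gt0.
move=> t ht; rewrite add0r scale0r addr0; apply: H; rewrite nrmZ.
apply: (@le_lt_trans _ _ (`|t| * (nrm w + 1))); first by rewrite ler_wpM2l// lerDl.
by rewrite -ltr_pdivlMr.
Qed.

Lemma der1_line (f : @pt R -> R) (x w : @pt R) (t d : R) : der1 (fun r => f (x + t *: w + r *: w)) 0 d -> der1 (fun r => f (x + r *: w)) t d.
Proof.
move=> H e e0; have [k k0 K] := H e e0; exists k => // r rk.
by rewrite scalerDl addrA; have := K r rk; rewrite !add0r scale0r addr0.
Qed.

Definition PA A : @pt R -> R := if pselect (regular A) is left rA then projT1 (cid (pc rA)) else fun=> 0.

Lemma PA_spec A : regular A -> is_cubic (PA A) /\ forall y, U y -> (forall i, same i A y) -> s y = PA A y.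
Proof. by rewrite /PA => rA; case: pselect => // rA'; case: cid. Qed.

Lemma PA_same A B : regular A -> regular B -> (forall i, same i A B) -> PA A = PA B.
Proof.
move=> rA rB sAB; have [cA HA] := PA_spec rA; have [cB HB] := PA_spec rB.
have [e e0 H] := near_regular Uopn rA.
apply/funext; apply: (@cubic_ball_eq _ _ _ A e cA cB e0) => w /H[[Uw rw] sw].
rewrite -HA// -HB// => i; apply: (same_trans _ _ (sw i)); last exact: sAB.
by case: rA.
Qed.

(** Coordinates [p] along the line and [r] along a transverse axis are used. Value, first and second
    [r]-derivative agree from both sides at [r = 0] for all small [p], so the two cubics can differ
    only in the coefficient of [r ^+ 3], and [r] is proportional to the form of the line. *)
Lemma PA_jump A B i : regular A -> regular B -> sep i A B ->
  (forall k, k != i -> same k A B) -> exists c : R, forall y, PA B y - PA A y = c * a i y ^+ 3.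
Proof.
move=> rA rB siAB sj; have [cA HA] := PA_spec rA; have [cB HB] := PA_spec rB.
have [UA nA] := rA; have [UB nB] := rB.
have dAB : a i B - a i A != 0.
  by apply/eqP => e; move: siAB; rewrite /separates (_ : a i B = a i A) ?ltNge -?expr2 ?sqr_ge0//; lra.
pose t : R := - a i A / (a i B - a i A).
have t01 : 0 <= t <= 1.
  have : t * (a i B - a i A) = - a i A by rewrite /t divfK.
  move: siAB dAB; rewrite /separates; move: (a i A) (a i B) t => p q r pq d e.
  have h1 : (p + r * (q - p)) = 0 by lra.
  have d2 : 0 < (q - p) ^+ 2 by rewrite lt_neqAle eq_sym sqrf_eq0 d sqr_ge0.
  have e1 : r * (q - p) ^+ 2 = p ^+ 2 - p * q.
    by rewrite expr2 mulrA e; ring.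
  have e2 : (1 - r) * (q - p) ^+ 2 = q ^+ 2 - p * q.
    by rewrite mulrBl mul1r e1; ring.
  apply/andP; split.
    by rewrite -(pmulr_lge0 _ d2) e1; have := sqr_ge0 p; lra.
  by rewrite -subr_ge0 -(pmulr_lge0 _ d2) e2; have := sqr_ge0 q; lra.
pose z := A + t *: (B - A).
have Uz : U z by exact: Ucvx.
have iz : a i z = 0 by rewrite /z affD linZ affB /t divfK// subrr.
have sz j : j != i -> same j z A /\ same j z B.
  move=> ji; have := sj j ji; rewrite /same_side /z affD linZ affB.
  move: (a j A) (a j B) => p q pq.
  have e1 : (p + t * (q - p)) * p = (1 - t) * p ^+ 2 + t * (p * q) by ring.
  have e2 : (p + t * (q - p)) * q = (1 - t) * (p * q) + t * q ^+ 2 by ring.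
  have p0 : 0 < p ^+ 2 by rewrite lt_neqAle eq_sym sqrf_eq0 sqr_ge0 andbT; apply/eqP => p0; rewrite p0 mul0r ltxx in pq.
  have q0 : 0 < q ^+ 2 by rewrite lt_neqAle eq_sym sqrf_eq0 sqr_ge0 andbT; apply/eqP => q0; rewrite q0 mulr0 ltxx in pq.
  by rewrite e1 e2; split; apply: conv_pos.
have nz j : j != i -> a j z != 0.
  move=> ji; have [h1 _] := sz j ji; move: h1; rewrite /same_side.
  by apply: contraTneq => ->; rewrite mul0r ltxx.
have [e e0 He] := near_point L Uopn Uz.
have [j lj] : exists j, lin (L i) (edir j) != 0.
  have [h1|h1] := eqVneq (lin (L i) (edir false)) 0; last by exists false.
  exists true; apply: contra (Lnz i) => /eqP h2; move: h1 h2; rewrite /lin /= !mulr0 !mulr1 addr0 add0r.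
  by move=> h1 h2; rewrite [(L i).2]surjective_pairing h1 h2.
pose lam := lin (L i) (edir j); pose u := along L i.
pose k := e / (nrm u + nrm (@edir R j) + 1).
have n1 : 0 < nrm u + nrm (@edir R j) + 1 by rewrite ltr_wpDl// addr_ge0// nrm_ge0.
have k0 : 0 < k by rewrite divr_gt0.
have small (p r : R) : `|p| < k -> `|r| < k -> nrm (p *: u + r *: edir j) < e.
  move=> pk rk; apply: (@le_lt_trans _ _ (`|p| * nrm u + `|r| * nrm (@edir R j))).
    rewrite -!nrmZ /nrm /=; have := ler_normD (p *: u.1) (r *: (@edir R j).1).
    have := ler_normD (p *: u.2) (r *: (@edir R j).2); rewrite /GRing.scale /=; lra.
  apply: (@le_lt_trans _ _ (k * nrm u + k * nrm (@edir R j))).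
    by apply: lerD; rewrite ler_wpM2r ?nrm_ge0// ltW.
  have -> : e = k * (nrm u + nrm (@edir R j) + 1) by rewrite /k divfK// gt_eqF.
  by rewrite !mulrDr mulr1 ltrDl.
have ay (p r : R) : a i (z + p *: u + r *: edir j) = r * lam.
  by rewrite affD (affD _ z) iz !linZ lin_along0 mulr0 !add0r.
(* [Q sg] is the polynomial on the side where [r] has the sign [(-1) ^+ sg]; which of the two cells
   this is depends on the sign of [lam]. *)
pose Q (sg : bool) := if ((-1) ^+ sg * lam) * a i A > 0 then PA A else PA B.
have QE (sg : bool) (p r : R) : `|p| < k -> 0 < r < k ->
    s (z + p *: u + ((-1) ^+ sg * r) *: edir j) = Q sg (z + p *: u + ((-1) ^+ sg * r) *: edir j).
  move=> pk /andP[r0 rk]; set y := z + _ + _.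
  have rk' : `|(-1) ^+ sg * r| < k by rewrite normrM normrX normrN1 expr1n mul1r gtr0_norm.
  have [Uy sy] : U y /\ forall j0, a j0 z != 0 -> same j0 z y.
    by rewrite /y -addrA; apply: He; exact: small.
  have aiy : a i y = ((-1) ^+ sg * lam) * r by rewrite ay; ring.
  have nl : (-1) ^+ sg * lam != 0 by rewrite mulf_neq0// signr_eq0.
  rewrite /Q; case: ifP => hA.
    apply: HA => // j0; have [->|j0i] := eqVneq j0 i.
      by rewrite /same_side aiy mulrA pmulr_lgt0// mulrC.
    by apply: same_trans (nz j0 j0i) (sz j0 j0i).1 (sy j0 (nz j0 j0i)).
  apply: HB => // j0; have [->|j0i] := eqVneq j0 i.
    rewrite /same_side aiy mulrA pmulr_lgt0//; move/negbT: hA; rewrite -leNgt => hA.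
    have hA' : (-1) ^+ sg * lam * a i A < 0 by rewrite lt_neqAle hA mulf_neq0.
    by rewrite mulrC; apply: sign_prod hA' siAB.
  by apply: same_trans (nz j0 j0i) (sz j0 j0i).2 (sy j0 (nz j0 j0i)).
have cQ sg : is_cubic (Q sg) by rewrite /Q; case: ifP.
have side sg : exists d, [/\ forall p r, Q sg (z + p *: u + r *: edir j) = cubf d (p, r) &
    forall p, `|p| < k -> [/\ s (z + p *: u) = d 0%N + d 1%N * p + d 3%N * p ^+ 2 + d 6%N * p ^+ 3,
       g j (z + p *: u) = d 2%N + d 4%N * p + d 7%N * p ^+ 2 & h j (z + p *: u) = 2 * (d 5%N + d 8%N * p)]].
  have [d dE] := is_cubic_affine z u (edir j) (cQ sg); exists d; split; first by move=> p r; have := dE (p, r).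
  move=> p pk; pose x0 := z + p *: u.
  have Ux (r : R) : `|r| < k -> U (x0 + r *: edir j).
    by move=> rk; rewrite /x0 -addrA; apply: (He _ _).1; exact: small.
  have U0 : U x0 by have := Ux 0; rewrite normr0 scale0r addr0; apply.
  have := @C2_cubic_side R (fun r => s (x0 + r *: edir j)) (fun r => g j (x0 + r *: edir j)) (fun r => h j (x0 + r *: edir j))
    (d 0%N + d 1%N * p + d 3%N * p ^+ 2 + d 6%N * p ^+ 3) (d 2%N + d 4%N * p + d 7%N * p ^+ 2) (d 5%N + d 8%N * p) (d 9%N) k sg k0.
  rewrite /= !scale0r !addr0; apply.
  - exact/cont2_line/cs.
  - exact/cont2_line/cg.
  - exact/cont2_line/ch.
  - by move=> r rk; apply: der1_line; exact/ds/Ux.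
  - by move=> r rk; apply: der1_line; exact/dg/Ux.
  - move=> r rk; rewrite QE//; have := dE (p, (-1) ^+ sg * r); rewrite /= => ->.
    rewrite /cubf /= exprMn; have -> : ((-1) ^+ sg) ^+ 2 = 1 :> R by rewrite -exprM mulnC exprM sqrrN expr1n expr1n.
    ring.
have [d [dE dP]] := side false; have [d' [d'E d'P]] := side true.
have eqs (p : R) : `|p| < k -> [/\ (d 0%N - d' 0%N) + (d 1%N - d' 1%N) * p + (d 3%N - d' 3%N) * p ^+ 2 + (d 6%N - d' 6%N) * p ^+ 3 = 0,
   (d 2%N - d' 2%N) + (d 4%N - d' 4%N) * p + (d 7%N - d' 7%N) * p ^+ 2 + 0 * p ^+ 3 = 0 &
   (d 5%N - d' 5%N) + (d 8%N - d' 8%N) * p + 0 * p ^+ 2 + 0 * p ^+ 3 = 0].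
  by move=> pk; have [e1 e2 e3] := dP p pk; have [e4 e5 e6] := d'P p pk; split; lra.
have [z0 z1 z3 z6] := @cubic_small0 R _ _ _ _ k k0 (fun p pk => let: And3 x _ _ := eqs p pk in x).
have [z2 z4 z7 _] := @cubic_small0 R _ _ _ _ k k0 (fun p pk => let: And3 _ x _ := eqs p pk in x).
have [z5 z8 _ _] := @cubic_small0 R _ _ _ _ k k0 (fun p pk => let: And3 _ _ x := eqs p pk in x).
have D y : Q false y - Q true y = (d 9%N - d' 9%N) / lam ^+ 3 * a i y ^+ 3.
  pose r := a i y / lam; have rl : r * lam = a i y by rewrite divfK.
  have [p pE] : exists p : R, y = z + p *: u + r *: edir j.
    have e9 : lin (L i) (y - z - r *: edir j) = 0.
      have h9 : a i y = lin (L i) (y - z) by rewrite -[y in LHS](subrK z) [y - z + z]addrC affD iz add0r.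
      by rewrite linD -scaleNr linZ -h9 -/lam mulNr rl subrr.
    by have [p pE] := along_span e9; exists p; rewrite -pE -addrA subrK addrC subrK.
  have [c0 c1 c2 c3 [c4 c5 c6 c7 c8]] : [/\ d 0%N = d' 0%N, d 1%N = d' 1%N, d 2%N = d' 2%N, d 3%N = d' 3%N & [/\ d 4%N = d' 4%N,
     d 5%N = d' 5%N, d 6%N = d' 6%N, d 7%N = d' 7%N & d 8%N = d' 8%N]] by split; [..|split]; exact/subr0_eq.
  rewrite -rl {1 2}pE dE d'E /cubf /= c0 c1 c2 c3 c4 c5 c6 c7 c8.
  have -> : (d 9%N - d' 9%N) / lam ^+ 3 * (r * lam) ^+ 3 = (d 9%N - d' 9%N) * r ^+ 3.
    by rewrite exprMn [r ^+ 3 * _]mulrC mulrA divfK ?expf_neq0.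
  ring.
have [hA|hA] := boolP (0 < (-1) ^+ false * lam * a i A).
  exists (- ((d 9%N - d' 9%N) / lam ^+ 3)) => y; rewrite mulNr -D /Q hA ifF; first by ring.
  by apply/negbTE; rewrite -leNgt; move: hA; rewrite expr0 expr1; lra.
exists ((d 9%N - d' 9%N) / lam ^+ 3) => y; rewrite -D /Q (negbTE hA) ifT//.
by move: hA; rewrite -leNgt le_eqVlt expr0 expr1 mul1r !mulN1r mulNr oppr_gt0 mulf_eq0 (negPf lj) (negPf (nA i)).
Qed.

Theorem arrangement_spline z0 : U z0 -> exists (P : @pt R -> R) (k : 'I_m -> R), is_cubic P /\
  forall A, regular A -> s A = P A + \sum_i k i * pp (a i A) ^+ 3.
Proof.
move=> U0; have [P [k [cP PE]]] := arrangement_cubics Ucvx Uopn npar conc3 Lnz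
  (fun A rA => (PA_spec rA).1) PA_same PA_jump U0.
exists P, k; split => // A rA.
have [_ HA] := PA_spec rA; rewrite HA; last 2 first.
- by case: rA.
- by move=> i; rewrite /same_side -expr2 lt_neqAle eq_sym sqrf_eq0 sqr_ge0 andbT; case: rA => _; apply.
rewrite PE//; congr (_ + _); apply: eq_bigr => i _.
rewrite ppE; case: ltgtP => //; first by rewrite expr0n /= mulr0.
by move=> <-; rewrite expr0n /= mulr0.
Qed.

End SplineOnArrangement.

(** * Barycentric coordinates *)

(** Points and lines of the split have integer barycentric data. Incidences and signs are decided in
    [Z] and transported to the reals by [zr]. *)
Definition Z3 := (Z * Z * Z)%type.

Section IntegerCasts.
Context {R : realType}.

Definition zr (z : Z) : R := (int_of_Z z)%:~R.

Lemma zrD a b : zr (a + b)%Zb = zr a + zr b.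
Proof. by rewrite /zr -intrD -rmorphD. Qed.
Lemma zrM a b : zr (a * b)%Zb = zr a * zr b.
Proof. by rewrite /zr -intrM -rmorphM. Qed.
Lemma zrN a : zr (- a)%Zb = - zr a.
Proof. by rewrite /zr -mulrNz -rmorphN. Qed.
Lemma zrB a b : zr (a - b)%Zb = zr a - zr b.
Proof. by rewrite -zrN -zrD. Qed.
Lemma zr_le0 a : (0 <= zr a) = (0 <=? a)%Zb.
Proof. by rewrite /zr ler0z; case: a. Qed.
Lemma zr_gt0 a : (0 < zr a) = (0 <? a)%Zb.
Proof. rewrite /zr ltr0z; case: a => //= p. by have := Pos2Nat.is_pos p; case: (Pos.to_nat p) => //; lia. Qed.
Lemma zr_eq0 a : (zr a == 0) = (a =? 0)%Zb.
Proof. rewrite /zr intr_eq0; case: a => //= p. by have := Pos2Nat.is_pos p; case: (Pos.to_nat p) => //; lia. Qed.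
Definition dotz (n m : Z3) : Z := (n.1.1 * m.1.1 + n.1.2 * m.1.2 + n.2 * m.2)%Zb.
Definition crossz (n m : Z3) : Z3 :=
  (n.1.2 * m.2 - n.2 * m.1.2, n.2 * m.1.1 - n.1.1 * m.2, n.1.1 * m.1.2 - n.1.2 * m.1.1)%Zb.
Definition sumz (n : Z3) : Z := (n.1.1 + n.1.2 + n.2)%Zb.

Definition R3' := (R * R * R)%type.
Definition zr3 (n : Z3) : R3' := (zr n.1.1, zr n.1.2, zr n.2).
Definition dot3 (n b : R3') : R := n.1.1 * b.1.1 + n.1.2 * b.1.2 + n.2 * b.2.
Definition sum3 (b : R3') : R := b.1.1 + b.1.2 + b.2.

Lemma dot_zr n m : dot3 (zr3 n) (zr3 m) = zr (dotz n m).
Proof. by rewrite /dot3 /dotz /= !zrD !zrM. Qed.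
Lemma sum_zr n : sum3 (zr3 n) = zr (sumz n).
Proof. by rewrite /sum3 /sumz /= !zrD. Qed.

End IntegerCasts.

Section Barycentric.
Context {R : realType}.
Variable v : 'I_3 -> @pt R.
Local Notation D := (det2 (v (1 : 'I_3) - v 0) (v (2 : 'I_3) - v 0)).

Definition bform1 : R * @pt R :=
  ((((v (2 : 'I_3)).1 - (v 0).1) * (v 0).2 - ((v (2 : 'I_3)).2 - (v 0).2) * (v 0).1) / D,
   (((v (2 : 'I_3)).2 - (v 0).2) / D, ((v 0).1 - (v (2 : 'I_3)).1) / D)).
Definition bform2 : R * @pt R :=
  ((((v (1 : 'I_3)).2 - (v 0).2) * (v 0).1 - ((v (1 : 'I_3)).1 - (v 0).1) * (v 0).2) / D,
   (((v 0).2 - (v (1 : 'I_3)).2) / D, ((v (1 : 'I_3)).1 - (v 0).1) / D)).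
Definition bform0 : R * @pt R := (1 - bform1.1 - bform2.1, (- bform1.2.1 - bform2.2.1, - bform1.2.2 - bform2.2.2)).

(** The affine form taking the values [c] at the three vertices. *)
Definition bform (c : R3') : R * @pt R :=
  (c.1.1 * bform0.1 + c.1.2 * bform1.1 + c.2 * bform2.1,
   (c.1.1 * bform0.2.1 + c.1.2 * bform1.2.1 + c.2 * bform2.2.1,
    c.1.1 * bform0.2.2 + c.1.2 * bform1.2.2 + c.2 * bform2.2.2)).

Definition bary (x : @pt R) : R3' := (aff bform0 x, aff bform1 x, aff bform2 x).
Definition dbary (w : @pt R) : R3' := (lin bform0 w, lin bform1 w, lin bform2 w).
Definition comb (b : R3') : @pt R := b.1.1 *: v 0 + b.1.2 *: v (1 : 'I_3) + b.2 *: v (2 : 'I_3).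

Lemma aff_bform c x : aff (bform c) x = dot3 c (bary x).
Proof. by rewrite /bform /aff /dot3 /bary /aff /=; case: bform0 => ? [? ?]; case: bform1 => ? [? ?]; case: bform2 => ? [? ?] /=; ring. Qed.
Lemma lin_bform c w : lin (bform c) w = dot3 c (dbary w).
Proof. by rewrite /bform /lin /dot3 /dbary /lin /=; case: bform0 => ? [? ?]; case: bform1 => ? [? ?]; case: bform2 => ? [? ?] /=; ring. Qed.
Lemma sum_bary x : sum3 (bary x) = 1.
Proof. by rewrite /sum3 /bary /bform0 /aff; case: bform1 => ? [? ?]; case: bform2 => ? [? ?] /=; ring. Qed.
Hypothesis nd : Defs.nondegenerate v.

Lemma baryK x : comb (bary x) = x.
Proof.
move: nd; rewrite /Defs.nondegenerate /comb /bary /aff /= /det2 /=; case: (v 0) => a1 a2; case: (v 1) => b1 b2.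
case: (v 2) => c1 c2; case: x => x1 x2; rewrite /GRing.scale /= => nz.
by rewrite [LHS]surjective_pairing; congr (_, _); rewrite /= /GRing.scale /=; field.
Qed.

Lemma combK b : sum3 b = 1 -> bary (comb b) = b.
Proof.
move: nd; rewrite /Defs.nondegenerate /comb /bary /aff /= /det2 /sum3 /=; case: (v 0) => a1 a2; case: (v 1) => b1 b2.
case: (v 2) => c1 c2; case: b => [[p q] r]; rewrite /GRing.scale /= => nz s1.
have -> : p = 1 - q - r by lra.
by congr (_, _, _); rewrite /GRing.scale /=; field.
Qed.

Lemma dcombK b : sum3 b = 0 -> dbary (comb b) = b.
Proof.
move: nd; rewrite /Defs.nondegenerate /comb /dbary /lin /= /det2 /sum3 /=; case: (v 0) => a1 a2; case: (v 1) => b1 b2.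
case: (v 2) => c1 c2; case: b => [[p q] r]; rewrite /GRing.scale /= => nz s1.
have -> : p = - q - r by lra.
by congr (_, _, _); rewrite /GRing.scale /=; field.
Qed.

(** The right-hand side is the coordinate sum of the cross product of [c] and [d]. Two lines are
    parallel exactly when their intersection in homogeneous barycentric coordinates has sum zero. *)
Lemma det2_bform c d : det2 (bform c).2 (bform d).2 * D =
  (c.1.2 * d.2 - c.2 * d.1.2) + (c.2 * d.1.1 - c.1.1 * d.2) + (c.1.1 * d.1.2 - c.1.2 * d.1.1).
Proof.
move: nd; rewrite /Defs.nondegenerate /bform /= /det2 /=; case: (v 0) => a1 a2; case: (v 1) => b1 b2.
by case: (v 2) => c1 c2 /= nz; field.
Qed.

Lemma baryD x w : bary (x + w) = bary x + dbary w.
Proof. by rewrite /bary /dbary !affD. Qed.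
Lemma dbaryZ k w : dbary (k *: w) = k *: dbary w.
Proof. by rewrite /dbary !linZ. Qed.

Arguments bary : simpl never.
Lemma tri_setP x : tri_set v x <-> [/\ 0 <= (bary x).1.1, 0 <= (bary x).1.2 & 0 <= (bary x).2].
Proof.
rewrite /tri_set; split.
  move=> /hull_finite[l [l0 [l1 xE]]].
  have l1' : l 0 + l (1 : 'I_3) + l (2 : 'I_3) = 1.
    rewrite -l1 !big_ord_recl big_ord0 addr0 addrA /=.
    by congr (_ + _ + _); congr l; apply: val_inj.
  have e : x = comb (l 0, l (1 : 'I_3), l (2 : 'I_3)).
    rewrite xE /comb !big_ord_recl big_ord0 addr0 addrA /=.
    by congr (_ + _ *: v _ + _ *: v _); try apply: val_inj => //=; congr l; apply: val_inj.
  by rewrite e combK//=; split; apply: l0.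
have := sum_bary x; have := baryK x; case: (bary x) => [[p q] r] /= <-; rewrite /sum3 /= => s1 [h0 h1 h2].
apply/hull_finite; exists (fun i => nth 0 [:: p; q; r] i); split; first by case=> [] [|[|[|]]].
  by rewrite !big_ord_recl !big_ord0 !addr0 !addrA /=.
rewrite !big_ord_recl !big_ord0 !addr0 !addrA /=.
by rewrite /comb /=; congr (_ + _ *: v _ + _ *: v _); exact: val_inj.
Qed.

End Barycentric.

(** * Continuity, interior and derivatives in terms of [nrm] and [der1] *)

Section TopologyBridge.
Context {R : realType}.
Implicit Types (x w : @pt R) (f s : @pt R -> R).

Lemma nbhs_nrmP x (A : set (@pt R)) : nbhs x A <-> exists2 e : R, 0 < e & forall w, nrm w < e -> A (x + w).
Proof.
split.
  move=> /nbhs_ballP[e /= e0 H]; exists e => // w we; apply: H; split; rewrite /ball /= opprD addNKr normrN.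
    by apply: le_lt_trans we; rewrite /nrm lerDl.
  by apply: le_lt_trans we; rewrite /nrm lerDr.
move=> [e e0 H]; apply/nbhs_ballP; exists (e / 2); first by rewrite /= divr_gt0.
move=> y [/= h1 h2]; rewrite -[y](subrK x) addrC; apply: H.
rewrite /nrm /= -normrN opprB -[`|y.2 - _|]normrN opprB.
by rewrite [e]splitr; apply: ltrD.
Qed.

Definition wcont (Om : set (@pt R)) f x := forall e : R, 0 < e -> exists2 d : R, 0 < d &
  forall w, nrm w < d -> Om (x + w) -> `|f (x + w) - f x| < e.

Lemma within_contP (Om : set (@pt R)) f : {within Om, continuous f} <-> forall x, Om x -> wcont Om f x.
Proof.
split=> [/subspace_continuousP H x Ox e e0|H].
  have /cvgrPdist_lt/(_ e e0)/nbhs_nrmP[d d0 K] := H x Ox; exists d => // w wd Ow.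
  by rewrite distrC; exact: K.
apply/subspace_continuousP => x Ox; apply/cvgrPdist_lt => e e0.
have [d d0 K] := H x Ox e e0; apply/nbhs_nrmP; exists d => // w wd Ow.
by rewrite distrC; exact: K.
Qed.

Lemma interior_nrmP (Om : set (@pt R)) x : Om° x <-> exists2 e : R, 0 < e & forall w, nrm w < e -> Om (x + w).
Proof. exact: nbhs_nrmP. Qed.

Lemma wcont_interior (Om : set (@pt R)) f x : Om° x -> wcont Om f x -> cont2 f x.
Proof.
move=> /interior_nrmP[e e0 He] H r r0; have [d d0 K] := H r r0.
by exists (Num.min e d) => [|w]; rewrite lt_min ?e0// => /andP[we wd]; apply: K => //; exact: He.
Qed.

Lemma is_derive_der1 f x w (df : R) : is_derive x w f df <-> der1 (fun t => f (x + t *: w)) 0 df.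
Proof.
split.
  case=> dv dE e e0; move: dv; rewrite /derivable => /cvgP H.
  have {}H : (fun h => h^-1 *: ((f \o shift x) (h *: w) - f x)) @ 0^' --> df.
    by rewrite -dE; exact: (cvgP _ H).
  move/cvgrPdist_le: H => /(_ e e0) /nbhs_ballP[k /= k0 K]; exists k => // h hk.
  rewrite !add0r scale0r addr0; have [->|h0] := eqVneq h 0.
    by rewrite scale0r addr0 subrr mulr0 subrr normr0 mulr0.
  have := K h; rewrite /ball /= sub0r normrN => /(_ hk h0); rewrite [h *: w + x]addrC.
  rewrite -(ler_pM2r (_ : 0 < `|h|)) ?normr_gt0// -normrM => K'.
  apply: le_trans K'; rewrite -normrN opprB mulrBl /GRing.scale /= mulrAC mulVf// mul1r.
  by rewrite le_eqVlt eqxx.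
move=> H; suff K : (fun h => h^-1 *: ((f \o shift x) (h *: w) - f x)) @ 0^' --> df.
  by split; [exact: cvgP K|exact: cvg_lim K].
apply/cvgrPdist_le => e e0; have [k k0 K] := H e e0; apply/nbhs_ballP; exists k => //= h.
rewrite /ball /= sub0r normrN => hk h0; have := K h hk; rewrite !add0r scale0r addr0 [h *: w + x]addrC => K'.
rewrite -(ler_pM2r (_ : 0 < `|h|)) ?normr_gt0// -normrM; apply: le_trans K'.
by rewrite mulrBl /GRing.scale /= [X in _ - X]mulrAC mulVf// mul1r distrC.
Qed.

Lemma der1_O2 f x w (d C : R) : (forall t : R, `|t| <= 1 -> `|f (x + t *: w) - f x - d * t| <= C * t ^+ 2) ->
  der1 (fun t => f (x + t *: w)) 0 d.
Proof.
move=> H e e0; pose C' := `|C| + 1; have C0 : 0 < C' by rewrite ltr_pwDr.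
exists (Num.min 1 (e / C')) => [|t]; first by rewrite lt_min ltr01 divr_gt0.
rewrite lt_min add0r scale0r addr0 => /andP[t1 ht]; apply: (le_trans (H t (ltW t1))); rewrite -real_normK ?num_real// expr2 mulrA.
rewrite ler_wpM2r//; apply: (@le_trans _ _ (C' * `|t|)).
  by rewrite ler_wpM2r// /C'; apply: (le_trans (ler_norm C)); rewrite lerDl.
by rewrite mulrC -ler_pdivlMr// ltW.
Qed.

Lemma cont2_O1 f x (C : R) : (forall w, nrm w <= 1 -> `|f (x + w) - f x| <= C * nrm w) -> cont2 f x.
Proof.
move=> H e e0; pose C' := `|C| + 1; have C0 : 0 < C' by rewrite ltr_pwDr.
exists (Num.min 1 (e / C')) => [|w]; first by rewrite lt_min ltr01 divr_gt0.
rewrite lt_min => /andP[w1 we]; apply: (le_lt_trans (H w (ltW w1))).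
apply: (@le_lt_trans _ _ (C' * nrm w)); last by rewrite mulrC -ltr_pdivlMr.
by rewrite ler_wpM2r ?nrm_ge0// /C'; apply: (le_trans (ler_norm C)); rewrite lerDl.
Qed.

Section TcsSmooth.
Context {I : finType}.
Variables (a : I -> R) (L : I -> R * @pt R).

Lemma tcs_der1 x w : der1 (fun t => tcs a L (x + t *: w)) 0 (tcs1 a L x w).
Proof.
have [C C0 /(_ x)[H _ _]] := tcs_taylor a L.
apply: (@der1_O2 _ _ _ _ (C * nrm w ^+ 3 + `|tcs2 a L x w w / 2|)) => t t1.
have := H (t *: w); rewrite tcs1Z tcs2Z tcs2C tcs2Z nrmZ => K.
have -> : tcs a L (x + t *: w) - tcs a L x - tcs1 a L x w * t =
  (tcs a L (x + t *: w) - tcs a L x - t * tcs1 a L x w - t * (t * tcs2 a L x w w) / 2) + t ^+ 2 * (tcs2 a L x w w / 2) by field.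
apply: (le_trans (ler_normD _ _)); rewrite mulrDl; apply: lerD; last by rewrite normrM normrX real_normK ?num_real// mulrC.
apply: (le_trans K); rewrite exprMn -mulrA ler_wpM2l// mulrC ler_wpM2l ?exprn_ge0 ?nrm_ge0//.
by rewrite exprSr -[t ^+ 2]real_normK ?num_real// -[leRHS]mulr1 ler_wpM2l ?exprn_ge0.
Qed.

Lemma tcs1_bound x w : `|tcs1 a L x w| <= (`|tcs1 a L x e1| + `|tcs1 a L x e2|) * nrm w.
Proof.
have -> : w = w.1 *: e1 + w.2 *: e2.
  by rewrite [LHS]surjective_pairing; congr (_, _); rewrite /= /GRing.scale /=; ring.
rewrite tcs1D !tcs1Z; apply: (le_trans (ler_normD _ _)); rewrite !normrM.
have -> : nrm (w.1 *: e1 + w.2 *: e2) = `|w.1| + `|w.2|.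
  by rewrite /nrm /= /GRing.scale /= !mulr0 !mulr1 addr0 add0r.
have := normr_ge0 w.1; have := normr_ge0 w.2; have := normr_ge0 (tcs1 a L x e1); have := normr_ge0 (tcs1 a L x e2).
by move=> *; nra.
Qed.

Lemma tcs2_bound x u : exists2 C : R, 0 <= C & forall w, `|tcs2 a L x u w| <= C * nrm w.
Proof.
exists (`|tcs2 a L x u e1| + `|tcs2 a L x u e2|); first exact: addr_ge0.
move=> w; have -> : w = w.1 *: e1 + w.2 *: e2.
  by rewrite [LHS]surjective_pairing; congr (_, _); rewrite /= /GRing.scale /=; ring.
rewrite tcs2D !tcs2Z; apply: (le_trans (ler_normD _ _)); rewrite !normrM.
have -> : nrm (w.1 *: e1 + w.2 *: e2) = `|w.1| + `|w.2|.
  by rewrite /nrm /= /GRing.scale /= !mulr0 !mulr1 addr0 add0r.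
have := normr_ge0 w.1; have := normr_ge0 w.2; have := normr_ge0 (tcs2 a L x u e1); have := normr_ge0 (tcs2 a L x u e2).
by move=> *; nra.
Qed.

Lemma tcs2_bound2 x : exists2 C : R, 0 <= C & forall u w, `|tcs2 a L x u w| <= C * (nrm u * nrm w).
Proof.
have [C1 C10 H1] := tcs2_bound x e1; have [C2 C20 H2] := tcs2_bound x e2.
exists (C1 + C2) => [|u w]; first exact: addr_ge0.
have -> : u = u.1 *: e1 + u.2 *: e2.
  by rewrite [LHS]surjective_pairing; congr (_, _); rewrite /= /GRing.scale /=; ring.
have -> : nrm (u.1 *: e1 + u.2 *: e2) = `|u.1| + `|u.2|.
  by rewrite /nrm /= /GRing.scale /= !mulr0 !mulr1 addr0 add0r.
rewrite tcs2C tcs2D !tcs2Z ![tcs2 _ _ _ w _]tcs2C.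
apply: (le_trans (ler_normD _ _)); rewrite !normrM.
have := H1 w; have := H2 w; have := normr_ge0 u.1; have := normr_ge0 u.2; have := nrm_ge0 w.
move: `|u.1| `|u.2| (nrm w) `|tcs2 a L x e1 w| `|tcs2 a L x e2 w| => p q r s t r0 p0 q0 h1 h2.
have := ler_wpM2l p0 h1; have := ler_wpM2l q0 h2; have : 0 <= C1 * (q * r) by rewrite !mulr_ge0.
have : 0 <= C2 * (p * r) by rewrite !mulr_ge0.
by move=> *; nra.
Qed.

Lemma tcs_cont x : cont2 (tcs a L) x.
Proof.
have [C C0 /(_ x)[H _ _]] := tcs_taylor a L; have [K K0 HK] := tcs2_bound2 x.
apply: (@cont2_O1 _ _ (C + (`|tcs1 a L x e1| + `|tcs1 a L x e2|) + K)) => w w1.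
have -> : tcs a L (x + w) - tcs a L x = (tcs a L (x + w) - tcs a L x - tcs1 a L x w - tcs2 a L x w w / 2) +
   tcs1 a L x w + tcs2 a L x w w / 2 by ring.
have n0 := nrm_ge0 w; rewrite !mulrDl -!mulrDl !mulrDl.
apply: (le_trans (ler_normD _ _)); rewrite lerD//.
  apply: (le_trans (ler_normD _ _)); rewrite lerD//; last by rewrite -mulrDl tcs1_bound.
  by apply: (le_trans (H w)); rewrite ler_wpM2l// exprSr -[leRHS]mul1r ler_wpM2r// exprn_ile1.
rewrite normrM; apply: (@le_trans _ _ (`|tcs2 a L x w w| * 1)).
  by rewrite ler_wpM2l// ger0_norm//; lra.
rewrite mulr1; apply: (le_trans (HK w w)); rewrite ler_wpM2l// -[leRHS]mul1r ler_wpM2r//.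
Qed.

Lemma tcs1_cont x v : cont2 (fun y => tcs1 a L y v) x.
Proof.
have [C C0 /(_ x)[_ H _]] := tcs_taylor a L; have [K K0 HK] := tcs2_bound2 x.
apply: (@cont2_O1 _ _ (C * nrm v + K * nrm v)) => w w1.
have -> : tcs1 a L (x + w) v - tcs1 a L x v = (tcs1 a L (x + w) v - tcs1 a L x v - tcs2 a L x v w) + tcs2 a L x v w by ring.
apply: (le_trans (ler_normD _ _)); rewrite mulrDl lerD//; last by rewrite -mulrA.
apply: (le_trans (H v w)); rewrite mulrA ler_wpM2l ?mulr_ge0 ?nrm_ge0// expr2 -[leRHS]mul1r.
by rewrite ler_wpM2r ?nrm_ge0.
Qed.

Lemma tcs1_der1 x v w : der1 (fun t => tcs1 a L (x + t *: w) v) 0 (tcs2 a L x v w).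
Proof.
have [C C0 /(_ x)[_ H _]] := tcs_taylor a L.
apply: (@der1_O2 (fun y => tcs1 a L y v) _ _ _ (C * (nrm v * nrm w ^+ 2))) => t _.
have := H v (t *: w); rewrite tcs2Z nrmZ [t * _]mulrC => K; apply: (le_trans K).
by rewrite exprMn real_normK ?num_real// le_eqVlt; apply/orP; left; apply/eqP; ring.
Qed.

Lemma tcs2_cont x u v : cont2 (fun y => tcs2 a L y u v) x.
Proof.
have [C C0 /(_ x)[_ _ H]] := tcs_taylor a L.
by apply: (@cont2_O1 _ _ (C * (nrm u * nrm v))) => w _; have := H u v w; rewrite !mulrA.
Qed.

End TcsSmooth.

End TopologyBridge.

(** * The Wang-Shi split of a triangle *)

(** Ten forms, nonnegative on the triangle, whose cubes span the cubic polynomials. The eighteen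
    [line_vecs] are the lines through pairs of the nine points other than the sides. Together they
    make the 28 truncated cubes. *)
Definition poly_vecs : seq Z3 := [:: (1,0,0); (0,1,0); (0,0,1); (1,1,0); (0,1,1); (1,0,1); (2,1,0); (0,2,1); (1,0,2); (1,1,1)]%Zb.
Definition line_vecs : seq Z3 := [:: (0,-1,2); (0,-2,1); (1,0,-2); (2,0,-1); (-1,2,0); (-2,1,0); (1,1,-2); (4,1,-2); (-1,2,-4);
  (-2,1,-2); (1,4,-2); (2,2,-1); (-1,2,-1); (-4,2,-1); (-1,2,2); (-2,1,4); (-2,4,1); (-2,1,1)]%Zb.
Definition side_vecs : seq Z3 := [:: (1,0,0); (0,1,0); (0,0,1)]%Zb.
Definition cube_vec i : Z3 := nth (0,0,0)%Zb (poly_vecs ++ line_vecs) i.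
Definition nine_vecs : seq Z3 := [:: (3,0,0); (0,3,0); (0,0,3); (0,2,1); (0,1,2); (2,0,1); (1,0,2); (2,1,0); (1,2,0)]%Zb.

Definition zero_on (n z : Z3) := (dotz n z =? 0)%Zb.

Lemma nine_joined : all (fun z => all (fun z' => has (fun n => zero_on n z && zero_on n z') (line_vecs ++ side_vecs)) nine_vecs) nine_vecs.
Proof. by vm_compute. Qed.
Lemma nine_sum : all (fun z => sumz z =? 3)%Zb nine_vecs.
Proof. by vm_compute. Qed.

Definition posz (n : Z3) := [&& 0 <? n.1.1, 0 <? n.1.2 & 0 <? n.2]%Zb.
Definition oppz (n : Z3) : Z3 := (- n.1.1, - n.1.2, - n.2)%Zb.

Lemma lines_distinct : all (fun i => all (fun j => (i == j) ||
  (crossz (nth (0,0,0)%Zb line_vecs i) (nth (0,0,0)%Zb line_vecs j) != (0,0,0)%Zb)) (iota 0 18)) (iota 0 18).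
Proof. by vm_compute. Qed.

(** The cross product of two line vectors is their intersection in homogeneous coordinates. It lies
    in the open triangle exactly when its three entries have one strict sign. *)
Lemma lines_concurrency : all (fun i => all (fun j =>
    posz (crossz (nth (0,0,0)%Zb line_vecs i) (nth (0,0,0)%Zb line_vecs j)) ||
    posz (oppz (crossz (nth (0,0,0)%Zb line_vecs i) (nth (0,0,0)%Zb line_vecs j))) ==>
    (count (zero_on ^~ (crossz (nth (0,0,0)%Zb line_vecs i) (nth (0,0,0)%Zb line_vecs j))) line_vecs <= 3)%N)
    (iota 0 18)) (iota 0 18).
Proof. by vm_compute. Qed.

Lemma lines_nonconst : all (fun n => ~~ ((n.1.1 =? n.1.2) && (n.1.2 =? n.2))%Zb) line_vecs.
Proof. by vm_compute. Qed.

Section OneTriangle.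
Context {R : realType}.
Variable v : 'I_3 -> @pt R.
Hypothesis nd : Defs.nondegenerate v.
Implicit Types (x w : @pt R).

Definition inner x := [/\ 0 < (bary v x).1.1, 0 < (bary v x).1.2 & 0 < (bary v x).2].
Definition cube_form (i : 'I_28) := bform v (zr3 (cube_vec i)).
Definition line_form (i : 'I_18) := bform v (zr3 (nth (0,0,0)%Zb line_vecs i)).

Lemma aff_seg (l : R * @pt R) x y (t : R) : aff l ((1 - t) *: x + t *: y) = (1 - t) * aff l x + t * aff l y.
Proof. by rewrite /aff /= /GRing.scale /=; ring. Qed.

Lemma aff_pos_near (l : R * @pt R) x : 0 < aff l x -> exists2 e : R, 0 < e & forall w, nrm w < e -> 0 < aff l (x + w).
Proof.
move=> l0; have n1 : 0 < nrm l.2 + 1 by rewrite ltr_wpDl// nrm_ge0.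
exists (aff l x / (nrm l.2 + 1)) => [|w]; first by rewrite divr_gt0.
rewrite ltr_pdivlMr// => H; rewrite affD; have := lin_bound l w; rewrite ler_norml => /andP[h _].
have := nrm_ge0 w; have := nrm_ge0 l.2; nra.
Qed.

Lemma inner_open x : inner x -> exists2 e : R, 0 < e & forall w, nrm w < e -> inner (x + w).
Proof.
move=> [/aff_pos_near[a a0 A] /aff_pos_near[b b0 B] /aff_pos_near[c c0 C]].
exists (Num.min a (Num.min b c)) => [|w]; first by rewrite !lt_min a0 b0.
by rewrite !lt_min => /andP[ha /andP[hb hc]]; split; [apply: A|apply: B|apply: C].
Qed.

Lemma inner_convex x y (t : R) : inner x -> inner y -> 0 <= t <= 1 -> inner (x + t *: (y - x)).
Proof.
move=> [x0 x1 x2] [y0 y1 y2] t01.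
have -> : x + t *: (y - x) = (1 - t) *: x + t *: y.
  by rewrite scalerBr scalerBl scale1r addrA addrAC.
by split; rewrite /bary /= aff_seg; apply: conv_pos.
Qed.

Lemma inner_tri x : inner x -> tri_set v x.
Proof. by move=> [h0 h1 h2]; apply/(tri_setP nd); split; exact: ltW. Qed.

Lemma interior_tri x : (tri_set v)° x <-> inner x.
Proof.
split=> [/interior_nrmP[e e0 H]|/inner_open[e e0 H]]; last first.
  by apply/interior_nrmP; exists e => // w /H; exact: inner_tri.
have /(tri_setP nd)[h0 h1 h2] : tri_set v x.
  by have := H 0; rewrite addr0; apply; rewrite /nrm /= normr0 addr0.
have key (c : @R3' R) : sum3 c = 0 -> exists2 k : R, 0 < k & tri_set v (x + k *: comb v c).
  move=> c0; have n1 : 0 < nrm (comb v c) + 1 by rewrite ltr_wpDl// nrm_ge0.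
  exists (e / (nrm (comb v c) + 1)); first by rewrite divr_gt0.
  apply: H; rewrite nrmZ gtr0_norm ?divr_gt0// mulrAC ltr_pdivrMr//.
  by rewrite ltr_pM2l// ltrDl.
have hB (c : @R3' R) (k : R) : sum3 c = 0 -> bary v (x + k *: comb v c) = bary v x + k *: c.
  by move=> c0; rewrite baryD dbaryZ dcombK.
split.
- have [|k k0] := key (-1, 1, 0); first by rewrite /sum3 /=; ring.
  move/(tri_setP nd); rewrite hB; last by rewrite /sum3 /=; ring.
  by move: (bary v x) => [[p q] r] [] /=; rewrite /GRing.scale /=; lra.
- have [|k k0] := key (1, -1, 0); first by rewrite /sum3 /=; ring.
  move/(tri_setP nd); rewrite hB; last by rewrite /sum3 /=; ring.
  by move: (bary v x) => [[p q] r] [] /=; rewrite /GRing.scale /=; lra.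
- have [|k k0] := key (1, 0, -1); first by rewrite /sum3 /=; ring.
  move/(tri_setP nd); rewrite hB; last by rewrite /sum3 /=; ring.
  by move: (bary v x) => [[p q] r] [] /=; rewrite /GRing.scale /=; lra.
Qed.

Definition centroid : @pt R := comb v (1/3, 1/3, 1/3).

Lemma bary_centroid : bary v centroid = (1/3, 1/3, 1/3).
Proof. by rewrite /centroid combK// /sum3 /=; field. Qed.

Lemma inner_centroid : inner centroid.
Proof. by rewrite /inner bary_centroid /=; split; lra. Qed.

Lemma inner_dense x (d : R) : tri_set v x -> 0 < d -> exists2 w, nrm w < d & inner (x + w).
Proof.
move=> /(tri_setP nd) tx d0; pose u := centroid - x.
have n1 : 0 < nrm u + 1 by rewrite ltr_wpDl// nrm_ge0.
pose k := Num.min 1 (d / (nrm u + 1)).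
have k0 : 0 < k by rewrite lt_min ltr01 divr_gt0.
have k1 : k <= 1 by rewrite ge_min lexx.
have kd : k <= d / (nrm u + 1) by rewrite ge_min lexx orbT.
exists (k *: u).
  rewrite nrmZ gtr0_norm//; apply: (@lt_le_trans _ _ (k * (nrm u + 1))).
    by rewrite ltr_pM2l// ltrDl.
  by rewrite -ler_pdivlMr.
have -> : x + k *: u = (1 - k) *: x + k *: centroid.
  by rewrite scalerBr scalerBl scale1r addrA addrAC.
move: tx; have := bary_centroid; rewrite /inner /bary => -[c0 c1 c2] /= [t0 t1 t2].
by split; rewrite aff_seg ?c0 ?c1 ?c2; nra.
Qed.

Lemma nine_pointsE : nine_points v = [seq comb v (3^-1 *: zr3 z) | z <- nine_vecs].
Proof.
have [z0 z1 z2 z3] : [/\ @zr R 0 = 0, @zr R 1 = 1, @zr R 2 = 2 & @zr R 3 = 3] by [].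
by rewrite /nine_points /= /v12 /v13 /v21 /v23 /v31 /v32 /comb /=; repeat (congr (_ :: _)); rewrite /zr3 /= ?z0 ?z1 ?z2 ?z3;
  rewrite [LHS]surjective_pairing [RHS]surjective_pairing; congr (_, _); rewrite /= /GRing.scale /=; field.
Qed.

(** A segment between two of the nine points lies on one of the eighteen lines or on a side. The
    form of such a line keeps its sign between [x] and [y], and the side forms are positive there,
    so the segments cannot meet. *)
Lemma same_cellP x y : inner x -> inner y -> (forall i, 0 < aff (line_form i) x * aff (line_form i) y) -> same_cell v x y.
Proof.
move=> ix iy sxy; split; first exact/interior_tri; split; first exact/interior_tri.
move=> a b; rewrite nine_pointsE => /mapP[za zaN aE] /mapP[zb zbN bE].
apply/seteqP; split => // q [[t [t01 qE]] [r [r01 qE']]].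
have sumE z : z \in nine_vecs -> sum3 (3^-1 *: (zr3 z : @R3' R)) = 1.
  move=> /(allP nine_sum)/Z.eqb_spec h; rewrite /sum3 /= /GRing.scale /= -!mulrDr.
  by have := @sum_zr R z; rewrite /sum3 h /= => ->; rewrite mulVf//.
have z0 n z : z \in nine_vecs -> zero_on n z -> aff (bform v (zr3 n)) (comb v (3^-1 *: zr3 z)) = 0.
  move=> zN /Z.eqb_spec h; rewrite aff_bform combK ?sumE//.
  have := @dot_zr R n z; rewrite h /dot3 /= /GRing.scale /= => e.
  by rewrite !(mulrCA _ 3^-1) -!mulrDr e mulr0.
have /(allP nine_joined)/allP/(_ zb zbN)/hasP[n nL /andP[na nb]] := zaN.
have q0 : aff (bform v (zr3 n)) q = 0 by rewrite qE' aff_seg aE bE !z0// !mulr0 addr0.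
move: nL; rewrite mem_cat => /orP[nL|nS].
  have iL : (index n line_vecs < 18)%N by rewrite (_ : 18%N = size line_vecs)// index_mem.
  have := sxy (Ordinal iL); rewrite /line_form /= nth_index// => h.
  have h1 : aff (bform v (zr3 n)) x != 0 by apply: contraTneq h => ->; rewrite mul0r ltxx.
  move: q0; rewrite qE aff_seg; move: h h1; move: (aff _ x) (aff _ y) => p1 p2 p12 p10 e.
  have p11 : 0 < p1 * p1 by rewrite -expr2 exprn_even_gt0.
  have := conv_pos t01 p11 p12; rewrite [_ + _](_ : _ = p1 * ((1 - t) * p1 + t * p2)); last by ring.
  by rewrite e mulr0 ltxx.
suff : 0 < aff (bform v (zr3 n)) q by rewrite q0 ltxx.
have [x0 x1 x2] := ix; have [y0 y1 y2] := iy.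
rewrite qE aff_seg !aff_bform; apply: conv_pos => //.
  by move: nS; rewrite !inE => /or3P[]/eqP ->; rewrite /dot3 /= /zr /= !mul0r ?addr0 ?add0r mul1r.
by move: nS; rewrite !inE => /or3P[]/eqP ->; rewrite /dot3 /= /zr /= !mul0r ?addr0 ?add0r mul1r.
Qed.

End OneTriangle.

(** * Splines on one split triangle are combinations of 28 truncated cubes *)

Section LocalForm.
Context {R : realType}.
Variable v : 'I_3 -> @pt R.
Hypothesis nd : Defs.nondegenerate v.
Implicit Types (x w : @pt R).

Definition cubes10 (a : nat -> R) (b : @R3' R) : R := \sum_(i < 10) a i * dot3 (zr3 (nth (0,0,0)%Zb poly_vecs i)) b ^+ 3.

Definition cube_spanned (f : @pt R -> R) := exists a : nat -> R, forall x, f x = cubes10 a (bary v x).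

Lemma cube_spannedD f g : cube_spanned f -> cube_spanned g -> cube_spanned (fun x => f x + g x).
Proof.
move=> [a aE] [b bE]; exists (fun i => a i + b i) => x; rewrite aE bE /cubes10 -big_split /=.
by apply: eq_bigr => i _; rewrite mulrDl.
Qed.

Lemma cube_spannedZ k f : cube_spanned f -> cube_spanned (fun x => k * f x).
Proof.
move=> [a aE]; exists (fun i => k * a i) => x; rewrite aE /cubes10 mulr_sumr.
by apply: eq_bigr => i _; rewrite mulrA.
Qed.

(* [X^2 Y = ((2X+Y)^3 - 8 X^3 - Y^3)/6 - S] with [S = X^2 Y + X Y^2 = ((X+Y)^3 - X^3 - Y^3)/3], and
   [XYZ] is obtained from [(X+Y+Z)^3]. *)
Lemma cubes10_monomials (m300 m030 m003 m210 m120 m021 m012 m102 m201 m111 : R) : exists a, forall b : @R3' R,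
  let: (X, Y, Z) := b in
  m300 * X ^+ 3 + m030 * Y ^+ 3 + m003 * Z ^+ 3 + m210 * (X ^+ 2 * Y) + m120 * (X * Y ^+ 2) +
  m021 * (Y ^+ 2 * Z) + m012 * (Y * Z ^+ 2) + m102 * (X * Z ^+ 2) + m201 * (X ^+ 2 * Z) + m111 * (X * Y * Z) = cubes10 a b.
Proof.
pose dxy := m210 - m120; pose dyz := m021 - m012; pose dzx := m102 - m201.
(* coefficients of [X^2 Y + X Y^2], etc., once the multiples of [(2X+Y)^3], etc., are removed *)
pose cxy := m120 - dxy - m111 / 2; pose cyz := m012 - dyz - m111 / 2; pose czx := m201 - dzx - m111 / 2.
exists (nth 0 [:: m300 - 8 / 6 * dxy - cxy / 3 - dzx / 6 - czx / 3 - m111 / 6;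
  m030 - dxy / 6 - cxy / 3 - 8 / 6 * dyz - cyz / 3 - m111 / 6;
  m003 - dyz / 6 - cyz / 3 - 8 / 6 * dzx - czx / 3 - m111 / 6;
  cxy / 3; cyz / 3; czx / 3; dxy / 6; dyz / 6; dzx / 6; m111 / 6]) => -[[X Y] Z].
have [z0 z1 z2] : [/\ @zr R 0 = 0, @zr R 1 = 1 & @zr R 2 = 2] by [].
rewrite /cubes10 !big_ord_recl big_ord0 /bump /= /dot3 /= ?z0 ?z1 ?z2 /cxy /cyz /czx /dxy /dyz /dzx.
by field.
Qed.

Lemma cube_spanned_prod (p q r : @R3' R) :
  cube_spanned (fun x => dot3 p (bary v x) * dot3 q (bary v x) * dot3 r (bary v x)).
Proof.
case: p => [[p0 p1] p2]; case: q => [[q0 q1] q2]; case: r => [[r0 r1] r2].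
have [a aE] := cubes10_monomials (p0 * q0 * r0) (p1 * q1 * r1) (p2 * q2 * r2)
 (p0 * q0 * r1 + p0 * q1 * r0 + p1 * q0 * r0) (p0 * q1 * r1 + p1 * q0 * r1 + p1 * q1 * r0)
 (p1 * q1 * r2 + p1 * q2 * r1 + p2 * q1 * r1) (p1 * q2 * r2 + p2 * q1 * r2 + p2 * q2 * r1)
 (p0 * q2 * r2 + p2 * q0 * r2 + p2 * q2 * r0) (p0 * q0 * r2 + p0 * q2 * r0 + p2 * q0 * r0)
 (p0 * q1 * r2 + p0 * q2 * r1 + p1 * q0 * r2 + p1 * q2 * r0 + p2 * q0 * r1 + p2 * q1 * r0).
exists a => x; move: (aE (bary v x)); case: (bary v x) => [[X Y] Z] <-; rewrite /dot3 /=; ring.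
Qed.

Lemma is_cubic_spanned P : is_cubic P -> cube_spanned P.
Proof.
move=> [c cE].
(* The constant 1 and the two Cartesian coordinates are written as linear forms in the barycentric
   coordinates; each monomial of degree at most 3 becomes a product of exactly three such forms. *)
pose o : @R3' R := (1, 1, 1).
pose X : @R3' R := ((v 0).1, (v (1 : 'I_3)).1, (v (2 : 'I_3)).1).
pose Y : @R3' R := ((v 0).2, (v (1 : 'I_3)).2, (v (2 : 'I_3)).2).
have oE x : dot3 o (bary v x) = 1 by rewrite -(sum_bary v x) /dot3 /sum3 /= !mul1r.
have XE x : dot3 X (bary v x) = x.1.
  rewrite -[in RHS](baryK nd x) /comb /dot3 /X /= /GRing.scale /=; ring.
have YE x : dot3 Y (bary v x) = x.2.
  rewrite -[in RHS](baryK nd x) /comb /dot3 /Y /= /GRing.scale /=; ring.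
suff : cube_spanned (fun x => c 0%N * (dot3 o (bary v x) * dot3 o (bary v x) * dot3 o (bary v x))
  + c 1%N * (dot3 X (bary v x) * dot3 o (bary v x) * dot3 o (bary v x))
  + c 2%N * (dot3 Y (bary v x) * dot3 o (bary v x) * dot3 o (bary v x))
  + c 3%N * (dot3 X (bary v x) * dot3 X (bary v x) * dot3 o (bary v x))
  + c 4%N * (dot3 X (bary v x) * dot3 Y (bary v x) * dot3 o (bary v x))
  + c 5%N * (dot3 Y (bary v x) * dot3 Y (bary v x) * dot3 o (bary v x))
  + c 6%N * (dot3 X (bary v x) * dot3 X (bary v x) * dot3 X (bary v x))
  + c 7%N * (dot3 X (bary v x) * dot3 X (bary v x) * dot3 Y (bary v x))
  + c 8%N * (dot3 X (bary v x) * dot3 Y (bary v x) * dot3 Y (bary v x))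
  + c 9%N * (dot3 Y (bary v x) * dot3 Y (bary v x) * dot3 Y (bary v x))).
  by move=> [a aE]; exists a => x; rewrite -aE cE !oE !XE !YE /cubf; ring.
by repeat apply: cube_spannedD; apply: cube_spannedZ; exact: cube_spanned_prod.
Qed.

Lemma poly_vec_ge0 (i : 'I_10) x : tri_set v x -> 0 <= dot3 (zr3 (nth (0,0,0)%Zb poly_vecs i)) (bary v x).
Proof.
move=> /(tri_setP nd); move: (bary v x) => [[p q] r] /= [p0 q0 r0].
have [z0 z1 z2] : [/\ @zr R 0 = 0, @zr R 1 = 1 & @zr R 2 = 2] by [].
by case: i => [] [|[|[|[|[|[|[|[|[|[|]]]]]]]]]] //= _; rewrite /dot3 /= ?z0 ?z1 ?z2; lra.
Qed.

Lemma line_form_nz i : (line_form v i).2 != 0.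
Proof.
apply/eqP => e.
have nL : nth (0,0,0)%Zb line_vecs i \in line_vecs by apply: mem_nth; exact: ltn_ord.
have /negP := allP lines_nonconst _ nL; apply.
move: e; rewrite /line_form; set n := nth _ _ _ => e.
have H (c : @R3' R) : sum3 c = 0 -> dot3 (zr3 n) c = 0.
  by move=> c0; rewrite -(dcombK nd c0) -lin_bform /lin e /= !mul0r addr0.
have e1 : @zr R n.1.1 = zr n.1.2.
  by have := H (1, -1, 0); rewrite /sum3 /dot3 /= => h; apply/eqP; rewrite -subr_eq0; apply/eqP; rewrite -[RHS]h; ring.
have e2 : @zr R n.1.2 = zr n.2.
  by have := H (0, 1, -1); rewrite /sum3 /dot3 /= => h; apply/eqP; rewrite -subr_eq0; apply/eqP; rewrite -[RHS]h; ring.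
have : @zr R (n.1.1 - n.1.2)%Zb == 0 by rewrite zrB e1 subrr.
have : @zr R (n.1.2 - n.2)%Zb == 0 by rewrite zrB e2 subrr.
rewrite !zr_eq0 => /Z.eqb_spec a /Z.eqb_spec b; apply/andP; split; apply/Z.eqb_spec; lia.
Qed.

(* The common zero [z] of two of the lines is [w / sum w], for [w] the cross product of their vectors. *)
Lemma line_common_zero (n m : Z3) x : dot3 (zr3 n) (bary v x) = 0 -> dot3 (zr3 m) (bary v x) = 0 ->
  let w := @zr3 R (crossz n m) in
  [/\ w.1.1 = (bary v x).1.1 * sum3 w, w.1.2 = (bary v x).1.2 * sum3 w & w.2 = (bary v x).2 * sum3 w].
Proof.
have := sum_bary v x; move: (bary v x) => [[X Y] Z]; rewrite /sum3 /dot3 /= => s1.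
rewrite /crossz /= !zrB !zrM; move: (zr n.1.1) (zr n.1.2) (zr n.2) (zr m.1.1) (zr m.1.2) (zr m.2) => a b c d e f h1 h2.
have -> : Z = 1 - X - Y by lra.
have h1' : a * X + b * Y + c * (1 - X - Y) = 0 by rewrite -h1 -s1; ring.
have h2' : d * X + e * Y + f * (1 - X - Y) = 0 by rewrite -h2 -s1; ring.
split; apply/eqP; rewrite -subr_eq0; apply/eqP.
- rewrite [LHS](_ : _ = (f - e) * (a * X + b * Y + c * (1 - X - Y)) - (c - b) * (d * X + e * Y + f * (1 - X - Y))).
    by rewrite h1' h2' !mulr0 subrr.
  ring.
- rewrite [LHS](_ : _ = (d - f) * (a * X + b * Y + c * (1 - X - Y)) - (a - c) * (d * X + e * Y + f * (1 - X - Y))).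
    by rewrite h1' h2' !mulr0 subrr.
  ring.
- rewrite [LHS](_ : _ = (e - d) * (a * X + b * Y + c * (1 - X - Y)) - (b - a) * (d * X + e * Y + f * (1 - X - Y))).
    by rewrite h1' h2' !mulr0 subrr.
  ring.
Qed.

Lemma lines_npar i j x : i != j -> aff (line_form v i) x = 0 -> aff (line_form v j) x = 0 ->
  det2 (line_form v i).2 (line_form v j).2 != 0.
Proof.
move=> ij; rewrite /line_form; set n := nth _ _ i; set m := nth _ _ j; rewrite !aff_bform => h1 h2.
have [w0 w1 w2] := line_common_zero h1 h2.
have wn : crossz n m != (0,0,0)%Zb.
  have := allP (allP lines_distinct i _) j _; rewrite !mem_iota !add0n !ltn_ord => /(_ isT isT).
  by rewrite (negPf (_ : nat_of_ord i != j)).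
apply/eqP => d0; have := det2_bform nd (zr3 n) (zr3 m); rewrite d0 mul0r => e0.
have s0 : sum3 (@zr3 R (crossz n m)) = 0.
  by rewrite /sum3 /crossz /= !zrB !zrM; move: e0; rewrite /=; lra.
move: w0 w1 w2; rewrite s0 !mulr0 /=.
move=> /eqP; rewrite zr_eq0 => /Z.eqb_spec a /eqP; rewrite zr_eq0 => /Z.eqb_spec b /eqP; rewrite zr_eq0 => /Z.eqb_spec c.
by move/eqP: wn; apply; rewrite [LHS]surjective_pairing [(crossz _ _).1]surjective_pairing /= a b c.
Qed.

Lemma posz_multiple (w : Z3) (p q r t : R) : 0 < p -> 0 < q -> 0 < r ->
  zr w.1.1 = p * t -> zr w.1.2 = q * t -> zr w.2 = r * t -> t != 0 -> posz w || posz (oppz w).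
Proof.
move=> p0 q0 r0 w0 w1 w2 t0; have [tp|tn|/esym/eqP] := ltrgtP 0 t; last by rewrite (negPf t0).
  by apply/orP; left; rewrite /posz -!(@zr_gt0 R) w0 w1 w2 !mulr_gt0.
by apply/orP; right; rewrite /posz /oppz /= -!(@zr_gt0 R) !zrN w0 w1 w2 !oppr_gt0 !pmulr_rlt0// tn.
Qed.

Lemma wcont_eq (Om : set (@pt R)) f F x : wcont Om f x -> cont2 F x ->
  (forall d, 0 < d -> exists2 w, nrm w < d & Om (x + w) /\ f (x + w) = F (x + w)) -> f x = F x.
Proof.
move=> cf cF H; apply/eqP; rewrite -subr_eq0 -normr_eq0 eq_le normr_ge0 andbT leNgt; apply/negP => c0.
have e0 : 0 < `|f x - F x| / 2 by rewrite divr_gt0.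
have [d d0 K] := cf _ e0; have [d' d'0 K'] := cF _ e0.
have [|w] := H (Num.min d d'); first by rewrite lt_min d0.
rewrite lt_min => /andP[wd wd'] [Ow fF]; have := K w wd Ow; have := K' w wd'; rewrite fF => h1 h2.
have := ler_distD (F (x + w)) (f x) (F x); rewrite [`|f x - F (x + w)|]distrC; lra.
Qed.

(** The cross product of two lines through [x] is a nonzero multiple of the barycentric coordinates
    of [x]. It is thus counted in [lines_concurrency], and every further line through [x] vanishes
    at it. *)
Lemma lines_conc3 x : inner v x -> (#|[set i | (aff (line_form v i) x == 0)%R]%SET| <= 3)%N.
Proof.
move=> [x0 x1 x2]; set S := [set i | _]%SET.
have [->|[i0 i0S]] := set_0Vmem S; first by rewrite cards0.
have [e|[j0]] := set_0Vmem (S :\ i0); first by rewrite (cardsD1 i0) i0S e cards0.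
rewrite in_setD1 => /andP[ji j0S].
move: i0S j0S; rewrite !inE /line_form => /eqP h1 /eqP h2; rewrite !aff_bform in h1 h2.
have := line_common_zero h1 h2; set w := crossz _ _ => -[w0 w1 w2].
have sw : sum3 (@zr3 R w) != 0.
  apply/eqP => s0; move: w0 w1 w2; rewrite s0 !mulr0 /=.
  move=> /eqP; rewrite zr_eq0 => /Z.eqb_spec a /eqP; rewrite zr_eq0 => /Z.eqb_spec b /eqP; rewrite zr_eq0 => /Z.eqb_spec c.
  have := allP (allP lines_distinct i0 _) j0 _; rewrite !mem_iota !add0n !ltn_ord => /(_ isT isT).
  rewrite (negPf (_ : nat_of_ord i0 != j0)) 1?eq_sym//= => /eqP; apply.
  by rewrite /crossz /= a b c.
have pw : posz w || posz (oppz w) by exact: (posz_multiple x0 x1 x2 w0 w1 w2 sw).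
have := allP (allP lines_concurrency i0 _) j0 _; rewrite !mem_iota !add0n !ltn_ord => /(_ isT isT).
rewrite -/w pw implyTb => H; apply: leq_trans H; rewrite -sum1_count.
have -> : (\sum_(n <- line_vecs | zero_on n w) 1 = \sum_(i < 18 | zero_on (nth (0,0,0)%Zb line_vecs i) w) 1)%N.
  by rewrite (big_nth (0,0,0)%Zb) big_mkord.
rewrite sum1_card; apply: subset_leq_card; apply/fintype.subsetP => i; rewrite !inE unfold_in /line_form aff_bform => /eqP h.
rewrite /zero_on -(@zr_eq0 R) -dot_zr.
have -> : dot3 (zr3 (nth (0,0,0)%Zb line_vecs i)) (zr3 w) = sum3 (@zr3 R w) * dot3 (zr3 (nth (0,0,0)%Zb line_vecs i)) (bary v x).
  by rewrite [in LHS]/dot3 w0 w1 w2 /dot3; ring.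
by rewrite h mulr0.
Qed.

(** The arrangement theorem gives the formula at regular inner points; these are dense in the closed
    triangle and both sides are continuous. *)
Theorem piecewise_cubic_tcs (Om : set (@pt R)) s : (tri_set v `<=` Om) -> C2_on Om s -> piecewise_cubic_WS3 v s ->
  exists a : 'I_28 -> R, forall x, tri_set v x -> s x = tcs a (cube_form v) x.
Proof.
move=> tO [cs Hs] pc.
have [g Hg] := choice Hs.
have cont f x : {within Om, continuous f} -> inner v x -> cont2 f x.
  move=> cf ix; have iO : Om° x by apply: (interiorS tO); exact/interior_tri.
  by apply: (wcont_interior iO); move/within_contP: cf; apply; exact: interior_subset iO.
have [h Hh] := choice (fun j => (Hg j).2.2 j).
have iO x : inner v x -> Om° x by move=> ix; apply: (interiorS tO); exact/interior_tri.
have pcell A : regular (line_form v) (inner v) A -> exists P, is_cubic P /\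
    forall y, inner v y -> (forall i, same_side (line_form v) i A y) -> s y = P y.
  move=> [iA nA]; have [|P [/cubic_poly_is_cubic cP PE]] := pc A.
    by apply: (same_cellP nd iA iA) => i; rewrite -expr2 exprn_even_gt0//= nA.
  by exists P; split => // y iy sy; apply: PE; exact: (same_cellP nd iA iy).
have [P [k [cP PE]]] := @arrangement_spline R 18 (line_form v) (inner v) (@inner_convex _ v) (@inner_open _ v)
  (fun i j z ij _ => @lines_npar i j z ij) lines_conc3 line_form_nz s g h
  (fun x ix => cont s x cs ix) (fun j x ix => cont (g j) x (Hg j).1 ix) (fun j x ix => cont (h j) x (Hh j).1 ix)
  (fun j x ix => (is_derive_der1 _ _ _ _).1 ((Hg j).2.1 x (iO x ix)))
  (fun j x ix => (is_derive_der1 _ _ _ _).1 ((Hh j).2 x (iO x ix)))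
  pcell _ (inner_centroid nd).
have [b bE] := is_cubic_spanned cP.
(* The first ten coefficients come from the global cubic, whose forms are nonnegative on the
   triangle, so truncation does not affect their cubes; the other eighteen are the jumps. *)
pose a (i : 'I_28) := match fintype.split (i : 'I_(10 + 18)) with inl j => b j | inr j => k j end.
have aE x : tri_set v x -> tcs a (cube_form v) x = P x + \sum_i k i * pp (aff (line_form v i) x) ^+ 3.
  move=> tx; rewrite /tcs (@big_split_ord _ _ _ 10 18) /= bE; congr (_ + _).
    apply: eq_bigr => i _; rewrite /a /= (_ : fintype.split _ = inl i); last first.
      by rewrite -[RHS](@unsplitK 10 18 (inl i)); congr fintype.split; exact: val_inj.
    rewrite pp_pos /cube_form /= ?aff_bform /cube_vec nth_cat ltn_ord//; exact: poly_vec_ge0.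
  apply: eq_bigr => i _; rewrite /a /= (_ : fintype.split _ = inr i); last first.
    by rewrite -[RHS](@unsplitK 10 18 (inr i)); congr fintype.split; exact: val_inj.
  have e : cube_vec (10 + i) = nth (0,0,0)%Zb line_vecs i.
    by rewrite /cube_vec nth_cat (_ : size poly_vecs = 10%N)// ltnNge leq_addr addKn.
  by rewrite /cube_form /line_form -e.
exists a => x tx; apply: (@wcont_eq Om) => [||d d0].
- by move/within_contP: cs; apply; exact: tO.
- exact: tcs_cont.
have d2 : 0 < d / 2 by rewrite divr_gt0.
have [w wd iw] := inner_dense nd tx d2.
have [w' wd' [rw _]] := regular_near (@inner_open _ v) line_form_nz iw d2.
have tw : tri_set v (x + (w + w')) by rewrite addrA; apply: inner_tri => //; case: rw.
exists (w + w'); last by split; [exact: tO|rewrite aE// addrA PE].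
rewrite [d]splitr; apply: le_lt_trans (ltrD wd wd'); rewrite /nrm /= addrACA.
by rewrite lerD// ler_normD.
Qed.

Lemma tri_set_ext (Om : set (@pt R)) f F : (tri_set v `<=` Om) -> {within Om, continuous f} -> (forall x, cont2 F x) ->
  (forall x, inner v x -> f x = F x) -> forall x, tri_set v x -> f x = F x.
Proof.
move=> tO cf cF H x tx; apply: (@wcont_eq Om) => [||d d0]; [|exact: cF|].
  by move/within_contP: cf; apply; exact: tO.
by have [w wd iw] := inner_dense nd tx d0; exists w => //; split; [exact/tO/inner_tri|exact: H].
Qed.

(** At inner points the derivative is unique; continuity carries the equality to edges and vertices.
    There the jets of the triangle's formula are thereby identified with the continuous extensions
    of the derivatives of the spline. *)
Lemma tri_set_derive (Om : set (@pt R)) f F g G w : (tri_set v `<=` Om) -> {within Om, continuous g} -> (forall x, cont2 G x) ->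
  (forall x, Om° x -> is_derive x w f (g x)) -> (forall x, der1 (fun t => F (x + t *: w)) 0 (G x)) ->
  (forall x, tri_set v x -> f x = F x) -> forall x, tri_set v x -> g x = G x.
Proof.
move=> tO cg cG df dF fF; apply: (tri_set_ext tO cg cG) => x ix.
have iO : Om° x by apply: (interiorS tO); exact/interior_tri.
have /is_derive_der1 d1 := df x iO.
have [e e0 He] := inner_open ix.
have n1 : 0 < nrm w + 1 by rewrite ltr_wpDl// nrm_ge0.
have fl t : `|t| < e / (nrm w + 1) -> f (x + t *: w) = F (x + t *: w).
  move=> tk; apply/fF/inner_tri => //; apply: He; rewrite nrmZ.
  apply: le_lt_trans (_ : `|t| * (nrm w + 1) < e); first by rewrite ler_wpM2l// lerDl.
  by rewrite -ltr_pdivlMr.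
have k0 : 0 < e / (nrm w + 1) by rewrite divr_gt0.
apply: (der1_uniq d1) => r r0; have [d d0 K] := dF x r r0.
exists (Num.min d (e / (nrm w + 1))) => [|t]; first by rewrite lt_min d0.
rewrite lt_min => /andP[td tk]; rewrite add0r !fl ?normr0//.
by have := K t td; rewrite add0r.
Qed.

End LocalForm.

(** * Bounds for the simplex splines *)

Definition knot_vecs : seq (seq Z3) :=
  let v1 := (3,0,0)%Zb in let v2 := (0,3,0)%Zb in let v3 := (0,0,3)%Zb in
  let v12 := (0,2,1)%Zb in let v13 := (0,1,2)%Zb in let v21 := (2,0,1)%Zb in
  let v23 := (1,0,2)%Zb in let v31 := (2,1,0)%Zb in let v32 := (1,2,0)%Zb in
  [:: [:: v1; v1; v1; v1; v31; v21];
  [:: v2; v2; v2; v2; v32; v12];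
  [:: v3; v3; v3; v3; v13; v23];
  [:: v1; v1; v1; v31; v32; v21];
  [:: v1; v1; v1; v21; v23; v31];
  [:: v2; v2; v2; v12; v13; v32];
  [:: v2; v2; v2; v32; v31; v12];
  [:: v3; v3; v3; v23; v21; v13];
  [:: v3; v3; v3; v13; v12; v23];
  [:: v1; v1; v31; v32; v2; v21];
  [:: v1; v1; v21; v23; v3; v31];
  [:: v2; v2; v12; v13; v3; v32];
  [:: v2; v2; v32; v31; v1; v12];
  [:: v3; v3; v23; v21; v1; v13];
  [:: v3; v3; v13; v12; v2; v23];
  [:: v1; v1; v31; v32; v21; v23];
  [:: v2; v2; v32; v31; v12; v13];
  [:: v3; v3; v13; v12; v23; v21];
  [:: v1; v2; v31; v32; v21; v12];
  [:: v2; v3; v12; v13; v32; v23];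
  [:: v3; v1; v23; v21; v13; v31];
  [:: v1; v31; v32; v12; v23; v21];
  [:: v1; v21; v23; v13; v32; v31];
  [:: v2; v12; v13; v23; v31; v32];
  [:: v2; v31; v32; v12; v13; v21];
  [:: v3; v23; v21; v31; v12; v13];
  [:: v3; v12; v13; v23; v21; v32];
  [:: v31; v32; v12; v13; v23; v21] ].

Definition knot_vec (i j : nat) : Z3 := nth (0,0,0)%Zb (nth [::] knot_vecs i) j.

Definition det3z (a b c : Z3) : Z := dotz a (crossz b c).

Section Knots.
Context {R : realType}.
Variable v : 'I_3 -> @pt R.

Definition zpt (z : Z3) : @pt R := comb v (3^-1 *: zr3 z).

Lemma knot_listE : knot_list v = map (map zpt) knot_vecs.
Proof.
have [z0 z1 z2 z3] : [/\ @zr R 0 = 0, @zr R 1 = 1, @zr R 2 = 2 & @zr R 3 = 3] by [].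
have t := (@surjective_pairing R R).
have [e1 e2 e3] : [/\ v 0 = zpt (3,0,0)%Zb, v 1 = zpt (0,3,0)%Zb & v 2 = zpt (0,0,3)%Zb].
  by split; rewrite /zpt /comb /zr3 /= z0 z3; rewrite [LHS]t [RHS]t; congr (_, _); rewrite /= /GRing.scale /=; field.
have [e12 e13 e21] : [/\ v12 v = zpt (0,2,1)%Zb, v13 v = zpt (0,1,2)%Zb & v21 v = zpt (2,0,1)%Zb].
  by split; rewrite /v12 /v13 /v21 /zpt /comb /zr3 /= z0 z1 z2; rewrite [LHS]t [RHS]t; congr (_, _); rewrite /= /GRing.scale /=; field.
have [e23 e31 e32] : [/\ v23 v = zpt (1,0,2)%Zb, v31 v = zpt (2,1,0)%Zb & v32 v = zpt (1,2,0)%Zb].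
  by split; rewrite /v23 /v31 /v32 /zpt /comb /zr3 /= z0 z1 z2; rewrite [LHS]t [RHS]t; congr (_, _); rewrite /= /GRing.scale /=; field.
by rewrite /knot_list /knot_vecs /= e12 e13 e21 e23 e31 e32 e1 e2 e3.
Qed.

Lemma knots_sizes : all (fun s => size s == 6%N) knot_vecs. Proof. by []. Qed.

Lemma knotsE (i : nat) (j : 'I_6) : (i < 28)%N -> knots v i j = zpt (knot_vec i j).
Proof.
move=> i28; rewrite /knots knot_listE (nth_map [::]) ?size_map// (nth_map (0,0,0)%Zb)//.
by rewrite (eqP (allP knots_sizes _ _)) ?ltn_ord// mem_nth.
Qed.

Lemma knots_sum : all (all (fun z => sumz z =? 3)%Zb) knot_vecs. Proof. by vm_compute. Qed.

Lemma knot_vec_sum (i : nat) (j : 'I_6) : (i < 28)%N -> sumz (knot_vec i j) = 3%Zb.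
Proof.
move=> i28; apply/Z.eqb_spec; have iS : (i < size knot_vecs)%N by [].
have h := allP knots_sizes _ (mem_nth [::] iS).
by apply: (allP (allP knots_sum _ (mem_nth [::] iS))); apply: mem_nth; rewrite (eqP h).
Qed.

Hypothesis nd : Defs.nondegenerate v.

Lemma bary_zpt z : sumz z = 3%Zb -> bary v (zpt z) = 3^-1 *: zr3 z.
Proof.
move=> h; rewrite /zpt combK// /sum3 /= /GRing.scale /= -!mulrDr.
by have := @sum_zr R z; rewrite /sum3 h /= => ->; rewrite mulVf.
Qed.

Lemma det2_zpt a b c : sumz a = 3%Zb -> sumz b = 3%Zb -> sumz c = 3%Zb ->
  det2 (zpt b - zpt a) (zpt c - zpt a) = det2 (v 1 - v 0) (v 2 - v 0) * zr (det3z a b c) / 27.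
Proof.
move=> sa sb sc; have := @sum_zr R a; have := @sum_zr R b; have := @sum_zr R c; rewrite sa sb sc /sum3 /=.
have -> : @zr R 3 = 3 by [].
rewrite /det3z /dotz /crossz /= !zrD !zrM !zrB !zrM.
rewrite /zpt /comb /= /det2 /= /GRing.scale /=.
case: (v 0) => a1 a2; case: (v 1) => b1 b2; case: (v 2) => c1 c2 /=.
move: (zr a.1.1) (zr a.1.2) (zr a.2) (zr b.1.1) (zr b.1.2) (zr b.2) (zr c.1.1) (zr c.1.2) (zr c.2) => p q r s t u x y z.
move=> h1 h2 h3; have -> : x = 3 - y - z by lra.
have -> : s = 3 - t - u by lra.
have -> : p = 3 - q - r by lra.
by field.
Qed.

(** Weights on the knots with barycentre [b]. The factor 3 comes from knot vectors having coordinate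
    sum 3. *)
Definition balanced (n : 'I_6 -> Z3) (l : 'I_6 -> R) (b : @R3' R) :=
  [/\ forall i, 0 <= l i, \sum_i l i = 1, \sum_i l i * zr (n i).1.1 = 3 * b.1.1,
      \sum_i l i * zr (n i).1.2 = 3 * b.1.2 & \sum_i l i * zr (n i).2 = 3 * b.2].

Lemma balanced_dot n l b h : balanced n l b -> \sum_i l i * zr (dotz h (n i)) = 3 * dot3 (zr3 h) b.
Proof.
move=> [_ _ e1 e2 e3]; rewrite /dot3 /= mulrDr mulrDr !(mulrCA 3) -e1 -e2 -e3 !mulr_sumr -!big_split /=.
by apply: eq_bigr => i _; rewrite /dotz !zrD !zrM; ring.
Qed.

Lemma weights_point (P : 'I_6 -> @pt R) x q : det2 (P 1 - P 0) (P 2 - P 0) != 0 -> \sum_i weights P x q i *: P i = x.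
Proof.
move=> D0; have := bar_dec D0 (x - P 0 - knot_shift P q); rewrite sum_ord6 /weights /tnth /=; set u := x - _ - _.
move: (bar1 P u) (bar2 P u) => a b uE.
have -> : x = P 0 + knot_shift P q + (a *: (P 1 - P 0) + b *: (P 2 - P 0)) by rewrite -uE /u -[x - P 0 - _]addrA -opprD [RHS]addrC subrK.
rewrite /knot_shift; case: (P 0) (P 1) (P 2) (P 3) (P 4) (P 5) => ? ? [? ?] [? ?] [? ?] [? ?] [? ?].
by congr (_, _); rewrite /= /GRing.scale /=; ring.
Qed.

Lemma QsetP (P : 'I_6 -> @pt R) (n : 'I_6 -> Z3) x q : (forall i, P i = zpt (n i)) -> (forall i, sumz (n i) = 3%Zb) ->
  det2 (P 1 - P 0) (P 2 - P 0) != 0 ->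
  Qset P x q <-> exists2 l, balanced n l (bary v x) & q = (l 3, l 4, l 5).
Proof.
move=> PE ns D0; have affP (f : R * @pt R) l : \sum_i l i = 1 -> aff f (\sum_i l i *: P i) = \sum_i l i * aff f (P i).
  rewrite !sum_ord6 => h; rewrite /aff /= /GRing.scale /=.
  by rewrite -[f.1 in LHS]mulr1 -h; ring.
have bP i : bary v (P i) = 3^-1 *: zr3 (n i) by rewrite PE bary_zpt.
have bE l : \sum_i l i = 1 -> let b := bary v (\sum_i l i *: P i) in
   [/\ \sum_i l i * zr (n i).1.1 = 3 * b.1.1,
      \sum_i l i * zr (n i).1.2 = 3 * b.1.2 & \sum_i l i * zr (n i).2 = 3 * b.2].
  move=> h; rewrite /bary /= !affP// !mulr_sumr; split; apply: eq_bigr => i _;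
   have := bP i; rewrite /bary /= => -[e1 e2 e3]; rewrite ?e1 ?e2 ?e3 /GRing.scale /= mulrCA; congr (_ * _); by rewrite mulrA divff// mul1r.
split=> [H|[l [l0 l1 e1 e2 e3]] ->].
  exists (weights P x q); last by rewrite /weights /tnth /=; case: q {H} => [[? ?] ?].
  have := bE _ (sum_weights P x q); rewrite weights_point//= => -[b1 b2 b3].
  by split => //; exact: sum_weights.
suff xE : x = \sum_i l i *: P i by move=> i; rewrite -(weightsP D0 l1 xE).
have := bE l l1; rewrite e1 e2 e3 /= => -[b1 b2 b3]; have n3 : 3 != 0 :> R by [].
rewrite -(baryK nd x) -(baryK nd (\sum_i _)); congr (comb _ _).
by rewrite /bary; congr (_, _, _); apply: (mulfI n3).
Qed.

End Knots.

Section Rates.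
Context {R : realType}.
Local Notation T1 := (measurableTypeR R).
Local Notation T2 := (T1 * T1)%type.
Local Notation T3 := (T2 * T1)%type.

Lemma fine_leb3_le (S : set T3) (r : R) : (leb3m S <= r%:E)%E -> fine (leb3m S) <= r.
Proof.
move=> h; rewrite -lee_fin fineK// ge0_fin_numE//; exact: le_lt_trans h (ltry _).
Qed.

Lemma fine_leb3_ge (S : set T3) (r : R) : (leb3m S < +oo)%E -> (r%:E <= leb3m S)%E -> r <= fine (leb3m S).
Proof. by move=> f h; rewrite -lee_fin fineK// ge0_fin_numE. Qed.

Variable v : 'I_3 -> @pt R.
Hypothesis nd : Defs.nondegenerate v.

(** A witness [w] is an ordering of the six knots; the first three span the plane and the weights of the
    last three parametrize the slice. *)
Definition kv (i : nat) (w : seq nat) (j : nat) : Z3 := knot_vec i (nth 0%N w j).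
Definition witness (i : nat) (w : seq nat) : bool :=
  [&& (i < 28)%N, perm_eq w (iota 0 6) & ~~ (det3z (kv i w 0) (kv i w 1) (kv i w 2) =? 0)%Zb].
Definition witness_pts i w (j : 'I_6) : @pt R := zpt v (kv i w j).

Lemma witness_lt6 i w (j : 'I_6) : witness i w -> (nth 0%N w j < 6)%N.
Proof.
move=> /and3P[_ pw _]; have : nth 0%N w j \in w by apply: mem_nth; rewrite (perm_size pw) size_iota.
by rewrite (perm_mem pw) mem_iota.
Qed.

Lemma witness_sum i w (j : 'I_6) : witness i w -> sumz (kv i w j) = 3%Zb.
Proof.
move=> W; have /and3P[i28 _ _] := W; rewrite /kv.
by have := knot_vec_sum (Ordinal (witness_lt6 j W)) i28.
Qed.

Lemma witness_det i w : witness i w ->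
  det2 (witness_pts i w 1 - witness_pts i w 0) (witness_pts i w 2 - witness_pts i w 0) != 0.
Proof.
move=> W; have /and3P[_ _ d0] := W; rewrite /witness_pts det2_zpt//.
- by rewrite !mulf_neq0 ?invr_eq0// zr_eq0.
- exact: (witness_sum (0 : 'I_6) W).
- exact: (witness_sum (1 : 'I_6) W).
- exact: (witness_sum (2 : 'I_6) W).
Qed.

Lemma witness_spline i w x : witness i w ->
  simplex_spline (knots v i) x = kap (witness_pts i w) * fine (leb3m (Qset (witness_pts i w) x)).
Proof.
move=> W; have /and3P[i28 pw _] := W.
have sj : injective (fun j : 'I_6 => inord (nth 0%N w j) : 'I_6).
  move=> j k /(congr1 val); rewrite /= !inordK ?(witness_lt6 _ W)// => /eqP.
  rewrite nth_uniq ?(perm_size pw) ?size_iota// ?(perm_uniq pw) ?iota_uniq// => /eqP; exact: val_inj.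
apply: (@simplex_splineE _ _ (perm sj)); last exact: witness_det.
by move=> j; rewrite permE knotsE// /witness_pts /kv inordK// (witness_lt6 _ W).
Qed.

Lemma witness_Qset i w x q : witness i w ->
  Qset (witness_pts i w) x q <-> exists2 l, balanced (fun j : 'I_6 => kv i w j) l (bary v x) & q = (l 3, l 4, l 5).
Proof. by move=> W; apply: (QsetP nd); [|move=> j; exact: witness_sum|exact: witness_det]. Qed.

Lemma spline_ge0 i w x : witness i w -> 0 <= simplex_spline (knots v i) x.
Proof.
move=> W; rewrite (witness_spline _ W) mulr_ge0//; first by apply/ltW/kap_gt0/witness_det.
by rewrite fine_ge0.
Qed.

Definition hval (h : Z3) (x : @pt R) : R := dot3 (zr3 h) (bary v x).

(** A form that is nonnegative at all six knots and positive at the [k]-th free one has weighted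
    mean [3 * hval (h k) x], so it bounds that free weight by a multiple of its value at [x]. Three
    such forms enclose the admissible set in a box. *)
Definition upper_ok i w (h : nat -> Z3) : bool := witness i w &&
  all (fun k => all (fun j => 0 <=? dotz (h k) (kv i w j))%Zb (iota 0 6) && (0 <? dotz (h k) (kv i w (3 + k)))%Zb) (iota 0 3).

Lemma spline_upper i w h : upper_ok i w h -> exists2 K : R, 0 <= K & forall x,
  0 <= hval (h 0) x -> 0 <= hval (h 1%N) x -> 0 <= hval (h 2%N) x ->
  simplex_spline (knots v i) x <= K * (hval (h 0) x * hval (h 1%N) x * hval (h 2%N) x).
Proof.
move=> /andP[W /allP H].
pose d k : R := zr (dotz (h k) (kv i w (3 + k))).
have d0 k : (k < 3)%N -> 0 < d k.
  move=> k3; have /H/andP[_ dk] : k \in iota 0 3 by rewrite mem_iota.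
  by rewrite /d zr_gt0.
have dj k j : (k < 3)%N -> (j < 6)%N -> 0 <= @zr R (dotz (h k) (kv i w j)).
  move=> k3 j6; have /H/andP[/allP h1 _] : k \in iota 0 3 by rewrite mem_iota.
  by rewrite zr_le0; apply: h1; rewrite mem_iota.
have k0 := kap_gt0 (witness_det W).
exists (kap (witness_pts i w) * (3 / d 0 * (3 / d 1%N) * (3 / d 2%N))).
  by rewrite mulr_ge0// ?(ltW k0)// !mulr_ge0// invr_ge0 ltW// d0.
move=> x h0 h1 h2; rewrite (witness_spline _ W) -mulrA ler_wpM2l ?(ltW k0)//.
have -> : 3 / d 0 * (3 / d 1%N) * (3 / d 2%N) * (hval (h 0) x * hval (h 1%N) x * hval (h 2%N) x) =
   (3 * hval (h 0) x / d 0 - 0) * (3 * hval (h 1%N) x / d 1%N - 0) * (3 * hval (h 2%N) x / d 2%N - 0) by rewrite !subr0; ring.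
apply: fine_leb3_le; rewrite -leb3_itv; try by rewrite divr_ge0 ?mulr_ge0// ltW// d0.
apply: le_leb3 => q /(witness_Qset _ _ W)[l bl ->].
have [l0 _ _ _ _] := bl.
have key k (k3 : (k < 3)%N) (j : 'I_6) : nat_of_ord j = (3 + k)%N -> l j * d k <= 3 * hval (h k) x.
  move=> jE; rewrite -(balanced_dot (h k) bl) (bigD1 j)//= jE lerDl; apply: sumr_ge0 => j' _.
  by rewrite mulr_ge0// dj.
by split; [split|]; rewrite /= in_itv /= l0 /= ler_pdivlMr ?d0//; apply: key.
Qed.

(** A box contained in the admissible set bounds its volume from below. Two moment equations are
    asked for besides the total mass, because the first barycentric coordinate follows from
    these. *)
Lemma spline_lower i w : witness i w -> exists2 k : R, 0 < k & forall x (a b : R * R * R),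
  a.1.1 <= b.1.1 -> a.1.2 <= b.1.2 -> a.2 <= b.2 -> 0 <= a.1.1 -> 0 <= a.1.2 -> 0 <= a.2 ->
  (forall q0 q1 q2 : R, a.1.1 <= q0 <= b.1.1 -> a.1.2 <= q1 <= b.1.2 -> a.2 <= q2 <= b.2 ->
    exists l0 l1 l2 : R, [/\ 0 <= l0, 0 <= l1 & 0 <= l2] /\
    [/\ l0 + l1 + l2 + q0 + q1 + q2 = 1,
        l0 * zr (kv i w 0).1.2 + l1 * zr (kv i w 1).1.2 + l2 * zr (kv i w 2).1.2 + q0 * zr (kv i w 3).1.2
          + q1 * zr (kv i w 4).1.2 + q2 * zr (kv i w 5).1.2 = 3 * (bary v x).1.2 &
        l0 * zr (kv i w 0).2 + l1 * zr (kv i w 1).2 + l2 * zr (kv i w 2).2 + q0 * zr (kv i w 3).2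
          + q1 * zr (kv i w 4).2 + q2 * zr (kv i w 5).2 = 3 * (bary v x).2]) ->
  k * ((b.1.1 - a.1.1) * (b.1.2 - a.1.2) * (b.2 - a.2)) <= simplex_spline (knots v i) x.
Proof.
move=> W; have k0 := kap_gt0 (witness_det W).
exists (kap (witness_pts i w)) => // x a b h0 h1 h2 a0 a1 a2 H.
rewrite (witness_spline _ W) ler_wpM2l ?(ltW k0)//.
apply: fine_leb3_ge.
  apply: (le_lt_trans (le_leb3 (@Qset_sub1 _ _ x))).
  by rewrite leb3_itv// ltry.
rewrite -leb3_itv//; apply: le_leb3 => -[[q0 q1] q2] [[/= hq0 hq1] hq2].
rewrite !in_itv /= in hq0 hq1 hq2; have [l0 [l1 [l2 [[p0 p1 p2] [s1 e2 e3]]]]] := H q0 q1 q2 hq0 hq1 hq2.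
apply/(witness_Qset _ _ W); exists (fun j => nth 0 [:: l0; l1; l2; q0; q1; q2] j) => //.
have n3 (j : 'I_6) : @zr R (kv i w j).1.1 = 3 - zr (kv i w j).1.2 - zr (kv i w j).2.
  have : @zr R (sumz (kv i w j)) = 3 by rewrite witness_sum.
  by rewrite /sumz !zrD => <-; ring.
have b3 : (bary v x).1.1 = 1 - (bary v x).1.2 - (bary v x).2 by have := sum_bary v x; rewrite /sum3 /=; lra.
split.
- case=> [] [|[|[|[|[|[|//]]]]]] _ //=.
  + by apply: le_trans a0 _; case/andP: hq0.
  + by apply: le_trans a1 _; case/andP: hq1.
  + by apply: le_trans a2 _; case/andP: hq2.
- by rewrite sum_ord6 /= -s1; ring.
- under eq_bigr do rewrite n3.
  rewrite b3; move: e2 e3; move: (bary v x).1.2 (bary v x).2 => Y Z e2 e3.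
  by rewrite sum_ord6 /= (_ : 3 * (1 - Y - Z) = 3 * 1 - 3 * Y - 3 * Z); [rewrite -e2 -e3 -s1; ring|ring].
- by rewrite sum_ord6 /= -e2; ring.
- by rewrite sum_ord6 /= -e3; ring.
Qed.

End Rates.

(** One order serves all 28 multisets: repeated knots are listed first, and the last three listed
    are never collinear. *)
Definition span_witness : seq (seq nat) :=
  [:: [:: 3; 4; 5; 0; 1; 2]; [:: 3; 4; 5; 0; 1; 2]; [:: 3; 4; 5; 0; 1; 2]; [:: 3; 4; 5; 0; 1; 2]; [:: 3; 4; 5; 0; 1; 2]; [:: 3; 4; 5; 0; 1; 2]; [:: 3; 4; 5; 0; 1; 2]; [:: 3; 4; 5; 0; 1; 2]; [:: 3; 4; 5; 0; 1; 2]; [:: 3; 4; 5; 0; 1; 2]; [:: 3; 4; 5; 0; 1; 2]; [:: 3; 4; 5; 0; 1; 2]; [:: 3; 4; 5; 0; 1; 2]; [:: 3; 4; 5; 0; 1; 2]; [:: 3; 4; 5; 0; 1; 2]; [:: 3; 4; 5; 0; 1; 2]; [:: 3; 4; 5; 0; 1; 2]; [:: 3; 4; 5; 0; 1; 2]; [:: 3; 4; 5; 0; 1; 2]; [:: 3; 4; 5; 0; 1; 2]; [:: 3; 4; 5; 0; 1; 2]; [:: 3; 4; 5; 0; 1; 2]; [:: 3; 4; 5; 0; 1; 2]; [:: 3; 4; 5; 0; 1; 2]; [:: 3; 4; 5; 0; 1; 2]; [:: 3; 4; 5; 0; 1; 2]; [:: 3; 4; 5; 0; 1; 2]; [:: 3;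 4; 5; 0; 1; 2]].
(** Outside the group of the first vertex, [v1] occurs at most once among the knots. It is kept
    among the base knots, so [b_2 + b_3] is positive at the three free ones and the spline decays
    cubically at [v1]. Indices of the group carry an empty entry. *)
Definition off_vertex_witness : seq (seq nat) :=
  [:: [::]; [:: 3; 4; 5; 0; 1; 2]; [:: 3; 4; 5; 0; 1; 2]; [::]; [::]; [:: 3; 4; 5; 0; 1; 2]; [:: 3; 4; 5; 0; 1; 2]; [:: 3; 4; 5; 0; 1; 2]; [:: 3; 4; 5; 0; 1; 2]; [::]; [::]; [:: 3; 4; 5; 0; 1; 2]; [:: 3; 4; 5; 0; 1; 2]; [:: 3; 4; 5; 0; 1; 2]; [:: 3; 4; 5; 0; 1; 2]; [::]; [:: 3; 4; 5; 0; 1; 2]; [:: 3; 4; 5; 0; 1; 2]; [:: 0; 4; 5; 1; 2; 3]; [:: 3; 4; 5; 0; 1; 2]; [:: 1; 4; 5; 0; 2; 3]; [:: 0; 3; 5; 1; 2; 4]; [:: 0; 3; 5; 1; 2; 4]; [:: 3; 4; 5; 0; 1; 2]; [:: 3; 4; 5; 0; 1; 2]; [:: 3; 4; 5; 0; 1; 2]; [:: 3; 4; 5; 0; 1; 2]; [:: 3; 4; 5; 0; 1; 2]].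
Definition vertex_group : seq nat := [:: 0; 3; 4; 9; 10; 15]%N.

Lemma span_witnessP : all (fun i => witness i (nth [::] span_witness i)) (iota 0 28).
Proof. by vm_compute. Qed.
Lemma off_vertex_witnessP : all (fun i => (i \in vertex_group) ||
  upper_ok i (nth [::] off_vertex_witness i) (fun=> (0,1,1)%Zb)) (iota 0 28).
Proof. by vm_compute. Qed.

(* Orders of vanishing at v_1 in the barycentric coordinates of v_2 and v_3. *)
Definition vertex_order (i : nat) : nat * nat :=
  match i with 3 => (1, 0) | 4 => (0, 1) | 9 => (2, 0) | 10 => (0, 2) | 15 => (1, 1) | _ => (0, 0) end%N.
(** In all six cases the base knots are [v1], [v31], [v21]. A free knot at [v1] contributes a
    bounded weight, one further along an edge contributes a factor [Y] or [Z]; the leading orders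
    become 1, Y, Z, Y^2, Z^2 and YZ, one for each entry of a 2-jet. *)
Definition vertex_witness (i : nat) : seq nat :=
  match i with 0 => [:: 0; 4; 5; 1; 2; 3] | 3 => [:: 0; 3; 5; 1; 2; 4] | 4 => [:: 0; 5; 3; 1; 2; 4]
  | 9 => [:: 0; 2; 5; 1; 3; 4] | 10 => [:: 0; 5; 2; 1; 3; 4] | _ => [:: 0; 2; 4; 1; 3; 5] end%N.
Definition vertex_form (i k : nat) : Z3 :=
  let o := (1,1,1)%Zb in let y := (0,1,0)%Zb in let z := (0,0,1)%Zb in
  nth o (match i with 3 => [:: o; o; y] | 4 => [:: o; o; z] | 9 => [:: o; y; y] | 10 => [:: o; z; z]
  | 15 => [:: o; y; z] | _ => [::] end) k.
Lemma vertex_witnessP : all (fun i => upper_ok i (vertex_witness i) (vertex_form i)) vertex_group.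
Proof. by vm_compute. Qed.

(** * Combinations of the basis functions near a vertex *)

Section Combinations.
Context {R : realType}.
Variable v : 'I_3 -> @pt R.
Hypothesis nd : Defs.nondegenerate v.
Implicit Types (x : @pt R) (c : nat -> R).

Lemma area_gt0 : 0 < tri_area v.
Proof. by rewrite /tri_area divr_gt0// normr_gt0. Qed.

Lemma cweight_gt0 i : 0 < @cweight R i.
Proof. by rewrite /cweight; repeat (case: ifP => _; first lra); lra. Qed.

Lemma scale_gt0 i : 0 < tri_area v / 15 * cweight i.
Proof. by rewrite mulr_gt0 ?cweight_gt0// divr_gt0// area_gt0. Qed.

Lemma Bws_ge0 i x : (i < 28)%N -> 0 <= Bws v i x.
Proof.
move=> i28; rewrite /Bws mulr_ge0 ?(ltW (scale_gt0 i))//.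
by apply: (spline_ge0 nd); apply: (allP span_witnessP); rewrite mem_iota.
Qed.

Lemma Bws_upper i w h : upper_ok i w h -> exists2 K : R, 0 <= K & forall x,
  0 <= hval v (h 0%N) x -> 0 <= hval v (h 1%N) x -> 0 <= hval v (h 2%N) x ->
  Bws v i x <= K * (hval v (h 0%N) x * hval v (h 1%N) x * hval v (h 2%N) x).
Proof.
move=> /(spline_upper nd)[K K0 H]; have s0 := scale_gt0 i.
exists (tri_area v / 15 * cweight i * K) => [|x h0 h1 h2]; first by rewrite mulr_ge0// ltW.
by rewrite /Bws -[leRHS]mulrA ler_wpM2l ?(ltW s0)// H.
Qed.

(** The coefficients, with respect to the nonnegative functions [Bws], of a combination given in the
    mixed basis. They differ from [c] only from index 21 on. *)
Definition unmix c (j : nat) : R :=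
  match j with
  | 21 => 2 * c 21%N - c 22%N | 22 => 2 * c 22%N - c 21%N
  | 23 => 2 * c 23%N - c 24%N | 24 => 2 * c 24%N - c 23%N
  | 25 => 2 * c 25%N - c 26%N | 26 => 2 * c 26%N - c 25%N
  | 27 => (c 21%N + c 22%N + c 23%N + c 24%N + c 25%N + c 26%N) / 3 - c 27%N
  | k => c k
  end.

Definition combination c x : R := \sum_(i < 28) c i * Btilde v i x.

Lemma combinationE c x : combination c x = \sum_(j < 28) unmix c j * Bws v j x.
Proof.
rewrite /combination !(@big_split_ord _ _ _ 21 7) /=; congr (_ + _).
  apply: eq_bigr => -[i i21] _; rewrite /Btilde /=.
  by do 21 (case: i i21 => [|i] i21 //).
rewrite !big_ord_recl !big_ord0 /Btilde /= /bump /=.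
move: (Bws v 21 x) (Bws v 22 x) (Bws v 23 x) (Bws v 24 x) (Bws v 25 x) (Bws v 26 x) (Bws v 27 x) => B1 B2 B3 B4 B5 B6 B7.
by field.
Qed.

Lemma combination_upper c (X : @pt R -> Prop) (g : @pt R -> R) :
  (forall j, (j < 28)%N -> unmix c j != 0 -> exists2 K : R, 0 <= K & forall x, X x -> Bws v j x <= K * g x) ->
  exists2 K : R, 0 <= K & forall x, X x -> `|combination c x| <= K * g x.
Proof.
move=> H; have H' (j : 'I_28) : exists K : R, 0 <= K /\ forall x, X x -> `|unmix c j| * Bws v j x <= `|unmix c j| * (K * g x).
  have [->|d0] := eqVneq (unmix c j) 0; first by exists 0; split => // x _; rewrite normr0 !mul0r.
  by have [K K0 HK] := H j (ltn_ord j) d0; exists K; split => // x Xx; rewrite ler_wpM2l// HK.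
have [K HK] := choice H'.
exists (\sum_(j < 28) `|unmix c j| * K j) => [|x Xx].
  by apply: sumr_ge0 => j _; rewrite mulr_ge0//; have [] := HK j.
rewrite combinationE; apply: (le_trans (ler_norm_sum _ _ _)); rewrite mulr_suml; apply: ler_sum => j _.
by rewrite normrM (ger0_norm (Bws_ge0 _ (ltn_ord j))) -[leRHS]mulrA; have [_] := HK j; apply.
Qed.

Lemma small_zero (c k K e : R) n : 0 < k -> 0 < e ->
  (forall h : R, 0 < h < e -> `|c| * (k * h ^+ n) <= K * h ^+ n.+1) -> c = 0.
Proof.
move=> k0 e0 H; apply/eqP; rewrite -normr_eq0 eq_le normr_ge0 andbT leNgt; apply/negP => c0.
pose K' : R := `|K| + 1; have K0 : 0 < K' by rewrite ltr_pwDr.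
pose h : R := Num.min e (`|c| * k / K') / 2.
have m0 : 0 < Num.min e (`|c| * k / K') by rewrite lt_min e0 divr_gt0// mulr_gt0.
have h0 : 0 < h by rewrite divr_gt0.
have hm : h < Num.min e (`|c| * k / K') by rewrite /h; lra.
have /andP[he hk] : (h < e) && (h < `|c| * k / K') by move: hm; rewrite lt_min.
clearbody h; have := H h; rewrite h0 he => /(_ isT); rewrite exprS !mulrA ler_pM2r ?exprn_gt0//.
move: hk; rewrite ltr_pdivlMr// => hk; apply/negP; rewrite -ltNge.
apply: le_lt_trans hk; rewrite [leLHS]mulrC ler_wpM2l ?(ltW h0)// /K'.
by apply: (le_trans (ler_norm K)); rewrite lerDl.
Qed.

(** Along the curve, term [m] is the combination minus the other terms. It would be of exact order
    [n] while everything else is smaller, so its coefficient vanishes. The range 1/100 is a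
    convenient common range for the explicit boxes. *)
Lemma dominant_coef (m n : nat) (curve : R -> @pt R) c : (m < 28)%N ->
  (forall j, (j < 28)%N -> j != m -> unmix c j != 0 ->
    exists2 K : R, 0 <= K & forall h : R, 0 < h < 1 / 100 -> Bws v j (curve h) <= K * h ^+ n.+1) ->
  (exists2 k : R, 0 < k & forall h : R, 0 < h < 1 / 100 -> k * h ^+ n <= Bws v m (curve h)) ->
  (exists2 e : R, 0 < e & exists K : R, forall h : R, 0 < h < e -> `|combination c (curve h)| <= K * h ^+ n.+1) ->
  unmix c m = 0.
Proof.
move=> m28 H [k k0 Hk] [e e0 [K HK]].
have H' (j : 'I_28) : exists K : R, (j != m :> nat) -> forall h : R, 0 < h < 1 / 100 ->
    `|unmix c j * Bws v j (curve h)| <= K * h ^+ n.+1.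
  have [jm|jm] := eqVneq (nat_of_ord j) m; first by exists 0.
  have [->|d0] := eqVneq (unmix c j) 0.
    by exists 0 => _ h /andP[h0 _]; rewrite !mul0r normr0.
  have [C C0 HC] := H j (ltn_ord j) jm d0; exists (`|unmix c j| * C) => _ h hh.
  by rewrite normrM (ger0_norm (Bws_ge0 _ (ltn_ord j))) -[leRHS]mulrA ler_wpM2l// HC.
have [C HC] := choice H'.
apply: (@small_zero _ k (K + \sum_(j < 28 | j != Ordinal m28) C j) (Num.min e (1 / 100)) n k0).
  by rewrite lt_min e0; lra.
move=> h; rewrite lt_min => /andP[h0 /andP[he h1]].
have h01 : 0 < h < 1 / 100 by rewrite h0.
apply: (@le_trans _ _ `|unmix c m * Bws v m (curve h)|).
  by rewrite normrM (ger0_norm (Bws_ge0 _ m28)) ler_wpM2l// Hk.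
have := combinationE c (curve h); rewrite (bigD1 (Ordinal m28))//= => E.
have -> : unmix c m * Bws v m (curve h) = combination c (curve h) -
   \sum_(i < 28 | i != Ordinal m28) unmix c i * Bws v i (curve h) by rewrite E addrK.
apply: (le_trans (ler_normB _ _)); rewrite mulrDl lerD ?HK ?h0 ?he//.
apply: (le_trans (ler_norm_sum _ _ _)); rewrite mulr_suml; apply: ler_sum => j jm.
by apply: (HC j).
Qed.

Lemma hval_one x : hval v (1,1,1)%Zb x = 1.
Proof.
by rewrite -(sum_bary v x) /hval /dot3 /sum3 /=; have -> : @zr R 1 = 1 by []; rewrite !mul1r.
Qed.
Lemma hval_y x : hval v (0,1,0)%Zb x = (bary v x).1.2.
Proof. by rewrite /hval /dot3; case: (bary v x) => [[? ?] ?] /=; have [-> ->] : @zr R 0 = 0 /\ @zr R 1 = 1 by []; rewrite !mul0r mul1r add0r addr0. Qed.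
Lemma hval_z x : hval v (0,0,1)%Zb x = (bary v x).2.
Proof. by rewrite /hval /dot3; case: (bary v x) => [[? ?] ?] /=; have [-> ->] : @zr R 0 = 0 /\ @zr R 1 = 1 by []; rewrite !mul0r mul1r !add0r. Qed.
Lemma hval_yz x : hval v (0,1,1)%Zb x = (bary v x).1.2 + (bary v x).2.
Proof. by rewrite /hval /dot3; case: (bary v x) => [[? ?] ?] /=; have [-> ->] : @zr R 0 = 0 /\ @zr R 1 = 1 by []; rewrite !mul0r !mul1r !add0r. Qed.

Lemma off_vertex_upper i : (i < 28)%N -> i \notin vertex_group -> exists2 K : R, 0 <= K & forall x, tri_set v x ->
  Bws v i x <= K * ((bary v x).1.2 + (bary v x).2) ^+ 3.
Proof.
move=> i28 iG; have := allP off_vertex_witnessP i; rewrite mem_iota (negPf iG) => /(_ i28) /Bws_upper[K K0 H].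
exists K => // x /(tri_setP nd)[_ y0 z0]; rewrite exprSr expr2 -hval_yz; apply: H; rewrite hval_yz; exact: addr_ge0.
Qed.

Lemma vertex_upper i : i \in vertex_group -> exists2 K : R, 0 <= K & forall x, tri_set v x ->
  Bws v i x <= K * ((bary v x).1.2 ^+ (vertex_order i).1 * (bary v x).2 ^+ (vertex_order i).2).
Proof.
move=> iG; have [K K0 H] := Bws_upper (allP vertex_witnessP i iG); exists K => // x /(tri_setP nd)[_ y0 z0].
have := H x; move: iG; rewrite !inE.
by move=> /or4P[/eqP ->|/eqP ->|/eqP ->|/or3P[/eqP ->|/eqP ->|/eqP ->]] /=;
  rewrite ?hval_one ?hval_y ?hval_z ?mulr1 ?mul1r ?expr0 ?expr1 ?mulr1 ?mul1r ?expr2; apply.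
Qed.

Definition box_fits i w (Y Z : R) (a b : R * R * R) : Prop :=
  [/\ a.1.1 <= b.1.1, a.1.2 <= b.1.2 & a.2 <= b.2] /\ [/\ 0 <= a.1.1, 0 <= a.1.2 & 0 <= a.2] /\
  forall q0 q1 q2 : R, a.1.1 <= q0 <= b.1.1 -> a.1.2 <= q1 <= b.1.2 -> a.2 <= q2 <= b.2 ->
    exists l0 l1 l2 : R, [/\ 0 <= l0, 0 <= l1 & 0 <= l2] /\
    [/\ l0 + l1 + l2 + q0 + q1 + q2 = 1,
        l0 * zr (kv i w 0).1.2 + l1 * zr (kv i w 1).1.2 + l2 * zr (kv i w 2).1.2 + q0 * zr (kv i w 3).1.2
          + q1 * zr (kv i w 4).1.2 + q2 * zr (kv i w 5).1.2 = 3 * Y &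
        l0 * zr (kv i w 0).2 + l1 * zr (kv i w 1).2 + l2 * zr (kv i w 2).2 + q0 * zr (kv i w 3).2
          + q1 * zr (kv i w 4).2 + q2 * zr (kv i w 5).2 = 3 * Z].

Lemma Bws_lower i w : witness i w -> exists2 k : R, 0 < k & forall x a b,
  box_fits i w (bary v x).1.2 (bary v x).2 a b ->
  k * ((b.1.1 - a.1.1) * (b.1.2 - a.1.2) * (b.2 - a.2)) <= Bws v i x.
Proof.
move=> /(spline_lower nd)[k k0 H]; have s0 := scale_gt0 i.
exists (tri_area v / 15 * cweight i * k) => [|x a b [[h0 h1 h2] [[a0 a1 a2] h3]]]; first by rewrite mulr_gt0.
by rewrite /Bws -[leLHS]mulrA ler_wpM2l ?(ltW s0)// H.
Qed.

Lemma zr_small : [/\ @zr R 0 = 0, @zr R 1 = 1, @zr R 2 = 2 & @zr R 3 = 3]. Proof. by []. Qed.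

(** Caps for the free weights, small enough that the base weights solved from the moment equations
    remain nonnegative when [Y] and [Z] are at most 1/100. *)
Definition vertex_box (i : nat) (Y Z : R) : R * R * R :=
  match i with 0 => (1/8, 1/8, 1/8) | 3 => (1/8, 1/8, Y/2) | 4 => (1/8, 1/8, Z/2)
  | 9 => (1/8, Y/2, Y/2) | 10 => (1/8, Z/2, Z/2) | _ => (1/8, Y/2, Z/2) end.

Lemma vertex_box_fits i (Y Z : R) : i \in vertex_group -> 0 < Y <= 1 / 100 -> 0 < Z <= 1 / 100 ->
  box_fits i (vertex_witness i) Y Z (0, 0, 0) (vertex_box i Y Z).
Proof.
have [z0 z1 z2 z3] := zr_small => iG /andP[Y0 Y1] /andP[Z0 Z1]; rewrite /box_fits.
split; first by move: iG; rewrite !inE => /or4P[/eqP ->|/eqP ->|/eqP ->|/or3P[/eqP ->|/eqP ->|/eqP ->]] /=; split; lra.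
split; first by [].
move=> q0 q1 q2; move: iG; rewrite !inE.
move=> /or4P[/eqP ->|/eqP ->|/eqP ->|/or3P[/eqP ->|/eqP ->|/eqP ->]]; rewrite /kv /knot_vec /= ?z0 ?z1 ?z2 ?z3.
- move=> *; exists (1 - 3 * Y - 3 * Z - q0 - q1 - q2), (3 * Y), (3 * Z); split; split; lra.
- move=> *; exists (1 - (3 * Y - 2 * q2) - 3 * Z - q0 - q1 - q2), (3 * Y - 2 * q2), (3 * Z); split; split; lra.
- move=> *; exists (1 - 3 * Y - (3 * Z - 2 * q2) - q0 - q1 - q2), (3 * Y), (3 * Z - 2 * q2); split; split; lra.
- move=> *; exists (1 - (3 * Y - 2 * q1 - 3 * q2) - 3 * Z - q0 - q1 - q2), (3 * Y - 2 * q1 - 3 * q2), (3 * Z); split; split; lra.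
- move=> *; exists (1 - 3 * Y - (3 * Z - 2 * q1 - 3 * q2) - q0 - q1 - q2), (3 * Y), (3 * Z - 2 * q1 - 3 * q2); split; split; lra.
- move=> *; exists (1 - (3 * Y - 2 * q1) - (3 * Z - 2 * q2) - q0 - q1 - q2), (3 * Y - 2 * q1), (3 * Z - 2 * q2); split; split; lra.
Qed.

Lemma vertex_lower i : i \in vertex_group -> exists2 k : R, 0 < k & forall x,
  0 < (bary v x).1.2 <= 1 / 100 -> 0 < (bary v x).2 <= 1 / 100 ->
  k * ((bary v x).1.2 ^+ (vertex_order i).1 * (bary v x).2 ^+ (vertex_order i).2) <= Bws v i x.
Proof.
move=> iG; have /andP[W _] := allP vertex_witnessP i iG; have [k k0 H] := Bws_lower W.
(* The smallest of the constants 1/512, 1/128 and 1/32 in the volumes of the boxes. *)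
exists (k / 512) => [|x hY hZ]; first by apply: divr_gt0 k0 _; rewrite ltr0n.
apply: le_trans (H x _ _ (vertex_box_fits iG hY hZ)); move: hY hZ; move: (bary v x).1.2 (bary v x).2 => Y Z.
move=> /andP[Y0 Y1] /andP[Z0 Z1]; rewrite -mulrA ler_wpM2l ?(ltW k0)//.
have YZ : 0 < Y * Z by rewrite mulr_gt0.
have YY : 0 < Y * Y by rewrite mulr_gt0.
have ZZ : 0 < Z * Z by rewrite mulr_gt0.
move: iG; rewrite !inE.
by move=> /or4P[/eqP ->|/eqP ->|/eqP ->|/or3P[/eqP ->|/eqP ->|/eqP ->]] /=; rewrite ?expr0 ?expr1 ?expr2; lra.
Qed.

Lemma vertex_small c : (forall i, i \in vertex_group -> c i = 0) -> exists2 K : R, 0 <= K & forall x, tri_set v x ->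
  `|combination c x| <= K * ((bary v x).1.2 + (bary v x).2) ^+ 3.
Proof.
move=> c0; apply: (@combination_upper _ (tri_set v) (fun x => ((bary v x).1.2 + (bary v x).2) ^+ 3)) => j j28 dj.
apply: off_vertex_upper => //; apply: contra dj; rewrite !inE.
by move=> /or4P[/eqP ->|/eqP ->|/eqP ->|/or3P[/eqP ->|/eqP ->|/eqP ->]] /=; rewrite c0.
Qed.

Definition vertex_curve (d1 d2 : nat) (h : R) : @pt R := comb v (1 - h ^+ d1 - h ^+ d2, h ^+ d1, h ^+ d2).

Lemma bary_vertex_curve d1 d2 h : bary v (vertex_curve d1 d2 h) = (1 - h ^+ d1 - h ^+ d2, h ^+ d1, h ^+ d2).
Proof. by rewrite /vertex_curve combK// /sum3 /=; ring. Qed.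

Lemma vertex_curve_small d1 d2 (h : R) : (0 < d1)%N -> (0 < d2)%N -> 0 < h < 1 / 100 ->
  [/\ 0 < h ^+ d1 <= h, 0 < h ^+ d2 <= h & inner v (vertex_curve d1 d2 h)].
Proof.
move=> d10 d20 /andP[h0 h1]; have h1' : h <= 1 by lra.
have p1 : 0 < h ^+ d1 <= h by rewrite exprn_gt0//= -[leRHS]expr1 ler_wiXn2l// ltW.
have p2 : 0 < h ^+ d2 <= h by rewrite exprn_gt0//= -[leRHS]expr1 ler_wiXn2l// ltW.
split => //; rewrite /inner bary_vertex_curve /=; case/andP: p1 => *; case/andP: p2 => *; split; lra.
Qed.

(** Along [(h ^+ d1, h ^+ d2)] the monomial [Y ^+ a * Z ^+ b] has order [d1 * a + d2 * b]. The
    restriction to orders at most 2 keeps the cubic contributions of the remaining splines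
    negligible. *)
Lemma vertex_coef c d1 d2 m : m \in vertex_group -> (0 < d1)%N -> (0 < d2)%N ->
  (let n := (d1 * (vertex_order m).1 + d2 * (vertex_order m).2)%N in (n <= 2)%N /\
   forall j, j \in vertex_group -> j != m -> unmix c j != 0 ->
    (n < d1 * (vertex_order j).1 + d2 * (vertex_order j).2)%N) ->
  (exists2 e : R, 0 < e & exists K : R, forall x, inner v x -> (bary v x).1.2 + (bary v x).2 < e ->
     `|combination c x| <= K * ((bary v x).1.2 + (bary v x).2) ^+ 3) ->
  unmix c m = 0.
Proof.
move=> mG d10 d20; set n := (_ + _)%N => -[n2 H] [e e0 [K HK]].
have cube (d : nat) (h y z : R) : (d <= 3)%N -> 0 < h < 1 / 100 -> 0 < y <= h -> 0 < z <= h -> (y + z) ^+ 3 <= 8 * h ^+ d.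
  move=> d3 /andP[h0 h1] /andP[y0 yh] /andP[z0 zh]; apply: (@le_trans _ _ ((h + h) ^+ 3)).
    by apply: lerXn2r; rewrite ?nnegrE; [lra|lra|exact: lerD].
  have -> : (h + h) ^+ 3 = 8 * h ^+ 3 by ring.
  by rewrite ler_wpM2l// ler_wiXn2l ?(ltW h0)//; lra.
have mono (a b : nat) (h : R) : (h ^+ d1) ^+ a * (h ^+ d2) ^+ b = h ^+ (d1 * a + d2 * b) by rewrite -!exprM -exprD.
have m28 : (m < 28)%N by move: mG; rewrite !inE => /or4P[/eqP ->|/eqP ->|/eqP ->|/or3P[/eqP ->|/eqP ->|/eqP ->]].
apply: (@dominant_coef m n (vertex_curve d1 d2)) => //.
- move=> j j28 jm dj; have [jG|jG] := boolP (j \in vertex_group).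
    have [C C0 HC] := vertex_upper jG; exists C => // h hh.
    have [p1 p2 ic] := vertex_curve_small d10 d20 hh; apply: (le_trans (HC _ (inner_tri nd ic))).
    rewrite bary_vertex_curve /= mono ler_wpM2l// ler_wiXn2l//; last exact: H.
      by case/andP: hh => /ltW.
    by case/andP: hh => *; lra.
  have [C C0 HC] := off_vertex_upper j28 jG; exists (C * 8) => [|h hh]; first by rewrite mulr_ge0.
  have [p1 p2 ic] := vertex_curve_small d10 d20 hh; apply: (le_trans (HC _ (inner_tri nd ic))).
  by rewrite bary_vertex_curve /= -mulrA ler_wpM2l//; exact: cube.
- have [k k0 Hk] := vertex_lower mG; exists k => // h hh.
  have [/andP[p1 p1'] /andP[p2 p2'] ic] := vertex_curve_small d10 d20 hh; case/andP: hh => h0 h1.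
  have := Hk (vertex_curve d1 d2 h); rewrite bary_vertex_curve /= mono.
  by apply; apply/andP; split => //; lra.
- exists (Num.min (e / 2) (1 / 100)); first by rewrite lt_min divr_gt0//=; lra.
  exists (`|K| * 8) => h; rewrite lt_min => /andP[h0 /andP[he h1]].
  have hh : 0 < h < 1 / 100 by rewrite h0.
  have [p1 p2 ic] := vertex_curve_small d10 d20 hh; have /andP[q1 q1'] := p1; have /andP[q2 q2'] := p2.
  have := HK _ ic; rewrite bary_vertex_curve /= => HK'.
  apply: (@le_trans _ _ (`|K| * (h ^+ d1 + h ^+ d2) ^+ 3)).
    apply: (le_trans (HK' _)); first lra.
    by rewrite ler_wpM2r ?ler_norm// exprn_ge0// addr_ge0// ltW.
  by rewrite -mulrA ler_wpM2l//; apply: cube.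
Qed.

(** The coefficients are eliminated in the order 1, Y, Z, Y^2, Z^2, YZ. The exponents of each curve
    make the current monomial strictly dominant among those not yet eliminated. *)
Lemma vertex_coefs c :
  (exists2 e : R, 0 < e & exists K : R, forall x, inner v x -> (bary v x).1.2 + (bary v x).2 < e ->
     `|combination c x| <= K * ((bary v x).1.2 + (bary v x).2) ^+ 3) ->
  forall i, i \in vertex_group -> c i = 0.
Proof.
move=> H.
have c0 : c 0%N = 0.
  apply: (@vertex_coef c 1 1 0) => //; split => // j.
  by rewrite !inE => /or4P[/eqP ->|/eqP ->|/eqP ->|/or3P[/eqP ->|/eqP ->|/eqP ->]].
have c3 : c 3%N = 0.
  apply: (@vertex_coef c 1 2 3) => //; split => // j.
  by rewrite !inE => /or4P[/eqP ->|/eqP ->|/eqP ->|/or3P[/eqP ->|/eqP ->|/eqP ->]] //= _; rewrite c0 eqxx.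
have c4 : c 4%N = 0.
  apply: (@vertex_coef c 2 1 4) => //; split => // j.
  by rewrite !inE => /or4P[/eqP ->|/eqP ->|/eqP ->|/or3P[/eqP ->|/eqP ->|/eqP ->]] //= _; rewrite ?c0 ?c3 eqxx.
have c9 : c 9%N = 0.
  apply: (@vertex_coef c 1 2 9) => //; split => // j.
  by rewrite !inE => /or4P[/eqP ->|/eqP ->|/eqP ->|/or3P[/eqP ->|/eqP ->|/eqP ->]] //= _; rewrite ?c0 ?c3 ?c4 eqxx.
have c10 : c 10%N = 0.
  apply: (@vertex_coef c 2 1 10) => //; split => // j.
  by rewrite !inE => /or4P[/eqP ->|/eqP ->|/eqP ->|/or3P[/eqP ->|/eqP ->|/eqP ->]] //= _; rewrite ?c0 ?c3 ?c4 ?c9 eqxx.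
have c15 : c 15%N = 0.
  apply: (@vertex_coef c 1 1 15) => //; split => // j.
  by rewrite !inE => /or4P[/eqP ->|/eqP ->|/eqP ->|/or3P[/eqP ->|/eqP ->|/eqP ->]] //= _; rewrite ?c0 ?c3 ?c4 ?c9 ?c10 eqxx.
by move=> i; rewrite !inE => /or4P[/eqP ->|/eqP ->|/eqP ->|/or3P[/eqP ->|/eqP ->|/eqP ->]].
Qed.

End Combinations.

(** For the edge from [v1] to [v2] and the indices from 19 on: the first two free knots lie off the
    edge, each giving a factor [Z]. *)
Definition edge_witness : seq (seq nat) :=
  [:: [::]; [::]; [::]; [::]; [::]; [::]; [::]; [::]; [::]; [::]; [::]; [::]; [::]; [::]; [::]; [::]; [::]; [::]; [::]; [:: 3; 4; 5; 1; 2; 0]; [:: 3; 4; 5; 0; 2; 1]; [:: 1; 2; 5; 3; 4; 0]; [:: 3; 4; 5; 1; 2; 0]; [:: 3; 4; 5; 1; 2; 0]; [:: 1; 2; 5; 3; 4; 0]; [:: 3; 4; 5; 0; 1; 2]; [:: 3; 4; 5; 0; 1; 2]; [:: 1; 4; 5; 2; 3; 0]].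
(** Cubic decay at [v31] needs three free knots off a line through it. For 23 and 24 the knots on
    the edge are collinear and cannot serve as base, so the line through [v31] and [v21] replaces
    the edge. For 21 and 22 the decay is only quadratic, and their entries are empty. *)
Definition third_witness : seq (seq nat) :=
  [:: [::]; [::]; [::]; [::]; [::]; [::]; [::]; [::]; [::]; [::]; [::]; [::]; [::]; [::]; [::]; [::]; [::]; [::]; [::]; [:: 0; 4; 5; 1; 2; 3]; [:: 1; 4; 5; 0; 2; 3]; [::]; [::]; [:: 3; 4; 5; 0; 1; 2]; [:: 1; 4; 5; 0; 2; 3]; [:: 3; 4; 5; 0; 1; 2]; [:: 3; 4; 5; 0; 1; 2]; [:: 0; 1; 5; 2; 3; 4]].
(* [2 b_2 + 2 b_3 - b_1] vanishes at the point v_31. *)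
Definition third_form (i : nat) : Z3 := if (i \in [:: 23; 24])%N then (-1,2,2)%Zb else (0,0,1)%Zb.

Lemma edge_witnessP : all (fun i => upper_ok i (nth [::] edge_witness i)
  (nth (0,0,0) [:: (0,0,1); (0,0,1); (1,1,1)])%Zb) (iota 19 9).
Proof. by vm_compute. Qed.
Lemma third_witnessP : all (fun i => (i \in [:: 21; 22]%N) || upper_ok i (nth [::] third_witness i) (fun=> third_form i)) (iota 19 9).
Proof. by vm_compute. Qed.

(** * Combinations of the basis functions near an edge *)

Section EdgeBounds.
Context {R : realType}.
Local Notation T1 := (measurableTypeR R).
Local Notation T2 := (T1 * T1)%type.
Local Notation T3 := (T2 * T1)%type.
Variable v : 'I_3 -> @pt R.
Hypothesis nd : Defs.nondegenerate v.
Implicit Types (x : @pt R) (c : nat -> R).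

Lemma unmix_lt j c : (j < 21)%N -> unmix c j = c j.
Proof. by do 21 (case: j => [|j] //). Qed.

Lemma edge_upper i : (18 < i < 28)%N -> exists2 K : R, 0 <= K & forall x, tri_set v x ->
  Bws v i x <= K * (bary v x).2 ^+ 2.
Proof.
move=> i28; have := allP edge_witnessP i; rewrite mem_iota => /(_ i28) /(Bws_upper nd)[K K0 H].
exists K => // x /(tri_setP nd)[_ _ Z0]; have := H x; rewrite /= hval_z hval_one mulr1 expr2; exact.
Qed.

Lemma edge_small c : (forall i, (i < 19)%N -> c i = 0) -> exists2 K : R, 0 <= K & forall x, tri_set v x ->
  `|combination v c x| <= K * (bary v x).2 ^+ 2.
Proof.
move=> c0; apply: (@combination_upper _ v nd _ (tri_set v) (fun x => (bary v x).2 ^+ 2)) => j j28 dj.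
apply: edge_upper; rewrite j28 andbT ltnNge; apply: contra dj => j18.
by rewrite unmix_lt ?c0// (leq_ltn_trans j18).
Qed.

Definition mid_ray (h : R) : @pt R := comb v ((1 - h) / 2, (1 - h) / 2, h).

Lemma bary_mid_ray h : bary v (mid_ray h) = ((1 - h) / 2, (1 - h) / 2, h).
Proof. by rewrite /mid_ray combK// /sum3 /=; field. Qed.

Lemma mid_ray_inner (h : R) : 0 < h < 1 -> inner v (mid_ray h).
Proof. by move=> /andP[h0 h1]; rewrite /inner bary_mid_ray /=; split; lra. Qed.

(** At the midpoint of the edge the spline with index 18 decays linearly along the ray and those
    after it quadratically, so a quadratic bound on the combination removes its coefficient. *)
Lemma edge_coef c : (forall i, (i < 18)%N -> c i = 0) ->
  (exists2 e : R, 0 < e & exists K : R, forall h : R, 0 < h < e -> `|combination v c (mid_ray h)| <= K * h ^+ 2) ->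
  c 18%N = 0.
Proof.
move=> c0 H; apply: (@dominant_coef _ v nd 18 1 mid_ray) => //.
- move=> j j28 j18 dj; have [|C C0 HC] := @edge_upper j.
    rewrite j28 andbT ltn_neqAle eq_sym j18 leqNgt; apply: contra dj => jl.
    by rewrite unmix_lt ?c0// (leq_trans jl).
  exists C => // h /andP[h0 h1]; have := HC (mid_ray h); rewrite bary_mid_ray /=; apply.
  by apply/inner_tri => //; apply: mid_ray_inner; rewrite h0/=; lra.
- have [|k k0 Hk] := @Bws_lower _ v nd 18 [:: 0; 1; 4; 2; 3; 5]%N; first by vm_compute.
  exists (k / 64) => [|h /andP[h0 h1]]; first by rewrite divr_gt0.
  have := Hk (mid_ray h) (0, 0, 0) (1/8, 1/8, h); rewrite bary_mid_ray /= => K.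
  apply: le_trans (K _); first by rewrite expr1 -!mulrA ler_wpM2l ?(ltW k0)//; lra.
  have [z0 z1 z2 z3] := @zr_small R; rewrite /box_fits /kv /knot_vec /= ?z0 ?z1 ?z2 ?z3.
  split; first by split; lra.
  split; first by [].
  move=> p q r *; pose l1 := (1 - h) / 2 - (p + 2 * q + 2 * r) / 3; pose l2 := 3 * h - r.
  exists (1 - l1 - l2 - p - q - r), l1, l2; rewrite /l1 /l2; split; split; lra.
Qed.

Definition third_ray (ka h : R) : @pt R := comb v (2/3 - (1 + ka) * h, 1/3 + ka * h, h).

Lemma bary_third_ray ka h : bary v (third_ray ka h) = (2/3 - (1 + ka) * h, 1/3 + ka * h, h).
Proof. by rewrite /third_ray combK// /sum3 /=; field. Qed.

Lemma third_ray_inner (ka h : R) : -1 <= ka <= 1 -> 0 < h < 1 / 100 -> inner v (third_ray ka h).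
Proof. by move=> /andP[k0 k1] /andP[h0 h1]; rewrite /inner bary_third_ray /=; split; nra. Qed.

Lemma third_upper i (ka : R) : -1 <= ka <= 1 -> (18 < i < 28)%N -> i \notin [:: 21; 22]%N -> exists2 K : R, 0 <= K & forall h,
  0 < h < 1 / 100 -> Bws v i (third_ray ka h) <= K * h ^+ 3.
Proof.
move=> /andP[ka0 ka1] i28 iN; have := allP third_witnessP i; rewrite mem_iota (negPf iN) => /(_ i28) /(Bws_upper nd)[K K0 H].
exists (K * 216) => [|h /andP[h0 h1]]; first by rewrite mulr_ge0 ?ler0n.
(* On the ray the third coordinate is [h] and the other form is [3 * (1 + ka) * h], which is at most
   [6 * h]; the cube of 6 is the constant 216. *)
have b : 0 <= hval v (third_form i) (third_ray ka h) <= 6 * h.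
  rewrite /third_form; case: ifP => _; last by rewrite hval_z bary_third_ray /=; apply/andP; split; lra.
  rewrite /hval /dot3 bary_third_ray /=; have [-> ->] : @zr R (-1) = -1 /\ @zr R 2 = 2 by [].
  by apply/andP; split; nra.
have /andP[b0 b1] := b; apply: (le_trans (H _ b0 b0 b0)); rewrite -[leRHS]mulrA ler_wpM2l//.
have -> : 216 * h ^+ 3 = (6 * h) ^+ 3 by ring.
by rewrite -expr2 -exprSr; apply: lerXn2r; rewrite ?nnegrE//; lra.
Qed.

(** The two knot sets differ only by [v12] against [v13]. Both orders start with [v1], [v31], [v21],
    which makes the normalizing constants equal, and then list [v12] or [v13], [v23] and [v32]. *)
Definition near_witness (i : nat) : seq nat := if i == 21%N then [:: 0; 1; 5; 3; 4; 2]%N else [:: 0; 5; 1; 3; 2; 4]%N.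
Definition near_pts i := @witness_pts R v i (near_witness i).

Lemma near_kap : kap (near_pts 21) = kap (near_pts 22).
Proof.
by rewrite /kap /total_volume /cone_volume /tri_cone /bar1 /bar2.
Qed.

Lemma near_Qset21 x (p q r : R) : Qset (near_pts 21) x (p, q, r) <->
  [/\ 0 <= p, 0 <= q & 0 <= r] /\
  [/\ p + 2 * q <= 3 * (bary v x).2, 2 * p + 2 * r <= 3 * (bary v x).1.2 &
      3 * (bary v x).1.2 + 3 * (bary v x).2 - 1 <= 2 * p + q + r].
Proof.
rewrite (witness_Qset nd)//.
have [z0 z1 z2 z3] := @zr_small R.
have X1 : (bary v x).1.1 = 1 - (bary v x).1.2 - (bary v x).2 by have := sum_bary v x; rewrite /sum3; lra.
rewrite /balanced X1; move: (bary v x).1.2 (bary v x).2 => Y Z; split.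
  move=> [l [l0]]; rewrite !sum_ord6 /kv /knot_vec /= ?z0 ?z1 ?z2 ?z3 => s1 e1 e2 e3 [-> -> ->].
  have := l0 0; have := l0 1; have := l0 2; have := l0 3; have := l0 4; have := l0 5.
  by move=> *; split; split => //; lra.
move=> [[p0 q0 r0] [h1 h2 h3]].
exists (fun i : 'I_6 => nth 0 [:: 1 - (3 * Y - 2 * p - 2 * r) - (3 * Z - p - 2 * q) - p - q - r;
  3 * Y - 2 * p - 2 * r; 3 * Z - p - 2 * q; p; q; r] i) => //.
split; first by case=> [] [|[|[|[|[|[|//]]]]]] _ //=; lra.
all: by rewrite sum_ord6 /kv /knot_vec /= ?z0 ?z1 ?z2 ?z3; lra.
Qed.

Lemma near_Qset22 x (p q r : R) : Qset (near_pts 22) x (p, q, r) <->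
  [/\ 0 <= p, 0 <= q & 0 <= r] /\
  [/\ 2 * p + 2 * q <= 3 * (bary v x).2, p + 2 * r <= 3 * (bary v x).1.2 &
      3 * (bary v x).1.2 + 3 * (bary v x).2 - 1 <= 2 * p + q + r].
Proof.
rewrite (witness_Qset nd)//.
have [z0 z1 z2 z3] := @zr_small R.
have X1 : (bary v x).1.1 = 1 - (bary v x).1.2 - (bary v x).2 by have := sum_bary v x; rewrite /sum3; lra.
rewrite /balanced X1; move: (bary v x).1.2 (bary v x).2 => Y Z; split.
  move=> [l [l0]]; rewrite !sum_ord6 /kv /knot_vec /= ?z0 ?z1 ?z2 ?z3 => s1 e1 e2 e3 [-> -> ->].
  have := l0 0; have := l0 1; have := l0 2; have := l0 3; have := l0 4; have := l0 5.
  by move=> *; split; split => //; lra.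
move=> [[p0 q0 r0] [h1 h2 h3]].
exists (fun i : 'I_6 => nth 0 [:: 1 - (3 * Y - p - 2 * r) - (3 * Z - 2 * p - 2 * q) - p - q - r;
  3 * Y - p - 2 * r; 3 * Z - 2 * p - 2 * q; p; q; r] i) => //.
split; first by case=> [] [|[|[|[|[|[|//]]]]]] _ //=; lra.
all: by rewrite sum_ord6 /kv /knot_vec /= ?z0 ?z1 ?z2 ?z3; lra.
Qed.

(** Three times the third barycentric coordinate is 1 at [v12] and 2 at [v13]. Near the edge, a
    weight on [v12] therefore corresponds to half that weight on [v13]. *)
Definition halve (q : T3) : T3 := (q.1.1 / 2, q.1.2, q.2).

Lemma measurable_scale1 (k : R) : measurable_fun setT (fun q : T3 => (q.1.1 * k, q.1.2, q.2) : T3).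
Proof.
apply: measurable_fun_pair; last exact: measurable_snd.
apply: measurable_fun_pair.
  by apply: measurable_funM => //; apply: (measurableT_comp measurable_fst); exact: measurable_fst.
by apply: (measurableT_comp measurable_snd); exact: measurable_fst.
Qed.

Lemma leb3_halve (S : set T3) : measurable S -> leb3m (halve @^-1` S) = (2%:E * leb3m S)%E.
Proof.
have [|||||K K0 HK] := @leb3_linear R halve (fun q => (q.1.1 * 2, q.1.2, q.2)).
- exact: measurable_scale1.
- exact: measurable_scale1.
- by move=> [[p q] r]; rewrite /halve /= divfK.
- by move=> [[p q] r]; rewrite /halve /= mulfK.
- by move=> x y; rewrite /halve /= mulrDl.
move=> mS; rewrite HK//; congr (_%:E * _)%E.
(* The scaling factor is read off from the unit cube. *)
have := HK (`[0, 1] `*` `[0, 1] `*` `[0, 1]); rewrite (_ : halve @^-1` _ = `[0, 2] `*` `[0, 1] `*` `[0, 1]); last first.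
  apply/seteqP; split => -[[p q] r] [[/= h1 h2] h3]; split => //; split => //=; move: h1; rewrite !in_itv /= => /andP[h1 h1'];
  by apply/andP; split; lra.
rewrite !leb3_itv//; last 1 first.
have mB : measurable (`[0, 1] `*` `[0, 1] `*` `[0, 1] : set T3) by apply: measurableX; [exact: measurableX|].
by move=> /(_ mB) /eqP; rewrite -EFinM eqe => /eqP; lra.
Qed.

(** The first two free weights are of order [h]. After halving the first, the two admissible sets
    can differ only where the third weight is within order [h] of 0 or of 1/2; the boxes [E1] and
    [E2] cover these places, with volumes [54 h^3] and [90 h^3]. *)
Lemma near_volumes (ka h : R) : -1 <= ka <= 1 -> 0 < h < 1 / 100 ->
  `|fine (leb3m (Qset (near_pts 21) (third_ray ka h))) - 2 * fine (leb3m (Qset (near_pts 22) (third_ray ka h)))| <= 144 * h ^+ 3.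
Proof.
move=> /andP[k0 k1] /andP[h0 h1]; set x := third_ray ka h.
have [xY xZ] : (bary v x).1.2 = 1 / 3 + ka * h /\ (bary v x).2 = h by rewrite /x bary_third_ray.
set A := Qset _ x; set B := Qset _ x.
have mA : measurable A by exact: measurable_Qset.
have mB : measurable B by exact: measurable_Qset.
have mhB : measurable (halve @^-1` B) by have := measurable_scale1 2^-1 measurableT mB; rewrite setTI.
pose E1 : set T3 := `[0, 3 * h] `*` `[0, 3 * h] `*` `[0, 6 * h].
pose E2 : set T3 := `[0, 3 * h] `*` `[0, 3 * h] `*` `[1 / 2 - 5 * h, 1 / 2 + 5 * h].
have mE1 : measurable E1 by apply: measurableX; [exact: measurableX|].
have mE2 : measurable E2 by apply: measurableX; [exact: measurableX|].
have kh : -h <= ka * h <= h by apply/andP; split; nra.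
have /andP[kh0 kh1] := kh.
have AB : A `<=` halve @^-1` B `|` (E1 `|` E2).
  move=> [[p q] r] /near_Qset21; rewrite xY xZ => -[[p0 q0 r0] [a1 a2 a3]]; rewrite /setU /= /B near_Qset22 xY xZ /=.
  clear - h0 h1 kh0 kh1 p0 q0 r0 a1 a2 a3; move: (ka * h) kh0 kh1 a1 a2 a3 => g kh0 kh1 a1 a2 a3.
  have [r1|r1] := leP r (6 * h).
    by right; left; split; [split|]; rewrite /= in_itv /=; apply/andP; split; lra.
  have [r2|r2] := leP (1 / 2 - 5 * h) r.
    by right; right; split; [split|]; rewrite /= in_itv /=; apply/andP; split; lra.
  by left; split; split; lra.
have BA : halve @^-1` B `<=` A `|` (E1 `|` E2).
  move=> [[p q] r]; rewrite /setU /= /B near_Qset22 /A near_Qset21 xY xZ /= => -[[p0 q0 r0] [a1 a2 a3]].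
  clear - h0 h1 kh0 kh1 p0 q0 r0 a1 a2 a3; move: (ka * h) kh0 kh1 a1 a2 a3 => g kh0 kh1 a1 a2 a3.
  have [r1|r1] := leP r (6 * h).
    by right; left; split; [split|]; rewrite /= in_itv /=; apply/andP; split; lra.
  have [r2|r2] := leP (1 / 2 - 5 * h) r.
    by right; right; split; [split|]; rewrite /= in_itv /=; apply/andP; split; lra.
  by left; split; split; lra.
have vE : (leb3m (E1 `|` E2) <= (144 * h ^+ 3)%:E)%E.
  have U : (leb3m (E1 `|` E2) <= leb3m E1 + leb3m E2)%E by exact: measureU2.
  have [h3 h6 h5] : [/\ 0 <= 3 * h, 0 <= 6 * h & 1 / 2 - 5 * h <= 1 / 2 + 5 * h] by clear -h0; split; lra.
  by apply: (le_trans U); rewrite /E1 /E2 !leb3_itv// -EFinD (_ : _ + _ = 144 * h ^+ 3)//; field.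
have finQ i (S := Qset (near_pts i) x) : leb3m S \is a fin_num.
  rewrite ge0_fin_numE//; apply: (le_lt_trans (le_leb3 (@Qset_sub1 _ _ x))).
  by rewrite leb3_itv// ltry.
have sub (S T : set T3) : measurable S -> measurable T -> S `<=` T `|` (E1 `|` E2) -> (leb3m S <= leb3m T + (144 * h ^+ 3)%:E)%E.
  move=> mS mT /le_leb3 H; apply: (le_trans H).
  have U : (leb3m (T `|` (E1 `|` E2)) <= leb3m T + leb3m (E1 `|` E2))%E by apply: measureU2 => //; exact: measurableU.
  by apply: (le_trans U); rewrite leeD2l.
have hAB := sub _ _ mA mhB AB; have hBA := sub _ _ mhB mA BA.
have fA : leb3m A \is a fin_num by exact: finQ.
have fB : leb3m B \is a fin_num by exact: finQ.
rewrite leb3_halve// in hAB hBA.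
move: (leb3m A) (leb3m B) fA fB hAB hBA => a b.
case: a b => [a| |] [b| |] // _ _; rewrite -!EFinM -!EFinD !lee_fin => h2 h3.
rewrite /= ler_norml; move: (h ^+ 3) h2 h3 => e h2 h3; clear -h2 h3.
by apply/andP; split; lra.
Qed.

Lemma near_ratio (ka : R) : -1 <= ka <= 1 -> exists2 K : R, 0 <= K & forall h : R, 0 < h < 1 / 100 ->
  `|Bws v 21 (third_ray ka h) - 2 * Bws v 22 (third_ray ka h)| <= K * h ^+ 3.
Proof.
move=> hk; have W21 : witness 21 (near_witness 21) by vm_compute.
have W22 : witness 22 (near_witness 22) by vm_compute.
pose C := tri_area v / 15 * cweight 21 * kap (near_pts 22).
have C0 : 0 <= C by rewrite mulr_ge0// ltW// ?(scale_gt0 nd)// kap_gt0//; exact: (witness_det nd W22).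
exists (C * 144) => [|h hh]; first by rewrite mulr_ge0.
rewrite /Bws (witness_spline nd _ W21) (witness_spline nd _ W22) -/(near_pts 21) -/(near_pts 22) near_kap.
have -> : @cweight R 22 = cweight 21 by [].
have E (s k a b : R) : s * (k * a) - 2 * (s * (k * b)) = s * k * (a - 2 * b) by ring.
rewrite E -/C; have H := near_volumes hk hh.
by rewrite normrM (ger0_norm C0) -mulrA ler_wpM2l.
Qed.

(* [unmix] turns [2 B_22 - B_23 + B_28/3] into [3 B_23] up to third order, and [2 B_23 - B_22 + B_28/3] into a
   third-order term: this is where the mixed basis localizes the edge coefficients. *)
Lemma third_main c (ka : R) : -1 <= ka <= 1 -> (forall i, (i < 19)%N -> c i = 0) -> exists2 K : R, 0 <= K & forall h : R,
  0 < h < 1 / 100 -> `|combination v c (third_ray ka h) - 3 * c 21%N * Bws v 22 (third_ray ka h)| <= K * h ^+ 3.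
Proof.
move=> hk c0; have [K0 K00 HK0] := near_ratio hk.
have H (j : 'I_28) : exists K : R, 0 <= K /\ forall h : R, 0 < h < 1 / 100 -> (nat_of_ord j \notin [:: 21; 22]%N) ->
    `|unmix c j * Bws v j (third_ray ka h)| <= K * h ^+ 3.
  have [jl|jl] := ltnP j 19.
    by exists 0; split => // h hh _; rewrite unmix_lt ?c0 ?mul0r ?normr0// (leq_trans jl).
  have [j2|j2] := boolP (nat_of_ord j \in [:: 21; 22]%N); first by exists 0.
  have [|K K1 HK] := third_upper hk _ j2; first by rewrite jl /=.
  exists (`|unmix c j| * K); split => [|h hh _]; first by rewrite mulr_ge0.
  by rewrite normrM (ger0_norm (Bws_ge0 nd _ (ltn_ord j))) -[leRHS]mulrA ler_wpM2l// HK.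
have [K HK] := choice H.
exists (`|2 * c 21%N - c 22%N| * K0 + \sum_(j < 28) K j) => [|h hh].
  by rewrite addr_ge0 ?mulr_ge0//; apply: sumr_ge0 => j _; have [] := HK j.
pose j1 := Ordinal (isT : (21 < 28)%N); pose j2 := Ordinal (isT : (22 < 28)%N).
have := combinationE v c (third_ray ka h); rewrite (bigD1 j1)// (bigD1 j2)//= => ->.
have E (B1 B2 S : R) : (2 * c 21%N - c 22%N) * B1 + ((2 * c 22%N - c 21%N) * B2 + S) - 3 * c 21%N * B2 =
  (2 * c 21%N - c 22%N) * (B1 - 2 * B2) + S by ring.
rewrite E [leRHS]mulrDl; apply: (le_trans (ler_normD _ _)); rewrite lerD//.
  by rewrite normrM -mulrA ler_wpM2l// HK0.
apply: (le_trans (ler_norm_sum _ _ _)); rewrite mulr_suml.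
rewrite [leRHS](bigD1 j1)// [X in _ <= _ + X](bigD1 j2)//=.
have h3 : 0 <= h ^+ 3 by rewrite exprn_ge0//; case/andP: hh => /ltW.
have [k1 _] := HK j1; have [k2 _] := HK j2.
rewrite -[leLHS]add0r; apply: lerD; first by rewrite mulr_ge0.
rewrite -[leLHS]add0r; apply: lerD; first by rewrite mulr_ge0.
apply: ler_sum => j /andP[n1 n2]; have [_] := HK j; apply => //.
by rewrite !inE negb_or; apply/andP; split; [apply: contra n1|apply: contra n2] => /eqP e; apply/eqP/val_inj.
Qed.

Lemma third_small c (ka : R) : -1 <= ka <= 1 -> (forall i, (i < 19)%N -> c i = 0) -> c 21%N = 0 ->
  exists2 K : R, 0 <= K & forall h : R, 0 < h < 1 / 100 -> `|combination v c (third_ray ka h)| <= K * h ^+ 3.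
Proof.
move=> hk c0 c21; have [K K0 H] := third_main hk c0; exists K => // h hh.
by have := H h hh; rewrite c21 mulr0 mul0r subr0.
Qed.

Lemma third_lower : exists2 k : R, 0 < k & forall h : R, 0 < h < 1 / 100 -> k * h ^+ 2 <= Bws v 22 (third_ray 0 h).
Proof.
have [|k k0 Hk] := @Bws_lower _ v nd 22 (near_witness 22); first by vm_compute.
(* The box with sides [h / 2], [h / 2] and 1/8 has volume [h^2 / 32]. Its last side starts at 1/8
   rather than 0, which keeps the weight of [v1] nonnegative. *)
exists (k / 32) => [|h /andP[h0 h1]]; first by rewrite divr_gt0.
have := Hk (third_ray 0 h) (0, 0, 1/8) (h / 2, h / 2, 1/4); rewrite bary_third_ray /= => K.
apply: le_trans (K _); first by rewrite -[leLHS]mulrA ler_wpM2l ?(ltW k0)// expr2; lra.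
have [z0 z1 z2 z3] := @zr_small R; rewrite /box_fits /kv /knot_vec /= ?z0 ?z1 ?z2 ?z3.
split; first by split; lra.
split; first by [].
move=> p q r *; pose l1 := 3 * (1 / 3 + 0 * h) - p - 2 * r; pose l2 := 3 * h - 2 * p - 2 * q.
exists (1 - l1 - l2 - p - q - r), l1, l2; rewrite /l1 /l2; split; split; lra.
Qed.

(** By [third_main] the combination equals [3 * c 21] times a spline of exact order 2, up to order
    3; the ray with parameter 0 suffices. *)
Lemma third_coef c : (forall i, (i < 19)%N -> c i = 0) ->
  (exists2 e : R, 0 < e & exists K : R, forall h : R, 0 < h < e -> `|combination v c (third_ray 0 h)| <= K * h ^+ 3) ->
  c 21%N = 0.
Proof.
move=> c0 [e e0 [K HK]]; have hk : (-1 <= (0 : R)) && ((0 : R) <= 1) by apply/andP; split; lra.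
have [C C0 HC] := third_main hk c0; have [k k0 Hk] := third_lower.
have h3 : 3 * c 21%N = 0.
  apply: (@small_zero _ _ k (K + C) (Num.min e (1 / 100)) 2 k0); first by rewrite lt_min e0; lra.
  move=> h; rewrite lt_min => /andP[h0 /andP[he h1]].
  have hh : 0 < h < 1 / 100 by rewrite h0.
  apply: (@le_trans _ _ `|3 * c 21%N * Bws v 22 (third_ray 0 h)|).
    by rewrite [leRHS]normrM (ger0_norm (Bws_ge0 nd _ _))// ler_wpM2l// Hk.
  have -> : 3 * c 21%N * Bws v 22 (third_ray 0 h) = combination v c (third_ray 0 h) -
    (combination v c (third_ray 0 h) - 3 * c 21%N * Bws v 22 (third_ray 0 h)) by ring.
  by apply: (le_trans (ler_normB _ _)); rewrite [leRHS]mulrDl lerD ?HK ?h0 ?he ?HC.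
by apply/eqP; move/eqP: h3; rewrite mulf_eq0 => /orP[|//]; rewrite pnatr_eq0.
Qed.

End EdgeBounds.

(** * Reordering the vertices *)

Definition orders3 : seq (seq nat) := [:: [:: 0; 1; 2]; [:: 0; 2; 1]; [:: 1; 0; 2]; [:: 1; 2; 0]; [:: 2; 0; 1]; [:: 2; 1; 0]]%N.
Definition order3 (o k : nat) : nat := nth 0%N (nth [::] orders3 o) k.
(* How a reordering of the vertices permutes the 28 indices. *)
Definition index_tables : seq (seq nat) :=
  [:: [:: 0; 1; 2; 3; 4; 5; 6; 7; 8; 9; 10; 11; 12; 13; 14; 15; 16; 17; 18; 19; 20; 21; 22; 23; 24; 25; 26; 27];
    [:: 0; 2; 1; 4; 3; 8; 7; 6; 5; 10; 9; 14; 13; 12; 11; 15; 17; 16; 20; 19; 18; 22; 21; 26; 25; 24; 23; 27];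
    [:: 1; 0; 2; 6; 5; 4; 3; 8; 7; 12; 11; 10; 9; 14; 13; 16; 15; 17; 18; 20; 19; 24; 23; 22; 21; 26; 25; 27];
    [:: 1; 2; 0; 5; 6; 7; 8; 3; 4; 11; 12; 13; 14; 9; 10; 16; 17; 15; 19; 20; 18; 23; 24; 25; 26; 21; 22; 27];
    [:: 2; 0; 1; 7; 8; 3; 4; 5; 6; 13; 14; 9; 10; 11; 12; 17; 15; 16; 20; 18; 19; 25; 26; 21; 22; 23; 24; 27];
    [:: 2; 1; 0; 8; 7; 6; 5; 4; 3; 14; 13; 12; 11; 10; 9; 17; 16; 15; 19; 18; 20; 26; 25; 24; 23; 22; 21; 27]]%N.
Definition reorder_index (o j : nat) : nat := nth 0%N (nth [::] index_tables o) j.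

Definition permz (o : nat) (z : Z3) : Z3 :=
  let s := [:: z.1.1; z.1.2; z.2] in let f k := nth 0%Zb s (index k (nth [::] orders3 o)) in (f 0, f 1, f 2)%N.

(** Reordering the vertices permutes the 28 knot multisets. Hence estimates proved at [v1] and on
    the edge from [v1] to [v2] hold at all vertices and on all edges, in both directions. *)
Lemma reindex_knots : all (fun o => all (fun j =>
  perm_eq (map (permz o) (nth [::] knot_vecs j)) (nth [::] knot_vecs (reorder_index o j))) (iota 0 28)) (iota 0 6).
Proof. by vm_compute. Qed.

Lemma reorder_index_perm : all (fun o => perm_eq (nth [::] index_tables o) (iota 0 28)) (iota 0 6).
Proof. by vm_compute. Qed.

Definition weight_class (i : nat) : nat := find (fun b => i < b)%N [:: 3; 9; 15; 18; 21; 27]%N.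

Lemma reindex_weight : all (fun o => all (fun j => weight_class (reorder_index o j) == weight_class j) (iota 0 28)) (iota 0 6).
Proof. by vm_compute. Qed.

Section Reordering.
Context {R : realType}.
Implicit Types (v : 'I_3 -> @pt R) (x : @pt R) (c : nat -> R).

Definition reorder v (o : nat) : 'I_3 -> @pt R := fun k => v (inord (order3 o k)).

Lemma reorder_cases v o : (o < 6)%N ->
  [\/ [/\ reorder v o 0 = v 0, reorder v o 1 = v 1 & reorder v o 2 = v 2],
      [/\ reorder v o 0 = v 0, reorder v o 1 = v 2 & reorder v o 2 = v 1],
      [/\ reorder v o 0 = v 1, reorder v o 1 = v 0 & reorder v o 2 = v 2] |
   [\/ [/\ reorder v o 0 = v 1, reorder v o 1 = v 2 & reorder v o 2 = v 0],
       [/\ reorder v o 0 = v 2, reorder v o 1 = v 0 & reorder v o 2 = v 1] |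
       [/\ reorder v o 0 = v 2, reorder v o 1 = v 1 & reorder v o 2 = v 0]]].
Proof.
have e0 : inord 0 = 0 :> 'I_3 by apply: val_inj; rewrite /= inordK.
have e1 : inord 1 = 1 :> 'I_3 by apply: val_inj; rewrite /= inordK.
have e2 : inord 2 = 2 :> 'I_3 by apply: val_inj; rewrite /= inordK.
case: o => [|[|[|[|[|[|//]]]]]] _; rewrite /reorder /order3 /= ?e0 ?e1 ?e2.
- by constructor 1. - by constructor 2. - by constructor 3.
- by constructor 4; constructor 1. - by constructor 4; constructor 2. - by constructor 4; constructor 3.
Qed.

Lemma norm_eq (a b : R) : a = b \/ a = - b -> `|a| = `|b|.
Proof. by move=> [->|->]; rewrite ?normrN. Qed.

Lemma reorder_area v o : (o < 6)%N -> tri_area (reorder v o) = tri_area v.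
Proof.
move=> o6; rewrite /tri_area; congr (_ / _).
have [[-> -> ->]|[-> -> ->]|[-> -> ->]|[[-> -> ->]|[-> -> ->]|[-> -> ->]]] := reorder_cases v o6 => //;
  apply: norm_eq; rewrite /det2 /=; case: (v 0) (v 1) (v 2) => ? ? [? ?] [? ?] /=; first [by left; ring|by right; ring].
Qed.

Lemma reorder_nd v o : (o < 6)%N -> Defs.nondegenerate v -> Defs.nondegenerate (reorder v o).
Proof.
rewrite /Defs.nondegenerate => o6; rewrite -normr_gt0 => h; rewrite -normr_gt0.
have := reorder_area v o6; rewrite /tri_area => /(mulIf _) ->//; exact: invr_neq0.
Qed.

Lemma zpt_reorder v o z : (o < 6)%N -> zpt (reorder v o) z = zpt v (permz o z).
Proof.
move=> o6; rewrite /zpt /comb /zr3.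
have e0 : inord 0 = 0 :> 'I_3 by apply: val_inj; rewrite /= inordK.
have e1 : inord 1 = 1 :> 'I_3 by apply: val_inj; rewrite /= inordK.
have e2 : inord 2 = 2 :> 'I_3 by apply: val_inj; rewrite /= inordK.
case: o o6 => [|[|[|[|[|[|//]]]]]] _; rewrite /reorder /order3 /= ?e0 ?e1 ?e2 //.
- by rewrite addrAC.
- by rewrite [X in X + _]addrC.
- by rewrite [LHS]addrC addrA.
- by rewrite [RHS]addrC addrA.
- by rewrite [LHS]addrC [X in _ + X]addrC addrA.
Qed.

Lemma simplex_spline_perm (X Y P : 'I_6 -> @pt R) (s t : {perm 'I_6}) x : (forall i, X i = Y (s i)) ->
  (forall i, P i = Y (t i)) -> det2 (P 1 - P 0) (P 2 - P 0) != 0 -> simplex_spline X x = simplex_spline Y x.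
Proof.
move=> XY PY D0; rewrite (@simplex_splineE _ Y t P)// (@simplex_splineE _ X (t * s^-1)%g P)// => i.
by rewrite PY XY permM permKV.
Qed.

Lemma reorder_spline v o j x : Defs.nondegenerate v -> (o < 6)%N -> (j < 28)%N ->
  simplex_spline (knots (reorder v o) j) x = simplex_spline (knots v (reorder_index o j)) x.
Proof.
move=> nd o6 j28.
have r28 : (reorder_index o j < 28)%N.
  have po : perm_eq (nth [::] index_tables o) (iota 0 28) by apply: (allP reorder_index_perm); rewrite mem_iota.
  have : reorder_index o j \in nth [::] index_tables o by apply: mem_nth; rewrite (perm_size po) size_iota.
  by rewrite (perm_mem po) mem_iota.
have pk := allP (allP reindex_knots o _) j _; rewrite !mem_iota in pk; have {}pk := pk o6 j28.
have sz i : (i < 28)%N -> size (nth [::] knot_vecs i) == 6%N.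
  by move=> i28; apply: (allP knots_sizes); apply: mem_nth.
have szr := sz _ r28; have szj : size (map (permz o) (nth [::] knot_vecs j)) == 6%N by rewrite size_map sz.
have /tuple_permP[s sE] : perm_eq (Tuple szj) (Tuple szr) by [].
have XY i : knots (reorder v o) j i = knots v (reorder_index o j) (s i).
  rewrite !knotsE// zpt_reorder// /knot_vec; congr zpt.
  have <- : tnth (Tuple szj) i = permz o (nth (0,0,0)%Zb (nth [::] knot_vecs j) i).
    by rewrite (tnth_nth (0,0,0)%Zb) /= (nth_map (0,0,0)%Zb)// (eqP (sz _ j28)).
  have -> : tnth (Tuple szj) i = tnth [tuple tnth (Tuple szr) (s i) | i < 6] i.
    by rewrite !(tnth_nth (0,0,0)%Zb) sE.
  by rewrite tnth_mktuple (tnth_nth (0,0,0)%Zb).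
have W := allP span_witnessP (reorder_index o j); rewrite mem_iota in W; have {}W := W r28.
have /and3P[_ pw _] := W.
set w := nth _ _ _ in W pw.
have sj : injective (fun j : 'I_6 => inord (nth 0%N w j) : 'I_6).
  move=> a b /(congr1 val); rewrite /= !inordK ?(witness_lt6 _ W)// => /eqP.
  rewrite nth_uniq ?(perm_size pw) ?size_iota// ?(perm_uniq pw) ?iota_uniq// => /eqP; exact: val_inj.
apply: (@simplex_spline_perm _ _ (witness_pts v (reorder_index o j) w) s (perm sj) x XY); last exact: witness_det.
by move=> i; rewrite permE knotsE// /witness_pts /kv inordK// (witness_lt6 _ W).
Qed.

Lemma cweight_class i j : weight_class i = weight_class j -> @cweight R i = cweight j.
Proof.
have E k : @cweight R k = nth 1 [:: 1/6; 1/3; 1/2; 2/3; 5/6; 2/3] (weight_class k).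
  rewrite /weight_class /cweight /=; case: (k < 3)%N => //; case: (k < 9)%N => //; case: (k < 15)%N => //.
  by case: (k < 18)%N => //; case: (k < 21)%N => //; case: (k < 27)%N.
by rewrite !E => ->.
Qed.

Lemma reorder_Bws v o j x : Defs.nondegenerate v -> (o < 6)%N -> (j < 28)%N ->
  Bws (reorder v o) j x = Bws v (reorder_index o j) x.
Proof.
move=> nd o6 j28; have w : weight_class j = weight_class (reorder_index o j).
  by apply/esym/eqP; apply: (allP (allP reindex_weight o _)); rewrite mem_iota.
rewrite /Bws (reorder_area v o6) (reorder_spline x nd o6 j28) (cweight_class w); reflexivity.
Qed.

(** The pairs of mixed functions and the central one are permuted among themselves, so the passage
    to the mixed basis commutes with reindexing. *)
Lemma unmix_reindex c o j : (o < 6)%N -> (j < 28)%N -> unmix c (reorder_index o j) = unmix (fun j => c (reorder_index o j)) j.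
Proof.
case: o => [|[|[|[|[|[|//]]]]]] _;
  do 27 (case: j => [|j]; first by []); by case: j => // _; rewrite /unmix /reorder_index /=; ring.
Qed.

Lemma sum_iota (f : nat -> R) : \sum_(i < 28) f i = \sum_(i <- iota 0 28) f i.
Proof. by rewrite -(big_mkord xpredT f). Qed.

Lemma sum_perm (f : nat -> R) (s t : seq nat) : perm_eq s t -> \sum_(i <- s) f i = \sum_(i <- t) f i.
Proof. by move=> st; apply: perm_big. Qed.

Lemma sum_map (f : nat -> R) (h : nat -> nat) (s : seq nat) : \sum_(i <- map h s) f i = \sum_(i <- s) f (h i).
Proof. exact: big_map. Qed.

Lemma reorder_combination v o c x : Defs.nondegenerate v -> (o < 6)%N ->
  combination v c x = combination (reorder v o) (fun j => c (reorder_index o j)) x.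
Proof.
move=> nd o6; rewrite !combinationE.
have po : perm_eq (nth [::] index_tables o) (iota 0 28) by apply: (allP reorder_index_perm); rewrite mem_iota.
have mE : nth [::] index_tables o = map (reorder_index o) (iota 0 28).
  by rewrite /reorder_index; clear po; case: o o6 => [|[|[|[|[|[|//]]]]]].
apply: (etrans (sum_iota (fun j => unmix c j * Bws v j x))).
apply: (etrans _ (esym (sum_iota (fun j => unmix (fun j => c (reorder_index o j)) j * Bws (reorder v o) j x)))).
apply: (etrans (esym (sum_perm (fun j => unmix c j * Bws v j x) po))).
rewrite mE; apply: (etrans (sum_map (fun j => unmix c j * Bws v j x) _ _)).
apply: eq_big_seq => j; rewrite mem_iota => /andP[_ j28].
rewrite (reorder_Bws x nd o6 j28) (unmix_reindex c o6 j28); reflexivity.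
Qed.

End Reordering.

(** * Coefficients and jets *)

Section JetsFromBounds.
Context {R : realType} {I : finType}.
Variables (a : I -> R) (L : I -> R * @pt R).
Implicit Types (x w : @pt R).

Definition jet1 x := tcs a L x = 0 /\ forall w, tcs1 a L x w = 0.

(** After multiplication by [h] a first-order expansion becomes a quadratic one with zero constant
    term, to which [quadratic_O3] applies. *)
Lemma ray_O2P x w (C e : R) : 0 < e -> (forall h : R, 0 < h < e -> `|tcs a L (x + h *: w)| <= C * h ^+ 2) ->
  tcs a L x = 0 /\ tcs1 a L x w = 0.
Proof.
move=> e0 H; have [K K0 /(_ x)[T3 _ _]] := tcs_taylor a L.
have [||_ -> ->] := @quadratic_O3 R 0 (tcs a L x) (tcs1 a L x w) (C + K * nrm w ^+ 3 + `|tcs2 a L x w w / 2|) (Num.min e 1).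
- by rewrite lt_min e0 ltr01.
- move=> h; rewrite lt_min => /andP[h0 /andP[he h1]].
  have h01 : 0 < h < e by rewrite h0.
  have h2 := H h h01; have := T3 (h *: w).
  rewrite nrmZ (gtr0_norm h0) tcs1Z tcs2Z tcs2C tcs2Z exprMn => h3.
  have -> : 0 + tcs a L x * h + tcs1 a L x w * h ^+ 2 = h * (tcs a L x + h * tcs1 a L x w) by ring.
  rewrite normrM (gtr0_norm h0) exprS mulrCA ler_pM2l//.
  have -> : tcs a L x + h * tcs1 a L x w = tcs a L (x + h *: w) - h ^+ 2 * (tcs2 a L x w w / 2)
    - (tcs a L (x + h *: w) - tcs a L x - h * tcs1 a L x w - h * (h * tcs2 a L x w w) / 2) by field.
  apply: (le_trans (ler_normB _ _)).
  have -> : (C + K * nrm w ^+ 3 + `|tcs2 a L x w w / 2|) * h ^+ 2 =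
    C * h ^+ 2 + `|tcs2 a L x w w / 2| * h ^+ 2 + K * nrm w ^+ 3 * h ^+ 2 by ring.
  apply: lerD.
    apply: (le_trans (ler_normB _ _)); apply: lerD => //.
    by rewrite normrM normrX (gtr0_norm h0) mulrC.
  apply: (le_trans h3); have -> : K * (h ^+ 3 * nrm w ^+ 3) = (K * nrm w ^+ 3 * h ^+ 2) * h by ring.
  by rewrite -[leRHS]mulr1 ler_wpM2l ?mulr_ge0 ?exprn_ge0 ?nrm_ge0 ?(ltW h0)// ltW.
- by [].
Qed.

Lemma jet1_ray x w : jet1 x -> exists C : R, forall h : R, 0 < h < 1 -> `|tcs a L (x + h *: w)| <= C * h ^+ 2.
Proof.
move=> [z0 z1]; have [K K0 /(_ x)[T3 _ _]] := tcs_taylor a L.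
exists (K * nrm w ^+ 3 + `|tcs2 a L x w w / 2|) => h /andP[h0 h1]; have := T3 (h *: w).
rewrite z0 z1 !subr0 tcs2Z tcs2C tcs2Z nrmZ (gtr0_norm h0) exprMn => h3.
have -> : tcs a L (x + h *: w) = (tcs a L (x + h *: w) - h * (h * tcs2 a L x w w) / 2) + h ^+ 2 * (tcs2 a L x w w / 2) by field.
apply: (le_trans (ler_normD _ _)); rewrite [leRHS]mulrDl; apply: lerD; last first.
  by rewrite normrM normrX (gtr0_norm h0) mulrC.
apply: (le_trans h3); have -> : K * (h ^+ 3 * nrm w ^+ 3) = (K * nrm w ^+ 3 * h ^+ 2) * h by ring.
by rewrite -[leRHS]mulr1 ler_wpM2l ?mulr_ge0 ?exprn_ge0 ?nrm_ge0 ?(ltW h0)// ltW.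
Qed.

Lemma jet1_rays x u w (C C' e e' : R) : det2 u w != 0 -> 0 < e -> 0 < e' ->
  (forall h : R, 0 < h < e -> `|tcs a L (x + h *: u)| <= C * h ^+ 2) ->
  (forall h : R, 0 < h < e' -> `|tcs a L (x + h *: w)| <= C' * h ^+ 2) -> jet1 x.
Proof.
move=> D0 e0 e'0 /(ray_O2P e0)[z0 z1] /(ray_O2P e'0)[_ z2]; split => // y.
have -> : y = (det2 y w / det2 u w) *: u + (det2 u y / det2 u w) *: w.
  move: D0; rewrite /det2; case: u w y {z1 z2} => [? ?] [? ?] [? ?] /= D0.
  by rewrite [RHS]surjective_pairing; congr (_, _); rewrite /= /GRing.scale /=; field.
by rewrite tcs1D !tcs1Z z1 z2 !mulr0 addr0.
Qed.

Variable v : 'I_3 -> @pt R.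
Hypothesis nd : Defs.nondegenerate v.
Variable c : nat -> R.
Hypothesis tcsE : forall x, inner v x -> tcs a L x = combination v c x.

Lemma det2_comb (b b' : @R3' R) : sum3 b = 0 -> sum3 b' = 0 ->
  det2 (comb v b) (comb v b') = det2 (v 1 - v 0) (v 2 - v 0) * (b.1.2 * b'.2 - b.2 * b'.1.2).
Proof.
case: b => [[p q] r]; case: b' => [[p' q'] r']; rewrite /sum3 /comb /det2 /= /GRing.scale /= => h h'.
have -> : p = - q - r by lra.
have -> : p' = - q' - r' by lra.
by case: (v 0) (v 1) (v 2) => ? ? [? ?] [? ?] /=; ring.
Qed.

Lemma combD (b b' : @R3' R) (h : R) : comb v b + h *: comb v b' = comb v (b.1.1 + h * b'.1.1, b.1.2 + h * b'.1.2, b.2 + h * b'.2).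
Proof.
by rewrite /comb; case: (v 0) (v 1) (v 2) => ? ? [? ?] [? ?]; congr (_, _); rewrite /= /GRing.scale /=; ring.
Qed.

Lemma vertex0E : v 0 = comb v (1, 0, 0).
Proof. by rewrite /comb /= scale1r !scale0r !addr0. Qed.

(** Zero coefficients leave only splines of cubic decay, and three inward rays then kill the 2-jet.
    Conversely a zero 2-jet gives cubic decay by Taylor's formula, and [vertex_coefs] removes the
    coefficients one by one. *)
Lemma vertex_jet0 : (forall i, i \in vertex_group -> c i = 0) <-> jet0 a L (v 0).
Proof.
split=> [c0|j0].
  have [K K0 HK] := vertex_small nd c0.
  have ray (q r : R) : 0 < q -> 0 < r -> q + r <= 4 -> ray_O3 a L (v 0) (comb v (- q - r, q, r)).
    move=> q0 r0 qr; exists (K * (q + r) ^+ 3) => //; exists (1 / 10) => [|h /andP[h0 h1]]; first by lra.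
    have bE : bary v (v 0 + h *: comb v (- q - r, q, r)) = (1 - h * (q + r), h * q, h * r).
      rewrite vertex0E combD /= combK//; last by rewrite /sum3 /=; ring.
      by congr (_, _, _); ring.
    have ix : inner v (v 0 + h *: comb v (- q - r, q, r)).
      by rewrite /inner bE /=; split; [nra|rewrite mulr_gt0|rewrite mulr_gt0].
    rewrite tcsE//; apply: (le_trans (HK _ (inner_tri nd ix))); rewrite bE /= -mulrDr exprMn.
    by rewrite le_eqVlt; apply/orP; left; apply/eqP; ring.
  (* The third direction is a third of the sum of the other two; all three point strictly into the
     triangle, where the combination represents the spline. *)
  apply: (@jet0_rays R I a L (v 0) (comb v (-3, 1, 2)) (comb v (-3, 2, 1)) (comb v (-2, 1, 1)) (1/3) (1/3)).
  - rewrite det2_comb /sum3 /=; [|ring|ring]; apply: mulf_neq0 => //; apply/eqP => /= h; lra.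
  - by rewrite /comb; case: (v 0) (v 1) (v 2) => ? ? [? ?] [? ?]; congr (_, _); rewrite /= /GRing.scale /=; field.
  - by rewrite mul1r invr_eq0.
  - by rewrite mul1r invr_eq0.
  - by have := ray 1 2; rewrite (_ : - 1 - 2 = -3); [apply; lra|ring].
  - by have := ray 2 1; rewrite (_ : - 2 - 1 = -3); [apply; lra|ring].
  - by have := ray 1 1; rewrite (_ : - 1 - 1 = -2); [apply; lra|ring].
apply: (vertex_coefs nd); exists 1 => //.
have [C C0 HC] := jet0_ray 0 j0.
pose M := nrm (v 1 - v 0) + nrm (v 2 - v 0).
exists (C * M ^+ 3) => x ix _; rewrite -tcsE//.
have xE : x = v 0 + ((bary v x).1.2 *: (v 1 - v 0) + (bary v x).2 *: (v 2 - v 0)).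
  rewrite -[LHS](baryK nd) /comb; have := sum_bary v x; rewrite /sum3; move: (bary v x) => [[p q] r] /= s1.
  have -> : p = 1 - q - r by lra.
  by case: (v 0) (v 1) (v 2) => ? ? [? ?] [? ?]; congr (_, _); rewrite /= /GRing.scale /=; ring.
rewrite [X in tcs a L X]xE; apply: (le_trans (HC _)); rewrite -mulrA ler_wpM2l// -exprMn.
have [_ y0 z0] := ix; move: (bary v x) y0 z0 => [[p q] r] /= q0 r0.
have M0 : 0 <= M * (q + r) by rewrite mulr_ge0 ?addr_ge0 ?nrm_ge0// ltW.
apply: lerXn2r; rewrite ?nnegrE ?nrm_ge0//.
apply: (@le_trans _ _ (nrm (q *: (v 1 - v 0)) + nrm (r *: (v 2 - v 0)))).
  rewrite /nrm /=; have := ler_normD (q *: (v 1 - v 0)).1 (r *: (v 2 - v 0)).1.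
  have := ler_normD (q *: (v 1 - v 0)).2 (r *: (v 2 - v 0)).2; rewrite /=; lra.
rewrite !nrmZ (gtr0_norm q0) (gtr0_norm r0) /M.
have := nrm_ge0 (v 1 - v 0); have := nrm_ge0 (v 2 - v 0).
by move: (nrm _) (nrm _) => m n *; nra.
Qed.

(** Quadratic decay towards the edge is seen along two transverse rays at the midpoint, which gives
    the 1-jet; one ray suffices for the converse. *)
Lemma edge_jet1 : (forall i, (i < 18)%N -> c i = 0) -> c 18%N = 0 <-> jet1 (comb v (1/2, 1/2, 0)).
Proof.
move=> c0; split=> [c18|j1].
  have [|K K0 HK] := @edge_small _ v nd c.
    by move=> i; rewrite ltnS leq_eqVlt => /predU1P[->//|]; exact: c0.
  have ray (q r : R) : -1 < q -> -1 < r -> q + r = -1 -> forall h : R, 0 < h < 1 / 10 ->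
      `|tcs a L (comb v (1/2, 1/2, 0) + h *: comb v (q, r, 1))| <= K * h ^+ 2.
    move=> q0 r0 qr h /andP[h0 h1].
    have bE : bary v (comb v (1/2, 1/2, 0) + h *: comb v (q, r, 1)) = (1/2 + h * q, 1/2 + h * r, h).
      rewrite combD /= combK//; first by congr (_, _, _); ring.
      have -> : q = -1 - r by lra.
      by rewrite /sum3 /=; field.
    have ix : inner v (comb v (1/2, 1/2, 0) + h *: comb v (q, r, 1)).
      by rewrite /inner bE /=; split; nra.
    by rewrite tcsE//; apply: (le_trans (HK _ (inner_tri nd ix))); rewrite bE.
  have e0 : 0 < 1 / 10 :> R by lra.
  apply: (@jet1_rays _ (comb v (-3/4, -1/4, 1)) (comb v (-1/4, -3/4, 1)) K K _ _ _ e0 e0).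
  - rewrite det2_comb /sum3 /=; [|by field|by field].
    apply: mulf_neq0 => //; apply/eqP => /= h; lra.
  - by apply: ray; lra.
  - by apply: ray; lra.
apply: (edge_coef nd c0); exists 1 => //.
have [C HC] := jet1_ray (comb v (-1/2, -1/2, 1)) j1; exists C => h hh.
have /andP[h0 h1] := hh; rewrite -tcsE; last exact: mid_ray_inner.
have := HC h hh; rewrite combD /mid_ray /=; congr (`|tcs a L (comb v _)| <= _).
by congr (_, _, _); field.
Qed.

(** The coefficient of index 18 must already be known to vanish, because that spline is not covered
    by the bounds at [v31]. Among the remaining ones only [c 21] enters below third order there,
    thanks to the mixed basis. *)
Lemma third_jet0 : (forall i, (i < 19)%N -> c i = 0) -> c 21%N = 0 <-> jet0 a L (comb v (2/3, 1/3, 0)).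
Proof.
move=> c0.
have rayE (ka h : R) : comb v (2/3, 1/3, 0) + h *: comb v (- (1 + ka), ka, 1) = third_ray v ka h.
  by rewrite combD /third_ray /=; congr (comb v _); congr (_, _, _); ring.
split=> [c21|j0].
  have ray (ka : R) : -1 <= ka <= 1 -> ray_O3 a L (comb v (2/3, 1/3, 0)) (comb v (- (1 + ka), ka, 1)).
    move=> hk; have [K K0 HK] := third_small nd hk c0 c21; exists K => //; exists (1 / 100) => [|h hh]; first by lra.
    by rewrite rayE tcsE ?HK//; exact: third_ray_inner.
  apply: (@jet0_rays R I a L _ (comb v (-2, 1, 1)) (comb v (0, -1, 1)) (comb v (-1, 0, 1)) (1/2) (1/2)).
  - rewrite det2_comb /sum3 /=; [|ring|ring]; apply: mulf_neq0 => //; apply/eqP => /= h; lra.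
  - by rewrite /comb; case: (v 0) (v 1) (v 2) => ? ? [? ?] [? ?]; congr (_, _); rewrite /= /GRing.scale /=; field.
  - by rewrite mul1r invr_eq0.
  - by rewrite mul1r invr_eq0.
  - by have := ray 1; rewrite (_ : - (1 + 1) = -2); [apply; apply/andP; split; lra|ring].
  - by have := ray (-1); rewrite (_ : - (1 + -1) = 0); [apply; apply/andP; split; lra|ring].
  - by have := ray 0; rewrite (_ : - (1 + 0) = -1); [apply; apply/andP; split; lra|ring].
have [C C0 HC] := jet0_ray 0 j0.
apply: (third_coef nd c0); exists (1 / 100); first by lra.
exists (C * nrm (comb v (- (1 + 0), 0, 1)) ^+ 3) => h hh; have /andP[h0 h1] := hh.
rewrite -tcsE; last by apply: third_ray_inner => //; apply/andP; split; lra.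
rewrite -rayE; apply: (le_trans (HC _)); rewrite nrmZ (gtr0_norm h0) exprMn.
by rewrite le_eqVlt; apply/orP; left; apply/eqP; ring.
Qed.

End JetsFromBounds.

(** * Hermite data on an edge *)

Section EdgeLemma.
Context {R : realType}.

Definition third_spline (n : nat) (p0 p1 p2 p3 k1 k2 t : R) : R :=
  p0 + p1 * t + p2 * t ^+ 2 + p3 * t ^+ 3 + k1 * pp (3 * t - 1) ^+ n + k2 * pp (3 * t - 2) ^+ n.

Definition is_third_spline (n : nat) (f : R -> R) := exists p0 p1 p2 p3 k1 k2 : R,
  [/\ (n < 3)%N -> p3 = 0, (n < 2)%N -> p2 = 0 & forall t : R, 0 <= t <= 1 -> f t = third_spline n p0 p1 p2 p3 k1 k2 t].

Lemma third_splineD n f g : is_third_spline n f -> is_third_spline n g -> is_third_spline n (fun t => f t + g t).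
Proof.
move=> [p0 [p1 [p2 [p3 [k1 [k2 [h3 h2 E]]]]]]] [q0 [q1 [q2 [q3 [l1 [l2 [h3' h2' E']]]]]]].
exists (p0 + q0), (p1 + q1), (p2 + q2), (p3 + q3), (k1 + l1), (k2 + l2).
split=> [n3|n2|t t01]; first by rewrite h3// h3'// addr0.
  by rewrite h2// h2'// addr0.
by rewrite E// E'// /third_spline; ring.
Qed.

Lemma third_splineZ n f (c : R) : is_third_spline n f -> is_third_spline n (fun t => c * f t).
Proof.
move=> [p0 [p1 [p2 [p3 [k1 [k2 [h3 h2 E]]]]]]].
exists (c * p0), (c * p1), (c * p2), (c * p3), (c * k1), (c * k2).
split=> [n3|n2|t t01]; first by rewrite h3// mulr0.
  by rewrite h2// mulr0.
by rewrite E// /third_spline; ring.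
Qed.

Lemma third_spline0 n : is_third_spline n (fun=> 0).
Proof. by exists 0, 0, 0, 0, 0, 0; split => // t _; rewrite /third_spline; ring. Qed.

Lemma third_spline_sum n (I : finType) (f : I -> R -> R) : (forall i, is_third_spline n (f i)) ->
  is_third_spline n (fun t => \sum_i f i t).
Proof.
move=> H; rewrite (_ : (fun t => _) = \big[(fun f g t => f t + g t)/(fun=> 0)]_i f i).
  by elim/big_ind: _ => // [|f1 f2]; [exact: third_spline0|exact: third_splineD].
by apply/funext => t; elim/big_rec2: _ => // i y1 y2 _ ->.
Qed.

(** A form with end values [al] and [be] on an edge either does not change sign on it or vanishes at
    one of its third points: [be = - 2 * al] puts the zero at 1/3, [al = - 2 * be] at 2/3. *)
Definition good_ends (al be : R) := [\/ 0 <= al /\ 0 <= be, al <= 0 /\ be <= 0, be = - 2 * al | al = - 2 * be].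

Lemma third_spline_pow n (p q : R) : (0 < n <= 3)%N -> is_third_spline n (fun t => (p + q * t) ^+ n).
Proof.
case: n => [|[|[|[|//]]]] // _.
- by exists p, q, 0, 0, 0, 0; split => // t _; rewrite /third_spline; ring.
- by exists (p ^+ 2), (2 * p * q), (q ^+ 2), 0, 0, 0; split => // t _; rewrite /third_spline; ring.
- by exists (p ^+ 3), (3 * p ^+ 2 * q), (3 * p * q ^+ 2), (q ^+ 3), 0, 0; split => // t _; rewrite /third_spline; ring.
Qed.

Lemma third_spline_1 n : is_third_spline n (fun t => pp (3 * t - 1) ^+ n).
Proof. by exists 0, 0, 0, 0, 1, 0; split => // t _; rewrite /third_spline; ring. Qed.
Lemma third_spline_2 n : is_third_spline n (fun t => pp (3 * t - 2) ^+ n).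
Proof. by exists 0, 0, 0, 0, 0, 1; split => // t _; rewrite /third_spline; ring. Qed.

Lemma third_spline_eq n f g : (forall t : R, 0 <= t <= 1 -> f t = g t) -> is_third_spline n g -> is_third_spline n f.
Proof.
move=> fg [p0 [p1 [p2 [p3 [k1 [k2 [h3 h2 E]]]]]]]; exists p0, p1, p2, p3, k1, k2; split => // t t01.
by rewrite fg// E.
Qed.

Lemma pp_opp (u : R) n : (0 < n)%N -> pp (- u) ^+ n = (- u) ^+ n - (-1) ^+ n * pp u ^+ n.
Proof.
move=> n0; rewrite -exprMn mulN1r; have [u0|u0] := leP 0 u.
  by rewrite (pp_neg (_ : - u <= 0)) ?oppr_le0// (pp_pos u0) subrr expr0n eqn0Ngt n0.
have u1 := ltW u0; rewrite (pp_neg u1) oppr0 expr0n eqn0Ngt n0 subr0 pp_pos// oppr_ge0//.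
Qed.

Lemma third_spline_good n (al be : R) : (0 < n <= 3)%N -> good_ends al be ->
  is_third_spline n (fun t => pp (al + t * (be - al)) ^+ n).
Proof.
move=> n3; have /andP[n0 _] := n3.
have scaled (c : R) (u : R -> R) : is_third_spline n (fun t => pp (u t) ^+ n) -> is_third_spline n (fun t => pp (- u t) ^+ n) ->
    is_third_spline n (fun t => pp (c * u t) ^+ n).
  move=> hp hn; have [c0|c0] := leP 0 c.
    by apply: (third_spline_eq _ (third_splineZ (c ^+ n) hp)) => t _; rewrite ppZ// exprMn.
  apply: (third_spline_eq _ (third_splineZ ((- c) ^+ n) hn)) => t _.
  by rewrite -exprMn -ppZ ?mulrNN// oppr_ge0 ltW.
have opp (u : R -> R) (p q : R) : (forall t, - u t = p + q * t) -> is_third_spline n (fun t => pp (u t) ^+ n) ->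
    is_third_spline n (fun t => pp (- u t) ^+ n).
  move=> uE hu; apply: (third_spline_eq (g := fun t => (p + q * t) ^+ n + (- (-1) ^+ n) * pp (u t) ^+ n)).
    by move=> t _; rewrite pp_opp// uE mulNr.
  by apply: third_splineD; [exact: third_spline_pow|exact: third_splineZ].
move=> [[a0 b0]|[a0 b0]|->|->].
- apply: (third_spline_eq (g := fun t => (al + (be - al) * t) ^+ n)); last exact: third_spline_pow.
  by move=> t /andP[t0 t1]; rewrite pp_pos; [rewrite [t * _]mulrC|nra].
- apply: (third_spline_eq (g := fun=> 0)); last exact: third_spline0.
  by move=> t /andP[t0 t1]; rewrite pp_neg; [rewrite expr0n eqn0Ngt n0|nra].
- apply: (third_spline_eq (g := fun t => pp ((- al) * (3 * t - 1)) ^+ n)).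
    by move=> t _; congr (pp _ ^+ n); ring.
  by apply: scaled; [exact: third_spline_1|apply: (opp _ 1 (-3)); [move=> t; ring|exact: third_spline_1]].
- apply: (third_spline_eq (g := fun t => pp (be * (3 * t - 2)) ^+ n)).
    by move=> t _; congr (pp _ ^+ n); ring.
  by apply: scaled; [exact: third_spline_2|apply: (opp _ 2 (-3)); [move=> t; ring|exact: third_spline_2]].
Qed.

Lemma linear_O2 (p0 p1 C e : R) : 0 < e -> (forall h : R, 0 < h < e -> `|p0 + p1 * h| <= C * h ^+ 2) -> p0 = 0 /\ p1 = 0.
Proof.
move=> e0 H; have [||_ -> ->] := @quadratic_O3 R 0 p0 p1 C e => //.
move=> h /andP[h0 he]; have -> : 0 + p0 * h + p1 * h ^+ 2 = h * (p0 + p1 * h) by ring.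
rewrite normrM (gtr0_norm h0) exprS mulrCA ler_pM2l//; apply: H; by rewrite h0.
Qed.

(** Such cubic splines form a space of dimension 6, matched by the 2-jets at both ends. In the next
    two lemmas, degree 2 has dimension 5, matched by two 1-jets and the midpoint value, and degree 1
    has dimension 4, matched by the values at the ends and at the third points. *)
Lemma third_spline3_zero f (C : R) : is_third_spline 3 f ->
  (forall t : R, 0 <= t <= 1 -> `|f t| <= C * t ^+ 3) -> (forall t : R, 0 <= t <= 1 -> `|f t| <= C * (1 - t) ^+ 3) ->
  forall t : R, 0 <= t <= 1 -> f t = 0.
Proof.
move=> [p0 [p1 [p2 [p3 [k1 [k2 [_ _ E]]]]]]] H0 H1.
have e3 : 0 < 1 / 3 :> R by lra.
have [z0 z1 z2] : [/\ p0 = 0, p1 = 0 & p2 = 0].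
  apply: (@quadratic_O3 R _ _ _ (C + `|p3|) (1 / 3) e3) => h /andP[h0 h1].
  have h01 : 0 <= h <= 1 by apply/andP; split; lra.
  have := H0 h h01; rewrite E// /third_spline !pp_neg; [|lra|lra]; rewrite !expr0n /= !mulr0 !addr0 => K.
  have -> : p0 + p1 * h + p2 * h ^+ 2 = (p0 + p1 * h + p2 * h ^+ 2 + p3 * h ^+ 3) - p3 * h ^+ 3 by ring.
  apply: (le_trans (ler_normB _ _)); rewrite [leRHS]mulrDl lerD//.
  by rewrite normrM [`|h ^+ 3|]ger0_norm// exprn_ge0// ltW.
(* The coefficients of 1, [h] and [h^2] in the expansion at [t = 1 - h], where both truncated powers
   are active. *)
have [w0 w1 w2] : [/\ p3 + 8 * k1 + k2 = 0, - (3 * p3 + 36 * k1 + 9 * k2) = 0 & 3 * p3 + 54 * k1 + 27 * k2 = 0].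
  apply: (@quadratic_O3 R _ _ _ (C + `|p3 + 27 * k1 + 27 * k2|) (1 / 3) e3) => h /andP[h0 h1].
  have h01 : 0 <= 1 - h <= 1 by apply/andP; split; lra.
  have := H1 (1 - h) h01; rewrite E// /third_spline z0 z1 z2 !pp_pos; [|lra|lra].
  rewrite (_ : 1 - (1 - h) = h); last by ring.
  have -> : p3 + 8 * k1 + k2 + - (3 * p3 + 36 * k1 + 9 * k2) * h + (3 * p3 + 54 * k1 + 27 * k2) * h ^+ 2 =
   (0 + 0 * (1 - h) + 0 * (1 - h) ^+ 2 + p3 * (1 - h) ^+ 3 + k1 * (3 * (1 - h) - 1) ^+ 3 + k2 * (3 * (1 - h) - 2) ^+ 3) +
   (p3 + 27 * k1 + 27 * k2) * h ^+ 3 by ring.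
  move=> K; apply: (le_trans (ler_normD _ _)); rewrite [leRHS]mulrDl lerD//.
  by rewrite normrM [`|h ^+ 3|]ger0_norm// exprn_ge0// ltW.
have [y3 y1 y2] : [/\ p3 = 0, k1 = 0 & k2 = 0] by split; lra.
by move=> t t01; rewrite E// /third_spline z0 z1 z2 y3 y1 y2; ring.
Qed.

Lemma third_spline2_zero f (C : R) : is_third_spline 2 f ->
  (forall t : R, 0 <= t <= 1 -> `|f t| <= C * t ^+ 2) -> (forall t : R, 0 <= t <= 1 -> `|f t| <= C * (1 - t) ^+ 2) ->
  f (1 / 2) = 0 -> forall t : R, 0 <= t <= 1 -> f t = 0.
Proof.
move=> [p0 [p1 [p2 [p3 [k1 [k2 [h3 _ E]]]]]]] H0 H1 Hm; have {}h3 := h3 isT.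
have e3 : 0 < 1 / 3 :> R by lra.
have [z0 z1] : p0 = 0 /\ p1 = 0.
  apply: (@linear_O2 _ _ (C + `|p2|) (1 / 3) e3) => h /andP[h0 h1].
  have h01 : 0 <= h <= 1 by apply/andP; split; lra.
  have := H0 h h01; rewrite E// /third_spline h3 !pp_neg; [|lra|lra]; rewrite !expr0n /= !mulr0 mul0r !addr0 => K.
  have -> : p0 + p1 * h = (p0 + p1 * h + p2 * h ^+ 2) - p2 * h ^+ 2 by ring.
  apply: (le_trans (ler_normB _ _)); rewrite [leRHS]mulrDl lerD//.
  by rewrite normrM [`|h ^+ 2|]ger0_norm// exprn_ge0// ltW.
have [w0 w1] : p2 + 4 * k1 + k2 = 0 /\ - (2 * p2 + 12 * k1 + 6 * k2) = 0.
  apply: (@linear_O2 _ _ (C + `|p2 + 9 * k1 + 9 * k2|) (1 / 3) e3) => h /andP[h0 h1].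
  have h01 : 0 <= 1 - h <= 1 by apply/andP; split; lra.
  have := H1 (1 - h) h01; rewrite E// /third_spline z0 z1 h3 !pp_pos; [|lra|lra].
  rewrite (_ : 1 - (1 - h) = h); last by ring.
  have -> : p2 + 4 * k1 + k2 + - (2 * p2 + 12 * k1 + 6 * k2) * h =
   (0 + 0 * (1 - h) + p2 * (1 - h) ^+ 2 + 0 * (1 - h) ^+ 3 + k1 * (3 * (1 - h) - 1) ^+ 2 + k2 * (3 * (1 - h) - 2) ^+ 2) -
   (p2 + 9 * k1 + 9 * k2) * h ^+ 2 by ring.
  move=> K; apply: (le_trans (ler_normB _ _)); rewrite [leRHS]mulrDl lerD//.
  by rewrite normrM [`|h ^+ 2|]ger0_norm// exprn_ge0// ltW.
have m01 : (0 <= (1 / 2 : R)) && ((1 / 2 : R) <= 1) by apply/andP; split; lra.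
have wm : p2 / 4 + k1 / 4 = 0.
  rewrite -Hm E// /third_spline z0 z1 h3 (pp_neg (_ : 3 * (1 / 2) - 2 <= 0)); last by lra.
  by rewrite pp_pos; [field|lra].
have [y3 y1 y2] : [/\ p2 = 0, k1 = 0 & k2 = 0] by split; lra.
by move=> t t01; rewrite E// /third_spline z0 z1 h3 y3 y1 y2; ring.
Qed.

Lemma third_spline1_zero f : is_third_spline 1 f -> f 0 = 0 -> f (1 / 3) = 0 -> f (2 / 3) = 0 -> f 1 = 0 ->
  forall t : R, 0 <= t <= 1 -> f t = 0.
Proof.
move=> [p0 [p1 [p2 [p3 [k1 [k2 [h3 h2 E]]]]]]]; have {}h3 := h3 isT; have {}h2 := h2 isT.
rewrite (E 0) ?(E (1 / 3)) ?(E (2 / 3)) ?(E 1) /third_spline ?h3 ?h2; try (by apply/andP; split; lra).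
rewrite !(pp_neg (_ : 3 * 0 - _ <= 0)); [|lra|lra]; rewrite !(pp_neg (_ : 3 * (1 / 3) - _ <= 0)); [|lra|lra].
rewrite (pp_neg (_ : 3 * (2 / 3) - 2 <= 0)); [|lra]; rewrite (@pp_pos _ (3 * (2 / 3) - 1)); [|lra].
rewrite !(@pp_pos _ (3 * 1 - _)); [|lra|lra]; rewrite !expr1 => e0 e1 e2 e3.
have [y0 y1 y2 y3] : [/\ p0 = 0, p1 = 0, k1 = 0 & k2 = 0] by split; lra.
by move=> t t01; rewrite E// /third_spline y0 y1 h3 h2 y2 y3; ring.
Qed.

Lemma tcs2_span (I : finType) (a : I -> R) (L : I -> R * @pt R) x u w (p q p' q' : R) :
  tcs2 a L x u u = 0 -> tcs2 a L x w u = 0 -> tcs2 a L x w w = 0 -> tcs2 a L x (p *: u + q *: w) (p' *: u + q' *: w) = 0.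
Proof.
move=> uu wu ww; rewrite tcs2D !tcs2Z ![tcs2 _ _ _ (_ + _) _]tcs2C !tcs2D !tcs2Z uu ww wu [tcs2 _ _ _ u w]tcs2C wu.
by rewrite !(mulr0, addr0).
Qed.

Section EdgeJets.
Context {I : finType}.
Variables (a : I -> R) (L : I -> R * @pt R) (A B N : @pt R).
Hypothesis good : forall i, good_ends (aff (L i) A) (aff (L i) B).
Hypothesis transverse : det2 (B - A) N != 0.
Hypothesis jA : jet0 a L A.
Hypothesis jB : jet0 a L B.
Local Notation T := (B - A).
Local Notation x t := (A + t *: T).
Hypothesis mid1 : tcs1 a L (x (1 / 2)) N = 0.
Hypothesis third1 : tcs2 a L (x (1 / 3)) N N = 0.
Hypothesis third2 : tcs2 a L (x (2 / 3)) N N = 0.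

Lemma aff_edge i (t : R) : aff (L i) (x t) = aff (L i) A + t * (aff (L i) B - aff (L i) A).
Proof. by rewrite affD linZ; congr (_ + _ * _); rewrite /aff /lin /=; ring. Qed.

Lemma from_end (t : R) : x t = B + (1 - t) *: (A - B).
Proof. by case: A B => [? ?] [? ?]; congr (_, _); rewrite /= /GRing.scale /=; ring. Qed.

Lemma edge_spline3 : is_third_spline 3 (fun t => tcs a L (x t)).
Proof.
apply: third_spline_sum => i; apply: third_splineZ.
by apply: (third_spline_eq _ (third_spline_good _ (good i))) => // t _; rewrite aff_edge.
Qed.

Lemma edge_spline2 : is_third_spline 2 (fun t => tcs1 a L (x t) N).
Proof.
apply: third_spline_sum => i; apply: third_splineZ.
apply: (third_spline_eq _ (third_splineZ (3 * lin (L i) N) (third_spline_good (n := 2) _ (good i)))) => // t _.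
by rewrite aff_edge; ring.
Qed.

Lemma edge_spline1 : is_third_spline 1 (fun t => tcs2 a L (x t) N N).
Proof.
apply: third_spline_sum => i; apply: third_splineZ.
apply: (third_spline_eq _ (third_splineZ (6 * (lin (L i) N * lin (L i) N)) (third_spline_good (n := 1) _ (good i)))) => // t _.
by rewrite aff_edge expr1; ring.
Qed.

Lemma edge_value0 (t : R) : 0 <= t <= 1 -> tcs a L (x t) = 0.
Proof.
have [C C0 HC] := jet0_ray 0 jA; have [C' C'0 HC'] := jet0_ray 0 jB.
apply: (@third_spline3_zero _ (C * nrm T ^+ 3 + C' * nrm (A - B) ^+ 3) edge_spline3) => {}t /andP[t0 t1].
  apply: (le_trans (HC _)); rewrite nrmZ (ger0_norm t0) exprMn.
  rewrite (_ : C * _ = C * nrm T ^+ 3 * t ^+ 3); last by ring.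
  rewrite ler_wpM2r ?exprn_ge0//.
  by rewrite lerDl mulr_ge0// exprn_ge0// nrm_ge0.
have s0 : 0 <= 1 - t by lra.
rewrite from_end; apply: (le_trans (HC' _)); rewrite nrmZ (ger0_norm s0) exprMn.
rewrite (_ : C' * _ = C' * nrm (A - B) ^+ 3 * (1 - t) ^+ 3); last by ring.
rewrite ler_wpM2r ?exprn_ge0//.
by rewrite lerDr mulr_ge0// exprn_ge0// nrm_ge0.
Qed.

Lemma edge_normal0 (t : R) : 0 <= t <= 1 -> tcs1 a L (x t) N = 0.
Proof.
have [C C0 HC] := tcs_taylor a L; have [zA zA1 zA2] := jA; have [zB zB1 zB2] := jB.
apply: (@third_spline2_zero _ (C * nrm N * nrm T ^+ 2 + C * nrm N * nrm (A - B) ^+ 2) edge_spline2) => // {}t /andP[t0 t1].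
  have [_ H _] := HC A; have := H N (t *: T); rewrite zA1 zA2 !subr0 nrmZ (ger0_norm t0) => K.
  apply: (le_trans K); rewrite exprMn.
  rewrite (_ : C * _ = C * nrm N * nrm T ^+ 2 * t ^+ 2); last by ring.
  by rewrite ler_wpM2r ?exprn_ge0// lerDl !mulr_ge0 ?exprn_ge0 ?nrm_ge0.
have s0 : 0 <= 1 - t by lra.
have [_ H _] := HC B; have := H N ((1 - t) *: (A - B)); rewrite zB1 zB2 !subr0 nrmZ (ger0_norm s0) -from_end => K.
apply: (le_trans K); rewrite exprMn.
rewrite (_ : C * _ = C * nrm N * nrm (A - B) ^+ 2 * (1 - t) ^+ 2); last by ring.
by rewrite ler_wpM2r ?exprn_ge0// lerDr !mulr_ge0 ?exprn_ge0 ?nrm_ge0.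
Qed.

Lemma edge_normal2 (t : R) : 0 <= t <= 1 -> tcs2 a L (x t) N N = 0.
Proof.
have [zA zA1 zA2] := jA; have [zB zB1 zB2] := jB.
apply: (third_spline1_zero edge_spline1) => //; first by rewrite scale0r addr0.
by rewrite from_end subrr scale0r addr0.
Qed.

(** The value, the normal derivative and the second normal derivative vanish along the edge. The
    tangential and mixed entries of the 2-jet follow by moving along the edge, and the end [t = 1]
    is covered by hypothesis. *)
Lemma edge_jet0 (t : R) : 0 <= t <= 1 -> jet0 a L (x t).
Proof.
move=> t01; have [->|tn1] := eqVneq t 1; first by rewrite from_end subrr scale0r addr0.
have /andP[t0 t1] := t01; have {}t1 : t < 1 by rewrite lt_neqAle tn1.
have step (h : R) : x t + h *: T = x (t + h) by rewrite scalerDl addrA.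
have [v0 vT vTT] : [/\ tcs a L (x t) = 0, tcs1 a L (x t) T = 0 & tcs2 a L (x t) T T = 0].
  apply: ray_O3P; exists 0 => //; exists (1 - t) => [|h /andP[h0 h1]]; first by rewrite subr_gt0.
  by rewrite mul0r step edge_value0 ?normr0//; apply/andP; split; lra.
have vN := edge_normal0 t01; have vNN := edge_normal2 t01.
(* The normal derivative vanishes at all nearby points of the edge, so its Taylor expansion along
   the edge has no linear term. *)
have vNT : tcs2 a L (x t) N T = 0.
  have [C C0 HC] := tcs_taylor a L; have [_ H _] := HC (x t).
  have [||z0 z1] := @linear_O2 0 (tcs2 a L (x t) N T) (C * (nrm N * nrm T ^+ 2)) (1 - t); first by rewrite subr_gt0.
    move=> h /andP[h0 h1]; have := H N (h *: T); rewrite step !edge_normal0 ?t01//; last by apply/andP; split; lra.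
    rewrite !sub0r oppr0 add0r normrN tcs2Z nrmZ (gtr0_norm h0) exprMn add0r mulrC => K.
    by apply: (le_trans K); rewrite le_eqVlt; apply/orP; left; apply/eqP; ring.
  by [].
have dec (y : @pt R) : exists p q : R, y = p *: T + q *: N.
  exists (det2 y N / det2 T N), (det2 T y / det2 T N); move: transverse; case: (T) (N) y => [? ?] [? ?] [? ?].
  by rewrite /det2 /= => D0; congr (_, _); rewrite /= /GRing.scale /=; field.
split => // [y|y z].
  by have [p [q ->]] := dec y; rewrite tcs1D !tcs1Z vT vN !mulr0 addr0.
by have [p [q ->]] := dec y; have [p' [q' ->]] := dec z; apply: tcs2_span.
Qed.

End EdgeJets.

End EdgeLemma.

(** * Unisolvence on a triangle *)

Definition functional := (nat * Z3 * Z3 * Z3)%type.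

(* The entries [(k, z, u, w)] are value, first or second derivative ([k] = 0, 1, 2) at the point with
   barycentric coordinates proportional to [z], in the directions [u], [w]. *)
Definition functionals : seq functional :=
  [:: (0%N, (1,0,0), (0,0,0), (0,0,0));
  (1%N, (1,0,0), (-1,1,0), (0,0,0));
  (1%N, (1,0,0), (-1,0,1), (0,0,0));
  (2%N, (1,0,0), (-1,1,0), (-1,1,0));
  (2%N, (1,0,0), (-1,1,0), (-1,0,1));
  (2%N, (1,0,0), (-1,0,1), (-1,0,1));
  (0%N, (0,1,0), (0,0,0), (0,0,0));
  (1%N, (0,1,0), (0,-1,1), (0,0,0));
  (1%N, (0,1,0), (1,-1,0), (0,0,0));
  (2%N, (0,1,0), (0,-1,1), (0,-1,1));
  (2%N, (0,1,0), (0,-1,1), (1,-1,0));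
  (2%N, (0,1,0), (1,-1,0), (1,-1,0));
  (0%N, (0,0,1), (0,0,0), (0,0,0));
  (1%N, (0,0,1), (1,0,-1), (0,0,0));
  (1%N, (0,0,1), (0,1,-1), (0,0,0));
  (2%N, (0,0,1), (1,0,-1), (1,0,-1));
  (2%N, (0,0,1), (1,0,-1), (0,1,-1));
  (2%N, (0,0,1), (0,1,-1), (0,1,-1));
  (1%N, (0,1,1), (2,-1,-1), (0,0,0));
  (2%N, (0,2,1), (2,-1,-1), (2,-1,-1));
  (2%N, (0,1,2), (2,-1,-1), (2,-1,-1));
  (1%N, (1,0,1), (-1,2,-1), (0,0,0));
  (2%N, (1,0,2), (-1,2,-1), (-1,2,-1));
  (2%N, (2,0,1), (-1,2,-1), (-1,2,-1));
  (1%N, (1,1,0), (-1,-1,2), (0,0,0));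
  (2%N, (2,1,0), (-1,-1,2), (-1,-1,2));
  (2%N, (1,2,0), (-1,-1,2), (-1,-1,2));
  (0%N, (1,1,1), (0,0,0), (0,0,0))]%Zb.

(** The factors 3 and 6 of the derivatives and the normalization of the point are dropped, to stay
    in integers. Each functional changes by a nonzero factor, which does not affect its
    vanishing. *)
Definition functional_value (f : functional) (n : Z3) : Z :=
  let: (k, z, u, w) := f in let p := Z.max 0 (dotz n z) in
  match k with 0%N => p * p * p | 1%N => p * p * dotz n u | _ => p * (dotz n u * dotz n w) end%Zb.

(* 1296 times the inverse of the matrix of the 28 functionals on the 28 truncated cubes. *)
Definition scaled_inverse : seq (seq Z) :=
  [:: [:: -15957; -5589; -6480; -54; 1728; -468; -31995; -32157; -648; -3843; -7830; 4293; -33696; -9558; -23895; -2988; 270; -5121; -5508; -630; -378; -1134; -162; 126; -162; -126; -180; 3024];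
  [:: -24219; -26325; 11826; -21375; 25542; -6741; -28350; -2106; -22923; -2322; 2214; -5085; -29079; -17415; -16038; -3276; -2484; -3888; -1134; -126; -18; -1134; -630; 1404; -5508; 162; 126; 3024];
  [:: -34182; -48762; 5103; -6273; -16092; 9882; -31509; -15309; -7047; -14409; 14364; -3906; -15957; 14094; -26163; 3753; 1728; -4275; -4536; -486; 126; 3240; -126; 144; -5508; -1926; 1404; 3024];
  [:: 9072; 4212; 6318; 1368; 756; 1242; 8100; 6318; 972; 1062; -540; 1008; 6156; 486; 810; 486; -2808; 342; 1296; -108; 180; 1296; 36; 252; 324; -36; 108; -864];
  [:: 10530; 10692; -648; -2268; 8856; -6138; 9072; 648; 8100; -1224; 1728; 1404; 3726; 162; 648; -72; -1512; -288; 324; -36; 108; 324; -108; 504; 2268; 684; 252; -864];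
  [:: 3726; 162; 648; -72; -1512; -288; 10530; 8586; 3564; -2106; 5940; -954; 9072; 4212; 6318; 1368; 756; 1242; 1296; 36; 252; 324; -36; 108; 324; -108; 504; -864];
  [:: -162; -756; -216; -276; -432; -30; 162; 216; 108; 30; 432; -372; 0; 54; -54; -24; 0; 24; 0; 60; -24; 0; 24; -60; 0; 24; -24; 0];
  [:: -1458; -1404; -1512; 1515; -3888; 1563; 567; -108; 513; 372; -432; 132; 891; 945; 756; 192; 432; 276; 0; 24; -24; 0; 60; -186; 0; -138; -60; 0];
  [:: 891; 945; 756; 192; 432; 276; -729; -594; -864; 1272; -1944; 267; -162; -756; -216; -276; -432; -30; 0; 24; -60; 0; 24; -24; 0; 60; -186; 0];
  [:: -2592; -612; -612; -156; 768; -156; -3888; -1908; -1908; -156; -528; -156; -2592; -612; -612; -156; 768; -156; -360; -32; -32; -360; -32; -32; -360; -32; -32; 384];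
  [:: 243; 3159; -2673; 675; 648; -1188; 972; -486; 1215; 0; -162; 297; -1215; -1458; 486; -351; 162; 0; 0; 0; 0; -486; 0; -54; 486; 108; 0; 0];
  [:: 243; -2673; 3159; -1188; 648; 675; -1215; 486; -1458; 0; 162; -351; 972; 1215; -486; 297; -162; 0; 0; 0; 0; 486; 0; 108; -486; -54; 0; 0];
  [:: 972; 1215; -486; 297; -162; 0; 243; -2673; 3159; -1188; 648; 675; -1215; 486; -1458; 0; 162; -351; -486; -54; 0; 0; 0; 0; 486; 0; 108; 0];
  [:: -1215; -1458; 486; -351; 162; 0; 243; 3159; -2673; 675; 648; -1188; 972; -486; 1215; 0; -162; 297; 486; 108; 0; 0; 0; 0; -486; 0; -54; 0];
  [:: 972; -486; 1215; 0; -162; 297; -1215; -1458; 486; -351; 162; 0; 243; 3159; -2673; 675; 648; -1188; -486; 0; -54; 486; 108; 0; 0; 0; 0; 0];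
  [:: -1215; 486; -1458; 0; 162; -351; 972; 1215; -486; 297; -162; 0; 243; -2673; 3159; -1188; 648; 675; 486; 0; 108; -486; -54; 0; 0; 0; 0; 0];
  [:: -2808; -2916; 270; -648; -108; 186; -2808; 270; -2916; 186; -108; -648; -2160; -1242; -1242; -186; -216; -186; 0; 12; -12; 0; -12; 12; -540; -36; -36; 288];
  [:: 459; 369; 54; 83; -6; 13; 432; 18; 351; 8; -78; 145; 405; 207; 216; 44; 12; 40; 18; -10; 6; 18; 2; 0; 72; 2; 6; -48];
  [:: 432; 18; 351; 8; -78; 145; 405; 207; 216; 44; 12; 40; 459; 369; 54; 83; -6; 13; 18; 2; 0; 72; 2; 6; 18; -10; 6; -48];
  [:: -1350; -756; -459; -174; 90; -171; -1188; -378; -378; -114; 252; -114; -1350; -459; -756; -171; 90; -174; -162; -18; 6; -108; -6; -6; -162; 6; -18; 144];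
  [:: 432; 351; 18; 145; -78; 8; 459; 54; 369; 13; -6; 83; 405; 216; 207; 40; 12; 44; 18; 0; 2; 18; 6; -10; 72; 6; 2; -48];
  [:: -1350; -459; -756; -171; 90; -174; -1350; -756; -459; -174; 90; -171; -1188; -378; -378; -114; 252; -114; -162; 6; -18; -162; -18; 6; -108; -6; -6; 144];
  [:: -2808; 270; -2916; 186; -108; -648; -2160; -1242; -1242; -186; -216; -186; -2808; -2916; 270; -648; -108; 186; 0; -12; 12; -540; -36; -36; 0; 12; -12; 288];
  [:: 459; 54; 369; 13; -6; 83; 405; 216; 207; 40; 12; 44; 432; 351; 18; 145; -78; 8; 18; 6; -10; 72; 6; 2; 18; 0; 2; -48];
  [:: -1188; -378; -378; -114; 252; -114; -1350; -459; -756; -171; 90; -174; -1350; -756; -459; -174; 90; -171; -108; -6; -6; -162; 6; -18; -162; -18; 6; 144];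
  [:: 405; 216; 207; 40; 12; 44; 432; 351; 18; 145; -78; 8; 459; 54; 369; 13; -6; 83; 72; 6; 2; 18; 0; 2; 18; 6; -10; -48];
  [:: 405; 207; 216; 44; 12; 40; 459; 369; 54; 83; -6; 13; 432; 18; 351; 8; -78; 145; 72; 2; 6; 18; -10; 6; 18; 2; 0; -48];
  [:: -2160; -1242; -1242; -186; -216; -186; -2808; -2916; 270; -648; -108; 186; -2808; 270; -2916; 186; -108; -648; -540; -36; -36; 0; 12; -12; 0; -12; 12; 288]]%Zb.

Definition sumZ (s : seq Z) : Z := foldr Z.add 0%Zb s.

Lemma scaled_inverseP : all (fun j => all (fun i =>
  (sumZ (map (fun r => nth 0%Zb (nth [::] scaled_inverse j) r *
     functional_value (nth (0%N, (0,0,0), (0,0,0), (0,0,0)) functionals r) (cube_vec i)) (iota 0 28))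
   =? (if i == j then 1296 else 0))%Zb) (iota 0 28)) (iota 0 28).
Proof. by vm_compute. Qed.

Definition functional_wf (f : functional) : bool :=
  let: (k, z, u, w) := f in [&& 0 <? sumz z, sumz u =? 0 & sumz w =? 0]%Zb.
Lemma functionals_wf : all functional_wf functionals. Proof. by vm_compute. Qed.

Section Unisolvence.
Context {R : realType}.
Variable v : 'I_3 -> @pt R.
Hypothesis nd : Defs.nondegenerate v.
Variable a : 'I_28 -> R.
Local Notation L := (cube_form v).

Definition zpoint (z : Z3) : @pt R := comb v ((zr (sumz z))^-1 *: zr3 z).

Lemma aff_zpoint n z : (0 <? sumz z)%Zb -> aff (bform v (zr3 n)) (zpoint z) = (zr (sumz z))^-1 * zr (dotz n z).
Proof.
rewrite -(@zr_gt0 R) => s0; rewrite aff_bform /zpoint combK//.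
  by rewrite -dot_zr /dot3 /= /GRing.scale /=; ring.
by rewrite /sum3 /= /GRing.scale /= -!mulrDr -[_ + _ + _]/(sum3 (zr3 z)) sum_zr mulVf// gt_eqF.
Qed.

Lemma lin_zdir n u : (sumz u =? 0)%Zb -> lin (bform v (zr3 n)) (comb v (zr3 u)) = zr (dotz n u).
Proof.
move=> /Z.eqb_spec s0; rewrite lin_bform dcombK// ?dot_zr//.
by rewrite sum_zr s0.
Qed.

Lemma pp_zr (c : R) z : 0 < c -> pp (c^-1 * zr z) = c^-1 * zr (Z.max 0 z).
Proof.
move=> c0; rewrite ppZ ?invr_ge0 ?ltW//; congr (_ * _); rewrite ppE zr_le0.
by case: Z.leb_spec => h; [rewrite Z.max_r|rewrite Z.max_l//; lia].
Qed.

Definition vanishes (f : functional) : Prop :=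
  let: (k, z, u, w) := f in
  match k with 0%N => tcs a L (zpoint z) = 0 | 1%N => tcs1 a L (zpoint z) (comb v (zr3 u)) = 0
  | _ => tcs2 a L (zpoint z) (comb v (zr3 u)) (comb v (zr3 w)) = 0 end.

Lemma vanishes_sum f : functional_wf f -> vanishes f -> \sum_i a i * zr (functional_value f (cube_vec i)) = 0.
Proof.
case: f => [[[k z] u] w] /= /and3P[sz su sw]; have s0 : 0 < @zr R (sumz z) by rewrite zr_gt0.
have si : (@zr R (sumz z))^-1 != 0 by rewrite invr_eq0 gt_eqF.
case: k => [|[|k]] /= H.
- apply: (mulfI (expf_neq0 3 si)); rewrite mulr0 -[RHS]H mulr_sumr; apply: eq_bigr => i _.
  by rewrite /cube_form aff_zpoint// pp_zr// !zrM; ring.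
- apply: (mulfI (mulf_neq0 (_ : 3 != 0) (expf_neq0 2 si))); rewrite ?pnatr_eq0// mulr0 -[RHS]H mulr_sumr; apply: eq_bigr => i _.
  by rewrite /cube_form aff_zpoint// lin_zdir// pp_zr// !zrM; ring.
- apply: (mulfI (mulf_neq0 (_ : 6 != 0) si)); rewrite ?pnatr_eq0// mulr0 -[RHS]H mulr_sumr; apply: eq_bigr => i _.
  by rewrite /cube_form aff_zpoint// !lin_zdir// pp_zr// !zrM; ring.
Qed.

Lemma zr_sumZ s : @zr R (sumZ s) = \sum_(z <- s) zr z.
Proof. by elim: s => [|z s IH]; rewrite ?big_nil// big_cons /= zrD IH. Qed.

Lemma tcs_unisolvent : (forall f, f \in functionals -> vanishes f) -> forall i, a i = 0.
Proof.
move=> H j; have n0 : (@zr R 1296) != 0 by rewrite zr_eq0.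
apply: (mulfI n0); rewrite mulr0.
pose M r := @zr R (nth 0%Zb (nth [::] scaled_inverse j) r).
pose F r i := @zr R (functional_value (nth (0%N, (0,0,0), (0,0,0), (0,0,0))%Zb functionals r) (cube_vec i)).
have E i : (i < 28)%N -> \sum_(r <- iota 0 28) M r * F r i = if i == j then @zr R 1296 else 0.
  move=> i28; have := allP (allP scaled_inverseP j _) i _; rewrite !mem_iota add0n ltn_ord => /(_ isT i28) /Z.eqb_spec.
  move=> /(congr1 (@zr R)); rewrite zr_sumZ big_map [RHS]fun_if => <-.
  by apply: eq_bigr => r _; rewrite zrM.
have -> : zr 1296 * a j = \sum_(i < 28) a i * (\sum_(r <- iota 0 28) M r * F r i).
  rewrite (bigD1 j)//= E// eqxx big1 ?addr0 1?mulrC// => i ij.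
  by rewrite E// (negPf (_ : nat_of_ord i != j)) ?mulr0.
under eq_bigr do rewrite mulr_sumr.
rewrite exchange_big; apply: big1_seq => r /andP[_]; rewrite mem_iota => /andP[_ r28].
have rF : nth (0%N, (0,0,0), (0,0,0), (0,0,0))%Zb functionals r \in functionals by apply: mem_nth.
have := vanishes_sum (allP functionals_wf _ rF) (H _ rF) => S0.
rewrite -[RHS](mulr0 (M r)) -[in RHS]S0 mulr_sumr; apply: eq_bigr => i _.
by rewrite /F; ring.
Qed.

(** All functionals other than the value at the barycentre are entries of 2-jets at points of the
    edges. *)
Lemma tcs_unisolvent_edges : (forall k1 k2 (t : R), 0 <= t <= 1 -> jet0 a L (v k1 + t *: (v k2 - v k1))) ->
  tcs a L (centroid v) = 0 -> forall i, a i = 0.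
Proof.
move=> H Hc; apply: tcs_unisolvent.
have [z0 z1 z2 z3] : [/\ @zr R 0 = 0, @zr R 1 = 1, @zr R 2 = 2 & @zr R 3 = 3] by [].
have t0 : (0 <= (0 : R)) && ((0 : R) <= 1) by rewrite lexx ler01.
have t1 : (0 <= (1 / 3 : R)) && ((1 / 3 : R) <= 1) by apply/andP; split; lra.
have t2 : (0 <= (2 / 3 : R)) && ((2 / 3 : R) <= 1) by apply/andP; split; lra.
have tm : (0 <= (1 / 2 : R)) && ((1 / 2 : R) <= 1) by apply/andP; split; lra.
have P k1 k2 t (t01 : 0 <= t <= 1) x : v k1 + t *: (v k2 - v k1) = x -> jet0 a L x by move=> <-; exact: H.
have c : zpoint (1,1,1)%Zb = centroid v.
  by rewrite /zpoint /centroid /zr3 /sumz /= z3 z1; congr comb; congr (_, _, _); rewrite /= /GRing.scale /=; field.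
have jets z : z \in [:: (1,0,0); (0,1,0); (0,0,1); (0,1,1); (1,0,1); (1,1,0); (0,2,1); (0,1,2); (1,0,2); (2,0,1); (2,1,0); (1,2,0)]%Zb ->
    jet0 a L (zpoint z).
  rewrite !inE => /or4P[/eqP ->|/eqP ->|/eqP ->|/or4P[/eqP ->|/eqP ->|/eqP ->|/or4P[/eqP ->|/eqP ->|/eqP ->|/or3P[/eqP ->|/eqP ->|/eqP ->]]]];
    [apply: (P 0 1 0 t0)|apply: (P 1 0 0 t0)|apply: (P 2 0 0 t0)|apply: (P 1 2 (1 / 2) tm)|apply: (P 0 2 (1 / 2) tm)
    |apply: (P 0 1 (1 / 2) tm)|apply: (P 1 2 (1 / 3) t1)|apply: (P 1 2 (2 / 3) t2)|apply: (P 0 2 (2 / 3) t2)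
    |apply: (P 0 2 (1 / 3) t1)|apply: (P 0 1 (1 / 3) t1)|apply: (P 0 1 (2 / 3) t2)];
    rewrite /zpoint /comb /zr3 /sumz /= ?z0 ?z1 ?z2 ?z3; case: (v 0) (v 1) (v 2) => ? ? [? ?] [? ?];
    congr (_, _); rewrite /= /GRing.scale /=; by field.
move=> f fF; have : f \in functionals by []; rewrite /functionals.
have : all (fun f : functional => let: (k, z, u, w) := f in (k == 0%N) && (z == (1,1,1)%Zb) ||
  (z \in [:: (1,0,0); (0,1,0); (0,0,1); (0,1,1); (1,0,1); (1,1,0); (0,2,1); (0,1,2); (1,0,2); (2,0,1); (2,1,0); (1,2,0)]%Zb)) functionals.
  by vm_compute.
move=> /allP/(_ f fF) + _; case: f fF => [[[k z] u] w] _ /orP[/andP[/eqP -> /eqP ->]|/jets[h0 h1 h2]].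
  by rewrite /= c.
by case: k => [|[|k]] /=.
Qed.

End Unisolvence.

Definition coordz (z : Z3) (k : nat) : Z := nth 0%Zb [:: z.1.1; z.1.2; z.2] k.

(* The ends [za], [zb] of the chord cut by each line, a coordinate vanishing at [za] but not at [zb], and one
   vanishing at [zb] but not at [za]. *)
Definition chords : seq (Z3 * Z3 * nat * nat) :=
  [:: ((3,0,0), (0,2,1), 1%N, 0%N);
  ((3,0,0), (0,1,2), 1%N, 0%N);
  ((0,3,0), (2,0,1), 0%N, 1%N);
  ((0,3,0), (1,0,2), 0%N, 1%N);
  ((0,0,3), (2,1,0), 0%N, 2%N);
  ((0,0,3), (1,2,0), 0%N, 2%N);
  ((0,2,1), (2,0,1), 0%N, 1%N);
  ((0,2,1), (1,0,2), 0%N, 1%N);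
  ((0,2,1), (2,1,0), 0%N, 2%N);
  ((0,2,1), (1,2,0), 0%N, 2%N);
  ((0,1,2), (2,0,1), 0%N, 1%N);
  ((0,1,2), (1,0,2), 0%N, 1%N);
  ((0,1,2), (2,1,0), 0%N, 2%N);
  ((0,1,2), (1,2,0), 0%N, 2%N);
  ((2,0,1), (2,1,0), 1%N, 2%N);
  ((2,0,1), (1,2,0), 1%N, 2%N);
  ((1,0,2), (2,1,0), 1%N, 2%N);
  ((1,0,2), (1,2,0), 1%N, 2%N)]%Zb.

(** The last clause says that the third coordinate occurs in the equation of the line, so that the
    coordinates [k] and [l] determine a point of the line. *)
Definition chord_ok (n : Z3) (c : Z3 * Z3 * nat * nat) : bool :=
  let: (za, zb, k, l) := c in
  [&& za \in nine_vecs, zb \in nine_vecs, zero_on n za, zero_on n zb &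
  [&& (k < 3)%N, (l < 3)%N, k != l, (coordz za k =? 0)%Zb & [&& (0 <? coordz zb k)%Zb, (coordz zb l =? 0)%Zb, (0 <? coordz za l)%Zb &
  ~~ (coordz n (3 - k - l) =? 0)%Zb]]].

Lemma chordsP : all (fun i => chord_ok (nth (0,0,0)%Zb line_vecs i) (nth ((0,0,0)%Zb, (0,0,0)%Zb, 0%N, 0%N) chords i)) (iota 0 18).
Proof. by vm_compute. Qed.

(** * Combinations of the 28 truncated cubes are piecewise cubic on the split *)

Section PiecewiseCubic.
Context {R : realType}.
Variable v : 'I_3 -> @pt R.
Hypothesis nd : Defs.nondegenerate v.

Definition coord3 (b : @R3' R) (k : nat) : R := nth 0 [:: b.1.1; b.1.2; b.2] k.

Lemma dot3_coord (n b : @R3' R) (k l : nat) : (k < 3)%N -> (l < 3)%N -> k != l ->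
  dot3 n b = coord3 n k * coord3 b k + coord3 n l * coord3 b l + coord3 n (3 - k - l) * coord3 b (3 - k - l).
Proof. by case: k => [|[|[|//]]]; case: l => [|[|[|//]]] //= _ _ _; rewrite /dot3 /coord3 /=; ring. Qed.

Lemma coord3_eq (b c : @R3' R) (k l : nat) : (k < 3)%N -> (l < 3)%N -> k != l ->
  coord3 b k = coord3 c k -> coord3 b l = coord3 c l -> coord3 b (3 - k - l) = coord3 c (3 - k - l) -> b = c.
Proof.
case: b c => [[? ?] ?] [[? ?] ?].
by case: k => [|[|[|//]]]; case: l => [|[|[|//]]] //= _ _ _; rewrite /coord3 /= => -> -> ->.
Qed.

Lemma coord3_zr z k : coord3 (zr3 z) k = @zr R (coordz z k).
Proof. by case: k => [|[|[|k]]] //; rewrite /coord3 /coordz /= !nth_nil. Qed.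

(** The weights of [x] at the two ends of the chord are read from two coordinates, each vanishing at
    one end only. The equation of the line gives agreement in the third, and nonnegative coordinates
    give nonnegative weights. *)
Lemma on_chord (i : 'I_18) x : tri_set v x -> aff (line_form v i) x = 0 ->
  exists a b, [/\ a \in nine_points v, b \in nine_points v & segment a b x].
Proof.
move=> tx x0; have := allP chordsP i; rewrite mem_iota ltn_ord => /(_ isT).
case: (nth _ chords i) => [[[za zb] k] l] /and5P[zaN zbN na nb /and5P[k3 l3 kl zak /and4P[zbk zbl zal nm]]].
move: x0; rewrite /line_form aff_bform; set n := nth _ _ _ in na nb nm *; set b := bary v x => nb0.
have b0 j : 0 <= coord3 b j.
  by move/(tri_setP nd): tx; rewrite -/b /coord3 => -[h0 h1 h2]; case: j => [|[|[|j]]] //=; rewrite nth_nil.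
have zk : 0 < @zr R (coordz zb k) by rewrite zr_gt0.
have zl : 0 < @zr R (coordz za l) by rewrite zr_gt0.
pose mu := coord3 b k / zr (coordz zb k); pose la := coord3 b l / zr (coordz za l).
have mu0 : 0 <= mu by rewrite divr_ge0// ltW.
have la0 : 0 <= la by rewrite divr_ge0// ltW.
pose c : @R3' R := (la * (zr3 za).1.1 + mu * (zr3 zb).1.1, la * (zr3 za).1.2 + mu * (zr3 zb).1.2, la * (zr3 za).2 + mu * (zr3 zb).2).
have cE j : coord3 c j = la * zr (coordz za j) + mu * zr (coordz zb j).
  rewrite -!coord3_zr /c /coord3; case: j => [|[|[|j]]] //=; rewrite !nth_nil !mulr0 addr0//.
have zak0 : @zr R (coordz za k) = 0 by apply/eqP; rewrite zr_eq0.
have zbl0 : @zr R (coordz zb l) = 0 by apply/eqP; rewrite zr_eq0.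
have ck : coord3 b k = coord3 c k by rewrite cE zak0 mulr0 add0r /mu divfK// gt_eqF.
have cl : coord3 b l = coord3 c l by rewrite cE zbl0 mulr0 addr0 /la divfK// gt_eqF.
have za0 : dot3 (zr3 n) (zr3 za) = 0 :> R by rewrite dot_zr; move/Z.eqb_spec: na => ->.
have zb0 : dot3 (zr3 n) (zr3 zb) = 0 :> R by rewrite dot_zr; move/Z.eqb_spec: nb => ->.
have nc0 : dot3 (zr3 n) c = 0.
  rewrite (_ : dot3 _ c = la * dot3 (zr3 n) (zr3 za) + mu * dot3 (zr3 n) (zr3 zb)); last by rewrite /dot3 /c /=; ring.
  by rewrite za0 zb0 !mulr0 addr0.
have nm0 : coord3 (@zr3 R n) (3 - k - l) != 0 by rewrite coord3_zr zr_eq0.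
have cm : coord3 b (3 - k - l) = coord3 c (3 - k - l).
  apply: (mulfI nm0); move: nb0 nc0; rewrite !(dot3_coord _ _ k3 l3 kl) ck cl => h1 h2; lra.
have bc := coord3_eq k3 l3 kl ck cl cm.
have s1 : 3 * la + 3 * mu = 1.
  have := sum_bary v x; rewrite -/b bc /c /sum3 /= => s1.
  have sz z : z \in nine_vecs -> @zr R z.1.1 + zr z.1.2 + zr z.2 = 3.
    by move=> /(allP nine_sum)/Z.eqb_spec h; have := @sum_zr R z; rewrite /sum3 h /= => ->.
  have h1 : la * (zr za.1.1 + zr za.1.2 + zr za.2) = la * 3 by rewrite sz.
  have h2 : mu * (zr zb.1.1 + zr zb.1.2 + zr zb.2) = mu * 3 by rewrite sz.
  rewrite !mulrDr in h1 h2; clear -s1 h1 h2; lra.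
exists (comb v (3^-1 *: zr3 za)), (comb v (3^-1 *: zr3 zb)).
have mf z : z \in nine_vecs -> comb v (3^-1 *: zr3 z) \in nine_points v.
  by move=> zN; rewrite nine_pointsE; apply/mapP; exists z.
split; [exact: mf|exact: mf|].
exists (3 * mu); split; first by apply/andP; split; lra.
rewrite -(baryK nd x) -/b bc (_ : 1 - 3 * mu = 3 * la); last by lra.
rewrite /c /comb /zr3; case: (v 0) (v 1) (v 2) => ? ? [? ?] [? ?].
by rewrite [LHS]surjective_pairing [RHS]surjective_pairing; congr (_, _); rewrite /= /GRing.scale /=; field.
Qed.

(** Converse of [same_cellP]: without a common strict sign, the form of the line vanishes somewhere
    on the segment from [x] to [y], and by [on_chord] that point belongs to a segment of the
    split. *)
Lemma same_cell_sign x y (i : 'I_18) : same_cell v x x -> same_cell v x y -> 0 < aff (line_form v i) x * aff (line_form v i) y.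
Proof.
move=> [ix [_ xx]] [_ [iy xy]].
have tx : tri_set v x by apply: interior_subset ix.
have ty : tri_set v y by apply: interior_subset iy.
have [ix' iy'] : inner v x /\ inner v y by split; exact/(interior_tri nd).
have off z : segment x y z -> tri_set v z -> aff (line_form v i) z != 0.
  move=> sz tz; apply/eqP => z0; have [a [b [aN bN sab]]] := on_chord tz z0.
  by have := xy a b aN bN; move/seteqP => [/(_ z) H _]; apply: H.
rewrite ltNge; apply/negP => h.
pose p := aff (line_form v i) x; pose q := aff (line_form v i) y.
have p0 : p != 0 by apply: (off x) => //; exists 0; rewrite lexx ler01 subr0 scale1r scale0r addr0.
have q0 : q != 0 by apply: (off y) => //; exists 1; rewrite lexx ler01 subrr scale1r scale0r add0r.
have pq : p - q != 0.
  apply/eqP => e; have : p * q = p ^+ 2 by rewrite (_ : q = p) ?expr2//; lra.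
  by move: h; rewrite -/p -/q => h e2; move: h; rewrite e2 exprn_even_le0//= (negPf p0).
pose t := p / (p - q).
have t01 : 0 <= t <= 1.
  have d2 : 0 < (p - q) ^+ 2 by rewrite exprn_even_gt0//= pq.
  have tE : t * (p - q) ^+ 2 = p ^+ 2 - p * q by rewrite expr2 mulrA /t divfK//; ring.
  have h' : p * q <= 0 by [].
  apply/andP; split; first by rewrite -(pmulr_lge0 _ d2) tE; have := sqr_ge0 p; lra.
  rewrite -subr_ge0 -(pmulr_lge0 _ d2) mulrBl mul1r tE; have := sqr_ge0 q.
  rewrite (_ : (p - q) ^+ 2 - _ = q ^+ 2 - p * q); [lra|ring].
have sz : segment x y ((1 - t) *: x + t *: y) by exists t.
have iz : inner v ((1 - t) *: x + t *: y).
  have -> : (1 - t) *: x + t *: y = x + t *: (y - x) by rewrite scalerBr scalerBl scale1r addrA addrAC.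
  exact: inner_convex.
have := off _ sz (inner_tri nd iz); rewrite aff_seg -/p -/q => /eqP; apply.
by rewrite (_ : (1 - t) * p + t * q = p - t * (p - q)); [rewrite /t divfK// subrr|ring].
Qed.

Lemma is_cubic_sum (I : finType) (P : I -> @pt R -> R) : (forall i, is_cubic (P i)) -> is_cubic (fun y => \sum_i P i y).
Proof.
move=> H; rewrite (_ : (fun y => _) = \big[(fun f g y => f y + g y)/(fun=> 0)]_i P i).
  elim/big_ind: _ => // [|f1 f2]; last exact: is_cubicD.
  by exists (fun=> 0) => y; rewrite /cubf; ring.
by apply/funext => t; elim/big_rec2: _ => // i y1 y2 _ ->.
Qed.

Lemma poly_form_ge0 (i : 'I_28) x : (i < 10)%N -> tri_set v x -> 0 <= aff (cube_form v i) x.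
Proof.
move=> i10 tx; rewrite /cube_form aff_bform /cube_vec nth_cat i10.
exact: (poly_vec_ge0 nd (Ordinal i10) tx).
Qed.

Lemma line_cube_form (i : 'I_28) : (10 <= i)%N -> exists j : 'I_18, cube_form v i = line_form v j.
Proof.
move=> i10; have j18 : (i - 10 < 18)%N by rewrite ltn_subLR.
exists (Ordinal j18); rewrite /cube_form /line_form /cube_vec nth_cat ifF//.
by apply/negbTE; rewrite -leqNgt.
Qed.

Lemma tcs_piecewise_cubic (a : 'I_28 -> R) s : (forall x, tri_set v x -> s x = tcs a (cube_form v) x) ->
  piecewise_cubic_WS3 v s.
Proof.
move=> sE x xx.
(* The polynomial of the cell keeps the cubes of the forms that are positive at [x]. *)
exists (fun y => \sum_i (if 0 < aff (cube_form v i) x then a i else 0) *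
   (aff (cube_form v i) y * aff (cube_form v i) y * aff (cube_form v i) y)); split.
  by apply: is_cubic_poly; apply: is_cubic_sum => i; apply: is_cubicZ; exact: is_cubic_prod3.
move=> y xy; have [ix [iy _]] := xy.
have tx : tri_set v x by exact: interior_subset ix.
have ty : tri_set v y by exact: interior_subset iy.
rewrite sE//; apply: eq_bigr => i _.
have [i10|i10] := ltnP i 10.
  rewrite pp_pos ?poly_form_ge0//; have := poly_form_ge0 i10 tx; rewrite le_eqVlt => /predU1P[x0|->]; last by ring.
  rewrite -x0 ltxx mul0r; have /(interior_tri nd)[p0 p1 p2] := ix.
  exfalso; move: x0; rewrite /cube_form aff_bform /cube_vec nth_cat i10.
  have [z0 z1 z2] : [/\ @zr R 0 = 0, @zr R 1 = 1 & @zr R 2 = 2] by [].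
  move: p0 p1 p2; move: (bary v x) => [[X Y] Z] /= p0 p1 p2.
  by case: i i10 => [] [|[|[|[|[|[|[|[|[|[|]]]]]]]]]] //= _ _; rewrite /dot3 /= ?z0 ?z1 ?z2; lra.
have [j ->] := line_cube_form i10; have := same_cell_sign j xx xy.
case: (ltrgtP 0 (aff (line_form v j) x)) => h.
- by rewrite pmulr_rgt0// => h'; rewrite pp_pos ?ltW//; ring.
- by rewrite nmulr_rgt0// => h'; rewrite pp_neg ?ltW//; ring.
- by rewrite -h mul0r ltxx.
Qed.

End PiecewiseCubic.

(** * Gluing *)

Section Gluing.
Context {R : realType} {nT : nat}.
Variable V : 'I_nT -> 'I_3 -> @pt R.
Hypothesis nd : forall t, Defs.nondegenerate (V t).
Implicit Types (x w : @pt R) (t : 'I_nT).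

Local Notation Om := (\bigcup_(t in [set: 'I_nT]) tri_set (V t)).

(** The triangle containing [x] is picked by choice; [agree] makes the value independent of the
    pick. *)
Definition glued (G : 'I_nT -> @pt R -> R) x : R :=
  match pselect (exists t, tri_set (V t) x) with left h => G (projT1 (cid h)) x | right _ => 0 end.

Definition agree (G : 'I_nT -> @pt R -> R) := forall t t' x, tri_set (V t) x -> tri_set (V t') x -> G t x = G t' x.

Lemma glueE G t x : agree G -> tri_set (V t) x -> glued G x = G t x.
Proof.
move=> aG tx; rewrite /glued; case: pselect => [h|[]]; last by exists t.
by apply: aG tx; case: cid.
Qed.

Lemma finite_pos (P : 'I_nT -> R -> Prop) : (forall t, exists2 d : R, 0 < d & P t d) ->
  (forall t (d d' : R), P t d -> 0 < d' <= d -> P t d') -> exists2 d : R, 0 < d & forall t, P t d.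
Proof.
move=> H mono; have H' t : exists d : R, 0 < d /\ P t d by have [d d0 hd] := H t; exists d.
have [d Hd] := choice H'.
have inv0 t : 0 <= (d t)^-1 by rewrite invr_ge0 ltW//; have [] := Hd t.
have S0 : 0 < 1 + \sum_t (d t)^-1 by rewrite ltr_pwDl// sumr_ge0.
(* A positive number below every [d t], available also when there are no triangles. *)
exists (1 + \sum_t (d t)^-1)^-1 => [|t]; first by rewrite invr_gt0.
have [dt Pt] := Hd t; apply: mono Pt _; rewrite invr_gt0 S0 /= -[d t]invrK lef_pV2 ?posrE ?invr_gt0//.
rewrite (bigD1 t)//= addrCA lerDl addr_ge0// sumr_ge0//.
Qed.

Lemma tri_closed t x : ~ tri_set (V t) x -> exists2 d : R, 0 < d & forall w, nrm w < d -> ~ tri_set (V t) (x + w).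
Proof.
move=> H; have : exists c : @R3' R, 0 < aff (bform (V t) c) x /\ forall y, tri_set (V t) y -> aff (bform (V t) c) y <= 0.
  have [h0|h0] := ltP (bary (V t) x).1.1 0.
    exists (-1, 0, 0); split=> [|y /(tri_setP (nd t))[y0 _ _]]; rewrite aff_bform.
      by move: h0; case: (bary _ _) => [[? ?] ?]; rewrite /dot3 /=; lra.
    by move: y0; case: (bary _ _) => [[? ?] ?]; rewrite /dot3 /=; lra.
  have [h1|h1] := ltP (bary (V t) x).1.2 0.
    exists (0, -1, 0); split=> [|y /(tri_setP (nd t))[_ y0 _]]; rewrite aff_bform.
      by move: h1; case: (bary _ _) => [[? ?] ?]; rewrite /dot3 /=; lra.
    by move: y0; case: (bary _ _) => [[? ?] ?]; rewrite /dot3 /=; lra.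
  have [h2|h2] := ltP (bary (V t) x).2 0.
    exists (0, 0, -1); split=> [|y /(tri_setP (nd t))[_ _ y0]]; rewrite aff_bform.
      by move: h2; case: (bary _ _) => [[? ?] ?]; rewrite /dot3 /=; lra.
    by move: y0; case: (bary _ _) => [[? ?] ?]; rewrite /dot3 /=; lra.
  by case: H; apply/(tri_setP (nd t)).
move=> [c [/aff_pos_near[d d0 Hd] Hc]]; exists d => // w /Hd + /Hc.
by rewrite leNgt => ->.
Qed.

(** Triangles are closed and finite in number, so close to [x] only triangles through [x] occur.
    Local estimates need be made only for these. *)
Lemma tri_near x : exists2 d : R, 0 < d & forall t w, nrm w < d -> tri_set (V t) (x + w) -> tri_set (V t) x.
Proof.
have [||d d0 Hd] := @finite_pos (fun t d => forall w, nrm w < d -> tri_set (V t) (x + w) -> tri_set (V t) x).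
- move=> t; have [tx|tx] := pselect (tri_set (V t) x); first by exists 1.
  by have [d d0 Hd] := tri_closed tx; exists d => // w /Hd.
- by move=> t d d' H /andP[_ dd'] w wd; apply: H; exact: lt_le_trans wd dd'.
- by exists d.
Qed.

Lemma glue_within G : agree G -> (forall t x, cont2 (G t) x) -> {within Om, continuous (glued G)}.
Proof.
move=> aG cG; apply/within_contP => x [t0 _ t0x] e e0.
have [d1 d10 H1] := tri_near x.
have [||d2 d20 H2] := @finite_pos (fun t d => forall w, nrm w < d -> `|G t (x + w) - G t x| < e).
- by move=> t; exact: cG.
- by move=> t d d' H /andP[_ dd'] w wd; apply: H; exact: lt_le_trans wd dd'.
exists (Num.min d1 d2) => [|w]; first by rewrite lt_min d10.
rewrite lt_min => /andP[wd1 wd2] [t _ tw]; have tx := H1 t w wd1 tw.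
by rewrite !(glueE aG tw) !(glueE aG tx); exact: H2.
Qed.

(** A small displacement from an interior point of the domain ends in some triangle that also
    contains [x]. The expansion of that triangle's formula applies, and all formulas at [x] share
    value and derivative. *)
Lemma glue_is_derive G G' u x : agree G -> agree G' -> (forall t y, der1 (fun r => G t (y + r *: u)) 0 (G' t y)) ->
  Om° x -> is_derive x u (glued G) (glued G' x).
Proof.
move=> aG aG' dG /interior_nrmP[d0 d00 H0]; apply/is_derive_der1 => e e0.
have [d1 d10 H1] := tri_near x.
have [||d2 d20 H2] := @finite_pos (fun t d => forall r : R, `|r| < d -> `|G t (x + r *: u) - G t x - G' t x * r| <= e * `|r|).
- by move=> t; have [k k0 K] := dG t x e e0; exists k => // r /K; rewrite add0r scale0r addr0.
- by move=> t d d' H /andP[_ dd'] r rd; apply: H; exact: lt_le_trans rd dd'.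
have n1 : 0 < nrm u + 1 by rewrite ltr_wpDl// nrm_ge0.
pose m := Num.min d0 d1; have m0 : 0 < m by rewrite lt_min d00.
exists (Num.min (m / (nrm u + 1)) d2) => [|r]; first by rewrite lt_min divr_gt0.
rewrite lt_min => /andP[rm rd2]; rewrite add0r scale0r addr0.
have : nrm (r *: u) < m.
  rewrite nrmZ; apply: le_lt_trans (_ : `|r| * (nrm u + 1) < m); first by rewrite ler_wpM2l// lerDl.
  by rewrite -ltr_pdivlMr.
rewrite lt_min => /andP[ru0 ru1]; have [t _ tw] := H0 _ ru0; have tx := H1 t _ ru1 tw.
by rewrite !(glueE aG tw) !(glueE aG tx) (glueE aG' tx); exact: H2.
Qed.

Definition tri_tcs (a : 'I_nT -> 'I_28 -> R) t := tcs (a t) (cube_form (V t)).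
Definition tri_tcs1 (a : 'I_nT -> 'I_28 -> R) u t x := tcs1 (a t) (cube_form (V t)) x u.
Definition tri_tcs2 (a : 'I_nT -> 'I_28 -> R) u w t x := tcs2 (a t) (cube_form (V t)) x u w.

Definition consistent (a : 'I_nT -> 'I_28 -> R) :=
  [/\ agree (tri_tcs a), forall u, agree (tri_tcs1 a u) & forall u w, agree (tri_tcs2 a u w)].

Lemma consistent_spline a : consistent a -> exists s, [/\ C2_on Om s, forall t, piecewise_cubic_WS3 (V t) s &
  forall t x, tri_set (V t) x -> s x = tri_tcs a t x].
Proof.
move=> [a0 a1 a2]; exists (glued (tri_tcs a)); split.
- split; first by apply: glue_within => // t x; exact: tcs_cont.
  move=> j; exists (glued (tri_tcs1 a (edir j))); split; first by apply: glue_within => // t x; exact: tcs1_cont.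
  split; first by move=> x; apply: glue_is_derive => // t y; exact: tcs_der1.
  move=> k; exists (glued (tri_tcs2 a (edir j) (edir k))); split; first by apply: glue_within => // t x; exact: tcs2_cont.
  by move=> x; apply: glue_is_derive => // t y; exact: tcs1_der1.
- by move=> t; apply: (tcs_piecewise_cubic (nd t) (a := a t)) => x tx; exact: glueE.
- by move=> t x tx; exact: glueE.
Qed.

(** The derivatives of a C^2 spline are single functions, continuous up to the boundary of the
    domain. Each triangle's formula has the same jets as these, so the formulas agree to second
    order at every common point, vertices included. *)
Lemma spline_consistent s : C2_on Om s -> (forall t, piecewise_cubic_WS3 (V t) s) -> exists2 a, consistent a &
  forall t x, tri_set (V t) x -> s x = tri_tcs a t x.
Proof.
move=> Cs pc; have sub t : tri_set (V t) `<=` Om by move=> x tx; exists t.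
have [a aE] := choice (fun t => piecewise_cubic_tcs (nd t) (sub t) Cs (pc t)).
have [cs Hs] := Cs; have [g Hg] := choice Hs; 
have Hg' j : exists h : bool -> @pt R -> R, forall k, {within Om, continuous h k} /\
    forall x, Om° x -> is_derive x (edir k) (g j) (h k x).
  by have [h Hh] := choice (Hg j).2.2; exists h.
have [h Hh] := choice Hg'.
have gE j t x : tri_set (V t) x -> g j x = tri_tcs1 a (edir j) t x.
  apply: (@tri_set_derive _ _ (nd t) _ s _ _ (tri_tcs1 a (edir j) t) _ (sub t) (Hg j).1 _ (Hg j).2.1 _ (aE t)) => y; [exact: tcs1_cont|exact: tcs_der1].
have hE j k t x : tri_set (V t) x -> h j k x = tri_tcs2 a (edir j) (edir k) t x.
  apply: (@tri_set_derive _ _ (nd t) _ (g j) _ _ (tri_tcs2 a (edir j) (edir k) t) _ (sub t) (Hh j k).1 _ (Hh j k).2 _ (gE j t)) => y; [exact: tcs2_cont|exact: tcs1_der1].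
have dec (w : @pt R) : w = w.1 *: edir false + w.2 *: edir true.
  by case: w => p q; congr (_, _); rewrite /= /GRing.scale /=; ring.
exists a => //; split=> [t t' x tx t'x|u t t' x tx t'x|u w t t' x tx t'x].
- by rewrite /tri_tcs -!aE.
- by rewrite (dec u) /tri_tcs1 !tcs1D !tcs1Z -![tcs1 _ _ x (edir _)]/(tri_tcs1 a _ _ x) -!gE.
- rewrite (dec u) (dec w) /tri_tcs2 !tcs2D !tcs2Z.
  rewrite ![tcs2 _ _ x _ (edir _)]tcs2C !tcs2D !tcs2Z.
  by rewrite -![tcs2 _ _ x (edir _) (edir _)]/(tri_tcs2 a _ _ _ x) -!hE.
Qed.

Lemma tri_tcs0 (a : 'I_28 -> R) t : (forall x, tri_set (V t) x -> tcs a (cube_form (V t)) x = 0) ->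
  [/\ forall x u, tri_set (V t) x -> tcs1 a (cube_form (V t)) x u = 0 &
      forall x u w, tri_set (V t) x -> tcs2 a (cube_form (V t)) x u w = 0].
Proof.
move=> H.
have sub : tri_set (V t) `<=` tri_set (V t) by [].
have c0 : {within tri_set (V t), continuous (fun=> 0 : R)}.
  by apply/within_contP => x _ e e0; exists 1 => // w _ _; rewrite subrr normr0.
have H1 u x : tri_set (V t) x -> 0 = tcs1 a (cube_form (V t)) x u.
  move: x; apply: (@tri_set_derive _ _ (nd t) _ (fun=> 0) (tcs a (cube_form (V t))) (fun=> 0)
    (fun y => tcs1 a (cube_form (V t)) y u) u sub c0) => [y|y|y ty]; [exact: tcs1_cont|exact: tcs_der1|by rewrite H].
split=> [x u tx|x u w tx]; first by rewrite -H1.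
apply/esym; move: x tx.
apply: (@tri_set_derive _ _ (nd t) _ (fun=> 0) (fun y => tcs1 a (cube_form (V t)) y u) (fun=> 0)
  (fun y => tcs2 a (cube_form (V t)) y u w) w sub c0) => [y|y|y ty]; [exact: tcs2_cont|exact: tcs1_der1|by rewrite -H1].
Qed.

End Gluing.

(** * Degrees of freedom of a triangulation *)

(** The integer form of [good_ends] for all 28 forms and all pairs of vertices: traces on edges
    break at third points only. *)
Lemma edge_values_good : all (fun i => all (fun k => all (fun l =>
  let al := coordz (cube_vec i) k in let be := coordz (cube_vec i) l in
  [|| (0 <=? al) && (0 <=? be), (al <=? 0) && (be <=? 0), be =? - 2 * al | al =? - 2 * be]%Zb) (iota 0 3)) (iota 0 3)) (iota 0 28).
Proof. by vm_compute. Qed.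

Section JetValues.
Context {R : realType} {I : finType}.
Implicit Types (b : I -> R) (L : I -> R * @pt R) (x A B : @pt R).

(** Vertex data use the coordinate axes, and edge data the rotated edge vector. No triangle is
    involved, so neighbouring triangles can be given literally the same values. *)
Definition vjet b L x (j : 'I_6) : R :=
  tnth [tuple tcs b L x; tcs1 b L x e1; tcs1 b L x e2; tcs2 b L x e1 e1; tcs2 b L x e1 e2; tcs2 b L x e2 e2] j.

Definition rot90 A : @pt R := (- A.2, A.1).

Definition ejet b L A B (j : 'I_3) : R := let N := rot90 (B - A) in
  tnth [tuple tcs1 b L (A + (1/2) *: (B - A)) N; tcs2 b L (A + (1/3) *: (B - A)) N N; tcs2 b L (A + (2/3) *: (B - A)) N N] j.

Lemma vjet_jet0 b L x : (forall j, vjet b L x j = 0) -> jet0 b L x.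
Proof.
move=> H; have h0 := H 0; have h1 := H 1; have h2 := H 2; have h3 := H 3; have h4 := H 4; have h5 := H 5.
have dec (w : @pt R) : w = w.1 *: e1 + w.2 *: e2.
  by case: w => p q; congr (_, _); rewrite /= /GRing.scale /=; ring.
rewrite /vjet /tnth /= in h0 h1 h2 h3 h4 h5.
split => // [u|u w]; first by rewrite (dec u) tcs1D !tcs1Z h1 h2 !mulr0 addr0.
by rewrite (dec u) (dec w) tcs2_span// tcs2C.
Qed.

Lemma ejet_jet0 b L A B : A != B -> (forall i, good_ends (aff (L i) A) (aff (L i) B)) ->
  (forall j, vjet b L A j = 0) -> (forall j, vjet b L B j = 0) -> (forall j, ejet b L A B j = 0) ->
  forall t : R, 0 <= t <= 1 -> jet0 b L (A + t *: (B - A)).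
Proof.
move=> AB gd /vjet_jet0 jA /vjet_jet0 jB H.
have h0 := H 0; have h1 := H 1; have h2 := H 2; rewrite /ejet /tnth /= in h0 h1 h2.
apply: edge_jet0 gd _ jA jB h0 h1 h2; rewrite /det2 /rot90 /= mulrN opprK.
apply/eqP => e; move/eqP: AB; apply; move: e => /eqP.
rewrite -!expr2 paddr_eq0 ?sqr_ge0// !sqrf_eq0 !subr_eq0 => /andP[/eqP f1 /eqP f2].
by rewrite [A]surjective_pairing [B]surjective_pairing f1 f2.
Qed.

End JetValues.

Section Difference.
Context {R : realType} {I : finType}.
Variables (b c : I -> R) (L M : I -> R * @pt R).

(** The difference of the formulas on two triangles is again a combination of truncated cubes, over
    the disjoint union of the index sets. The edge lemma thus applies to it directly. *)
Definition diff_coef (i : I + I) : R := match i with inl i => b i | inr i => - c i end.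
Definition diff_form (i : I + I) : R * @pt R := match i with inl i => L i | inr i => M i end.

Lemma tcs_diff x : tcs diff_coef diff_form x = tcs b L x - tcs c M x.
Proof. by rewrite /tcs big_sumType /=; congr (_ + _); rewrite -sumrN; apply: eq_bigr => i _; ring. Qed.
Lemma tcs1_diff x u : tcs1 diff_coef diff_form x u = tcs1 b L x u - tcs1 c M x u.
Proof. by rewrite /tcs1 big_sumType /=; congr (_ + _); rewrite -sumrN; apply: eq_bigr => i _; ring. Qed.
Lemma tcs2_diff x u w : tcs2 diff_coef diff_form x u w = tcs2 b L x u w - tcs2 c M x u w.
Proof. by rewrite /tcs2 big_sumType /=; congr (_ + _); rewrite -sumrN; apply: eq_bigr => i _; ring. Qed.

Lemma vjet_diff x j : vjet diff_coef diff_form x j = vjet b L x j - vjet c M x j.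
Proof.
by case: j => [] [|[|[|[|[|[|//]]]]]] ?; rewrite /vjet /tnth /= ?tcs_diff ?tcs1_diff ?tcs2_diff.
Qed.
Lemma ejet_diff A B j : ejet diff_coef diff_form A B j = ejet b L A B j - ejet c M A B j.
Proof. by case: j => [] [|[|[|//]]] ?; rewrite /ejet /tnth /= ?tcs1_diff ?tcs2_diff. Qed.

Lemma jet0_diff x : jet0 diff_coef diff_form x ->
  [/\ tcs b L x = tcs c M x, forall u, tcs1 b L x u = tcs1 c M x u & forall u w, tcs2 b L x u w = tcs2 c M x u w].
Proof.
move=> [h0 h1 h2]; split=> [|u|u w]; apply/eqP; rewrite -subr_eq0.
- by rewrite -tcs_diff h0.
- by rewrite -tcs1_diff h1.
- by rewrite -tcs2_diff h2.
Qed.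

End Difference.

Section Freedom.
Context {R : realType} {nV nT : nat}.
Variables (p : 'I_nV -> @pt R) (tri : 'I_nT -> 'I_3 -> 'I_nV).
Hypothesis hT : is_triangulation p tri.
Local Notation V := (tverts p tri).
Implicit Types (t : 'I_nT) (w : 'I_nV).

Lemma tri_nd t : Defs.nondegenerate (V t). Proof. by case: hT => _ []. Qed.

Lemma tri_inj t : injective (tri t).
Proof.
have := tri_nd t; rewrite /Defs.nondegenerate /tverts /det2 => nd.
have n01 : tri t 0 != tri t 1 by apply: contra nd => /eqP ->; rewrite subrr /= !mul0r subrr.
have n02 : tri t 0 != tri t 2 by apply: contra nd => /eqP ->; rewrite subrr /= !mulr0 subrr.
have n12 : tri t 1 != tri t 2.
  by apply: contra nd => /eqP ->; apply/eqP; ring.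
have o (k : 'I_3) : [\/ k = 0, k = 1 | k = 2].
  by case: k => [] [|[|[|//]]] i; [constructor 1|constructor 2|constructor 3]; apply: val_inj.
move=> k l; case: (o k) => ->; case: (o l) => -> // /eqP; rewrite ?(negPf n01) ?(negPf n02) ?(negPf n12)//;
by rewrite eq_sym ?(negPf n01) ?(negPf n02) ?(negPf n12).
Qed.

Lemma card_vset t : #|vset tri t| = 3%N.
Proof. by rewrite /vset card_imset ?card_ord//; exact: tri_inj. Qed.

Lemma vsetP t w : w \in vset tri t -> exists k, w = tri t k.
Proof. by move=> /imsetP[k _ ->]; exists k. Qed.

Lemma vertex_in t k : tri t k \in vset tri t. Proof. exact: imset_f. Qed.

(** Two distinct triangles have distinct vertex sets of three elements, hence at most two common
    vertices. The hull of these is a segment, a single point when [w1 = w2]. *)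
Lemma common_points t t' x : t != t' -> tri_set (V t) x -> tri_set (V t') x ->
  exists w1 w2 (r : R), [/\ w1 \in vset tri t :&: vset tri t', w2 \in vset tri t :&: vset tri t', 0 <= r <= 1 &
    x = p w1 + r *: (p w2 - p w1)].
Proof.
move=> tt' tx t'x; have [_ [_ [_ H]]] := hT; have [vv E] := H t t' tt'.
have : (tri_set (V t) `&` tri_set (V t')) x by [].
rewrite E => -[n [q [l [qS [l0 [l1 xE]]]]]]; set S := vset tri t :&: vset tri t' in qS *.
have S2 : (#|S| <= 2)%N.
  have := card_vset t; rewrite -ltnS => <-; apply: proper_card; rewrite properE subsetIl /=; apply: contra vv => sub.
  rewrite eqEcard !card_vset leqnn andbT; apply: (fintype.subset_trans sub); exact: subsetIr.
have n0 : (0 < n)%N.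
  by move: l1; case: (n) l {qS l0 xE} => [|//] l; rewrite big_ord0 => /eqP; rewrite eq_sym oner_eq0.
have [w1 w1S _] := qS (Ordinal n0); rewrite /= in w1S.
have [w2 [w2S sub]] : exists w2, w2 \in S /\ forall w, w \in S -> w = w1 \/ w = w2.
  have [e|[w2]] := set_0Vmem (S :\ w1).
    exists w1; split => // w wS; left; apply/eqP; apply: contraT => ww; have : w \in S :\ w1 by rewrite in_setD1 ww wS.
    by rewrite e inE.
  rewrite in_setD1 => /andP[w21 w2S]; exists w2; split => // w wS.
  have [->|ww1] := eqVneq w w1; [by left|right].
  apply/eqP; apply: contraT => ww2; have : (#|[set w1; w2; w]%SET| <= #|S|)%N.
    by apply: subset_leq_card; apply/fintype.subsetP => z; rewrite finset.in_setU in_set2 finset.in_set1 => /orP[/orP[]|] /eqP ->.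
  have -> : #|[set w1; w2; w]%SET| = 3%N.
    by rewrite finset.setUC cardsU1 cards2 in_set2 (negPf ww1) (negPf ww2) eq_sym (negPf w21).
  by move=> h; have := leq_trans h S2.
(* The parameter is the total weight carried by [p w2]. *)
exists w1, w2, (\sum_(i | q i == p w2) l i); split => //.
  rewrite sumr_ge0//= -l1 [leRHS](bigID (fun i => q i == p w2)) /= lerDl sumr_ge0//.
rewrite xE scaler_suml [X in _ + X]big_mkcond /=.
have -> : p w1 = \sum_i l i *: p w1 by rewrite -scaler_suml l1 scale1r.
rewrite -big_split /=; apply: eq_bigr => i _; rewrite -scaler_suml l1 scale1r.
have [w wS <-] := qS i; have [->|->] := sub w wS.
  by case: eqP => [->|_]; rewrite ?subrr ?scaler0 addr0.
by rewrite eqxx scalerBr addrC subrK.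
Qed.

End Freedom.

Lemma good_ends_sym {R : realType} (al be : R) : good_ends al be -> good_ends be al.
Proof. by move=> [[? ?]|[? ?]|?|?]; [constructor 1|constructor 2|constructor 4|constructor 3]. Qed.

Section EdgeGood.
Context {R : realType}.
Variable v : 'I_3 -> @pt R.
Hypothesis nd : Defs.nondegenerate v.

Lemma aff_cube_vertex i k : aff (cube_form v i) (v k) = zr (coordz (cube_vec i) k) :> R.
Proof.
rewrite /cube_form aff_bform -coord3_zr; set z := zr3 _.
have o : [\/ k = 0, k = 1 | k = 2].
  by case: k => [] [|[|[|//]]] j; [constructor 1|constructor 2|constructor 3]; apply: val_inj.
have c (b : R3') : sum3 b = 1 -> comb v b = v k -> dot3 z (bary v (v k)) = dot3 z b.
  by move=> b1 <-; rewrite combK.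
case: o c => -> c.
- by rewrite (c (1, 0, 0)) ?/sum3 /= ?addr0// /comb /= ?scale1r ?scale0r ?addr0// /dot3 /coord3 /=; ring.
- by rewrite (c (0, 1, 0)) ?/sum3 /= ?addr0 ?add0r// /comb /= ?scale1r ?scale0r ?addr0 ?add0r// /dot3 /coord3 /=; ring.
- by rewrite (c (0, 0, 1)) ?/sum3 /= ?addr0 ?add0r// /comb /= ?scale1r ?scale0r ?addr0 ?add0r// /dot3 /coord3 /=; ring.
Qed.

Lemma cube_good i k1 k2 : good_ends (aff (cube_form v i) (v k1)) (aff (cube_form v i) (v k2) : R).
Proof.
have m n (j : 'I_n) : (j : nat) \in iota 0 n by rewrite mem_iota /= ltn_ord.
have /= := allP (allP (allP edge_values_good _ (m _ i)) _ (m _ k1)) _ (m _ k2).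
rewrite !aff_cube_vertex; set al := coordz _ _; set be := coordz _ _.
have z2 : @zr R 2 = 2 by [].
case/or4P => [/andP[h1 h2]|/andP[h1 h2]|/Z.eqb_spec h|/Z.eqb_spec h].
- by constructor 1; rewrite !zr_le0.
- by constructor 2; rewrite -[zr al]opprK -[zr be]opprK !oppr_le0 -!zrN !zr_le0; split; lia.
- by constructor 3; change (be = (- 2 * al)%Zb) in h; rewrite h zrM (zrN 2) z2.
- by constructor 4; change (al = (- 2 * be)%Zb) in h; rewrite h zrM (zrN 2) z2.
Qed.

Lemma tri_set_vertex k : tri_set v (v k).
Proof.
exists 1%N, (fun=> v k), (fun=> 1); split; first by move=> _; exists k.
by rewrite !big_ord1 scale1r; split.
Qed.

Lemma tri_set_segment x y (r : R) : tri_set v x -> tri_set v y -> 0 <= r <= 1 -> tri_set v (x + r *: (y - x)).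
Proof.
move=> /(tri_setP nd)[x0 x1 x2] /(tri_setP nd)[y0 y1 y2] /andP[r0 r1]; apply/(tri_setP nd).
have -> : x + r *: (y - x) = (1 - r) *: x + r *: y.
  by rewrite scalerBr scalerBl scale1r addrA addrAC.
by rewrite /bary /= in x0 x1 x2 y0 y1 y2 *; rewrite !aff_seg; split; apply: addr_ge0; apply: mulr_ge0 => //; rewrite subr_ge0.
Qed.

End EdgeGood.

(** * Global degrees of freedom and their local unisolvence *)

Section Dofs.
Context {R : realType} {nV nT : nat}.
Variables (p : 'I_nV -> @pt R) (tri : 'I_nT -> 'I_3 -> 'I_nV).
Hypothesis hT : is_triangulation p tri.
Local Notation V := (tverts p tri).
Implicit Types (t : 'I_nT) (w : 'I_nV).

(** Six jet entries for a vertex, three edge values for a pair of vertices, one value for a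
    triangle. The type contains all pairs of vertices; [incident] restricts them to edges with
    increasing ends, which fixes the orientation of the normal. *)
Definition dof := ('I_nV * 'I_6 + ('I_nV * 'I_nV * 'I_3 + 'I_nT))%type.
Implicit Types (g : dof).

Definition incident t g : bool :=
  match g with
  | inl (w, _) => w \in vset tri t
  | inr (inl (e, _)) => [&& (e.1 < e.2)%N, e.1 \in vset tri t & e.2 \in vset tri t]
  | inr (inr t0) => t == t0
  end.

Definition dof_value (b : 'I_28 -> R) t g : R :=
  match g with
  | inl (w, j) => vjet b (cube_form (V t)) (p w) j
  | inr (inl (e, j)) => ejet b (cube_form (V t)) (p e.1) (p e.2) j
  | inr (inr t0) => tcs b (cube_form (V t)) (centroid (V t0))
  end.

Lemma dof_value_linear t g : exists phi : 'I_28 -> R, forall b, dof_value b t g = \sum_i b i * phi i.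
Proof.
have h0 x : exists phi : 'I_28 -> R, forall b, tcs b (cube_form (V t)) x = \sum_i b i * phi i.
  by exists (fun i => pp (aff (cube_form (V t) i) x) ^+ 3).
have h1 x u : exists phi : 'I_28 -> R, forall b, tcs1 b (cube_form (V t)) x u = \sum_i b i * phi i.
  by eexists => b; rewrite /tcs1; reflexivity.
have h2 x u (w : @pt R) : exists phi : 'I_28 -> R, forall b, tcs2 b (cube_form (V t)) x u w = \sum_i b i * phi i.
  by eexists => b; rewrite /tcs2; reflexivity.
case: g => [[w [] [|[|[|[|[|[|//]]]]]] ?]|[[e [] [|[|[|//]]] ?]|t0]];
by [exact: h0|exact: h1|exact: h2].
Qed.

(** Edge data exist for increasing ends only, so the other orientation is handled by reversing the
    parameter; when the ends coincide the vertex data suffice. *)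
Lemma segment_jet (I : finType) (b : I -> R) L w1 w2 :
  (forall i, good_ends (aff (L i) (p w1)) (aff (L i) (p w2))) ->
  (forall j, vjet b L (p w1) j = 0) -> (forall j, vjet b L (p w2) j = 0) ->
  ((w1 < w2)%N -> forall j, ejet b L (p w1) (p w2) j = 0) ->
  ((w2 < w1)%N -> forall j, ejet b L (p w2) (p w1) j = 0) ->
  forall r : R, 0 <= r <= 1 -> jet0 b L (p w1 + r *: (p w2 - p w1)).
Proof.
have [pI _] := hT.
move=> gd v1 v2 e12 e21 r r01; case: (ltngtP w1 w2) => [lt|lt|/val_inj ew].
- by apply: ejet_jet0 (e12 lt) _ r01 => //; rewrite (inj_eq pI) -val_eqE /= ltn_eqF.
- have -> : p w1 + r *: (p w2 - p w1) = p w2 + (1 - r) *: (p w1 - p w2).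
    by case: (p w1) => ? ?; case: (p w2) => ? ?; congr (_, _); rewrite /= /GRing.scale /=; ring.
  apply: ejet_jet0 (e21 lt) _ _ => //; first by rewrite (inj_eq pI) -val_eqE /= ltn_eqF.
    by move=> i; apply: good_ends_sym.
  by move: r01 => /andP[? ?]; apply/andP; split; lra.
- by rewrite ew subrr scaler0 addr0; apply: vjet_jet0.
Qed.

Lemma dof_unisolvent t b : (forall g, incident t g -> dof_value b t g = 0) -> forall i, b i = 0.
Proof.
move=> H; have nd := tri_nd hT t; apply: (tcs_unisolvent_edges nd); last first.
  by have := H (inr (inr t)); rewrite /= eqxx => ->.
move=> k1 k2; apply: (@segment_jet _ b (cube_form (V t)) (tri t k1) (tri t k2)).
- by move=> i; exact: cube_good.
- by move=> j; apply: (H (inl (tri t k1, j))); exact: vertex_in.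
- by move=> j; apply: (H (inl (tri t k2, j))); exact: vertex_in.
- by move=> lt j; apply: (H (inr (inl (tri t k1, tri t k2, j)))); rewrite /= lt !vertex_in.
- by move=> lt j; apply: (H (inr (inl (tri t k2, tri t k1, j)))); rewrite /= lt !vertex_in.
Qed.

(** Unisolvence as independence of the 28 rows, stated before the number of columns is known to be
    28. *)
Lemma dof_matrix t : exists phi : dof -> 'I_28 -> R, (forall b g, dof_value b t g = \sum_i b i * phi g i) /\
  row_free (\matrix_(i < 28, j < #|[set g | incident t g]%SET|) phi (enum_val j) i).
Proof.
have [phi phiE] := choice (dof_value_linear t); exists phi; split => [b g|]; first exact: phiE.
set S := [set g | incident t g]%SET; set M := matrix_of_fun _ _.
rewrite -kermx_eq0; apply/eqP/row_matrixP => i; rewrite row0.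
have /sub_kermxP : (row i (kermx M) <= kermx M)%MS by exact: row_sub.
move: (row i _) => b bM; apply/rowP => j; rewrite mxE.
apply: (@dof_unisolvent t (b 0)) => g gt; have gS : g \in S by rewrite inE.
move/rowP: bM => /(_ (enum_rank_in gS g)); rewrite !mxE phiE => bM0; rewrite -[RHS]bM0.
by apply: eq_bigr => k _; rewrite mxE enum_rankK_in.
Qed.

(* The pair (r, j) at position i: r < 3 is the vertex, 3 <= r < 6 the edge opposite to vertex r - 3, and r = 6 the
   triangle with which i is associated, and i is the j-th index of its group. *)
Definition index_class : seq (nat * nat) := [:: (0,0); (1,0); (2,0); (0,1); (0,2); (1,1); (1,2); (2,1); (2,2);
  (0,3); (0,4); (1,3); (1,4); (2,3); (2,4); (0,5); (1,5); (2,5);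
  (5,0); (3,0); (4,0); (5,1); (4,1); (3,1); (5,2); (4,2); (3,2); (6,0)]%N.

Definition ordered_pair w1 w2 := if (w1 < w2)%N then (w1, w2) else (w2, w1).

(** Addition in ['I_3] is modulo 3: adding 1 and 2 to a vertex number yields the two ends of the
    opposite edge. *)
Definition local_dof t (i : 'I_28) : dof := let: (r, j) := nth (6, 0)%N index_class i in
  if (r < 3)%N then inl (tri t (inord r), inord j)
  else if (r < 6)%N then inr (inl (ordered_pair (tri t (inord (r - 3) + 1)) (tri t (inord (r - 3) + 2)), inord j))
  else inr (inr t).

Lemma mem_index_class (n m d : nat) : all (fun r => all (fun j => (d + r, j)%N \in index_class) (iota 0 m)) (iota 0 n) ->
  forall (r : 'I_n) (j : 'I_m), exists i : 'I_28, nth (6, 0)%N index_class i = (d + r, j : nat)%N.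
Proof.
move=> H r j; have m' l (k : 'I_l) : (k : nat) \in iota 0 l by rewrite mem_iota /= ltn_ord.
have h := allP (allP H _ (m' _ r)) _ (m' _ j).
have lt : (index (d + r, j : nat)%N index_class < 28)%N by rewrite -[28%N]/(size index_class) index_mem.
by exists (Ordinal lt); rewrite /= nth_index.
Qed.

Lemma opposite_vertex (k1 k2 : 'I_3) : k1 != k2 ->
  let k := inord (3 - (k1 + k2)) in (k1 = k + 1 /\ k2 = k + 2) \/ (k1 = k + 2 /\ k2 = k + 1).
Proof.
move=> nk /=; suff E (k : 'I_3) : (k : nat) = (3 - (k1 + k2))%N ->
    ((k1 == k + 1) && (k2 == k + 2)) || ((k1 == k + 2) && (k2 == k + 1)).
  have /E/orP[] : (inord (3 - (k1 + k2)) : 'I_3) = (3 - (k1 + k2))%N :> nat.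
  - by rewrite inordK//; move: nk; clear; case: k1 => [] [|[|[|//]]] i1; case: k2 => [] [|[|[|//]]] i2.
  - by move=> /andP[/eqP ? /eqP ?]; left.
  - by move=> /andP[/eqP ? /eqP ?]; right.
by move: nk; case: k => [] [|[|[|//]]] i; case: k1 => [] [|[|[|//]]] i1; case: k2 => [] [|[|[|//]]] i2.
Qed.

Lemma ordered_pairC w1 w2 : ordered_pair w1 w2 = ordered_pair w2 w1.
Proof. by rewrite /ordered_pair; case: (ltngtP w1 w2) => // /val_inj ->. Qed.

Lemma ordered_pair_tri t k1 k2 : (tri t k1 < tri t k2)%N ->
  ordered_pair (tri t (inord (3 - (k1 + k2)) + 1)) (tri t (inord (3 - (k1 + k2)) + 2)) = (tri t k1, tri t k2).
Proof.
move=> lt; have nk : k1 != k2 by apply: contraTneq lt => ->; rewrite ltnn.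
have e : ordered_pair (tri t k1) (tri t k2) = (tri t k1, tri t k2) by rewrite /ordered_pair lt.
rewrite -e; have := opposite_vertex nk; cbv zeta; move: (inord _) => k [[h1 h2]|[h1 h2]]; rewrite h1 h2//.
exact: ordered_pairC.
Qed.

Lemma local_dof_surj t g : incident t g -> exists i, local_dof t i = g.
Proof.
case: g => [[w j]|[[[a b] j]|t0]] /=.
- move=> /vsetP[k ->]; have [i ie] := @mem_index_class 3 6 0 isT k j.
  by exists i; rewrite /local_dof ie add0n ltn_ord !inord_val.
- move=> /and3P[ab /vsetP[k1 e1] /vsetP[k2 e2]]; rewrite e1 e2 in ab *.
  have [i ie] := @mem_index_class 3 3 3 isT (inord (3 - (k1 + k2))) j.
  exists i; rewrite /local_dof ie ltnNge leq_addr /= -[6%N]/(3 + 3)%N ltn_add2l ltn_ord addKn !inord_val.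
  by rewrite ordered_pair_tri.
- by move=> /eqP <-; exists ord_max; rewrite /local_dof.
Qed.

Lemma incident_local_dof t i : incident t (local_dof t i).
Proof.
rewrite /local_dof; case: (nth _ _ _) => r j; case: ifP => _; first exact: vertex_in.
case: ifP => _ /=; last by rewrite eqxx.
have : tri t (inord (r - 3) + 1) != tri t (inord (r - 3) + 2).
  by rewrite (inj_eq (tri_inj hT (t := t))) (inj_eq (addrI _)).
by rewrite /ordered_pair; case: (ltngtP (tri t _) (tri t _)) => [lt|lt|/val_inj ->] /=; rewrite ?lt ?vertex_in ?eqxx.
Qed.

Lemma incident_image t : [set g | incident t g]%SET = finset.imset (local_dof t) (mem [set: 'I_28]%SET).
Proof.
apply/finset.setP => g; rewrite inE; apply/idP/imsetP => [/local_dof_surj[i <-]|[i _ ->]]; first by exists i.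
exact: incident_local_dof.
Qed.

(** At most 28, since the indices map onto the incident degrees of freedom; at least 28, since a
    matrix with 28 independent rows has that many columns. The injectivity of [local_dof]
    follows. *)
Lemma card_incident t : #|[set g | incident t g]%SET| = 28%N.
Proof.
apply/eqP; rewrite eqn_leq; apply/andP; split.
  by rewrite incident_image (leq_trans (leq_imset_card _ _))// finset.cardsT card_ord.
by have [phi [_ /eqP <-]] := dof_matrix t; exact: rank_leq_col.
Qed.

Lemma local_dof_inj t : injective (local_dof t).
Proof.
have /imset_injP H : #|finset.imset (local_dof t) (mem [set: 'I_28]%SET)| == #|[set: 'I_28]%SET|.
  by rewrite -incident_image card_incident finset.cardsT card_ord.
by move=> i j; apply: H; rewrite finset.in_setT.
Qed.

(** The matrix of the functionals is square with independent rows, so its row space is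
    everything. *)
Lemma dof_solvable t (y : dof -> R) : exists b, forall g, incident t g -> dof_value b t g = y g.
Proof.
have [phi [phiE]] := dof_matrix t; set S := [set g | incident t g]%SET; set M := matrix_of_fun _ _ => /eqP rM.
have full : row_full M by rewrite /row_full rM card_incident.
have /submxP[b bE] : ((\row_(j < #|S|) y (enum_val j)) <= M)%MS by rewrite submx_full.
exists (b 0) => g gt; have gS : g \in S by rewrite inE.
move/rowP: bE => /(_ (enum_rank_in gS g)); rewrite !mxE enum_rankK_in// phiE => ->.
by apply: eq_bigr => k _; rewrite mxE enum_rankK_in.
Qed.

Definition solves (a : 'I_nT -> 'I_28 -> R) (y : dof -> R) := forall t g, incident t g -> dof_value (a t) t g = y g.

Lemma vertex_point w t : w \in vset tri t -> tri_set (V t) (p w).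
Proof. by move=> /vsetP[k ->]; exact: (tri_set_vertex (V t)). Qed.

(** Common points of two triangles lie on a segment between common vertices. All data attached to
    that segment agree, so the difference of the two formulas has zero 2-jet along it. *)
Lemma solves_consistent a y : solves a y -> consistent V a.
Proof.
move=> H.
have key t t' x : tri_set (V t) x -> tri_set (V t') x ->
  jet0 (diff_coef (a t) (a t')) (diff_form (cube_form (V t)) (cube_form (V t'))) x.
  move=> tx t'x; have [->|tt'] := eqVneq t t'.
    by split=> [|u|u w]; rewrite ?tcs_diff ?tcs1_diff ?tcs2_diff subrr.
  have [w1 [w2 [r [w1S w2S r01 ->]]]] := common_points hT tt' tx t'x.
  move: w1S w2S; rewrite !finset.in_setI => /andP[w1t w1t'] /andP[w2t w2t'].
  apply: segment_jet r01.
  - move: w1t w1t' w2t w2t' => /vsetP[k1 e1] /vsetP[k1' e1'] /vsetP[k2 e2] /vsetP[k2' e2'] [] i /=.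
      by rewrite e1 e2; apply: (cube_good (tri_nd hT t)).
    by rewrite e1' e2'; apply: (cube_good (tri_nd hT t')).
  - by move=> j; rewrite vjet_diff; apply/eqP; rewrite subr_eq0; apply/eqP; 
    rewrite [LHS](H t (inl (w1, j)))// [RHS](H t' (inl (w1, j))).
  - by move=> j; rewrite vjet_diff; apply/eqP; rewrite subr_eq0; apply/eqP; 
    rewrite [LHS](H t (inl (w2, j)))// [RHS](H t' (inl (w2, j))).
  - by move=> lt j; rewrite ejet_diff; apply/eqP; rewrite subr_eq0; apply/eqP; 
    rewrite [LHS](H t (inr (inl (w1, w2, j)))) ?[RHS](H t' (inr (inl (w1, w2, j))))//=; apply/and3P.
  - by move=> lt j; rewrite ejet_diff; apply/eqP; rewrite subr_eq0; apply/eqP; 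
    rewrite [LHS](H t (inr (inl (w2, w1, j)))) ?[RHS](H t' (inr (inl (w2, w1, j))))//=; apply/and3P.
split=> [t t' x tx t'x|u t t' x tx t'x|u w t t' x tx t'x]; have [h0 h1 h2] := jet0_diff (key _ _ _ tx t'x).
- exact: h0.
- exact: h1.
- exact: h2.
Qed.

Lemma consistent_dof a : consistent V a -> forall t t' g, incident t g -> incident t' g ->
  dof_value (a t) t g = dof_value (a t') t' g.
Proof.
move=> [c0 c1 c2] t t' [[w j]|[[[w1 w2] j]|t0]] /=.
- move=> /vertex_point h /vertex_point h'.
  by case: j => [] [|[|[|[|[|[|//]]]]]] ?; rewrite /vjet /tnth /=; [exact: c0|exact: c1|exact: c1|exact: c2|exact: c2|exact: c2].
- move=> /and3P[_ a1 a2] /and3P[_ b1 b2].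
  have in12 (r : R) : (0 <= r) && (r <= 1) -> tri_set (V t) (p w1 + r *: (p w2 - p w1)) /\ tri_set (V t') (p w1 + r *: (p w2 - p w1)).
    by move=> r01; split; apply: tri_set_segment => //; [exact: (tri_nd hT)|exact: vertex_point|exact: vertex_point|exact: (tri_nd hT)|exact: vertex_point|exact: vertex_point].
  have r1 : (0 <= (1/2 : R)) && ((1/2 : R) <= 1) by apply/andP; split; lra.
  have r2 : (0 <= (1/3 : R)) && ((1/3 : R) <= 1) by apply/andP; split; lra.
  have r3 : (0 <= (2/3 : R)) && ((2/3 : R) <= 1) by apply/andP; split; lra.
  have [p1 q1] := in12 _ r1; have [p2 q2] := in12 _ r2; have [p3 q3] := in12 _ r3.
  by case: j => [] [|[|[|//]]] ?; rewrite /ejet /tnth /=; [exact: c1|exact: c2|exact: c2].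
- by move=> /eqP -> /eqP ->.
Qed.

End Dofs.

(** * The dimension of the spline space *)

Section Dimension.
Context {R : realType} {nV nT : nat}.
Variables (p : 'I_nV -> @pt R) (tri : 'I_nT -> 'I_3 -> 'I_nV).
Hypothesis hT : is_triangulation p tri.
Local Notation V := (tverts p tri).
Local Notation dof := (@dof nV nT).
Implicit Types (t : 'I_nT) (w : 'I_nV) (g : dof).

Definition dofs : {set dof} := [set g | [exists t, incident tri t g]]%SET.

Lemma is_edgeP (a b : 'I_nV) : (a < b)%N -> is_edge tri a b = [exists t, (a \in vset tri t) && (b \in vset tri t)].
Proof.
move=> ab; apply/idP/idP => [/existsP[t /existsP[k1 /existsP[k2 /andP[/andP[_ /eqP <-] /eqP <-]]]]|/existsP[t /andP[/vsetP[k1 e1] /vsetP[k2 e2]]]].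
  by apply/existsP; exists t; rewrite !vertex_in.
apply/existsP; exists t; apply/existsP; exists k1; apply/existsP; exists k2; rewrite -e1 -e2 !eqxx !andbT.
by apply: contraTneq ab => k12; rewrite e1 e2 k12 ltnn.
Qed.

Lemma card_dofs : #|dofs| = (6 * nV + 3 * nE tri + nT)%N.
Proof.
pose E := [set e : 'I_nV * 'I_nV | (e.1 < e.2)%N && is_edge tri e.1 e.2]%SET.
rewrite cardsE -sum1_card big_sumType big_sumType /= -addnA; congr (_ + (_ + _))%N.
- rewrite (eq_bigl predT) => [|[w j]]; first by rewrite sum1_card card_prod !card_ord mulnC.
  have [_ [_ [/(_ w)[t [k <-]] _]]] := hT; apply/existsP; exists t; exact: vertex_in.
- have -> : (3 * nE tri)%N = #|finset.setX E [set: 'I_3]%SET|.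
    rewrite finset.cardsX cardsT card_ord mulnC; congr (_ * _)%N.
    apply: eq_card => e; rewrite !inE; exact: asboolb.
  rewrite -sum1_card; apply: eq_bigl => -[e j]; rewrite !inE /= andbT.
  rewrite unfold_in; case: ltnP => [lt|ge]; last by apply/existsP => -[t]; rewrite /= ltnNge ge.
  by rewrite /= is_edgeP//; apply: eq_existsb => t; rewrite /= lt.
- rewrite (eq_bigl predT) => [|t]; first by rewrite sum1_card card_ord.
  by apply/existsP; exists t; rewrite /= eqxx.
Qed.

Lemma tcs_lincomb (I J : finType) (c : I -> R) (A : I -> J -> R) L x :
  tcs (fun k => \sum_i c i * A i k) L x = \sum_i c i * tcs (A i) L x.
Proof.
rewrite /tcs; under eq_bigr do rewrite mulr_suml; rewrite exchange_big; apply: eq_bigr => i _.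
by rewrite mulr_sumr; apply: eq_bigr => k _; rewrite mulrA.
Qed.

Lemma dof_lincomb (I : finType) (c : I -> R) (A : I -> 'I_28 -> R) t g :
  dof_value p tri (fun k => \sum_i c i * A i k) t g = \sum_i c i * dof_value p tri (A i) t g.
Proof.
have [phi phiE] := dof_value_linear p tri t g.
rewrite phiE; under eq_bigr do rewrite mulr_suml; rewrite exchange_big; apply: eq_bigr => i _.
by rewrite phiE mulr_sumr; apply: eq_bigr => k _; rewrite mulrA.
Qed.

Lemma tri_tcs_eq0 (b : 'I_28 -> R) t : (forall x, tri_set (V t) x -> tcs b (cube_form (V t)) x = 0) -> forall i, b i = 0.
Proof.
move=> H; have nd := tri_nd hT t; have [h1 h2] := tri_tcs0 (tri_nd hT) H.
apply: (tcs_unisolvent_edges nd) => [k1 k2 r r01|]; last by apply/H/inner_tri/inner_centroid.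
have tx : tri_set (V t) (V t k1 + r *: (V t k2 - V t k1)) by apply: tri_set_segment => //; exact: tri_set_vertex.
by split=> [|u|u w]; [exact: H|exact: h1|exact: h2].
Qed.

Lemma solution_exists (y : dof -> R) : exists a, solves p tri a y.
Proof. by have [a aE] := choice (fun t => dof_solvable hT t y); exists a. Qed.

(** The basis is dual to the degrees of freedom: [A g] has all values zero except that of [g].
    Evaluating a relation gives independence, and local unisolvence shows that a spline is the
    combination of the basis with its own values. *)
Lemma S32_dim : has_dim_on (domain p tri) (S32 p tri) (6 * nV + 3 * nE tri + nT).
Proof.
rewrite -card_dofs.
have [A AE] := choice (fun g => solution_exists (fun h => (h == g)%:R)).
have [f fE] := choice (fun g => consistent_spline (tri_nd hT) (solves_consistent hT (AE g))).
exists (fun i => f (enum_val i)); split; last split.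
- by move=> i; have [h1 h2 _] := fE (enum_val i).
- move=> c H i0; have := enum_valP i0; rewrite inE => /existsP[t ti0].
  have b0 : forall k, \sum_i c i * A (enum_val i) t k = 0.
    apply: (@tri_tcs_eq0 _ t) => x tx; rewrite tcs_lincomb -[RHS](H x); last by exists t.
    by apply: eq_bigr => i _; have [_ _ h] := fE (enum_val i); rewrite (h t).
  have := dof_lincomb c (fun i => A (enum_val i) t) t (enum_val i0).
  have [phi ->] := dof_value_linear p tri t (enum_val i0).
  rewrite big1 => [|k _]; last by rewrite b0 mul0r.
  rewrite (bigD1 i0)//= AE// eqxx mulr1 big1 ?addr0 => [->//|i ni].
  by rewrite AE// (inj_eq enum_val_inj) eq_sym (negPf ni) mulr0.
- move=> s [Cs pc]; have [a ca aE] := spline_consistent (tri_nd hT) Cs pc.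
  have ex g : exists y : R, forall t, incident tri t g -> dof_value p tri (a t) t g = y.
    have [[t0 h0]|h] := pselect (exists t, incident tri t g).
      exists (dof_value p tri (a t0) t0 g) => t h; exact: consistent_dof.
    by exists 0 => t ht; case: h; exists t.
  have [y yE] := choice ex; exists (fun i => y (enum_val i)) => x [t _ tx].
  rewrite (aE t)//; have -> : \sum_(i < #|dofs|) y (enum_val i) * f (enum_val i) x =
      tcs (fun k => \sum_(i < #|dofs|) y (enum_val i) * A (enum_val i) t k) (cube_form (V t)) x.
    by rewrite tcs_lincomb; apply: eq_bigr => i _; have [_ _ h] := fE (enum_val i); rewrite (h t).
  suff E k : a t k = \sum_(i < #|dofs|) y (enum_val i) * A (enum_val i) t k.
    by apply: eq_bigr => k _; rewrite E.
  apply/eqP; rewrite -subr_eq0; apply/eqP; move: k.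
  (* The difference of two coefficient vectors is written as a sum over the booleans, so that the
     linearity lemma applies to it. *)
  pose c (o : bool) := if o then 1 else -1 : R.
  pose D (o : bool) := if o then a t else fun k => \sum_(i < #|dofs|) y (enum_val i) * A (enum_val i) t k.
  suff H : forall k, \sum_o c o * D o k = 0 by move=> k; rewrite -[RHS](H k) big_bool /= mul1r mulN1r.
  apply: (@dof_unisolvent _ _ _ _ _ hT t) => g gt; rewrite dof_lincomb big_bool.
  change (1 * dof_value p tri (a t) t g + -1 * dof_value p tri (D false) t g = 0); rewrite mul1r mulN1r (yE g)// dof_lincomb.
  have gS : g \in dofs by rewrite inE; apply/existsP; exists t.
  rewrite (bigD1 (enum_rank_in gS g))//= AE// enum_rankK_in// eqxx mulr1 big1 ?addr0 ?subrr// => i ni.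
  rewrite AE// (_ : g == _ = false) ?mulr0//; apply: contraNF ni => /eqP ge.
  by apply/eqP/enum_val_inj; rewrite enum_rankK_in.
Qed.

End Dimension.

(** * The minimal determining set *)

Lemma index_classP : (all (fun i => let r := (nth (6, 0) index_class i).1 in
  [&& all (fun k => (i \in nth [::] [:: [:: 0; 3; 4; 9; 10; 15]; [:: 1; 5; 6; 11; 12; 16]; [:: 2; 7; 8; 13; 14; 17]] k) == (r == k)) (iota 0 3),
      all (fun m => (i \in nth [::] [:: [:: 19; 23; 26]; [:: 20; 22; 25]; [:: 18; 21; 24]] m) == (r == 3 + m)) (iota 0 3),
      (i == 27) == (r == 6) & r < 7]) (iota 0 28))%N.
Proof. by []. Qed.

(** * The cardinality of the determining set *)

Section DeterminingSet.
Context {R : realType} {nV nT : nat}.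
Variables (p : 'I_nV -> @pt R) (tri : 'I_nT -> 'I_3 -> 'I_nV).
Hypothesis hT : is_triangulation p tri.
Variables (vch : 'I_nV -> 'I_nT) (ech : 'I_nV -> 'I_nV -> 'I_nT).
Hypothesis hvch : forall w : 'I_nV, exists k : 'I_3, tri (vch w) k = w.
Hypothesis hech : forall a b : 'I_nV, (a < b)%N -> is_edge tri a b ->
  exists k1 k2 : 'I_3, tri (ech a b) k1 = a /\ tri (ech a b) k2 = b.
Implicit Types (t : 'I_nT) (w : 'I_nV) (g : @dof nV nT) (i : 'I_28).

Definition chosen g : 'I_nT :=
  match g with inl (w, _) => vch w | inr (inl (e, _)) => ech e.1 e.2 | inr (inr t) => t end.

Definition class_of (i : nat) : nat := (nth (6, 0)%N index_class i).1.

Lemma index_classE i : [/\ forall k, vidx k i = (class_of i == k),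
  forall k1 k2 : 'I_3, eidx k1 k2 i = (k1 != k2) && (class_of i == 3 + (3 - (k1 + k2)))%N,
  (i == 27 :> nat) = (class_of i == 6%N) & (class_of i < 7)%N].
Proof.
have m' l (k : 'I_l) : (k : nat) \in iota 0 l by rewrite mem_iota /= ltn_ord.
have /and4P[h1 h2 /eqP h3 h4] := allP index_classP _ (m' _ i); split => //.
- by move=> k; apply/eqP; exact: allP h1 _ (m' _ k).
- move=> k1 k2; rewrite /eidx; case: eqVneq => //= nk; apply/eqP; apply: allP h2 _ _.
  by move: nk; case: k1 => [] [|[|[|//]]] i1; case: k2 => [] [|[|[|//]]] i2.
Qed.

(** Membership is reduced to one condition: the triangle is the one chosen for the degree of freedom
    that the index represents in it. For the index of the triangle itself this always holds. *)
Lemma MsetE x : (x \in Mset tri vch ech) = (x.1 == chosen (local_dof tri x.1 x.2)).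
Proof.
case: x => t i; rewrite inE /=; have [hv he h27 h7] := index_classE i.
have ne k : k + 1 != k + 2 :> 'I_3 by rewrite (inj_eq (addrI _)).
have classD : local_dof tri t i = let r := class_of i in let j := (nth (6, 0)%N index_class i).2 in
  if (r < 3)%N then inl (tri t (inord r), inord j)
  else if (r < 6)%N then inr (inl (ordered_pair (tri t (inord (r - 3) + 1)) (tri t (inord (r - 3) + 2)), inord j))
  else inr (inr t).
  by rewrite /local_dof /class_of; case: (nth _ _ _).
rewrite h27; move: hv he h7 classD; move: (class_of i) => r hv he h7 ->; cbv zeta.
move: (nth _ _ _).2 => j.
apply/idP/idP => [/orP[/orP[]|]|].
- move=> /existsP[w /andP[/eqP tw /existsP[k /andP[/eqP kw]]]]; rewrite hv => /eqP ->.
  by rewrite ltn_ord inord_val kw /= tw.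
- move=> /existsP[a /existsP[b /and4P[ab _ /eqP tE /existsP[k1 /existsP[k2 /and3P[/eqP k1E /eqP k2E]]]]]].
  rewrite he => /andP[nk /eqP ->]; rewrite -k1E -k2E in ab.
  have lt3 : (3 - (k1 + k2) < 3)%N by move: nk; clear; case: k1 => [] [|[|[|//]]] i1; case: k2 => [] [|[|[|//]]] i2.
  rewrite ltnNge leq_addr /= -[6%N]/(3 + 3)%N ltn_add2l lt3 addKn ordered_pair_tri//= k1E k2E.
  exact/eqP.
- by move=> /eqP ->.
case: ifP => r3 /=.
  move=> /eqP tE; apply/orP; left; apply/orP; left; apply/existsP; exists (tri t (inord r)); rewrite -tE eqxx /=.
  by apply/existsP; exists (inord r); rewrite eqxx hv inordK//=.
case: ifP => r6 /= tE; last by apply/orP; right; apply/eqP; lia.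
apply/orP; left; apply/orP; right.
have r33 : (r - 3 < 3)%N by lia.
have cls (k1 k2 : 'I_3) : (k1 == inord (r - 3) + 1) && (k2 == inord (r - 3) + 2) || (k1 == inord (r - 3) + 2) && (k2 == inord (r - 3) + 1) ->
    eidx k1 k2 i.
  have : (inord (r - 3) : 'I_3) = (r - 3)%N :> nat by rewrite inordK.
  move: (inord _) => k kE h; rewrite he; apply/andP; split.
    by case/orP: h => /andP[/eqP -> /eqP ->]; rewrite ?ne// eq_sym ne.
  have -> : r = (3 + k)%N by rewrite kE; lia.
  by rewrite eqn_add2l; move: h; clear; case: k => [] [|[|[|//]]] i0; case: k1 => [] [|[|[|//]]] i1; case: k2 => [] [|[|[|//]]] i2.
move: tE cls; move: (inord (r - 3)) => k; rewrite /ordered_pair.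
case: (ltngtP (tri t (k + 1)) (tri t (k + 2))) => /= [lt|lt|/val_inj/(tri_inj hT) e]; last by move: (ne k); rewrite e eqxx.
- move=> tE cls; apply/existsP; exists (tri t (k + 1)); apply/existsP; exists (tri t (k + 2)); rewrite lt tE /=.
  rewrite is_edgeP//; apply/andP; split; first by apply/existsP; exists t; rewrite !vertex_in.
  by apply/existsP; exists (k + 1); apply/existsP; exists (k + 2); rewrite !eqxx cls// !eqxx.
- move=> tE cls; apply/existsP; exists (tri t (k + 2)); apply/existsP; exists (tri t (k + 1)); rewrite lt tE /=.
  rewrite is_edgeP//; apply/andP; split; first by apply/existsP; exists t; rewrite !vertex_in.
  by apply/existsP; exists (k + 2); apply/existsP; exists (k + 1); rewrite !eqxx cls// !eqxx orbT.
Qed.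

Lemma incident_chosen g : g \in dofs tri -> incident tri (chosen g) g.
Proof.
rewrite inE => /existsP[t]; case: g => [[w j]|[[[a b] j]|t0]] /=.
- by move=> _; have [k kw] := hvch w; apply/imsetP; exists k.
- move=> /and3P[ab at_ bt]; have [|k1 [k2 [h1 h2]]] := hech ab.
    by rewrite is_edgeP//; apply/existsP; exists t; rewrite at_.
  by rewrite ab /=; apply/andP; split; apply/imsetP; [exists k1|exists k2].
- by [].
Qed.

(** [local_dof] maps the set bijectively onto the degrees of freedom: the chosen triangle supplies a
    preimage, and the image determines that triangle, in which indices are distinguished. *)
Lemma card_Mset : #|Mset tri vch ech| = (6 * nV + 3 * nE tri + nT)%N.
Proof.
rewrite -(card_dofs hT).
have <- : finset.imset (fun x => local_dof tri x.1 x.2) (mem (Mset tri vch ech)) = dofs tri.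
  apply/finset.setP => g; apply/imsetP/idP => [[x _ ->]|gd].
    by rewrite inE; apply/existsP; exists x.1; exact: (incident_local_dof hT).
  have [i ig] := local_dof_surj (incident_chosen gd).
  by exists (chosen g, i); rewrite ?MsetE /= ig.
rewrite card_in_imset// => -[t i] [t' i']; rewrite !MsetE /= => /eqP h /eqP h' e.
have tt : t = t' by rewrite h h' e.
by move: e; rewrite tt => /(local_dof_inj hT) ->.
Qed.

End DeterminingSet.

Lemma vertex_class : all (fun o => perm_eq (map (reorder_index o) vertex_group)
  [seq i <- iota 0 28 | class_of i == order3 o 0]) (iota 0 6).
Proof. by []. Qed.

(* Orders 0 and 2, 1 and 4, 3 and 5 differ by exchanging the first two vertices. *)
Definition swapped_order (o : nat) : nat := nth 0%N [:: 2; 4; 0; 5; 1; 3]%N o.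

(** For an order that puts an edge first, the three indices of the edge are the image of 18
    (midpoint), the image of 21 (third point nearer the first end) and the image of 21 under the
    swapped order (the other third point). The class number is 3 plus the number of the opposite
    vertex. *)
Lemma edge_class : all (fun o => [&& order3 (swapped_order o) 0 == order3 o 1, order3 (swapped_order o) 1 == order3 o 0,
  (swapped_order o < 6)%N, reorder_index (swapped_order o) 18 == reorder_index o 18,
  perm_eq (map (reorder_index o) (iota 0 18)) (iota 0 18), order3 o 0 != order3 o 1, (order3 o 1 < 3)%N, (order3 o 0 < 3)%N &
  perm_eq [:: reorder_index o 18; reorder_index o 21; reorder_index (swapped_order o) 21]
    [seq i <- iota 0 28 | class_of i == (3 + (3 - (order3 o 0 + order3 o 1)))%N]]) (iota 0 6).
Proof. by []. Qed.

Lemma class_lt3 : all (fun i => (i < 18)%N == (class_of i < 3)%N) (iota 0 28).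
Proof. by []. Qed.

(** * Coefficient groups and jets at an arbitrary vertex or edge *)

Section LocalJets.
Context {R : realType} {I : finType}.
Variables (v : 'I_3 -> @pt R) (a : I -> R) (L : I -> R * @pt R) (c : nat -> R).
Hypothesis nd : Defs.nondegenerate v.
Hypothesis tcsE : forall x, inner v x -> tcs a L x = combination v c x.

Lemma inner_reorder o x : (o < 6)%N -> inner (reorder v o) x -> inner v x.
Proof.
move=> o6 /(interior_tri (reorder_nd o6 nd)) h; apply/(interior_tri nd); apply: interiorS h.
move=> y [n [q [l [qA H]]]]; exists n, q, l; split => // i.
by have [k _ <-] := qA i; exists (inord (order3 o k)).
Qed.

Lemma tcs_reorder o x : (o < 6)%N -> inner (reorder v o) x ->
  tcs a L x = combination (reorder v o) (fun j => c (reorder_index o j)) x.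
Proof. by move=> o6 ix; rewrite -reorder_combination//; apply/tcsE/(inner_reorder o6). Qed.

Lemma vertex_class_jet (k : 'I_3) : (forall i, (i < 28)%N -> class_of i = k -> c i = 0) <-> jet0 a L (v k).
Proof.
have [ o o6 ok] : exists2 o, (o < 6)%N & order3 o 0 = k.
  by exists (2 * k)%N; case: k => [] [|[|[|//]]].
have -> : v k = reorder v o 0 by rewrite /reorder ok inord_val.
have /perm_mem pm : perm_eq (map (reorder_index o) vertex_group) [seq i <- iota 0 28 | class_of i == order3 o 0].
  by apply: (allP vertex_class); rewrite mem_iota.
rewrite -(vertex_jet0 (reorder_nd o6 nd) (fun x => tcs_reorder o6)).
split=> H i.
  move=> iv; have := map_f (reorder_index o) iv; rewrite pm mem_filter mem_iota ok => /andP[/eqP ik i28]; exact: H.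
move=> i28 ik; have : i \in [seq i <- iota 0 28 | class_of i == order3 o 0] by rewrite mem_filter mem_iota ok ik eqxx.
by rewrite -pm => /mapP[j jv ->]; exact: H.
Qed.

Definition edge_jets A B := [/\ jet1 a L (A + (1/2) *: (B - A)), jet0 a L (A + (1/3) *: (B - A)) & jet0 a L (A + (2/3) *: (B - A))].

(** Two orders with the same edge in front and opposite directions are used. One gives the midpoint
    and the third point near [v k1], the other the third point near [v k2]; both need the index of
    the midpoint, which they share. *)
Lemma edge_class_jets (k1 k2 : 'I_3) : k1 != k2 -> (forall i, (i < 28)%N -> (class_of i < 3)%N -> c i = 0) ->
  (forall i, (i < 28)%N -> class_of i = (3 + (3 - (k1 + k2)))%N -> c i = 0) <-> edge_jets (v k1) (v k2).
Proof.
move=> nk c0.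
have c18 i : (i < 18)%N -> c i = 0.
  move=> i18; apply: c0; first by apply: ltn_trans i18 _.
  by have /eqP <- : (i < 18)%N == (class_of i < 3)%N by apply: (allP class_lt3); rewrite mem_iota (ltn_trans i18).
have [ o [ o6 ok1 ok2]] : exists o, [/\ (o < 6)%N, order3 o 0 = k1 & order3 o 1 = k2].
  exists (index (k1 : nat, k2 : nat) [:: (0, 1); (0, 2); (1, 0); (1, 2); (2, 0); (2, 1)]%N).
  by move: nk; case: k1 => [] [|[|[|//]]] i1; case: k2 => [] [|[|[|//]]] i2.
have := allP edge_class o; rewrite mem_iota => /(_ o6)/and5P[+ + + + /and5P[+ + + + +]].
set o' := swapped_order o => /eqP; rewrite ok2 => o'1 /eqP; rewrite ok1 => o'2 o'6 /eqP r18 p18 _ _ _ /perm_mem pm.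
have rlt (q : nat) : (q < 6)%N -> forall i, (i < 18)%N -> c (reorder_index q i) = 0.
  move=> q6 i i18; apply: c18; have := allP edge_class q; rewrite mem_iota => /(_ q6)/and5P[_ _ _ _ /and5P[/perm_mem p _ _ _ _]].
  have : reorder_index q i \in map (reorder_index q) (iota 0 18) by apply: map_f; rewrite mem_iota.
  by rewrite p mem_iota.
have J1 := edge_jet1 (reorder_nd o6 nd) (fun x => tcs_reorder o6) (rlt o o6).
have J2 := third_jet0 (reorder_nd o6 nd) (fun x => tcs_reorder o6).
have J3 := third_jet0 (reorder_nd o'6 nd) (fun x => tcs_reorder o'6).
have r0 : reorder v o 0 = v k1 by rewrite /reorder ok1 inord_val.
have r1 : reorder v o 1 = v k2 by rewrite /reorder ok2 inord_val.
have r0' : reorder v o' 0 = v k2 by rewrite /reorder o'1 inord_val.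
have r1' : reorder v o' 1 = v k1 by rewrite /reorder o'2 inord_val.
have m1 : comb (reorder v o) (1/2, 1/2, 0) = v k1 + (1/2) *: (v k2 - v k1).
  by rewrite /comb /= r0 r1 scale0r addr0; case: (v k1) (v k2) => ? ? [? ?]; congr (_, _); rewrite /= /GRing.scale /=; field.
have m2 : comb (reorder v o) (2/3, 1/3, 0) = v k1 + (1/3) *: (v k2 - v k1).
  by rewrite /comb /= r0 r1 scale0r addr0; case: (v k1) (v k2) => ? ? [? ?]; congr (_, _); rewrite /= /GRing.scale /=; field.
have m3 : comb (reorder v o') (2/3, 1/3, 0) = v k1 + (2/3) *: (v k2 - v k1).
  by rewrite /comb /= r0' r1' scale0r addr0; case: (v k1) (v k2) => ? ? [? ?]; congr (_, _); rewrite /= /GRing.scale /=; field.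
rewrite m1 in J1; rewrite m2 in J2; rewrite m3 in J3.
have le19 (q : nat) : (q < 6)%N -> c (reorder_index q 18) = 0 -> forall i, (i < 19)%N -> c (reorder_index q i) = 0.
  by move=> q6 h i; rewrite ltnS leq_eqVlt => /predU1P[->//|]; exact: rlt.
split=> [H|[h1 h2 h3] i i28 ik].
  have H' i : i \in [:: reorder_index o 18; reorder_index o 21; reorder_index o' 21] -> c i = 0.
    by rewrite pm mem_filter mem_iota => /andP[/eqP ik i28]; exact: H.
  have z18 : c (reorder_index o 18) = 0 by apply: H'; rewrite inE eqxx.
  split; first by apply/J1.
  - by apply/J2; [exact: le19|apply: H'; rewrite !inE eqxx orbT].
  - by apply/J3; [apply: le19 => //; rewrite r18|apply: H'; rewrite !inE eqxx !orbT].
have z18 : c (reorder_index o 18) = 0 by apply/J1.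
have : i \in [seq i <- iota 0 28 | class_of i == (3 + (3 - (k1 + k2)))%N] by rewrite mem_filter mem_iota ik eqxx.
rewrite -pm !inE => /or3P[] /eqP -> //.
- by apply/J2 => //; exact: le19.
- by apply/J3 => //; apply: le19 => //; rewrite r18.
Qed.

End LocalJets.

(** * Propagation of vanishing coefficients over the triangulation *)

Section Vanishing.
Context {R : realType} {nV nT : nat}.
Variables (p : 'I_nV -> @pt R) (tri : 'I_nT -> 'I_3 -> 'I_nV).
Hypothesis hT : is_triangulation p tri.
Variables (vch : 'I_nV -> 'I_nT) (ech : 'I_nV -> 'I_nV -> 'I_nT).
Hypothesis hvch : forall w : 'I_nV, exists k : 'I_3, tri (vch w) k = w.
Hypothesis hech : forall a b : 'I_nV, (a < b)%N -> is_edge tri a b ->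
  exists k1 k2 : 'I_3, tri (ech a b) k1 = a /\ tri (ech a b) k2 = b.
Local Notation V := (tverts p tri).

Lemma determining s (c : 'I_nT -> 'I_28 -> R) : S32 p tri s -> coeffs_of p tri s c ->
  (forall x, x \in Mset tri vch ech -> c x.1 x.2 = 0) -> forall x, domain p tri x -> s x = 0.
Proof.
move=> [Cs pc] sc c0; have [a [a0 a1 a2] aE] := spline_consistent (tri_nd hT) Cs pc.
(* Coefficients indexed by natural numbers, as the reordering tables require. *)
pose C t (i : nat) := c t (inord i).
have cC t (i : 'I_28) : c t i = C t i by rewrite /C inord_val.
have tcsE t x : inner (V t) x -> tcs (a t) (cube_form (V t)) x = combination (V t) (C t) x.
  move=> ix; have ti : (tri_set (V t))° x by apply/(interior_tri (tri_nd hT t)).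
  transitivity (s x); first by rewrite (aE t x (interior_subset ti)).
  by rewrite (sc t x ti); apply: eq_bigr => i _; rewrite -cC.
have Vj t := vertex_class_jet (tri_nd hT t) (tcsE t).
have Ej t := edge_class_jets (tri_nd hT t) (tcsE t).
have Jt t t' x : tri_set (V t) x -> tri_set (V t') x -> jet0 (a t) (cube_form (V t)) x -> jet0 (a t') (cube_form (V t')) x.
  move=> tx t'x [h0 h1 h2]; split=> [|u|u w].
  - by rewrite -[LHS](a0 t t' x tx t'x).
  - by rewrite -[LHS](a1 u t t' x tx t'x); exact: h1.
  - by rewrite -[LHS](a2 u w t t' x tx t'x); exact: h2.
have J1t t t' x : tri_set (V t) x -> tri_set (V t') x -> jet1 (a t) (cube_form (V t)) x -> jet1 (a t') (cube_form (V t')) x.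
  move=> tx t'x [h0 h1]; split=> [|u].
  - by rewrite -[LHS](a0 t t' x tx t'x).
  - by rewrite -[LHS](a1 u t t' x tx t'x); exact: h1.
(* In the triangle chosen for the vertex the coefficients vanish, hence the 2-jet; the jet is the
   same in every triangle at the vertex, so the coefficients vanish there too. *)
have vert t (k : 'I_3) : forall i, (i < 28)%N -> class_of i = k -> C t i = 0.
  apply/Vj; have [k0 k0w] := hvch (tri t k).
  have h : V (vch (tri t k)) k0 = V t k by rewrite /tverts k0w.
  apply: (Jt (vch (tri t k))); rewrite -?h; [exact: tri_set_vertex|rewrite h; exact: tri_set_vertex|].
  apply/Vj => i i28 ik; change (c (vch (tri t k), inord i : 'I_28).1 (inord i) = 0); apply: c0.
  rewrite inE; apply/orP; left; apply/orP; left; apply/existsP; exists (tri t k); rewrite eqxx /=.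
  by apply/existsP; exists k0; rewrite k0w eqxx /=; have [-> _ _ _] := index_classE (inord i); rewrite inordK// ik.
have vert3 t i : (i < 28)%N -> (class_of i < 3)%N -> C t i = 0.
  by move=> i28 i3; apply: (vert t (Ordinal i3)).
(* The same transfer along an edge. It relies on all vertex coefficients being zero in both
   triangles, which is why the vertices come first. *)
have edge t (k1 k2 : 'I_3) : (tri t k1 < tri t k2)%N -> forall i, (i < 28)%N -> class_of i = (3 + (3 - (k1 + k2)))%N -> C t i = 0.
  move=> lt; have nk : k1 != k2 by apply: contraTneq lt => ->; rewrite ltnn.
  apply/(Ej t k1 k2 nk (vert3 t)).
  have ed : is_edge tri (tri t k1) (tri t k2).
    by apply/existsP; exists t; apply/existsP; exists k1; apply/existsP; exists k2; rewrite nk !eqxx.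
  have [l1 [l2 [h1 h2]]] := hech lt ed; set t0 := ech _ _ in h1 h2.
  have nl : l1 != l2 by apply: contraTneq lt => e; rewrite -h1 -h2 e ltnn.
  have [|j1 j2 j3] := (Ej t0 l1 l2 nl (vert3 t0)).1.
    move=> i i28 ik; change (c (t0, inord i : 'I_28).1 (inord i) = 0); apply: c0.
    rewrite inE; apply/orP; left; apply/orP; right; apply/existsP; exists (tri t k1); apply/existsP; exists (tri t k2).
    rewrite lt ed eqxx /=; apply/existsP; exists l1; apply/existsP; exists l2; rewrite h1 h2 !eqxx /=.
    by have [_ -> _ _] := index_classE (inord i); rewrite nl inordK// ik eqxx.
  have e1 : V t0 l1 = V t k1 by rewrite /tverts h1.
  have e2 : V t0 l2 = V t k2 by rewrite /tverts h2.
  have in12 (r : R) : (0 <= r) && (r <= 1) ->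
      tri_set (V t0) (V t k1 + r *: (V t k2 - V t k1)) /\ tri_set (V t) (V t k1 + r *: (V t k2 - V t k1)).
    move=> r01; split; last by apply: tri_set_segment => //; [exact: (tri_nd hT)|exact: tri_set_vertex|exact: tri_set_vertex].
    by rewrite -e1 -e2; apply: tri_set_segment => //; [exact: (tri_nd hT)|exact: tri_set_vertex|exact: tri_set_vertex].
  have r1 : (0 <= (1/2 : R)) && ((1/2 : R) <= 1) by apply/andP; split; lra.
  have r2 : (0 <= (1/3 : R)) && ((1/3 : R) <= 1) by apply/andP; split; lra.
  have r3 : (0 <= (2/3 : R)) && ((2/3 : R) <= 1) by apply/andP; split; lra.
  rewrite e1 e2 in j1 j2 j3.
  have [p1 q1] := in12 _ r1; have [p2 q2] := in12 _ r2; have [p3 q3] := in12 _ r3.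
  by split; [exact: J1t j1|exact: Jt j2|exact: Jt j3].
have all0 t (i : 'I_28) : c t i = 0.
  have [_ _ h27 h7] := index_classE i.
  have [i3|i3] := ltnP (class_of i) 3; first by rewrite cC vert3.
  have [i6|i6] := ltnP (class_of i) 6; last first.
    by apply: (c0 (t, i)); rewrite inE h27 [class_of i == _](_ : _ = true) ?orbT//; apply/eqP; lia.
  have m3 : (class_of i - 3 < 3)%N by lia.
  pose m : 'I_3 := Ordinal m3.
  have mE k1 k2 : (k1 == m + 1) && (k2 == m + 2) || (k1 == m + 2) && (k2 == m + 1) -> class_of i = (3 + (3 - (k1 + k2)))%N.
    move=> h; have -> : class_of i = (3 + m)%N by rewrite /=; lia.
    apply/eqP; rewrite eqn_add2l; move: h; move: m; clear => m.
    by case: m => [] [|[|[|//]]] i0; case: k1 => [] [|[|[|//]]] i1; case: k2 => [] [|[|[|//]]] i2.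
  rewrite cC; case: (ltngtP (tri t (m + 1)) (tri t (m + 2))) => [lt|lt|/val_inj/(tri_inj hT)/addrI//].
  - by apply: (edge t _ _ lt) => //; apply: mE; rewrite !eqxx.
  - by apply: (edge t _ _ lt) => //; apply: mE; rewrite !eqxx orbT.
move=> x [t _ tx]; have sub : tri_set (V t) `<=` domain p tri by move=> y ty; exists t.
(* The representation by coefficients concerns interior points only; continuity extends the
   vanishing to the closed triangle. *)
apply: (tri_set_ext (tri_nd hT t) sub Cs.1 (F := fun=> 0)) tx => [y|y iy].
  by move=> e e0; exists 1 => // w _; rewrite subrr normr0.
have ti : (tri_set (V t))° y by apply/(interior_tri (tri_nd hT t)).
by rewrite (sc t y ti) big1// => i _; rewrite all0 mul0r.
Qed.

End Vanishing.

Theorem theorem4p6 (R : realType) (nV nT : nat)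
  (p : 'I_nV -> @pt R) (tri : 'I_nT -> 'I_3 -> 'I_nV)
  (hT : is_triangulation p tri)
  (hconn : connected (domain p tri))
  (vch : 'I_nV -> 'I_nT)
  (hvch : forall w : 'I_nV, exists k : 'I_3, tri (vch w) k = w)
  (ech : 'I_nV -> 'I_nV -> 'I_nT)
  (hech : forall a b : 'I_nV, (a < b)%N -> is_edge tri a b ->
            exists k1 k2 : 'I_3, tri (ech a b) k1 = a /\ tri (ech a b) k2 = b) :
  (forall s, S32 p tri s ->
     forall c : 'I_nT -> 'I_28 -> R, coeffs_of p tri s c ->
     (forall x, x \in Mset tri vch ech -> c x.1 x.2 = 0) ->
     forall x, domain p tri x -> s x = 0)
  /\ #|Mset tri vch ech| = (6 * nV + 3 * nE tri + nT)%N
  /\ has_dim_on (domain p tri) (S32 p tri) (6 * nV + 3 * nE tri + nT).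
Proof.
split; first by move=> s sS c sc c0; exact: (determining hT hvch hech sS sc c0).
by split; [exact: (card_Mset hT hvch hech)|exact: (S32_dim hT)].
Qed.
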